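(* Let $k\ge 3$ and let $p\in S(k)$ be a point of the $k$-th monster space over a surface $S$. Then: (1) For each $h\ge 2$, $\mathrm{SG}_h= 2+\#\{\,i : 2\le i\le\min\{h,k+1\},\ e_{hi}=0\,\}$. (2) For $2\le i\le k+1$ we have $\beta_{i+1}= b_i$.
   Context: Setting. $S$ is a surface: a smooth 2-manifold, or a complex manifold of dimension 2, or a nonsingular algebraic surface over an algebraically closed field of characteristic 0; all functions, vector fields, curves are taken in the chosen category. Monster tower. $S(0)=S$, $\Delta(0)=TS$. Recursively $S(j)=\mathbb P(\Delta(j-1))$ (a point is a point of $S(j-1)$ together with a line in the fiber of $\Delta(j-1)$ there), and $\Delta(j)$ is the rank 2 distribution on $S(j)$ of tangent vectors whose projection to $S(j-1)$ lies in the line represented by the point. $\dim S(k)=k+2$. Write $\Delta=\Delta(k)$, the focal distribution (also its sheaf of sections); curves tangent to it are focal curves. Small growth. $\Delta^1=\Delta$, and $\Delta^h=[\Delta,\Delta^{h-1}]$ is the subsheaf of the sheaf of vector fields generated by brackets of sections of $\Delta$ with sections of $\Delta^{h-1}$ and by the sections of $\Delta^{h-1}$. $\mathrm{SG}_h$ is the rank of $\Delta^h$ at $p$ (the dimension of the span in $T_pS(k)$ of the values at $p$ of its sections). The beta vector is $(\beta_2,\dots,\beta_{k+2})$ with $\beta_i=\min\{h:\mathrm{SG}_h=i\}$. Focal order. For a function $a$ near $p$ and a parameterized nonsingular focal curve germ $C$ through $p$, given by $\gamma$ with $\gamma(0)=p$, let $\#(a\cdot C)$ be the order of vanishing of $a\circ\gamma$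 at $0$. The focal order of $a$ at $p$ is $o(a)=\min_C\#(a\cdot C)$ over all focal curve germs $C$ through $p$. Vertical orders. For $2\le j\le k$, the divisor at infinity $I_j\subset S(k)$ is the set of points whose image in $S(j)$ represents the line in $\Delta(j-1)$ tangent to the fiber of $S(j-1)\to S(j-2)$. $\mathrm{VO}_j$ is the focal order at $p$ of a local defining function of $I_j$ ($0$ if $p\notin I_j$). The numbers $e_{hi}$ and $b_i$. For $h\ge2$ and $2\le i\le\min\{h,k+1\}$, $$e_{hi}=\max\Big\{0,\;-(h-i)+\sum_{j=k-i+4}^{k}(i+j-k-3)\,\mathrm{VO}_j\Big\}.$$ For $2\le i\le k+1$, $b_i$ is the smallest integer with $e_{b_i,i}=0$; equivalently $b_i=i+\sum_{j=k-i+4}^{k}(i+j-k-3)\,\mathrm{VO}_j$. *)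

(* Defs.v *)
From HB Require Import structures.
From mathcomp Require Import all_boot all_order all_algebra.
From mathcomp Require Import all_classical all_reals all_analysis.
From mathcomp Require Import complex.
From mathcomp Require mpoly.
Set Implicit Arguments.
Unset Strict Implicit.
Unset Printing Implicit Defensive.
Import Order.TTheory GRing.Theory Num.Theory.
Import numFieldNormedType.Exports.

Local Open Scope classical_set_scope.
Local Open Scope ring_scope.

(* A space with functions (the classical presentation of a sheaf of K-valued
   functions): [opn] is the set of open subsets, and [regular_at x f] says that
   f is a function of the chosen category on some open neighbourhood of x.
   Functions are total; only their germs at the points considered matter. *)
Record fspace (K : fieldType) := FSpace {
  pt :> Type;
  opn : set (set pt);
  regular_at : pt -> set (pt -> K) }.
Arguments opn {K} X : rename.
Arguments regular_at {K X} x f : rename.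

Definition regular_on (K : fieldType) (X : fspace K) (U : set X) (f : X -> K) :=
  forall x, U x -> regular_at x f.

Definition around (K : fieldType) (X : fspace K) (x : X) (P : set X) : Prop :=
  exists U : set X, [/\ opn X U, U x & U `<=` P].

Definition morphism (K : fieldType) (X Y : fspace K) (f : X -> Y) : Prop :=
  (forall V, opn Y V -> opn X (f @^-1` V)) /\
  (forall x a, regular_at (f x) a -> regular_at x (a \o f)).

(** * The three categories *)

(* A category is given by the open sets and the functions of the affine spaces
   K^n, and by the countability condition imposed on its objects. *)
Record geometry := Geometry {
  scalars : fieldType;
  affine_open : forall n, set (set 'rV[scalars]_n);
  affine_regular : forall n, 'rV[scalars]_n -> set ('rV[scalars]_n -> scalars);
  small : forall X : Type, set (set X) -> Prop }.

Definition affine (G : geometry) (n : nat) : fspace (scalars G) :=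
  FSpace (@affine_open G n) (@affine_regular G n).

Fixpoint class_C (F : numFieldType) (n r : nat) (U : set 'rV[F]_n)
    (f : 'rV[F]_n -> F) : Prop :=
  (forall x, U x -> {for x, continuous f}) /\
  (if r is r'.+1 then forall i : 'I_n,
     (forall x, U x -> derivable f x (delta_mx 0 i)) /\
     class_C r' U (fun x => 'D_(delta_mx 0 i) f x)
   else True).

Definition second_countable_opens (X : Type) (O : set (set X)) : Prop :=
  exists B : nat -> set X, (forall m, O (B m)) /\
    forall U x, O U -> U x -> exists m, B m x /\ B m `<=` U.

Definition quasi_compact_opens (X : Type) (O : set (set X)) : Prop :=
  forall C : set (set X), C `<=` O -> (forall x, exists2 U, C U & U x) ->
  exists (m : nat) (W : 'I_m -> set X),
    (forall i, C (W i)) /\ forall x, exists i, W i x.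

(* For F the reals these are the C^oo functions; for F the complex numbers the
   derivatives are complex derivatives, so (holomorphic functions being
   infinitely differentiable) these are exactly the holomorphic functions. *)
Definition differential_geometry (F : numFieldType) : geometry :=
  @Geometry F (fun n => [set U : set 'rV[F]_n | open U])
    (fun n x f => exists U : set 'rV[F]_n,
       [/\ open U, U x & forall r, class_C r U f])
    second_countable_opens.

Definition mpoly_fun (K : fieldType) (n : nat) (P : mpoly.mpoly n K)
    (x : 'rV[K]_n) : K := mpoly.meval (fun i => x 0 i) P.

Definition algebraic_geometry (K : fieldType) : geometry :=
  @Geometry K
    (fun n => [set U : set 'rV[K]_n | forall x, U x ->
       exists Q, mpoly_fun Q x != 0 /\ forall y, mpoly_fun Q y != 0 -> U y])
    (fun n x f => exists P Q, mpoly_fun Q x != 0 /\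
       forall y, mpoly_fun Q y != 0 -> f y = mpoly_fun P y / mpoly_fun Q y)
    quasi_compact_opens.

Inductive category : Type :=
| Smooth of realType
| Holomorphic of realType
| Algebraic (K : closedFieldType) of [pchar K] =i pred0.

Definition geometry_of (C : category) : geometry :=
  match C with
  | Smooth R => differential_geometry R
  | Holomorphic R => differential_geometry (complex R)
  | @Algebraic K _ => algebraic_geometry K
  end.

(** * Tangent vectors and vector fields *)

(* Tangent vectors at x are the point derivations of germs of functions at x.
   They are extended by 0 to functions that are not regular at x, so that a
   derivation has only one representative. *)
Definition tvec (K : fieldType) (X : fspace K) := (X -> K) -> K.

Definition is_tangent (K : fieldType) (X : fspace K) (x : X) (v : tvec X) : Prop :=
  [/\ forall f, ~ regular_at x f -> v f = 0,
      forall f g, regular_at x f -> regular_at x g ->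
        around x (fun y => f y = g y) -> v f = v g,
      forall (c : K) f g, regular_at x f -> regular_at x g ->
        v (fun y => c * f y + g y) = c * v f + v g
    & forall f g, regular_at x f -> regular_at x g ->
        v (fun y => f y * g y) = f x * v g + v f * g x].

Definition tzero (K : fieldType) (X : fspace K) : tvec X := fun _ => 0.

Definition push (K : fieldType) (X Y : fspace K) (f : X -> Y) (x : X)
    (v : tvec X) : tvec Y :=
  fun a => if `[< regular_at (f x) a >] then v (a \o f) else 0.

Definition independent (K : fieldType) (X : fspace K) (n : nat)
    (e : 'I_n -> tvec X) : Prop :=
  forall c : 'I_n -> K,
    (forall f, \sum_(i < n) c i * e i f = 0) -> forall i, c i = 0.

(* n is the dimension of the span of E: n independent elements of E span E *)
Definition span_dim (K : fieldType) (X : fspace K) (E : set (tvec X)) (n : nat) :=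
  exists e : 'I_n -> tvec X, [/\ forall i, E (e i), independent e &
    forall v, E v -> exists c : 'I_n -> K,
      forall f, v f = \sum_(i < n) c i * e i f].

Definition vfield (K : fieldType) (X : fspace K) := X -> tvec X.

Definition is_vfield (K : fieldType) (X : fspace K) (U : set X)
    (V : vfield X) : Prop :=
  forall x, U x -> is_tangent x (V x) /\
    forall f, regular_at x f -> regular_at x (fun y => V y f).

Definition lie (K : fieldType) (X : fspace K) (V W : vfield X) : vfield X :=
  fun x f => if `[< regular_at x f >]
             then V x (fun y => W y f) - W x (fun y => V y f) else 0.

(** * Manifolds *)

(* A chart identifies the open set U with a locally closed subset of K^(c+d)
   which near each of its points is cut out by c functions that generate its
   ideal and have linearly independent differentials. For c = 0 this is a chart
   onto an open subset of K^d; c > 0 is needed for algebraic varieties, which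
   have no such charts in the Zariski topology, and (implicit functions)
   nothing is added in the smooth and holomorphic categories. *)
Definition chart (G : geometry) (d : nat) (X : fspace (scalars G)) (U : set X)
    (c : nat) (phi : X -> affine G (c + d)) : Prop :=
  [/\ opn X U,
      forall x y, U x -> U y -> phi x = phi y -> x = y,
      forall W, W `<=` U ->
        (opn X W <->
         exists2 V, opn (affine G (c + d)) V & W = U `&` phi @^-1` V),
      forall x f, U x ->
        (regular_at x f <->
         exists V F, [/\ opn (affine G (c + d)) V, V (phi x), regular_on V F &
           forall y, U y -> V (phi y) -> f y = F (phi y)])
    & forall x, U x -> exists V (g : 'I_c -> affine G (c + d) -> scalars G),
        [/\ opn (affine G (c + d)) V /\ V (phi x),
            forall i, regular_on V (g i),
            forall z, V z -> ((phi @` U) z <-> forall i, g i z = 0),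
            forall F, regular_at (phi x) F ->
              around (phi x) (fun z => (phi @` U) z -> F z = 0) ->
              exists h : 'I_c -> affine G (c + d) -> scalars G,
                (forall i, regular_at (phi x) (h i)) /\
                around (phi x) (fun z => F z = \sum_(i < c) h i z * g i z)
          & forall a : 'I_c -> scalars G,
              (forall v, is_tangent (phi x) v -> \sum_(i < c) a i * v (g i) = 0) ->
              forall i, a i = 0]].

(* The third clause says that the diagonal is closed in the product: it is
   Hausdorffness in the smooth and holomorphic categories, and separatedness
   in the algebraic one. *)
Definition manifold (G : geometry) (d : nat) (X : fspace (scalars G)) : Prop :=
  [/\ [/\ opn X setT, forall U V, opn X U -> opn X V -> opn X (U `&` V) &
          forall C : set (set X), C `<=` opn X -> opn X (\bigcup_(U in C) U)],
      forall x, exists (U : set X) (c : nat) (phi : X -> affine G (c + d)),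
        chart U phi /\ U x,
      forall (U U' : set X) (c c' : nat) (phi : X -> affine G (c + d))
          (phi' : X -> affine G (c' + d)),
        chart U phi -> chart U' phi' ->
        forall x x', U x -> U' x' -> x <> x' ->
        exists O, [/\ opn (affine G ((c + d) + (c' + d))) O,
          O (row_mx (phi x) (phi' x')) &
          forall z, U z -> U' z -> ~ O (row_mx (phi z) (phi' z))]
    & small G (opn X)].

(* The structure on P for which the partially defined functions (D, u) of the
   family E, u being considered on D, are local coordinates: the open sets are
   generated by the preimages of open sets of K^n under n-tuples of such
   functions, and the functions are locally the functions of such tuples. *)
Definition generated (G : geometry) (P : Type) (E : set (set P * (P -> scalars G)))
    : fspace (scalars G) :=
  let dom n (s : 'I_n -> set P * (P -> scalars G)) : set P :=
    [set y | forall i, (s i).1 y] in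
  let val n (s : 'I_n -> set P * (P -> scalars G)) (y : P) : affine G n :=
    \row_i (s i).2 y in
  @FSpace (scalars G) P
    [set W : set P | forall x, W x -> exists n s V,
       [/\ forall i, E (s i), opn (affine G n) V, dom n s x /\ V (val n s x) &
           forall y, dom n s y -> V (val n s y) -> W y]]
    (fun x => [set f | exists n s V F,
       [/\ forall i, E (s i), opn (affine G n) V, dom n s x /\ V (val n s x),
           regular_on V F &
           forall y, dom n s y -> V (val n s y) -> f y = F (val n s y)]]).

(** * The monster tower *)

(* a space together with a distribution, given by its fibres *)
Record dspace (K : fieldType) := DSpace {
  space :> fspace K;
  fibre : forall x : space, set (tvec space) }.
Arguments fibre {K} D x : rename.

Definition is_section (K : fieldType) (D : dspace K) (U : set D)
    (V : vfield D) : Prop :=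
  is_vfield U V /\ forall x, U x -> fibre D x (V x).

Definition tline (K : fieldType) (X : fspace K) (v : tvec X) : set (tvec X) :=
  [set w | exists c : K, w = (fun f => c * v f)].

Definition is_line (K : fieldType) (D : dspace K) (x : D) (l : set (tvec D)) :=
  exists v, [/\ fibre D x v, v <> tzero (X := D) & l = tline v].

Definition line_pt (K : fieldType) (D : dspace K) : Type :=
  {xl : D * set (tvec D) | is_line xl.1 xl.2}.

Definition base (K : fieldType) (D : dspace K) (y : line_pt D) : D := (sval y).1.
Definition line (K : fieldType) (D : dspace K) (y : line_pt D) : set (tvec D) :=
  (sval y).2.

(* (V, W) is a local frame of the (rank 2) distribution over the open set U *)
Definition frame (K : fieldType) (D : dspace K) (U : set D) (V W : vfield D) :=
  [/\ opn D U, is_section U V, is_section U W &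
      forall x, U x ->
        independent (fun i : 'I_2 => if i == 0 then V x else W x) /\
        forall v, fibre D x v -> exists a b : K, forall f, v f = a * V x f + b * W x f].

(* The projectivization of the fibres, with its usual structure of P^1-bundle:
   coordinates are the functions coming from the base and, for a local frame
   (V, W), the affine coordinate t of the line spanned by V + t W. *)
Definition proj_space (G : geometry) (D : dspace (scalars G)) : fspace (scalars G) :=
  generated (G := G) (P := line_pt D)
    [set Du |
       (exists (U : set D) (f : D -> scalars G),
          [/\ opn D U, regular_on U f, Du.1 = base (D := D) @^-1` U &
              Du.2 = f \o base (D := D)]) \/
       (exists (U : set D) (V W : vfield D),
          [/\ frame U V W,
              Du.1 = [set y | U (base y) /\ ~ line y (W (base y))] &
              forall y, Du.1 y ->
                line y (fun f => V (base y) f + Du.2 y * W (base y) f)])].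

Definition proj_base (G : geometry) (D : dspace (scalars G)) : proj_space D -> D :=
  @base _ D.

Definition proj_line (G : geometry) (D : dspace (scalars G))
    : proj_space D -> set (tvec D) := @line _ D.

Definition prolong (G : geometry) (D : dspace (scalars G)) : dspace (scalars G) :=
  @DSpace (scalars G) (proj_space D)
    (fun y => [set v | is_tangent y v /\
       proj_line y (push (@proj_base G D) y v)]).

Fixpoint monster (G : geometry) (S : fspace (scalars G)) (k : nat)
    : dspace (scalars G) :=
  if k is k'.+1 then prolong (monster S k')
  else DSpace (fun x : S => [set v | is_tangent x v]).

Definition monster_proj (G : geometry) (S : fspace (scalars G)) (k : nat)
    : monster S k.+1 -> monster S k := @proj_base G (monster S k).

(** * Small growth *)

(* the sheaf [Delta, E], for a subsheaf E of the sheaf of vector fields *)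
Definition bracket_sheaf (K : fieldType) (D : dspace K)
    (E : set D -> set (vfield D)) (U : set D) (V : vfield D) : Prop :=
  is_vfield U V /\
  forall x, U x -> exists U' : set D, [/\ opn D U', U' x, U' `<=` U &
    exists (m : nat) (a : 'I_m -> D -> K) (A : 'I_m -> vfield D),
      [/\ forall i, regular_on U' (a i),
          forall i, E U' (A i) \/
            exists B C, [/\ is_section U' B, E U' C & A i = lie B C]
        & forall y f, U' y -> V y f = \sum_(i < m) a i y * A i y f]].

(* the sections of Delta^h; only h >= 1 is meaningful *)
Definition delta (K : fieldType) (D : dspace K) (h : nat)
    : set D -> set (vfield D) :=
  iter h.-1 (@bracket_sheaf K D) (@is_section K D).

(* the least element of A, 0 if A is empty *)
Definition least (A : set nat) : nat :=
  xget 0%N [set m | A m /\ forall m', A m' -> (m <= m')%N].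

Definition SG (K : fieldType) (D : dspace K) (p : D) (h : nat) : nat :=
  xget 0%N [set n | span_dim
    [set v | exists U V, [/\ opn D U, U p, delta h U V & v = V p]] n].

Definition beta (K : fieldType) (D : dspace K) (p : D) (i : nat) : nat :=
  least [set h | (1 <= h)%N /\ SG p h = i].

(** * Focal and vertical orders *)

(* the germ of f at x lies in the n-th power of the maximal ideal *)
Fixpoint in_max_power (K : fieldType) (X : fspace K) (x : X) (n : nat)
    (f : X -> K) : Prop :=
  if n is n'.+1 then
    regular_at x f /\
    exists (m : nat) (u w : 'I_m -> X -> K),
      [/\ forall i, regular_at x (u i) /\ u i x = 0,
          forall i, in_max_power x n' (w i)
        & around x (fun y => f y = \sum_(i < m) u i y * w i y)]
  else regular_at x f.

Definition order_at (K : fieldType) (X : fspace K) (x : X) (f : X -> K) (n : nat) :=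
  in_max_power x n f /\ ~ in_max_power x n.+1 f.

(* gamma parameterizes by (C, t0) a nonsingular focal curve germ through p *)
Definition focal_curve (G : geometry) (D : dspace (scalars G)) (p : D)
    (C : fspace (scalars G)) (t0 : C) (gamma : C -> D) : Prop :=
  [/\ manifold (G := G) 1 C, morphism gamma, gamma t0 = p,
      forall t v, is_tangent t v -> fibre D (gamma t) (push gamma t v)
    & exists v, is_tangent t0 v /\ push gamma t0 v <> tzero (X := D)].

(* The curves on which a vanishes identically (infinite order) do not
   contribute to the minimum. *)
Definition focal_order (G : geometry) (D : dspace (scalars G)) (p : D)
    (a : D -> scalars G) : nat :=
  least [set n | exists (C : fspace (scalars G)) (t0 : C) (gamma : C -> D),
           focal_curve p t0 gamma /\ order_at t0 (a \o gamma) n].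

(* the line represented by a point of S(k+1) is tangent to the fibre of
   S(k) -> S(k-1) *)
Definition vertical (G : geometry) (S : fspace (scalars G)) (k : nat)
    : set (monster S k.+1) :=
  match k return set (monster S k.+1) with
  | 0 => set0
  | k'.+1 => [set y | forall v, proj_line (D := monster S k'.+1) y v ->
      push (@monster_proj G S k') (@proj_base G (monster S k'.+1) y) v
      = tzero (X := monster S k')]
  end.

(* the divisor at infinity I_j in S(k), for 2 <= j <= k *)
Fixpoint infinity (G : geometry) (S : fspace (scalars G)) (k j : nat)
    : set (monster S k) :=
  match k return set (monster S k) with
  | 0 => set0
  | k'.+1 => if j == k'.+1 then @vertical G S k'
             else @monster_proj G S k' @^-1` @infinity G S k' j
  end.

(* a generates the ideal of the germs at p of the functions vanishing on I *)
Definition local_equation (K : fieldType) (X : fspace K) (p : X) (I : set X)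
    (a : X -> K) : Prop :=
  [/\ regular_at p a, around p (fun x => I x -> a x = 0) &
      forall f, regular_at p f -> around p (fun x => I x -> f x = 0) ->
        exists g, regular_at p g /\ around p (fun x => f x = g x * a x)].

Definition VO (G : geometry) (S : fspace (scalars G)) (k : nat)
    (p : monster S k) (j : nat) : nat :=
  if `[< infinity j p >] then
    xget 0%N [set n | exists a, local_equation p (infinity j) a /\
                                n = focal_order p a]
  else 0%N.

Definition e_num (G : geometry) (S : fspace (scalars G)) (k : nat)
    (p : monster S k) (h i : nat) : int :=
  Num.max 0 (- (h%:Z - i%:Z) +
    \sum_(k + 4 - i <= j < k.+1) (i%:Z + j%:Z - k%:Z - 3%:Z) * (VO p j)%:Z).

(* e_(h,i) is only defined for i <= h *)
Definition b_num (G : geometry) (S : fspace (scalars G)) (k : nat)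
    (p : monster S k) (i : nat) : nat :=
  least [set h | (i <= h)%N /\ e_num p h i = 0].

(* Main.v *)
(* Near p the space S(k) has functions w, t_0, ..., t_k and a frame (X, N) of Delta
   such that N = d/dt_k, X w and the X t_j (j < k) are monomials in the t_l, and t_l
   is an equation of I_l whenever p lies on I_l (2 <= l). Let a_j be the product of
   those t_l with l > j. The fields B_k = [N, X], B_(k-1), ..., B_1 with
   [X, B_j] = +-a_j B_(j-1) and [N, B_j] = 0 complete X, N to a frame of the tangent
   bundle, so the growth of Delta is governed by the orders of the a_j.

   A function f has order n along Delta when all words of length < n in X, N kill it
   at p while (X + N)^n f does not; this is multiplicative, and every t_l has such an
   order. Sections of Delta^h have B-coefficients of controlled order, which bounds
   SG_h from above; brackets with X + N only, whose leading coefficients are positive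
   integer multiples of fixed nonzero scalars, bound it from below. Thus B_j enters
   Delta^h exactly from h = b_(k+2-j) on, where b_2 = 2 and
   b_(n+1) = b_n + 1 + ord a_(k+2-n).

   These orders are focal orders: a function of order n has order at least n on
   every focal curve, and exactly n on the integral curve of X + N, which is given
   by polynomials in t_k. Hence ord t_l = VO_l, and summing the recursion gives the
   formula for b_i. *)

Require Import Defs.
From HB Require Import structures.
From mathcomp Require Import all_boot all_order all_algebra.
From mathcomp Require Import boolp classical_sets functions.
From mathcomp Require mpoly.
From mathcomp Require Import ring zify.
Set Implicit Arguments.
Unset Strict Implicit.
Unset Printing Implicit Defensive.
Import Order.TTheory GRing.Theory Num.Theory.
Local Open Scope classical_set_scope.
Local Open Scope ring_scope.

(** * Functions and derivations on affine spaces *)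

(** The recursion for b counts brackets: from B_j one bracket with X gives a_j B_(j-1), and ord a_j
    further ones differentiate a_j into a unit. Monomials appear because the next level is charted
    by the slope t of the new line. If p represents the line of N, the new X is N + t X, which
    multiplies the older derivatives by t, and t vanishes at p; otherwise the new X is X + t N,
    which leaves them alone, and t(p) may be any scalar. So only vertical levels enter the weights
    a_j. The obstacle is to treat three categories at once. The algebraic one has neither flows nor
    charts onto open subsets of K^n, so neighbourhoods are embedded in affine space by tuples of
    functions, tangent vectors are derivations, and a partial derivative is a difference quotient
    extended to step 0. The input from a category is collected in [good], [regular_zeros] and
    [small_subspaces]; the last two turn the polynomial solution for X + N into a manifold of the
    category, as focal orders demand. Characteristic 0 keeps the integer factors produced by
    differentiation from vanishing. *)

Lemma around_sub (K : fieldType) (X : fspace K) (x : X) (P Q : set X) :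
  around x P -> (forall y, P y -> Q y) -> around x Q.
Proof. by move=> [U [oU Ux UP]] PQ; exists U; split => // y /UP /PQ. Qed.

Lemma around_self (K : fieldType) (X : fspace K) (x : X) (P : set X) : around x P -> P x.
Proof. by move=> [U [_ Ux UP]]; apply: UP. Qed.

Lemma around_open (K : fieldType) (X : fspace K) (x : X) (P : set X) :
  around x P -> around x (fun y => around y P).
Proof. by move=> [U [oU Ux UP]]; exists U; split => // y Uy; exists U; split. Qed.

Lemma inj_unit (K : fieldType) n (A : 'M[K]_n) :
  (forall u : 'rV[K]_n, u *m A = 0 -> u = 0) -> A \in unitmx.
Proof.
move=> h; rewrite -row_free_unit -kermx_eq0; apply/eqP/row_matrixP => i.
by rewrite row0; apply: h; rewrite -row_mul mulmx_ker row0.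
Qed.

Section Tame.
Variables (G : geometry).
Local Notation K := (scalars G).
Local Notation aff := (affine G).

Definition setc n (z : 'rV[K]_n) (i : 'I_n) (a : K) : 'rV[K]_n :=
  \row_l (if l == i then a else z 0 l).

(* The properties of a point that hold on every space locally isomorphic to a
   subset of an affine space. *)
Record tame (X : fspace K) (x : X) : Prop := Tame {
  aroundT : around x setT;
  aroundI : forall P Q, around x P -> around x Q -> around x (P `&` Q);
  reg_open : forall f, regular_at x f -> around x (fun y => regular_at y f);
  reg_ext : forall f g, around x (fun y => f y = g y) -> regular_at x f ->
    regular_at x g;
  reg_comp : forall m (f : 'I_m -> X -> K) (F : aff m -> K),
    (forall j, regular_at x (f j)) ->
    regular_at (X := aff m) (\row_j f j x) F ->
    regular_at x (fun y => F (\row_j f j y));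
  reg_cont : forall m (f : 'I_m -> X -> K) (V : set (aff m)),
    (forall j, regular_at x (f j)) -> opn (aff m) V -> V (\row_j f j x) ->
    around x (fun y => V (\row_j f j y)) }.

(* What the argument uses of the functions of a category. Division by a
   coordinate, [aff_div], yields partial derivatives, Hadamard's lemma and local
   equations; [aff_dens] makes the quotient unique on the divisor. *)
Record good : Prop := Good {
  char0 : forall n, n.+1%:R != 0 :> K;
  aff_tame : forall n (z : aff n), tame z;
  aff_openL : forall n (W : set (aff n)),
    (forall x, W x -> around x W) -> opn (aff n) W;
  aff_cst : forall n (z : aff n) c, regular_at z (fun=> c);
  aff_coord : forall n (z : aff n) i, regular_at z (fun y : 'rV[K]_n => y 0 i);
  aff_add : forall z : aff 2, regular_at z (fun y : 'rV[K]_2 => y 0 0 + y 0 1);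
  aff_mul : forall z : aff 2, regular_at z (fun y : 'rV[K]_2 => y 0 0 * y 0 1);
  aff_inv : forall z : 'rV[K]_1, z 0 0 != 0 ->
    regular_at (X := aff 1) z (fun y : 'rV[K]_1 => (y 0 0)^-1);
  aff_ne0 : opn (aff 1) [set y : 'rV[K]_1 | y 0 0 != 0];
  aff_div : forall n (z : 'rV[K]_n) i F, z 0 i = 0 ->
    regular_at (X := aff n) z F ->
    exists Q, regular_at (X := aff n) z Q /\
      around (X := aff n) z (fun y => F y - F (setc y i 0) = y 0 i * Q y);
  aff_dens : forall F, regular_at (X := aff 1) 0 F ->
    around (X := aff 1) 0 (fun y => y 0 0 * F y = 0) -> F 0 = 0 }.

Hypothesis gG : good.

Section Point.
Variables (X : fspace K) (x : X).
Hypothesis tx : tame x.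

Lemma around_forall (I : finType) (P : I -> set X) :
  (forall i, around x (P i)) -> around x (fun y => forall i, P i y).
Proof.
move=> h; suff: forall s : seq I, around x (fun y => forall i, i \in s -> P i y).
  by move=> /(_ (enum I)) /around_sub; apply => y py i; apply: py; rewrite mem_enum.
elim=> [|i s ih]; first by apply: (around_sub (aroundT tx)).
apply: (around_sub (aroundI tx (h i) ih)) => y [pi ps] j.
by rewrite inE => /orP[/eqP -> //|]; exact: ps.
Qed.

Lemma reg_cst c : regular_at x (fun=> c).
Proof.
exact: (@reg_comp X x tx 0 (fun _ _ => 0) (fun=> c) (fun i => False_rect _ (notF (valP i)))
  (aff_cst gG _ c)).
Qed.

Lemma reg_add f g : regular_at x f -> regular_at x g ->
  regular_at x (fun y => f y + g y).
Proof.
move=> rf rg.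
have := @reg_comp X x tx 2 (fun i y => if i == 0 then f y else g y) _ _ (aff_add gG _).
move=> h; apply: (reg_ext tx _ (h _)) => [|j]; last by case: (j == 0).
by apply: (around_sub (aroundT tx)) => y _; rewrite !mxE.
Qed.

Lemma reg_mul f g : regular_at x f -> regular_at x g ->
  regular_at x (fun y => f y * g y).
Proof.
move=> rf rg.
have := @reg_comp X x tx 2 (fun i y => if i == 0 then f y else g y) _ _ (aff_mul gG _).
move=> h; apply: (reg_ext tx _ (h _)) => [|j]; last by case: (j == 0).
by apply: (around_sub (aroundT tx)) => y _; rewrite !mxE.
Qed.

Lemma reg_inv f : regular_at x f -> f x != 0 -> regular_at x (fun y => (f y)^-1).
Proof.
move=> rf fx.
have := @reg_comp X x tx 1 (fun i y => f y) _ (fun=> rf) (aff_inv gG _).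
rewrite mxE => /(_ fx); apply: (reg_ext tx).
by apply: (around_sub (aroundT tx)) => y _; rewrite !mxE.
Qed.

Lemma around_ne0 f : regular_at x f -> f x != 0 -> around x (fun y => f y != 0).
Proof.
move=> rf fx.
have := @reg_cont X x tx 1 (fun i y => f y) _ (fun=> rf) (aff_ne0 gG).
rewrite /= mxE => /(_ fx) /around_sub; apply => y; by rewrite mxE.
Qed.

Lemma reg_opp f : regular_at x f -> regular_at x (fun y => - f y).
Proof.
move=> rf; apply: (reg_ext tx _ (reg_mul (reg_cst (-1)) rf)).
by apply: (around_sub (aroundT tx)) => y _; rewrite mulN1r.
Qed.

Lemma reg_sub f g : regular_at x f -> regular_at x g ->
  regular_at x (fun y => f y - g y).
Proof. by move=> rf rg; exact: reg_add rf (reg_opp rg). Qed.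

Lemma reg_sum (I : Type) (s : seq I) (P : pred I) (f : I -> X -> K) :
  (forall i, P i -> regular_at x (f i)) -> regular_at x (fun y => \sum_(i <- s | P i) f i y).
Proof.
move=> h; elim: s => [|i s ih].
  apply: (reg_ext tx _ (reg_cst 0)).
  by apply: (around_sub (aroundT tx)) => y _; rewrite big_nil.
case Pi: (P i).
  apply: (reg_ext tx _ (reg_add (h i Pi) ih)).
  by apply: (around_sub (aroundT tx)) => y _; rewrite big_cons Pi.
apply: (reg_ext tx _ ih).
by apply: (around_sub (aroundT tx)) => y _; rewrite big_cons Pi.
Qed.

Lemma reg_prod (I : Type) (s : seq I) (P : pred I) (f : I -> X -> K) :
  (forall i, P i -> regular_at x (f i)) -> regular_at x (fun y => \prod_(i <- s | P i) f i y).
Proof.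
move=> h; elim: s => [|i s ih].
  apply: (reg_ext tx _ (reg_cst 1)).
  by apply: (around_sub (aroundT tx)) => y _; rewrite big_nil.
case Pi: (P i).
  apply: (reg_ext tx _ (reg_mul (h i Pi) ih)).
  by apply: (around_sub (aroundT tx)) => y _; rewrite big_cons Pi.
apply: (reg_ext tx _ ih).
by apply: (around_sub (aroundT tx)) => y _; rewrite big_cons Pi.
Qed.

Lemma reg_det n (A : X -> 'M[K]_n) : (forall i j, regular_at x (fun y => A y i j)) ->
  regular_at x (fun y => \det (A y)).
Proof.
move=> h; rewrite /determinant; apply: reg_sum => s _.
by apply: reg_mul; [exact: reg_cst|apply: reg_prod => i _; exact: h].
Qed.

Lemma reg_invmx n (A : X -> 'M[K]_n) : (forall i j, regular_at x (fun y => A y i j)) ->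
  A x \in unitmx ->
  (forall i j, regular_at x (fun y => invmx (A y) i j)) /\
  around x (fun y => A y \in unitmx).
Proof.
move=> h ux.
have un : around x (fun y => A y \in unitmx).
  have := around_ne0 (reg_det h).
  rewrite unitmxE unitfE in ux; move=> /(_ ux) /around_sub; apply => y.
  by rewrite unitmxE unitfE.
split => // i j.
have r1 : regular_at x (fun y => (\det (A y))^-1 * cofactor (A y) j i).
  apply: reg_mul; first by apply: reg_inv; [exact: reg_det|rewrite -unitfE -unitmxE].
  apply: reg_mul; first exact: reg_cst.
  by apply: reg_det => a b; under eq_fun do rewrite !mxE; exact: h.
apply: (reg_ext tx _ r1); apply: (around_sub un) => y uy.
by rewrite /invmx uy !mxE.
Qed.

Lemma tangent_cst (v : tvec X) c : is_tangent x v -> v (fun=> c) = 0.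
Proof.
move=> [_ h2 h3 h4].
have v1 : v (fun=> 1) = 0.
  have := h4 _ _ (reg_cst 1) (reg_cst 1); rewrite (_ : (fun y => 1 * 1) = fun=> 1 :> K); last first.
    by apply/funext => y; rewrite mulr1.
  rewrite mul1r mulr1 => e; have := congr1 (fun t => t - v (fun=> 1)) e.
  by rewrite subrr addrK => <-.
have := h3 c _ _ (reg_cst 1) (reg_cst 0).
rewrite (_ : (fun y => c * 1 + 0) = fun=> c); last by apply/funext => y; rewrite mulr1 addr0.
have v0 := h3 (-1) _ _ (reg_cst 1) (reg_cst 1).
rewrite (_ : (fun y => -1 * 1 + 1) = fun=> 0) in v0; last first.
  by apply/funext => y; rewrite mulr1 addNr.
by rewrite v0 v1 !mulr0 !addr0.
Qed.

Lemma tangentD (v : tvec X) f g : is_tangent x v -> regular_at x f -> regular_at x g ->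
  v (fun y => f y + g y) = v f + v g.
Proof.
move=> [_ h2 h3 h4] rf rg; have := h3 1 _ _ rf rg; rewrite mul1r => <-.
by congr v; apply/funext => y; rewrite mul1r.
Qed.

Lemma tangentZ (v : tvec X) c f : is_tangent x v -> regular_at x f ->
  v (fun y => c * f y) = c * v f.
Proof.
move=> tv rf; have [_ h2 h3 h4] := tv; have := h3 c _ _ rf (reg_cst 0).
rewrite (tangent_cst _ tv) addr0 => <-.
by congr v; apply/funext => y; rewrite addr0.
Qed.

Lemma tangentM (v : tvec X) f g : is_tangent x v -> regular_at x f -> regular_at x g ->
  v (fun y => f y * g y) = f x * v g + v f * g x.
Proof. by move=> [_ _ _]; apply. Qed.

Lemma tangent_ext (v : tvec X) f g : is_tangent x v -> regular_at x f ->
  around x (fun y => f y = g y) -> v f = v g.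
Proof. by move=> [_ h _ _] rf e; apply: h => //; exact: reg_ext e rf. Qed.

Lemma tangentB (v : tvec X) f g : is_tangent x v -> regular_at x f -> regular_at x g ->
  v (fun y => f y - g y) = v f - v g.
Proof.
move=> tv rf rg; rewrite (tangentD tv rf (reg_opp rg)); congr (_ + _).
rewrite -mulN1r -(tangentZ _ tv rg); congr v.
by apply/funext => y; rewrite mulN1r.
Qed.

Lemma tangent_sum (v : tvec X) (I : Type) (s : seq I) (P : pred I) (f : I -> X -> K) :
  is_tangent x v -> (forall i, P i -> regular_at x (f i)) ->
  v (fun y => \sum_(i <- s | P i) f i y) = \sum_(i <- s | P i) v (f i).
Proof.
move=> tv h; elim: s => [|i s ih].
  rewrite big_nil -[RHS](tangent_cst 0 tv); congr v.
  by apply/funext => y; rewrite big_nil.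
case Pi: (P i); rewrite big_cons Pi -ih.
  rewrite -tangentD //; [|exact: h|exact: reg_sum].
  by congr v; apply/funext => y; rewrite big_cons Pi.
by congr v; apply/funext => y; rewrite big_cons Pi.
Qed.

End Point.

Local Notation areg n z F := (@regular_at K (affine G n) z F).
Local Notation anear n z P := (@around K (affine G n) z P).

Lemma aff_comp m n (f : 'I_m -> 'rV[K]_n -> K) (z : 'rV[K]_n) (w : 'rV[K]_m)
    (F : 'rV[K]_m -> K) (H : 'rV[K]_n -> K) :
  w = \row_j f j z -> (forall j, areg n z (f j)) -> areg m w F ->
  (forall y, H y = F (\row_j f j y)) -> areg n z H.
Proof.
move=> -> rf rF e; apply: (reg_ext (aff_tame gG z) _ (reg_comp (aff_tame gG z) rf rF)).
by apply: (around_sub (aroundT (aff_tame gG z))) => y _; rewrite e.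
Qed.

Lemma aff_near m n (f : 'I_m -> 'rV[K]_n -> K) (z : 'rV[K]_n) (w : 'rV[K]_m)
    (P : set 'rV[K]_m) (Q : set 'rV[K]_n) :
  w = \row_j f j z -> (forall j, areg n z (f j)) -> anear m w P ->
  (forall y, P (\row_j f j y) -> Q y) -> anear n z Q.
Proof.
move=> -> rf [V [oV Vz VP]] PQ.
apply: (around_sub (reg_cont (aff_tame gG z) rf oV Vz)) => y Vy.
by apply: PQ; apply: VP.
Qed.

Definition lin n (z : 'rV[K]_n) (i : 'I_n) (s : K) : 'rV[K]_n :=
  \row_l (z 0 l + (l == i)%:R * s).

(** Differentiation without limits: the difference quotient along the i-th axis extends regularly
    over s = 0 by [aff_div], and by [aff_dens] its value there does not depend on the extension. *)
Definition pdv n (i : 'I_n) (F : 'rV[K]_n -> K) (z : 'rV[K]_n) : K :=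
  xget 0 [set a | exists Q : 'rV[K]_1 -> K, [/\ areg 1 0 Q,
    anear 1 0 (fun s => F (lin z i (s 0 0)) - F z = s 0 0 * Q s) & a = Q 0]].

Lemma lin0 n (z : 'rV[K]_n) i : lin z i 0 = z.
Proof. by apply/rowP => l; rewrite mxE mulr0 addr0. Qed.

Lemma pdvE n (i : 'I_n) F z (Q : 'rV[K]_1 -> K) : areg 1 0 Q ->
  anear 1 0 (fun s => F (lin z i (s 0 0)) - F z = s 0 0 * Q s) -> pdv i F z = Q 0.
Proof.
move=> rQ eQ; rewrite /pdv; case: xgetP => [a _ [Q' [rQ' eQ' ->]]|/(_ (Q 0))]; last first.
  by case; exists Q.
have := @aff_dens gG (fun s => Q' s - Q s) (reg_sub (aff_tame gG _) rQ' rQ).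
move=> h; apply/eqP; rewrite -subr_eq0; apply/eqP; apply: h.
apply: (around_sub (aroundI (aff_tame gG _) eQ eQ')) => s [e1 e2].
by rewrite mulrBr -e1 -e2 subrr.
Qed.

Lemma areg_lin m n (f : 'I_n -> 'rV[K]_m -> K) (s : 'rV[K]_m -> K) (i : 'I_n) z
    (F : 'rV[K]_n -> K) (w : 'rV[K]_n) :
  (forall j, areg m z (f j)) -> areg m z s -> areg n w F ->
  w = lin (\row_l f l z) i (s z) ->
  areg m z (fun y => F (lin (\row_l f l y) i (s y))).
Proof.
move=> rf rs rF ew; have tz := aff_tame gG z.
apply: (@aff_comp n m (fun l y => f l y + (l == i)%:R * s y) z w F) => //.
- by rewrite ew; apply/rowP => l; rewrite !mxE.
- by move=> j; apply: reg_add => //; apply: reg_mul => //; exact: reg_cst.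
- by move=> y; congr F; apply/rowP => l; rewrite !mxE.
Qed.

Lemma pdv_ex n (i : 'I_n) F z : areg n z F -> exists Q : 'rV[K]_1 -> K,
  areg 1 0 Q /\ anear 1 0 (fun s => F (lin z i (s 0 0)) - F z = s 0 0 * Q s).
Proof.
move=> rF.
have rH : areg 1 0 (fun s : 'rV[K]_1 => F (lin z i (s 0 0))).
  apply: (reg_ext (aff_tame gG _) _ (@areg_lin 1 n (fun l _ => z 0 l) (fun s => s 0 0) i 0 F z _ _ rF _)).
  - apply: (around_sub (aroundT (aff_tame gG _))) => y _.
    by congr (F (lin _ _ _)); apply/rowP => l; rewrite mxE.
  - by move=> j; exact: aff_cst.
  - exact: aff_coord.
  - by rewrite mxE; apply/rowP => l; rewrite !mxE mulr0 addr0.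
have [|Q [rQ eQ]] := @aff_div gG 1 0 ord0 _ _ rH; first by rewrite mxE.
exists Q; split => //; apply: (around_sub eQ) => s.
by rewrite (_ : setc s ord0 0 0 0 = 0) ?lin0 // mxE eqxx.
Qed.

(** All base points are treated at once: the step s becomes an extra coordinate, F (y + s e_i) - F y
    is divided by it on K^(n+1), and the quotient restricted to s = 0 is the derivative. *)
Lemma reg_pdv n (i : 'I_n) F z : areg n z F -> areg n z (pdv i F).
Proof.
move=> rF; have tz := aff_tame gG z.
pose z1 : 'rV[K]_(n + 1) := row_mx z 0.
have tz1 := aff_tame gG z1.
pose H (y : 'rV[K]_(n + 1)) := F (lin (\row_l y 0 (lshift 1 l)) i (y 0 (rshift n 0))).
have rH : areg (n + 1) z1 H.
  apply: (@areg_lin _ _ _ _ _ _ _ z) => //; try by move=> *; exact: aff_coord.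
  rewrite row_mxEr mxE lin0; apply/rowP => l; by rewrite mxE row_mxEl.
have [|Q [rQ eQ]] := @aff_div gG _ z1 (rshift n 0) _ _ rH; first by rewrite row_mxEr mxE.
pose emb (y : 'rV[K]_n) : 'rV[K]_(n + 1) := row_mx y 0.
have rowsplit (y : 'rV[K]_n) (s : 'rV[K]_1) :
    \row_(j < n + 1) (match fintype.split j with inl l => y 0 l | inr _ => s 0 0 end) = row_mx y s.
  by apply/rowP => j; rewrite !mxE; case: splitP => k _; rewrite ?mxE // ord1.
have near1 : anear n z (fun y => areg (n + 1) (emb y) Q /\
    anear (n + 1) (emb y) (fun y => H y - H (setc y (rshift n 0) 0) = y 0 (rshift n 0) * Q y)).
  apply: (@aff_near (n + 1) n (fun j y => match fintype.split j with inl l => y 0 l | inr _ => 0 end) z z1 _ _ _ _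
     (aroundI tz1 (reg_open tz1 rQ) (around_open eQ))).
  - by have := rowsplit z 0; rewrite mxE.
  - by move=> j; case: (fintype.split j) => l; [exact: aff_coord|exact: aff_cst].
  - by move=> y; have := rowsplit y 0; rewrite mxE => -> [].
have rE : areg n z (fun y => Q (emb y)).
  apply: (@aff_comp (n + 1) n (fun j y => match fintype.split j with inl l => y 0 l | inr _ => 0 end) z z1 Q) => //.
  - by have := rowsplit z 0; rewrite mxE.
  - by move=> j; case: (fintype.split j) => l; [exact: aff_coord|exact: aff_cst].
  - by move=> y; have := rowsplit y 0; rewrite mxE => ->.
apply: (reg_ext tz _ rE); apply: (around_sub near1) => y [rQy eQy].
rewrite (@pdvE n i F y (fun s => Q (row_mx y s))) //.
  apply: (@aff_comp (n + 1) 1 (fun j s => match fintype.split j with inl l => y 0 l | inr _ => s 0 0 end) 0 (emb y) Q) => //.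
  - by move=> j; case: (fintype.split j) => l; [exact: aff_cst|exact: aff_coord].
  - by move=> s; rewrite rowsplit.
apply: (@aff_near (n + 1) 1 (fun j s => match fintype.split j with inl l => y 0 l | inr _ => s 0 0 end) 0 (emb y) _ _ _ _ eQy) => [||s].
- by have := rowsplit y 0; rewrite mxE.
- by move=> j; case: (fintype.split j) => l; [exact: aff_cst|exact: aff_coord].
rewrite rowsplit /H row_mxEr => <-; congr (_ - _).
  by congr (F (lin _ _ _)); apply/rowP => l; rewrite mxE row_mxEl.
rewrite [setc _ _ _ 0 (rshift n 0)]mxE eqxx lin0; congr F; apply/rowP => l.
by rewrite mxE [setc _ _ _ _ _]mxE eq_lrshift row_mxEl.
Qed.

(** Walk from z to y along the axes, one coordinate at a time, and divide each increment by its
    coordinate difference; the increments telescope. *)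
Lemma hadamard n F (z : 'rV[K]_n) : areg n z F -> exists Q : 'I_n -> 'rV[K]_n -> K,
  [/\ forall l, areg n z (Q l), forall l, Q l z = pdv l F z &
   anear n z (fun y => F y = F z + \sum_l (y 0 l - z 0 l) * Q l y)].
Proof.
move=> rF; have tz := aff_tame gG z.
pose mix k (y : 'rV[K]_n) : 'rV[K]_n := \row_l (if (l < k)%N then y 0 l else z 0 l).
have mixz k : mix k z = z by apply/rowP => l; rewrite mxE if_same.
have step (k : 'I_n) : exists Q, [/\ areg n z Q, Q z = pdv k F z &
    anear n z (fun y => F (mix k.+1 y) - F (mix k y) = (y 0 k - z 0 k) * Q y)].
  (* [aff_div] divides by a coordinate that vanishes at the point, so z is first moved to the
     origin. *)
  pose H (w : 'rV[K]_n) := F (mix k.+1 (w + z)).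
  have t0 := aff_tame gG (0 : 'rV[K]_n).
  have rH : areg n 0 H.
    apply: (@aff_comp n n (fun l w => if (l < k.+1)%N then w 0 l + z 0 l else z 0 l) 0 z F) => //.
    - by apply/rowP => l; rewrite !mxE add0r if_same.
    - move=> j; case: (j < k.+1)%N; last exact: aff_cst.
      by apply: (reg_add t0); [exact: aff_coord|exact: aff_cst].
    - by move=> y; congr F; apply/rowP => l; rewrite !mxE.
  have [|Q [rQ eQ]] := @aff_div gG n 0 k _ _ rH; first by rewrite mxE.
  have sh : z - z = \row_l (z 0 l - z 0 l) by apply/rowP => l; rewrite !mxE.
  exists (fun y => Q (y - z)); split.
  - apply: (@aff_comp n n (fun l y => y 0 l - z 0 l) z 0 Q) => //.
    + by rewrite -sh subrr.
    + by move=> j; apply: (reg_sub tz); [exact: aff_coord|exact: aff_cst].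
    + by move=> y; congr Q; apply/rowP => l; rewrite !mxE.
  - rewrite subrr; symmetry.
    rewrite (@pdvE n k F z (fun s => Q (\row_l ((l == k)%:R * s 0 0)))).
    + by congr Q; apply/rowP => l; rewrite !mxE mulr0.
    + apply: (@aff_comp n 1 (fun l s => (l == k)%:R * s 0 0) 0 0 Q) => //.
        by apply/rowP => l; rewrite !mxE mulr0.
      by move=> j; apply: (reg_mul (aff_tame gG _)); [exact: aff_cst|exact: aff_coord].
    apply: (@aff_near n 1 (fun l s => (l == k)%:R * s 0 0) 0 0 _ _ _ _ eQ).
    + by apply/rowP => l; rewrite !mxE mulr0.
    + by move=> j; apply: (reg_mul (aff_tame gG _)); [exact: aff_cst|exact: aff_coord].
    move=> s; rewrite /H [X in _ = X * _]mxE eqxx mul1r => <-; congr (F _ - F _).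
      apply/rowP => l; rewrite !mxE; case: eqP => [->|]; first by rewrite ltnSn addrC.
      by rewrite !mul0r add0r addr0 if_same.
    apply/rowP => l; rewrite !mxE; case: eqP => [->|]; first by rewrite ltnSn add0r.
    by rewrite !mul0r add0r if_same.
  apply: (@aff_near n n (fun l y => y 0 l - z 0 l) z 0 _ _ _ _ eQ).
  - by rewrite -sh subrr.
  - by move=> j; apply: (reg_sub tz); [exact: aff_coord|exact: aff_cst].
  move=> y; rewrite [X in X * _]mxE (_ : \row_j _ = y - z); last by apply/rowP => l; rewrite !mxE.
  rewrite /H subrK => <-; congr (F _ - F _).
  apply/rowP => l; rewrite !mxE; case: eqP => [->|ne]; first by rewrite ltnn ltnSn add0r.
  rewrite subrK ltnS [(l <= k)%N]leq_eqVlt; have -> // : (nat_of_ord l == k) = false.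
  by apply/eqP => e; apply: ne; apply/val_inj.
have /choice[Q hQ] := step.
exists Q; split; [by move=> l; have [] := hQ l|by move=> l; have [] := hQ l|].
have := @around_forall _ _ tz _ (fun (k : 'I_n) y => F (mix k.+1 y) - F (mix k y) = (y 0 k - z 0 k) * Q k y)
  (fun k => let: And3 _ _ h := hQ k in h).
move=> /around_sub; apply => y hy.
under eq_bigr => l _ do rewrite -hy.
have -> : \sum_(i < n) (F (mix i.+1 y) - F (mix i y)) = F (mix n y) - F (mix 0 y).
  by rewrite -(big_mkord xpredT (fun i => F (mix i.+1 y) - F (mix i y))) telescope_sumr.
have -> : mix n y = y by apply/rowP => l; rewrite mxE ltn_ord.
have -> : mix 0 y = z by apply/rowP => l; rewrite mxE.
by rewrite addrC subrK.
Qed.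

(** Chain rule for abstract derivations: in the Hadamard expansion of F at the image of x each
    factor f_l - f_l(x) vanishes at x, so a derivation sees the quotients only through their values,
    the partial derivatives. *)
Lemma tangent_comp (X : fspace K) (x : X) (v : tvec X) m (f : 'I_m -> X -> K)
    (F : 'rV[K]_m -> K) (w : 'rV[K]_m) : tame x -> is_tangent x v ->
  (forall j, regular_at x (f j)) -> w = \row_j f j x -> areg m w F ->
  v (fun y => F (\row_j f j y)) = \sum_j v (f j) * pdv j F w.
Proof.
move=> tx tv rf -> rF; set w0 := \row_j _ in rF *.
have [Q [rQ Qw eQ]] := hadamard rF.
have rQf l : regular_at x (fun y => Q l (\row_j f j y)) by apply: (reg_comp tx rf).
have rd l : regular_at x (fun y => f l y - w0 0 l) by apply: (reg_sub tx) => //; exact: reg_cst.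
have near : around x (fun y => F (\row_j f j y) = F w0 + \sum_l (f l y - w0 0 l) * Q l (\row_j f j y)).
  have [V [oV Vz VP]] := eQ.
  apply: (around_sub (reg_cont tx rf oV Vz)) => y /VP ->.
  by congr (_ + _); apply: eq_bigr => l _; rewrite mxE.
rewrite (tangent_ext tx tv _ near); last exact: reg_comp.
rewrite (tangentD tv) ?(tangent_cst tx _ tv) ?add0r; last 2 first.
- exact: reg_cst.
- by apply: (reg_sum tx) => l _; apply: (reg_mul tx).
rewrite (tangent_sum tx _ tv); last by move=> l _; apply: (reg_mul tx).
apply: eq_bigr => l _; rewrite (tangentM tv) // -Qw (tangentB tx tv) //; last exact: reg_cst.
by rewrite (tangent_cst tx _ tv) subr0 mxE subrr mul0r add0r.
Qed.

Definition dvec n (u : 'rV[K]_n) (z : 'rV[K]_n) : tvec (affine G n) :=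
  fun F => if `[< areg n z F >] then \sum_l u 0 l * pdv l F z else 0.

Lemma dvecE n (u z : 'rV[K]_n) F : areg n z F -> dvec u z F = \sum_l u 0 l * pdv l F z.
Proof. by move=> rF; rewrite /dvec; case: asboolP. Qed.

Lemma near_lin n (i : 'I_n) (z : 'rV[K]_n) P : anear n z P ->
  anear 1 0 (fun s => P (lin z i (s 0 0))).
Proof.
move=> h; apply: (@aff_near n 1 (fun l s => z 0 l + (l == i)%:R * s 0 0) 0 z _ _ _ _ h).
- by apply/rowP => l; rewrite !mxE mulr0 addr0.
- move=> j; apply: (reg_add (aff_tame gG _)); first exact: aff_cst.
  by apply: (reg_mul (aff_tame gG _)); [exact: aff_cst|exact: aff_coord].
by move=> y py; rewrite /lin.
Qed.

Lemma reg_lin n (i : 'I_n) (z : 'rV[K]_n) F : areg n z F ->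
  areg 1 0 (fun s => F (lin z i (s 0 0))).
Proof.
move=> h; apply: (@aff_comp n 1 (fun l s => z 0 l + (l == i)%:R * s 0 0) 0 z _ _ _ _ h) => //.
- by apply/rowP => l; rewrite !mxE mulr0 addr0.
- move=> j; apply: (reg_add (aff_tame gG _)); first exact: aff_cst.
  by apply: (reg_mul (aff_tame gG _)); [exact: aff_cst|exact: aff_coord].
Qed.

Lemma pdv_ext n (i : 'I_n) F F' z : areg n z F -> anear n z (fun y => F y = F' y) ->
  pdv i F z = pdv i F' z.
Proof.
move=> rF e; have [Q [rQ eQ]] := pdv_ex i rF.
rewrite (pdvE rQ eQ) (@pdvE _ _ _ _ Q) //.
apply: (around_sub (aroundI (aff_tame gG _) eQ (near_lin i e))) => s [<- <-].
by rewrite (around_self e).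
Qed.

Lemma pdvP n (i : 'I_n) (c : K) F F' z : areg n z F -> areg n z F' ->
  pdv i (fun y => c * F y + F' y) z = c * pdv i F z + pdv i F' z.
Proof.
move=> rF rF'; have [Q [rQ eQ]] := pdv_ex i rF; have [Q' [rQ' eQ']] := pdv_ex i rF'.
have t0 := aff_tame gG (0 : 'rV[K]_1).
rewrite (pdvE rQ eQ) (pdvE rQ' eQ') (@pdvE _ _ _ _ (fun s => c * Q s + Q' s)) //.
  by apply: (reg_add t0) => //; apply: (reg_mul t0) => //; exact: aff_cst.
apply: (around_sub (aroundI t0 eQ eQ')) => s [e1 e2].
rewrite mulrDr [_ * (c * _)]mulrCA -e1 -e2; ring.
Qed.

Lemma pdvM n (i : 'I_n) F F' z : areg n z F -> areg n z F' ->
  pdv i (fun y => F y * F' y) z = F z * pdv i F' z + pdv i F z * F' z.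
Proof.
move=> rF rF'; have [Q [rQ eQ]] := pdv_ex i rF; have [Q' [rQ' eQ']] := pdv_ex i rF'.
have t0 := aff_tame gG (0 : 'rV[K]_1).
rewrite (pdvE rQ eQ) (pdvE rQ' eQ').
rewrite (@pdvE _ _ _ _ (fun s => F z * Q' s + Q s * F' (lin z i (s 0 0)))) //.
- by rewrite mxE lin0.
- apply: (reg_add t0); apply: (reg_mul t0) => //; first exact: aff_cst.
  exact: reg_lin.
apply: (around_sub (aroundI t0 eQ eQ')) => s [e1 e2].
rewrite mulrDr [_ * (F z * _)]mulrCA -e2 mulrA -e1; ring.
Qed.

Lemma pdv_coord n (i l : 'I_n) z : pdv i (fun y => y 0 l) z = (l == i)%:R.
Proof.
rewrite (@pdvE _ _ _ _ (fun=> (l == i)%:R)) //; first exact: aff_cst.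
apply: (around_sub (aroundT (aff_tame gG _))) => s _.
by rewrite mxE addrC addKr mulrC.
Qed.

Lemma dvec_tangent n (u z : 'rV[K]_n) : is_tangent (X := affine G n) z (dvec u z).
Proof.
have tz := aff_tame gG z; split.
- by move=> f nf; rewrite /dvec; case: asboolP.
- by move=> f g rf rg e; rewrite !dvecE //; apply: eq_bigr => l _; rewrite (pdv_ext _ rf e).
- move=> c f g rf rg; rewrite !dvecE //; last first.
    by apply: (reg_add tz) => //; apply: (reg_mul tz) => //; exact: aff_cst.
  rewrite mulr_sumr -big_split; apply: eq_bigr => l _ /=.
  by rewrite pdvP // mulrDr mulrCA.
- move=> f g rf rg; rewrite !dvecE //; last exact: (reg_mul tz).
  rewrite mulr_sumr mulr_suml -big_split; apply: eq_bigr => l _ /=.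
  rewrite pdvM //; ring.
Qed.

Lemma affine_tangent n (z : 'rV[K]_n) (v : tvec (affine G n)) :
  is_tangent (X := affine G n) z v ->
  v = dvec (\row_l v (fun y : 'rV[K]_n => y 0 l)) z.
Proof.
move=> tv; apply/funext => F; rewrite /dvec; case: asboolP => rF; last by case: tv => ->.
have := @tangent_comp (affine G n) z v n (fun l y => y 0 l) F z (aff_tame gG _) tv.
rewrite (_ : (fun y => F (\row_j _)) = F); last first.
  by apply/funext => y; congr F; apply/rowP => l; rewrite mxE.
move=> -> //.
- by apply: eq_bigr => l _; rewrite mxE.
- by move=> j; exact: aff_coord.
- by apply/rowP => l; rewrite mxE.
Qed.

Lemma aff_setc n (z : 'rV[K]_n) i (F : 'rV[K]_n -> K) : z 0 i = 0 -> areg n z F ->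
  areg n z (fun y => F (setc y i 0)).
Proof.
move=> zi rF.
apply: (@aff_comp n n (fun l y => if l == i then 0 else y 0 l) z z F) => //.
- by apply/rowP => l; rewrite mxE; case: eqP => [->|].
- by move=> j; case: (j == i); [exact: aff_cst|exact: aff_coord].
Qed.

Lemma near_setc n (z : 'rV[K]_n) i P : z 0 i = 0 -> anear n z P ->
  anear n z (fun y => P (setc y i 0)).
Proof.
move=> zi nP.
apply: (@aff_near n n (fun l y => if l == i then 0 else y 0 l) z z P) => //.
- by apply/rowP => l; rewrite mxE; case: eqP => [->|].
- by move=> j; case: (j == i); [exact: aff_cst|exact: aff_coord].
Qed.

(** Division by one coordinate after the other: setting one coordinate to 0 leaves a function
    handled by induction. This is [regular_zeros] for a linear subspace, to which the inverse
    function theorem reduces the differential categories. *)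
Lemma coord_ideal n m (F : 'rV[K]_n -> K) : (m <= n)%N -> areg n 0 F ->
  anear n 0 (fun y => (forall i : 'I_n, (i < m)%N -> y 0 i = 0) -> F y = 0) ->
  exists h : 'I_n -> 'rV[K]_n -> K, (forall i, areg n 0 (h i)) /\
    anear n 0 (fun y => F y = \sum_(i < n | (i < m)%N) h i y * y 0 i).
Proof.
have t0 := aff_tame gG (0 : 'rV[K]_n).
elim: m F => [|m ih] F mn rF hF.
  exists (fun _ _ => 0); split; first by move=> i; exact: aff_cst.
  by apply: (around_sub hF) => y ->; rewrite ?big_pred0.
pose i0 : 'I_n := Ordinal mn.
have z0 : (0 : 'rV[K]_n) 0 i0 = 0 by rewrite mxE.
have [|h [rh eh]] := ih _ (ltnW mn) (aff_setc z0 rF).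
  apply: (around_sub (near_setc z0 hF)) => y hy h; apply: hy => i.
  rewrite ltnS leq_eqVlt mxE => /orP[/eqP e|im]; first by rewrite (_ : i == i0) //; apply/eqP/val_inj.
  by case: eqP => // _; exact: h.
have [Q [rQ eQ]] := aff_div gG z0 rF.
exists (fun i => if i == i0 then Q else h i); split; first by move=> i; case: (i == i0).
apply: (around_sub (aroundI t0 eh eQ)) => y [e1 e2].
rewrite -[F y](subrK (F (setc y i0 0))) e2 e1 [RHS](bigD1 i0) /= ?ltnSn //.
rewrite eqxx mulrC; congr (_ + _); apply: eq_big => [i|i im].
  by rewrite ltnS ltn_neqAle -val_eqE andbC.
by have -> // : (i == i0) = false by apply/eqP => e; rewrite e /= ltnn in im.
Qed.

(* Functions vanishing on a smooth complete intersection lie in its ideal: by the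
   inverse function theorem in the differential categories, by the Nullstellensatz
   and Nakayama's lemma in the algebraic one. The function s completes the g_i to
   a coordinate system, so the intersection is a curve. *)
Definition regular_zeros := forall m (z : 'rV[K]_(m + 1))
    (g : 'I_m -> 'rV[K]_(m + 1) -> K) (s H : 'rV[K]_(m + 1) -> K),
  (forall i, areg _ z (g i)) -> areg _ z s -> (forall i, g i z = 0) -> s z = 0 ->
  (forall u : 'rV[K]_(m + 1), (forall i, dvec u z (g i) = 0) -> dvec u z s = 0 -> u = 0) ->
  areg _ z H -> anear _ z (fun y => (forall i, g i y = 0) -> H y = 0) ->
  exists h : 'I_m -> 'rV[K]_(m + 1) -> K, (forall i, areg _ z (h i)) /\
    anear _ z (fun y => H y = \sum_i h i y * g i y).

End Tame.

(** Focal curves are manifolds of the category, hence subject to its countability condition; a curve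
    built inside a stage inherits it through its embedding in affine space. *)
Definition small_subspaces (G : geometry) := forall n (T : Type) (f : T -> 'rV[scalars G]_n),
  @small G T [set W | exists2 V, opn (affine G n) V & W = f @^-1` V].

(** * Systems of parameters at a point *)

Section Zeros.
Variables (G : geometry).
Hypothesis gG : good G.
Local Notation K := (scalars G).
Local Notation areg n z F := (@regular_at K (affine G n) z F).
Local Notation anear n z P := (@around K (affine G n) z P).

Lemma tangentX (X : fspace K) (x : X) (v : tvec X) f n : tame (G := G) x -> is_tangent x v ->
  regular_at x f -> v (fun y => f y ^+ n.+1) = n.+1%:R * f x ^+ n * v f.
Proof.
move=> tx tv rf; elim: n => [|n ih]; first by rewrite expr0 !mul1r.
have e : (fun y => f y ^+ n.+2) = fun y => f y * f y ^+ n.+1.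
  by apply/funext => y; rewrite exprS.
have rX : regular_at x (fun y => f y ^+ n.+1).
  elim: n {ih e} => [|n ih]; first exact: rf.
  have e' : (fun y => f y ^+ n.+2) = fun y => f y * f y ^+ n.+1.
    by apply/funext => y; rewrite exprS.
  by rewrite e'; exact: (reg_mul gG tx).
rewrite e (tangentM tv) // ih exprS [n.+2%:R]mulrS; ring.
Qed.

Lemma reg_exp (X : fspace K) (x : X) f n : tame (G := G) x ->
  regular_at x f -> regular_at x (fun y => f y ^+ n).
Proof.
move=> tx rf; elim: n => [|n ih]; first exact: (reg_cst gG tx).
have e : (fun y => f y ^+ n.+1) = fun y => f y * f y ^+ n.
  by apply/funext => y; rewrite exprS.
by rewrite e; exact: (reg_mul gG tx).
Qed.

Variables (n : nat) (z : 'rV[K]_n) (gs : 'I_n -> 'rV[K]_n -> K).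
Hypotheses (rg : forall i, areg n z (gs i)) (gz : forall i, gs i z = 0)
  (ginj : forall u : 'rV[K]_n, (forall i, dvec u z (gs i) = 0) -> u = 0).
Let tz := aff_tame gG z.

(** By Hadamard the row of the gs is (y - z) A(y), where A(z) is their Jacobian and hence
    invertible; solving for y - z and substituting in the expansion of F gives the coefficients. *)
Lemma zeros_coord F : areg n z F -> F z = 0 ->
  exists c : 'I_n -> 'rV[K]_n -> K, (forall i, areg n z (c i)) /\
    anear n z (fun y => F y = \sum_i c i y * gs i y).
Proof.
move=> rF Fz.
have /choice[Q hQ] := fun i => hadamard gG (rg i).
have [QF [rQF _ eF]] := hadamard gG rF.
pose A (y : 'rV[K]_n) := \matrix_(l, i) Q i l y.
have rA l i : areg n z (fun y => A y l i).
  by under eq_fun do rewrite mxE; have [h _ _] := hQ i.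
have uA : A z \in unitmx.
  apply: inj_unit => u /matrixP h; apply: ginj => i.
  have := h 0 i; rewrite !mxE (dvecE _ (rg i)) => e; rewrite -[RHS]e.
  by apply: eq_bigr => l _; rewrite mxE; have [_ -> _] := hQ i.
have [rI nI] := reg_invmx gG tz rA uA.
exists (fun i y => \sum_l invmx (A y) i l * QF l y); split.
  by move=> i; apply: (reg_sum gG tz) => l _; apply: (reg_mul gG tz).
have near : anear n z (fun y => forall i, gs i y = gs i z + \sum_l (y 0 l - z 0 l) * Q i l y).
  by apply: (around_forall tz) => i; have [_ _ h] := hQ i.
apply: (around_sub (aroundI tz eF (aroundI tz nI near))) => y [-> [uy hy]].
have hv : \row_i gs i y *m invmx (A y) = y - z.
  apply: (can_inj (mulmxK uy)); rewrite mulmxKV //; apply/rowP => i.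
  by rewrite !mxE hy gz add0r; apply: eq_bigr => l _; rewrite !mxE.
rewrite Fz add0r.
under eq_bigr => l _.
  have := congr1 (fun M : 'rV[K]_n => M 0 l) hv; rewrite !mxE => <-; rewrite mulr_suml; over.
rewrite exchange_big /=; apply: eq_bigr => i _; rewrite mulr_suml.
by apply: eq_bigr => l _; rewrite mxE; ring.
Qed.

(** The field dual to gs k kills the other gs; applied to a relation for gs k ^ (N+1) it yields one
    for (N+1) gs k ^ N, and characteristic 0 allows the division. For N = 0 the relation reads 1 = 0
    at z. *)
Lemma zeros_power (k : 'I_n) N : ~ exists c : 'I_n -> 'rV[K]_n -> K,
  (forall i, areg n z (c i)) /\
  anear n z (fun y => gs k y ^+ N = \sum_(i | i != k) c i y * gs i y).
Proof.
elim: N => [|N ih] [c [rc ec]].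
  have := around_self ec; rewrite expr0 big1; first by move/eqP; rewrite oner_eq0.
  by move=> i _; rewrite gz mulr0.
pose A (y : 'rV[K]_n) := \matrix_(l, i) pdv l (gs i) y.
have rA l i : areg n z (fun y => A y l i).
  by under eq_fun do rewrite mxE; exact: reg_pdv.
have uA : A z \in unitmx.
  apply: inj_unit => u /matrixP h; apply: ginj => i.
  have := h 0 i; rewrite !mxE (dvecE _ (rg i)) => e; rewrite -[RHS]e.
  by apply: eq_bigr => l _; rewrite mxE.
have [rI nI] := reg_invmx gG tz rA uA.
pose u (y : 'rV[K]_n) := row k (invmx (A y)).
pose D (F : 'rV[K]_n -> K) y := \sum_l u y 0 l * pdv l F y.
have rD F : areg n z F -> areg n z (D F).
  move=> rF; apply: (reg_sum gG tz) => l _; apply: (reg_mul gG tz); last exact: reg_pdv.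
  by under eq_fun do rewrite mxE.
apply: ih; exists (fun i y => N.+1%:R^-1 * D (c i) y); split.
  by move=> i; apply: (reg_mul gG tz); [exact: (reg_cst gG tz)|exact: rD].
have n1 : anear n z (fun y => forall i, areg n y (gs i)).
  by apply: (around_forall tz) => i; exact: reg_open.
have n2 : anear n z (fun y => forall i, areg n y (c i)).
  by apply: (around_forall tz) => i; exact: reg_open.
apply: (around_sub (aroundI tz (around_open ec) (aroundI tz nI (aroundI tz n1 n2)))).
move=> y [ey [uy [rgy rcy]]].
have ty := aff_tame gG y; have tu := dvec_tangent gG (u y) y.
have Dg i : dvec (u y) y (gs i) = (i == k)%:R.
  rewrite dvecE //; have := mulVmx uy => /matrixP /(_ k i); rewrite !mxE eq_sym => <-.
  by apply: eq_bigr => l _; rewrite !mxE.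
have := tangent_ext ty tu (reg_exp N.+1 ty (rgy k)) ey.
rewrite (tangentX _ ty tu (rgy k)) Dg eqxx mulr1 (tangent_sum gG ty _ tu); last first.
  by move=> i _; apply: (reg_mul gG ty).
move=> h; rewrite -[LHS](mulKf (char0 gG N)) h mulr_sumr; apply: eq_bigr => i ik.
by rewrite (tangentM tu) // Dg (negPf ik) mulr0 add0r (dvecE _ (rcy i)) mulrA.
Qed.

End Zeros.

(** * Local coordinates and tangent vectors *)

Section Patches.
Variable (G : geometry).
Hypothesis gG : good G.
Local Notation K := (scalars G).
Local Notation areg n z F := (@regular_at K (affine G n) z F).
Local Notation anear n z P := (@around K (affine G n) z P).

Lemma tangent_eq (X : fspace K) (x : X) (v v' : tvec X) : is_tangent x v -> is_tangent x v' ->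
  (forall f, regular_at x f -> v f = v' f) -> v = v'.
Proof.
move=> [h _ _ _] [h' _ _ _] e; apply/funext => f.
by have [rf|rf] := pselect (regular_at x f); [exact: e|rewrite h // h'].
Qed.

Lemma tangent_comb (X : fspace K) (x : X) (I : finType) (c : I -> K) (v : I -> tvec X) :
  (forall i, is_tangent x (v i)) -> is_tangent x (fun f => \sum_i c i * v i f).
Proof.
move=> tv; split.
- by move=> f nf; rewrite big1 // => i _; have [-> //] := tv i; rewrite mulr0.
- by move=> f g rf rg e; apply: eq_bigr => i _; have [_ h _ _] := tv i; rewrite (h f g).
- move=> a f g rf rg; rewrite mulr_sumr -big_split; apply: eq_bigr => i _ /=.
  by have [_ _ h _] := tv i; rewrite h // mulrDr mulrCA.
- move=> f g rf rg; rewrite mulr_sumr mulr_suml -big_split; apply: eq_bigr => i _ /=.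
  by have [_ _ _ h] := tv i; rewrite h //; ring.
Qed.

Lemma tangent_comb2 (X : fspace K) (x : X) a b (v w : tvec X) :
  is_tangent x v -> is_tangent x w -> is_tangent x (fun f => a * v f + b * w f).
Proof.
move=> tv tw.
have := @tangent_comb X x 'I_2 (fun i => if i == 0 then a else b) (fun i => if i == 0 then v else w).
have e : (fun f => \sum_(i < 2) (if i == 0 then a else b) * (if i == 0 then v else w) f) =
    (fun f => a * v f + b * w f).
  by apply/funext => f; rewrite !big_ord_recl big_ord0 addr0.
by rewrite e; apply => i; case: (i == 0).
Qed.

Lemma tangent_tzero (X : fspace K) (x : X) : is_tangent x (tzero (X := X)).
Proof. by split => // *; rewrite /tzero ?mulr0 ?mul0r ?addr0. Qed.

(** What a chart retains when only the induced topology and functions matter. The image of U may be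
    any subset of K^n, which covers subvarieties in the algebraic category and passes to
    prolongations. *)
Record coords (X : fspace K) (U : set X) n (phi : X -> 'rV[K]_n) : Prop := Patch {
  patch_near : forall x P, U x -> (around x P <->
    exists Q : set 'rV[K]_n, anear n (phi x) Q /\ forall y, U y -> Q (phi y) -> P y);
  patch_reg : forall x f, U x -> (regular_at x f <->
    exists F : 'rV[K]_n -> K, areg n (phi x) F /\ around x (fun y => f y = F (phi y))) }.

(** The vector with components u, evaluated on some extension of the function to affine space. If u
    is [admissible], that is, annihilates the functions vanishing on the image of [phi] near x, the
    choice of the extension does not matter. *)
Definition ptan (X : fspace K) n (phi : X -> 'rV[K]_n) (x : X) (u : 'rV[K]_n) : tvec X :=
  fun f => if `[< regular_at x f >] then dvec (G := G) u (phi x)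
    (xget (fun=> 0) [set F : 'rV[K]_n -> K | areg n (phi x) F /\ around x (fun y => f y = F (phi y))])
  else 0.

Definition admissible (X : fspace K) n (phi : X -> 'rV[K]_n) (x : X) (u : 'rV[K]_n) :=
  forall F : 'rV[K]_n -> K, areg n (phi x) F -> around x (fun y => F (phi y) = 0) ->
  dvec (G := G) u (phi x) F = 0.

Section Patch.
Variables (X : fspace K) (U : set X) (n : nat) (phi : X -> 'rV[K]_n).
Hypothesis pU : coords U phi.
Implicit Types (x : X).

Lemma patch_self x : U x -> around x U.
Proof.
move=> Ux; apply/(patch_near pU _ Ux); exists setT; split => //.
exact: aroundT (aff_tame gG _).
Qed.

Lemma patch_pull x Q : U x -> anear n (phi x) Q -> around x (fun y => Q (phi y)).
Proof. by move=> Ux nQ; apply/(patch_near pU _ Ux); exists Q. Qed.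

Lemma patch_regF x F : U x -> areg n (phi x) F -> regular_at x (fun y => F (phi y)).
Proof.
move=> Ux rF; apply/(patch_reg pU _ Ux); exists F; split => //.
by apply: (around_sub (patch_self Ux)).
Qed.

Lemma patch_coord x l : U x -> regular_at x (fun y => phi y 0 l).
Proof. by move=> Ux; apply: (patch_regF Ux (aff_coord gG (phi x) l)). Qed.

Lemma patch_tame x : U x -> tame (G := G) x.
Proof.
move=> Ux; have tz := aff_tame gG (phi x).
have aI (P Q : set X) : around x P -> around x Q -> around x (P `&` Q).
  move=> /(patch_near pU _ Ux)[A [nA hA]] /(patch_near pU _ Ux)[B [nB hB]].
  apply/(patch_near pU _ Ux); exists (A `&` B); split; first exact: (aroundI tz).
  by move=> y Uy [Ay By]; split; [exact: hA|exact: hB].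
split => //.
- by apply: (around_sub (patch_self Ux)).
- move=> f /(patch_reg pU _ Ux)[F [rF eF]].
  apply: (around_sub (aI _ _ (patch_self Ux) (aI _ _ (around_open eF) (patch_pull Ux (reg_open tz rF))))).
  by move=> y [Uy [ey ry]]; apply/(patch_reg pU _ Uy); exists F.
- move=> f g e /(patch_reg pU _ Ux)[F [rF eF]]; apply/(patch_reg pU _ Ux); exists F; split => //.
  by apply: (around_sub (aI _ _ e eF)) => y [<- <-].
- move=> m f F rf rF.
  have /choice[H hH] : forall j, exists H : 'rV[K]_n -> K, areg n (phi x) H /\ around x (fun y => f j y = H (phi y)).
    by move=> j; apply/(patch_reg pU _ Ux).
  have e : around x (fun y => forall j, f j y = H j (phi y)).
    suff: forall s : seq 'I_m, around x (fun y => forall j, j \in s -> f j y = H j (phi y)).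
      by move=> /(_ (enum 'I_m)) /around_sub; apply => y hy j; apply: hy; rewrite mem_enum.
    elim=> [|j s ih]; first by apply: (around_sub (patch_self Ux)).
    apply: (around_sub (aI _ _ ih (hH j).2)) => y [h1 h2] i.
    by rewrite inE => /orP[/eqP ->|/h1].
  apply/(patch_reg pU _ Ux); exists (fun z => F (\row_j H j z)); split; last first.
    by apply: (around_sub e) => y ey; congr F; apply/rowP => j; rewrite !mxE ey.
  apply: (reg_comp tz); first by move=> j; case: (hH j).
  suff -> : \row_j H j (phi x) = \row_j f j x by [].
  by apply/rowP => j; rewrite !mxE (around_self e).
- move=> m f V rf oV Vx.
  have /choice[H hH] : forall j, exists H : 'rV[K]_n -> K, areg n (phi x) H /\ around x (fun y => f j y = H (phi y)).
    by move=> j; apply/(patch_reg pU _ Ux).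
  have e : around x (fun y => forall j, f j y = H j (phi y)).
    suff: forall s : seq 'I_m, around x (fun y => forall j, j \in s -> f j y = H j (phi y)).
      by move=> /(_ (enum 'I_m)) /around_sub; apply => y hy j; apply: hy; rewrite mem_enum.
    elim=> [|j s ih]; first by apply: (around_sub (patch_self Ux)).
    apply: (around_sub (aI _ _ ih (hH j).2)) => y [h1 h2] i.
    by rewrite inE => /orP[/eqP ->|/h1].
  have eH y : (forall j, f j y = H j (phi y)) -> \row_j H j (phi y) = \row_j f j y.
    by move=> ey; apply/rowP => j; rewrite !mxE ey.
  have := reg_cont tz (fun j => (hH j).1) oV; rewrite (eH _ (around_self e)) => /(_ Vx) nV.
  by apply: (around_sub (aI _ _ e (patch_pull Ux nV))) => y [/eH <-].
Qed.

Lemma ptanE x u f F : U x -> admissible phi x u -> areg n (phi x) F ->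
  around x (fun y => f y = F (phi y)) -> ptan phi x u f = dvec (G := G) u (phi x) F.
Proof.
move=> Ux au rF eF; have tx := patch_tame Ux; have tz := aff_tame gG (phi x).
rewrite /ptan; case: asboolP => [rf|nrf]; last by case: nrf; apply/(patch_reg pU _ Ux); exists F.
case: xgetP => [H _ [rH eH]|/(_ F)]; last by case.
have tu := dvec_tangent gG u (phi x).
apply/eqP; rewrite -subr_eq0 -(tangentB gG tz tu rH rF); apply/eqP; apply: au.
  exact: (reg_sub gG tz).
by apply: (around_sub (aroundI tx eH eF)) => y [<- <-]; rewrite subrr.
Qed.

Lemma ptan_coord x u l : U x -> admissible phi x u -> ptan phi x u (fun y => phi y 0 l) = u 0 l.
Proof.
move=> Ux au; rewrite (@ptanE x u _ (fun z => z 0 l)) //.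
- rewrite dvecE; last exact: aff_coord.
  rewrite (bigD1 l) //= (pdv_coord gG) eqxx mulr1 big1 ?addr0 // => j jl.
  by rewrite (pdv_coord gG) eq_sym (negPf jl) mulr0.
- exact: aff_coord.
- by apply: (around_sub (patch_self Ux)).
Qed.

Lemma ptan_tangent x u : U x -> admissible phi x u -> is_tangent x (ptan phi x u).
Proof.
move=> Ux au; have tx := patch_tame Ux; have tz := aff_tame gG (phi x).
have tu := dvec_tangent gG u (phi x); split.
- by move=> f nf; rewrite /ptan; case: asboolP.
- move=> f g /(patch_reg pU _ Ux)[F [rF eF]] rg e; rewrite (ptanE Ux au rF eF) (ptanE Ux au rF) //.
  by apply: (around_sub (aroundI tx e eF)) => y [<- <-].
- move=> c f g /(patch_reg pU _ Ux)[F [rF eF]] /(patch_reg pU _ Ux)[H [rH eH]].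
  have rc : areg n (phi x) (fun y => c * F y).
    by apply: (reg_mul gG tz) => //; exact: aff_cst.
  rewrite (ptanE Ux au rF eF) (ptanE Ux au rH eH) (@ptanE _ _ _ (fun y => c * F y + H y)) //.
  + by case: tu => _ _ h _; apply: h.
  + exact: (reg_add gG tz).
  + by apply: (around_sub (aroundI tx eF eH)) => y [-> ->].
- move=> f g /(patch_reg pU _ Ux)[F [rF eF]] /(patch_reg pU _ Ux)[H [rH eH]].
  rewrite (ptanE Ux au rF eF) (ptanE Ux au rH eH) (@ptanE _ _ _ (fun y => F y * H y)) //.
  + by rewrite (around_self eF) (around_self eH) (tangentM tu).
  + exact: (reg_mul gG tz).
  + by apply: (around_sub (aroundI tx eF eH)) => y [-> ->].
Qed.

Lemma tangentE x v F : U x -> is_tangent x v -> areg n (phi x) F ->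
  v (fun y => F (phi y)) = dvec (G := G) (\row_l v (fun y => phi y 0 l)) (phi x) F.
Proof.
move=> Ux tv rF; have tx := patch_tame Ux.
have := @tangent_comp G gG X x v n (fun l y => phi y 0 l) F (phi x) tx tv.
have e y : \row_l phi y 0 l = phi y by apply/rowP => l; rewrite mxE.
rewrite (_ : (fun y => F (\row_j _)) = (fun y => F (phi y))); last by apply/funext => y; rewrite e.
move=> -> //; last by move=> j; exact: patch_coord.
by rewrite dvecE //; apply: eq_bigr => l _; rewrite mxE.
Qed.

Lemma tangent_det x v v' : U x -> is_tangent x v -> is_tangent x v' ->
  (forall l, v (fun y => phi y 0 l) = v' (fun y => phi y 0 l)) -> v = v'.
Proof.
move=> Ux tv tv' h; apply: (tangent_eq tv tv') => f /(patch_reg pU _ Ux)[F [rF eF]].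
have tx := patch_tame Ux; have rF' := patch_regF Ux rF.
have rf : regular_at x f by apply: (reg_ext tx _ rF'); apply: (around_sub eF) => y ->.
rewrite (tangent_ext tx tv rf eF) (tangent_ext tx tv' rf eF) (tangentE Ux tv rF) (tangentE Ux tv' rF).
by congr (dvec _ _ _); apply/rowP => l; rewrite !mxE.
Qed.

Lemma ptan_vfield (u : X -> 'rV[K]_n) : (forall x, U x -> admissible phi x (u x)) ->
  (forall x l, U x -> regular_at x (fun y => u y 0 l)) ->
  is_vfield U (fun x => ptan phi x (u x)).
Proof.
move=> au ru x Ux; split; first exact: ptan_tangent (au x Ux).
move=> f /(patch_reg pU _ Ux)[F [rF eF]]; have tx := patch_tame Ux.
have tz := aff_tame gG (phi x).
have r : regular_at x (fun y => \sum_l u y 0 l * pdv l F (phi y)).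
  apply: (reg_sum gG tx) => l _; apply: (reg_mul gG tx); first exact: ru.
  exact: (patch_regF Ux (reg_pdv gG l rF)).
apply: (reg_ext tx _ r).
apply: (around_sub (aroundI tx (patch_self Ux) (aroundI tx (around_open eF) (patch_pull Ux (reg_open tz rF))))).
by move=> y [Uy [ey ry]]; rewrite (ptanE Uy (au y Uy) ry ey) dvecE.
Qed.

End Patch.

End Patches.

(** * Coordinates on a prolongation *)

Section Prolongation.
Variable (G : geometry).
Hypothesis gG : good G.
Local Notation K := (scalars G).
Local Notation areg n z F := (@regular_at K (affine G n) z F).
Local Notation anear n z P := (@around K (affine G n) z P).

Lemma line_pt_eq (D : dspace K) (y y' : line_pt D) : base y = base y' -> line y = line y' -> y = y'.
Proof.
by move: y y' => [[x l] h] [[x' l'] h'] /= exx ell; apply: eq_exist; rewrite /= [x]exx [l]ell.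
Qed.

(** fA and fB are dual to A and B: evaluating a section on them returns its coefficients, so these
    coefficients are regular functions. *)
Record framing (D : dspace K) (U : set D) (A B : vfield D) (fA fB : D -> K) : Prop := Framing {
  fr_A : is_vfield U A;
  fr_B : is_vfield U B;
  fr_fibre : forall x v, U x -> (fibre D x v <-> exists a b, v = fun f => a * A x f + b * B x f);
  fr_fA : regular_on U fA;
  fr_fB : regular_on U fB;
  fr_AA : forall x, U x -> A x fA = 1;
  fr_AB : forall x, U x -> A x fB = 0;
  fr_BA : forall x, U x -> B x fA = 0;
  fr_BB : forall x, U x -> B x fB = 1 }.

Lemma framing_swap (D : dspace K) (U : set D) A B fA fB : framing U A B fA fB -> framing U B A fB fA.
Proof.
move=> [h1 h2 h3 h4 h5 h6 h7 h8 h9]; split => // x v Ux.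
rewrite (h3 x v Ux); split=> -[a [b ->]]; exists b, a; apply/funext => f; exact: addrC.
Qed.

Variables (D : dspace K) (U : set D) (n : nat) (phi : D -> 'rV[K]_n).
Hypothesis pU : coords U phi.
Variables (A B : vfield D) (fA fB : D -> K).
Hypothesis fr : framing U A B fA fB.

Local Notation P := (proj_space D).

Definition slope (y : P) : K :=
  xget 0 [set s | line y (fun f => A (base y) f + s * B (base y) f)].
Definition slope_dom : set P := [set y | U (base y) /\ ~ line y (B (base y))].
Definition slope_coord (y : P) : 'rV[K]_(n + 1) := row_mx (phi (base y)) (const_mx (slope y)).

Local Notation U' := slope_dom.
Local Notation phi' := slope_coord.

Lemma tlineZ (X : fspace K) (v : tvec X) a : a != 0 -> tline (fun f => a * v f) = tline v.
Proof.
move=> a0; apply/seteqP; split=> w [c ->].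
  by exists (c * a); apply/funext => f; rewrite mulrA.
by exists (c / a); apply/funext => f; rewrite mulrA divfK.
Qed.

Lemma line_comb (y : line_pt D) : U (base y) -> exists a b,
  (a != 0) || (b != 0) /\ line y = tline (fun f => a * A (base y) f + b * B (base y) f).
Proof.
move=> Uy; have := svalP y; rewrite -/(base y) -/(line y) => -[v [fv v0 ->]].
have [a [b ev]] := (fr_fibre fr v Uy).1 fv.
exists a, b; rewrite ev; split => //.
apply: contra_notT v0; rewrite negb_or !negbK => /andP[/eqP a0 /eqP b0].
by rewrite ev; apply/funext => f; rewrite a0 b0 !mul0r addr0.
Qed.

Lemma slope_line (y : P) : U' y -> line y = tline (fun f => A (base y) f + slope y * B (base y) f).
Proof.
move=> [Uy nB]; have [a [b [ab e]]] := line_comb Uy.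
have a0 : a != 0.
  apply/eqP => a0; apply: nB; rewrite e a0; rewrite a0 eqxx /= in ab.
  by exists b^-1; apply/funext => f; rewrite mul0r add0r mulKf.
have e' : line y = tline (fun f => A (base y) f + (b / a) * B (base y) f).
  rewrite e -(tlineZ (fun f => A (base y) f + b / a * B (base y) f) a0); congr tline.
  by apply/funext => f; rewrite mulrDr mulrA [a * (b / a)]mulrC divfK.
rewrite /slope; case: xgetP => [s _ /= hs|/(_ (b / a))]; last first.
  by case; rewrite /= e'; exists 1; apply/funext => f; rewrite mul1r.
move: hs; rewrite e' => -[c ec]; congr tline.
have e1 := congr1 (fun v => v fA) ec; have e2 := congr1 (fun v => v fB) ec.
rewrite /= (fr_AA fr Uy) (fr_BA fr Uy) !mulr0 !addr0 mulr1 in e1.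
rewrite /= (fr_AB fr Uy) (fr_BB fr Uy) !add0r !mulr1 -e1 mul1r in e2.
by rewrite e2.
Qed.

Lemma slope_unique (y : P) s : U (base y) ->
  line y = tline (fun f => A (base y) f + s * B (base y) f) -> U' y /\ slope y = s.
Proof.
move=> Uy e; have Uy' : U' y.
  split => //; rewrite e => -[c ec].
  have e1 := congr1 (fun v => v fA) ec; have e2 := congr1 (fun v => v fB) ec.
  rewrite /= (fr_AA fr Uy) (fr_BA fr Uy) !mulr0 !addr0 mulr1 in e1.
  rewrite /= (fr_AB fr Uy) (fr_BB fr Uy) -e1 mul0r in e2.
  by move/eqP: e2; rewrite oner_eq0.
split => //; have := slope_line Uy'; rewrite e => e'.
have : tline (fun f => A (base y) f + s * B (base y) f) (fun f => A (base y) f + s * B (base y) f).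
  by exists 1; apply/funext => f; rewrite mul1r.
rewrite e' => -[c ec].
have e1 := congr1 (fun v => v fA) ec; have e2 := congr1 (fun v => v fB) ec.
rewrite /= (fr_AA fr Uy) (fr_BA fr Uy) !mulr0 !addr0 mulr1 in e1.
by rewrite /= (fr_AB fr Uy) (fr_BB fr Uy) !add0r !mulr1 -e1 mul1r in e2.
Qed.

Lemma slope_ex x s : U x -> exists y : P, [/\ U' y, base y = x & slope y = s].
Proof.
move=> Ux; have il : is_line x (tline (fun f => A x f + s * B x f)).
  exists (fun f => A x f + s * B x f); split => //.
    by apply/(fr_fibre fr _ Ux); exists 1, s; apply/funext => f; rewrite mul1r.
  move=> /(congr1 (fun v => v fA)); rewrite /= (fr_AA fr Ux) (fr_BA fr Ux) mulr0 addr0.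
  by move/eqP; rewrite oner_eq0.
exists (exist _ (x, tline (fun f => A x f + s * B x f)) il : P).
by have [] := @slope_unique (exist _ (x, tline (fun f => A x f + s * B x f)) il : P) s Ux erefl.
Qed.

Lemma slope_coordL y l : phi' y 0 (lshift 1 l) = phi (base y) 0 l.
Proof. by rewrite row_mxEl. Qed.

Lemma slope_coordR y : phi' y 0 (rshift n 0) = slope y.
Proof. by rewrite row_mxEr mxE. Qed.

Lemma slope_coord_inj : (forall x x', U x -> U x' -> phi x = phi x' -> x = x') ->
  forall y y', U' y -> U' y' -> phi' y = phi' y' -> y = y'.
Proof.
move=> h y y' Uy Uy' e.
have eb : base y = base y'.
  apply: h; [by case: Uy|by case: Uy'|].
  by apply/rowP => l; rewrite -!slope_coordL e.
apply: line_pt_eq => //; rewrite (slope_line Uy) (slope_line Uy') eb.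
by rewrite -!slope_coordR e.
Qed.

(** Vectors of the fibre are decomposed by fA and fB, so the coordinate of a second frame (V, W) is
    fractional linear in the slope, and its denominator is zero exactly when the line contains W. *)
Lemma slope_other (y : P) (V W : tvec D) s : U' y -> fibre D (base y) V -> fibre D (base y) W ->
  (line y W <-> W fA * slope y - W fB = 0) /\
  (line y (fun f => V f + s * W f) -> ~ line y W ->
   s = (V fB - V fA * slope y) * (W fA * slope y - W fB)^-1).
Proof.
move=> Uy' fV fW; have [Uy nB] := Uy'; have el := slope_line Uy'.
have dec v : fibre D (base y) v -> v = fun f => v fA * A (base y) f + v fB * B (base y) f.
  move=> /(fr_fibre fr _ Uy)[a [b e]]; rewrite {1}e; apply/funext => f.
  by rewrite e (fr_AA fr Uy) (fr_BA fr Uy) (fr_AB fr Uy) (fr_BB fr Uy) !mulr0 !mulr1 addr0 add0r.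
have lineP v : line y v -> v fA * slope y - v fB = 0.
  rewrite el => -[c ->]; rewrite (fr_AA fr Uy) (fr_BA fr Uy) (fr_AB fr Uy) (fr_BB fr Uy); ring.
have lineW : line y W <-> W fA * slope y - W fB = 0.
  split; first exact: lineP.
  move=> /eqP; rewrite subr_eq0 => /eqP h; rewrite el; exists (W fA).
  by rewrite {1}(dec W fW); apply/funext => f; rewrite -h; ring.
split => // /lineP h /lineW /eqP nW; apply: (mulIf nW); rewrite divfK //.
apply/eqP; rewrite -subr_eq0; apply/eqP; rewrite -h; ring.
Qed.

(** Neighbourhoods in the topology induced by the slope coordinates; [slope_around] identifies them
    with those of [proj_space], whose topology is generated by the functions of the base and all
    frames at once. *)
Definition slope_near (y : P) (Q : set P) := exists R, anear (n + 1) (phi' y) R /\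
  forall y', U' y' -> R (phi' y') -> Q y'.

Lemma slope_nearI y Q R : slope_near y Q -> slope_near y R -> slope_near y (Q `&` R).
Proof.
move=> [A1 [nA hA]] [B1 [nB hB]]; exists (A1 `&` B1); split.
  exact: (aroundI (aff_tame gG _)).
by move=> y' Uy [ay by_]; split; [exact: hA|exact: hB].
Qed.

Lemma slope_nearT y : slope_near y setT.
Proof. by exists setT; split => //; exact: aroundT (aff_tame gG _). Qed.

Lemma slope_near_sub y (Q R : set P) : slope_near y Q -> (forall y', U' y' -> Q y' -> R y') -> slope_near y R.
Proof. by move=> [S [nS hS]] h; exists S; split => // y' Uy /(hS _ Uy); exact: h. Qed.

Lemma slope_near_forall y m (Q : 'I_m -> set P) : (forall i, slope_near y (Q i)) ->
  slope_near y (fun y' => forall i, Q i y').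
Proof.
move=> h; suff: forall s : seq 'I_m, slope_near y (fun y' => forall i, i \in s -> Q i y').
  by move=> /(_ (enum 'I_m)) /slope_near_sub; apply => y' _ hy i; apply: hy; rewrite mem_enum.
elim=> [|i s ih]; first by apply: slope_near_sub (slope_nearT y) _.
apply: slope_near_sub (slope_nearI (h i) ih) _ => y' _ [h1 h2] j.
by rewrite inE => /orP[/eqP ->|/h2].
Qed.

Lemma slope_near_pull y R : anear (n + 1) (phi' y) R -> slope_near y (fun y' => R (phi' y')).
Proof. by move=> nR; exists R. Qed.

Let lsub (z : 'rV[K]_(n + 1)) : 'rV[K]_n := \row_l z 0 (lshift 1 l).

Let lsub_phi y : lsub (phi' y) = phi (base y).
Proof. by apply/rowP => l; rewrite mxE slope_coordL. Qed.

Lemma slope_near_base (y : P) (Q : set D) : U' y -> around (base y) Q ->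
  slope_near y (fun y' => Q (base y')).
Proof.
move=> [Uy _] /(patch_near pU _ Uy)[R [nR hR]].
have h : anear (n + 1) (phi' y) (fun z => R (lsub z)).
  apply: (@aff_near G gG n (n + 1) (fun l z => z 0 (lshift 1 l)) (phi' y) _ R _ _ _ nR) => //.
    by rewrite -[RHS]/(lsub (phi' y)) lsub_phi.
  by move=> j; exact: aff_coord.
apply: slope_near_sub (slope_near_pull h) _ => y' [Uy' _]; rewrite lsub_phi.
exact: hR.
Qed.

Lemma slope_rep_base (y : P) f : U' y -> regular_at (base y) f -> exists H,
  areg (n + 1) (phi' y) H /\ slope_near y (fun y' => f (base y') = H (phi' y')).
Proof.
move=> Uy' /(patch_reg pU _ Uy'.1)[F [rF eF]]; exists (fun z => F (lsub z)); split.
  apply: (@aff_comp G gG n (n + 1) (fun l z => z 0 (lshift 1 l)) (phi' y) _ F _ _ _ rF) => //.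
    by rewrite -[RHS]/(lsub (phi' y)) lsub_phi.
  by move=> j; exact: aff_coord.
by apply: slope_near_sub (slope_near_base Uy' eF) _ => y' _ /= ->; rewrite lsub_phi.
Qed.

Let gens : set (set P * (P -> K)) := [set Du : set P * (P -> K) |
       (exists (U : set D) (f : D -> K),
          [/\ opn D U, regular_on U f, Du.1 = base (D := D) @^-1` U &
              Du.2 = f \o base (D := D)]) \/
       (exists (U : set D) (V W : vfield D),
          [/\ frame U V W,
              Du.1 = [set y | U (base y) /\ ~ line y (W (base y))] &
              forall y, Du.1 y ->
                line y (fun f => V (base y) f + Du.2 y * W (base y) f)])].

(** Functions of the base are regular in the base coordinates, and by [slope_other] the coordinate
    of any other frame is fractional linear in the slope, with a denominator that stays nonzero
    nearby. *)
Lemma slope_rep_gen (y : P) Du : gens Du -> Du.1 y -> U' y -> exists H,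
  areg (n + 1) (phi' y) H /\ slope_near y (fun y' => Du.1 y' /\ Du.2 y' = H (phi' y')).
Proof.
move=> [[O [f [oO rf eD eu]]]|[O [V [W [[oO [vV sV] [vW sW] _] eD hu]]]]] Dy Uy'.
  have Oy : O (base y) by move: Dy; rewrite eD.
  have [H [rH eH]] := slope_rep_base Uy' (rf _ Oy).
  have nO : around (base y) O by exists O; split.
  exists H; split => //; apply: slope_near_sub (slope_nearI eH (slope_near_base Uy' nO)) _.
  by move=> y' _ [e Oy']; rewrite eD eu.
have [Oy nW] : O (base y) /\ ~ line y (W (base y)) by move: Dy; rewrite eD.
have [_ rV] := vV _ Oy; have [_ rW] := vW _ Oy; have [Uy _] := Uy'.
have rA := fr_fA fr Uy; have rB := fr_fB fr Uy.
have [H1 [r1 e1]] := slope_rep_base Uy' (rV _ rA).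
have [H2 [r2 e2]] := slope_rep_base Uy' (rV _ rB).
have [H3 [r3 e3]] := slope_rep_base Uy' (rW _ rA).
have [H4 [r4 e4]] := slope_rep_base Uy' (rW _ rB).
have tz := aff_tame gG (phi' y).
have rs := aff_coord gG (phi' y) (rshift n 0).
pose Den z := H3 z * z 0 (rshift n 0) - H4 z.
have rDen : areg (n + 1) (phi' y) Den.
  by apply: (reg_sub gG tz) => //; apply: (reg_mul gG tz).
have selfe Q : slope_near y Q -> Q y by move=> [R [nR hR]]; apply: hR => //; exact: around_self nR.
have Dy0 : Den (phi' y) != 0.
  apply/eqP; rewrite /Den slope_coordR -(selfe _ e3) -(selfe _ e4) => h.
  by apply: nW; apply/(slope_other 0 Uy' (sV _ Oy) (sW _ Oy)).1.
exists (fun z => (H2 z - H1 z * z 0 (rshift n 0)) * (Den z)^-1); split.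
  apply: (reg_mul gG tz); last exact: (reg_inv gG tz).
  by apply: (reg_sub gG tz) => //; apply: (reg_mul gG tz).
have nO : around (base y) O by exists O; split.
apply: slope_near_sub (slope_nearI (slope_near_base Uy' nO) (slope_nearI (slope_near_pull (around_ne0 gG tz rDen Dy0))
  (slope_nearI (slope_nearI e1 e2) (slope_nearI e3 e4)))) _.
move=> y' Uy'' [Oy' [D' [[h1 h2] [h3 h4]]]].
rewrite /Den slope_coordR -h3 -h4 in D'.
have [l1 l2] := slope_other (Du.2 y') Uy'' (sV _ Oy') (sW _ Oy').
have nW' : ~ line y' (W (base y')) by move=> /l1/eqP; apply/negP.
have Dy' : Du.1 y' by rewrite eD.
split => //; rewrite (l2 (hu _ Dy') nW') /Den slope_coordR.
by rewrite -h1 -h2 -h3 -h4.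
Qed.

Lemma slope_frame (O : set D) : opn D O -> O `<=` U -> frame O A B.
Proof.
move=> oO OU; split => //.
- split; first by move=> x /OU; exact: (fr_A fr).
  move=> x /OU Ux; apply/(fr_fibre fr _ Ux); exists 1, 0.
  by apply/funext => f; rewrite mul1r mul0r addr0.
- split; first by move=> x /OU; exact: (fr_B fr).
  move=> x /OU Ux; apply/(fr_fibre fr _ Ux); exists 0, 1.
  by apply/funext => f; rewrite mul1r mul0r add0r.
move=> x /OU Ux; split; last first.
  by move=> v /(fr_fibre fr _ Ux)[a [b ->]]; exists a, b.
move=> c h i.
have e1 := h fA; have e2 := h fB.
rewrite !big_ord_recl big_ord0 /= (fr_AA fr Ux) (fr_BA fr Ux) mulr1 mulr0 !addr0 in e1.
rewrite !big_ord_recl big_ord0 /= (fr_AB fr Ux) (fr_BB fr Ux) mulr1 mulr0 addr0 add0r in e2.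
case: i => -[|[|//]] i; first by rewrite -[RHS]e1; congr c; exact/val_inj.
by rewrite -[RHS]e2; congr c; exact/val_inj.
Qed.

(** The converse of [slope_rep_gen]: the slope coordinates are themselves a tuple of generators, so
    open sets and functions of K^(n+1) pull back to open sets and functions of [proj_space]. *)
Lemma slope_gens (y : P) : U' y -> exists s : 'I_(n + 1) -> set P * (P -> K),
  [/\ forall i, gens (s i), forall i, (s i).1 y,
      forall y', \row_i (s i).2 y' = phi' y' &
      forall y', (forall i, (s i).1 y') -> U' y'].
Proof.
move=> Uy'; have [Uy nB] := Uy'; have tx := patch_tame gG pU Uy.
have [O [oO Oy hO]] : around (base y) (fun x => U x /\ forall l, regular_at x (fun y => phi y 0 l)).
  apply: (aroundI tx (patch_self gG pU Uy)); apply: (around_forall tx) => l.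
  exact: (reg_open tx (patch_coord gG pU l Uy)).
exists (fun i => match fintype.split i with
  | inl l => (base (D := D) @^-1` O, (fun x => phi x 0 l) \o base (D := D))
  | inr _ => ([set y | O (base y) /\ ~ line y (B (base y))], slope) end); split.
- move=> i; case: (fintype.split i) => [l|_].
    left; exists O, (fun x => phi x 0 l); split => // x /hO[_]; exact.
  right; exists O, A, B; split => //; first by apply: slope_frame => // x /hO[].
  move=> y' [/hO[Uy1 _] nB']; rewrite slope_line //.
  by exists 1; apply/funext => f; rewrite mul1r.
- by move=> i; case: (fintype.split i).
- by move=> y'; apply/rowP => i; rewrite !mxE; case: (fintype.split i) => l /=; rewrite ?mxE.
- move=> y' /(_ (rshift n ord0)); rewrite (unsplitK (inr ord0)) /= => -[/hO[]] //.
Qed.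

Lemma slope_around (y : P) (Q : set P) : U' y -> (around y Q <-> slope_near y Q).
Proof.
move=> Uy'; split.
  move=> [O [oO Oy OQ]]; have [m [s [V [sE oV [dy Vy] hV]]]] := oO _ Oy.
  have /choice[H hH] : forall i, exists H, areg (n + 1) (phi' y) H /\
      slope_near y (fun y' => (s i).1 y' /\ (s i).2 y' = H (phi' y')).
    by move=> i; apply: slope_rep_gen => //; exact: sE.
  have near := slope_near_forall (fun i => (hH i).2).
  have selfe R : slope_near y R -> R y by move=> [S [nS hS]]; apply: hS => //; exact: around_self nS.
  have eV y' : (forall i, (s i).1 y' /\ (s i).2 y' = H i (phi' y')) -> \row_i H i (phi' y') = \row_i (s i).2 y'.
    by move=> h; apply/rowP => i; rewrite !mxE (h i).2.
  have nV : anear (n + 1) (phi' y) (fun z => V (\row_i H i z)).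
    apply: (reg_cont (aff_tame gG _) (fun i => (hH i).1) oV).
    by rewrite (eV _ (selfe _ near)).
  apply: slope_near_sub (slope_nearI near (slope_near_pull nV)) _ => y' _ [h1 h2].
  apply: OQ; apply: hV; first by move=> i; case: (h1 i).
  by rewrite -(eV _ h1).
move=> [R [[V [oV Vy VR]] hR]]; have [s [sE sy es sU]] := slope_gens Uy'.
exists [set y' | (forall i, (s i).1 y') /\ V (phi' y')]; split => //.
  move=> y' [dy' Vy']; exists (n + 1)%N, s, V; split => //; first by rewrite es.
  by move=> y1 d1; rewrite es.
by move=> y' [/sU Uy1 /VR]; exact: hR.
Qed.

Lemma prolong_patch : coords (U' : set P) phi'.
Proof.
split; first by move=> y Q Uy'; exact: slope_around.
move=> y f Uy'; have tz := aff_tame gG (phi' y); split.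
  move=> [m [s [V [F [sE oV [dy Vy] rF hV]]]]].
  have /choice[H hH] : forall i, exists H, areg (n + 1) (phi' y) H /\
      slope_near y (fun y' => (s i).1 y' /\ (s i).2 y' = H (phi' y')).
    by move=> i; apply: slope_rep_gen => //; exact: sE.
  have near := slope_near_forall (fun i => (hH i).2).
  have selfe R : slope_near y R -> R y by move=> [S [nS hS]]; apply: hS => //; exact: around_self nS.
  have eV y' : (forall i, (s i).1 y' /\ (s i).2 y' = H i (phi' y')) -> \row_i H i (phi' y') = \row_i (s i).2 y'.
    by move=> h; apply/rowP => i; rewrite !mxE (h i).2.
  have ey := eV _ (selfe _ near).
  have nV : anear (n + 1) (phi' y) (fun z => V (\row_i H i z)).
    by apply: (reg_cont tz (fun i => (hH i).1) oV); rewrite ey.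
  exists (fun z => F (\row_i H i z)); split.
    by apply: (reg_comp tz (fun i => (hH i).1)); rewrite ey; exact: rF.
  apply/(slope_around _ Uy'); apply: slope_near_sub (slope_nearI near (slope_near_pull nV)) _ => y' _ [h1 h2].
  rewrite hV ?(eV _ h1) //; first by move=> i; case: (h1 i).
  by rewrite -(eV _ h1).
move=> [H [rH /(slope_around _ Uy')[R [nR hR]]]].
have [V [oV Vy VR]] := aroundI tz nR (reg_open tz rH).
have [s [sE sy es sU]] := slope_gens Uy'.
exists (n + 1)%N, s, V, H; split => //.
- by rewrite es.
- by move=> z /VR[].
by move=> y' /sU Uy1; rewrite es => /VR[]; move=> h _; exact: hR.
Qed.

End Prolongation.

(** * Tangent vectors and fields on a prolongation *)

Section Lifts.
Variable (G : geometry).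
Hypothesis gG : good G.
Local Notation K := (scalars G).
Local Notation areg n z F := (@regular_at K (affine G n) z F).
Local Notation anear n z P := (@around K (affine G n) z P).

Lemma push_tangent (X Y : fspace K) (h : X -> Y) (x : X) (v : tvec X) :
  tame (G := G) x -> tame (G := G) (h x) ->
  (forall a, regular_at (h x) a -> regular_at x (a \o h)) ->
  (forall Q, around (h x) Q -> around x (fun y => Q (h y))) ->
  is_tangent x v -> is_tangent (h x) (push h x v).
Proof.
move=> tx ty hr hn tv; have pE a : regular_at (h x) a -> push h x v a = v (a \o h).
  by move=> ra; rewrite /push; case: asboolP.
have [_ v2 v3 v4] := tv; split.
- by move=> f nf; rewrite /push; case: asboolP.
- by move=> f g rf rg e; rewrite !pE //; apply: v2; [exact: hr|exact: hr|exact: hn e].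
- move=> c f g rf rg; rewrite !pE //; first by apply: v3; exact: hr.
  by apply: (reg_add gG ty) => //; apply: (reg_mul gG ty) => //; exact: (reg_cst gG ty).
- move=> f g rf rg; rewrite !pE //; first by apply: v4; exact: hr.
  exact: (reg_mul gG ty).
Qed.

Variables (D : dspace K) (U : set D) (n : nat) (phi : D -> 'rV[K]_n).
Hypothesis pU : coords U phi.
Variables (A B : vfield D) (fA fB : D -> K).
Hypothesis fr : framing U A B fA fB.

Local Notation P := (proj_space D).
Local Notation U' := (slope_dom U B).
Local Notation sl := (slope A B : P -> K).
Local Notation phi' := (slope_coord phi A B : P -> 'rV[K]_(n + 1)).
Let pP : coords (U' : set P) phi' := prolong_patch gG pU fr.

Lemma base_regular (y : P) f : U' y -> regular_at (base y) f ->
  regular_at y (fun y' : P => f (base y')).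
Proof.
move=> Uy rf; have [H [rH eH]] := slope_rep_base gG pU A Uy rf.
apply/(patch_reg pP _ Uy); exists H; split => //.
by apply/(slope_around gG pU fr _ Uy).
Qed.

Lemma base_near (y : P) Q : U' y -> around (base y) Q -> around y (fun y' : P => Q (base y')).
Proof.
by move=> Uy nQ; apply/(slope_around gG pU fr _ Uy); exact: (slope_near_base gG pU A Uy nQ).
Qed.

Lemma slope_regular (y : P) : U' y -> regular_at y sl.
Proof.
move=> Uy; have := patch_coord gG pP (rshift n 0) Uy; congr regular_at.
by apply/funext => y'; rewrite slope_coordR.
Qed.

Definition vlift (v : tvec D) (s : K) (y : P) : tvec P :=
  ptan phi' y (row_mx (\row_l v (fun x => phi x 0 l)) (const_mx s)).

(** The slope is unconstrained, so the image is a product with a line: a function vanishing on it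
    has derivative 0 in the slope direction, and on the slice of constant slope it restricts to a
    function vanishing on the base, which v kills. *)
Lemma lift_admissible (y : P) v s : U' y -> is_tangent (base y) v ->
  admissible phi' y (row_mx (\row_l v (fun x => phi x 0 l)) (const_mx s)).
Proof.
move=> Uy tv F rF /(slope_around gG pU fr _ Uy)[R [nR hR]]; have [Uby _] := Uy.
have tb := patch_tame gG pU Uby; have tz := aff_tame gG (phi' y).
have hR' x c : U x -> R (row_mx (phi x) (const_mx c)) -> F (row_mx (phi x) (const_mx c)) = 0.
  by move=> Ux; have [y' [Uy' <- <-]] := slope_ex fr c Ux; exact: hR.
rewrite dvecE // big_split_ord /= big_ord1 row_mxEr mxE.
have -> : pdv (rshift n ord0) F (phi' y) = 0.
  rewrite (@pdvE G gG _ _ _ _ (fun=> 0)) //; first exact: aff_cst.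
  apply: (around_sub (near_lin gG (rshift n ord0) nR)) => c hc.
  have e : lin (phi' y) (rshift n ord0) (c 0 0) = row_mx (phi (base y)) (const_mx (sl y + c 0 0)).
    apply/rowP => j; rewrite mxE -(splitK j); case: (fintype.split j) => l /=.
      by rewrite slope_coordL row_mxEl eq_lrshift mul0r addr0.
    by rewrite (ord1 l) slope_coordR row_mxEr mxE eqxx mul1r.
  rewrite e in hc *; rewrite (hR' _ _ Uby hc) (hR y Uy (around_self nR)) subrr mulr0 //.
rewrite mulr0 addr0.
pose f (j : 'I_(n + 1)) (x : D) := match fintype.split j with inl l => phi x 0 l | inr _ => sl y end.
have fE x : \row_j f j x = row_mx (phi x) (const_mx (sl y)).
  by apply/rowP => j; rewrite !mxE /f; case: (fintype.split j) => l //; rewrite mxE.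
have rf j : regular_at (base y) (f j).
  by rewrite /f; case: (fintype.split j) => l; [exact: (patch_coord gG pU l Uby)|exact: (reg_cst gG tb)].
have rF' : areg (n + 1) (\row_j f j (base y)) F by rewrite fE.
have := tangent_comp gG tb tv rf (erefl _) rF'.
have near : around (base y) (fun x => F (\row_j f j x) = 0).
  have [V [oV Vy VR]] := nR; rewrite -/(phi' y) -[phi' y](fE (base y)) in Vy.
  apply: (around_sub (aroundI tb (patch_self gG pU Uby) (reg_cont tb rf oV Vy))) => x [Ux].
  by rewrite fE => /VR; exact: hR'.
rewrite (tangent_ext tb tv (reg_comp tb rf rF') near) (tangent_cst gG tb _ tv).
rewrite big_split_ord /= big_ord1 fE => /esym; rewrite {2}/f (unsplitK (inr ord0)).
rewrite (tangent_cst gG tb _ tv) mul0r addr0 => h; rewrite -[RHS]h; apply: eq_bigr => l _.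
by rewrite row_mxEl mxE /f (unsplitK (inl l)).
Qed.

Lemma lift_tangent (y : P) v s : U' y -> is_tangent (base y) v -> is_tangent y (vlift v s y).
Proof. by move=> Uy tv; apply: (ptan_tangent gG pP Uy); exact: lift_admissible. Qed.

Lemma lift_slope (y : P) v s : U' y -> is_tangent (base y) v -> vlift v s y sl = s.
Proof.
move=> Uy tv; have := ptan_coord gG pP (rshift n 0) Uy (lift_admissible s Uy tv).
rewrite row_mxEr mxE => {2}<-; congr (vlift v s y _).
by apply/funext => y'; rewrite slope_coordR.
Qed.

Lemma push_base_tangent (y : P) w : U' y -> is_tangent y w ->
  is_tangent (base y) (push (@proj_base G D) y w).
Proof.
move=> Uy tw; apply: (@push_tangent P D (@proj_base G D) y w _ _ _ _ tw).
- exact: (patch_tame gG pP Uy).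
- exact: (patch_tame gG pU Uy.1).
- by move=> a ra; exact: base_regular.
- by move=> Q nQ; exact: base_near.
Qed.

Lemma push_baseE (y : P) w f : regular_at (base y) f ->
  push (@proj_base G D) y w f = w (fun y' => f (base y')).
Proof. by move=> rf; rewrite /push; case: asboolP. Qed.

Lemma lift_base (y : P) v s f : U' y -> is_tangent (base y) v -> regular_at (base y) f ->
  vlift v s y (fun y' => f (base y')) = v f.
Proof.
move=> Uy tv rf; have tl := lift_tangent s Uy tv.
rewrite -(push_baseE _ rf); congr (_ f).
apply: (tangent_det gG pU Uy.1 (push_base_tangent Uy tl) tv) => l.
rewrite push_baseE; last exact: (patch_coord gG pU l Uy.1).
have := ptan_coord gG pP (lshift 1 l) Uy (lift_admissible s Uy tv).
rewrite row_mxEl mxE => <-; congr (vlift v s y _).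
by apply/funext => y'; rewrite slope_coordL.
Qed.

Lemma prolong_tangent_eq (y : P) w w' : U' y -> is_tangent y w -> is_tangent y w' ->
  (forall f, regular_at (base y) f -> w (fun y' => f (base y')) = w' (fun y' => f (base y'))) ->
  w sl = w' sl -> w = w'.
Proof.
move=> Uy tw tw' h hs; apply: (tangent_det gG pP Uy tw tw') => j; case: (split_ordP j) => l ->.
  have e : (fun y' : P => phi' y' 0 (lshift 1 l)) = fun y' => phi (base y') 0 l.
    by apply/funext => y'; rewrite slope_coordL.
  by rewrite e; exact: (h _ (patch_coord gG pU l Uy.1)).
have e : (fun y' : P => phi' y' 0 (rshift n l)) = sl.
  by apply/funext => y'; rewrite (ord1 l) slope_coordR.
by rewrite e.
Qed.

Lemma lift_vfield (V : P -> tvec D) (s : P -> K) :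
  (forall y, U' y -> is_tangent (base y) (V y)) ->
  (forall y l, U' y -> regular_at y (fun y' : P => V y' (fun x => phi x 0 l))) ->
  (forall y, U' y -> regular_at y s) ->
  is_vfield (U' : set P) (fun y => vlift (V y) (s y) y).
Proof.
move=> tV rV rs; apply: (ptan_vfield gG pP (u := fun y => row_mx (\row_l V y (fun x => phi x 0 l)) (const_mx (s y)))).
  by move=> y Uy; apply: lift_admissible => //; exact: tV.
move=> y j Uy; case: (split_ordP j) => l ->.
  have e : (fun y' => row_mx (\row_l V y' (fun x => phi x 0 l)) (const_mx (s y')) 0 (lshift 1 l)) =
     fun y' => V y' (fun x => phi x 0 l).
    by apply/funext => y'; rewrite row_mxEl mxE.
  rewrite e; exact: (rV y l Uy).
have e : (fun y' => row_mx (\row_l V y' (fun x => phi x 0 l)) (const_mx (s y')) 0 (rshift n l)) = s.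
  by apply/funext => y'; rewrite row_mxEr mxE.
rewrite e; exact: (rs y Uy).
Qed.

Definition lift_field (V : vfield D) : vfield P := fun y => vlift (V (base y)) 0 y.
(** Lift of the tautological direction with constant slope: the field X one level up, while
    [fibre_field] is the field N. *)
Definition line_field : vfield P :=
  fun y => vlift (fun f => A (base y) f + sl y * B (base y) f) 0 y.
Definition fibre_field : vfield P := fun y => vlift (tzero (X := D)) 1 y.

Lemma line_vec_tangent (y : P) : U' y ->
  is_tangent (base y) (fun f => A (base y) f + sl y * B (base y) f).
Proof.
move=> [Uy _]; have [tA _] := fr_A fr Uy; have [tB _] := fr_B fr Uy.
have := tangent_comb2 1 (sl y) tA tB; congr is_tangent; apply/funext => f.
by rewrite mul1r.
Qed.

Lemma lift_field_vfield V : is_vfield U V -> is_vfield U' (lift_field V).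
Proof.
move=> vV; apply: (@lift_vfield (fun y => V (base y)) (fun=> 0)).
- by move=> y [Uy _]; have [] := vV _ Uy.
- move=> y l Uy; apply: (base_regular Uy (f := fun x => V x (fun x => phi x 0 l))).
  by have [_ h] := vV _ Uy.1; apply: h; exact: (patch_coord gG pU l Uy.1).
- by move=> y Uy; exact: (reg_cst gG (patch_tame gG pP Uy)).
Qed.

Lemma line_field_vfield : is_vfield U' line_field.
Proof.
apply: (@lift_vfield (fun y f => A (base y) f + sl y * B (base y) f) (fun=> 0)).
- exact: line_vec_tangent.
- move=> y l Uy; have ty := patch_tame gG pP Uy; have rl := patch_coord gG pU l Uy.1.
  apply: (reg_add gG ty); first apply: (base_regular Uy (f := fun x => A x (fun x => phi x 0 l))).
    by have [_ h] := fr_A fr Uy.1; apply: h.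
  apply: (reg_mul gG ty); first exact: slope_regular.
  apply: (base_regular Uy (f := fun x => B x (fun x => phi x 0 l))).
  by have [_ h] := fr_B fr Uy.1; apply: h.
- by move=> y Uy; exact: (reg_cst gG (patch_tame gG pP Uy)).
Qed.

Lemma fibre_field_vfield : is_vfield U' fibre_field.
Proof.
apply: (@lift_vfield (fun=> tzero (X := D)) (fun=> 1)).
- by move=> y Uy; exact: tangent_tzero.
- by move=> y l Uy; exact: (reg_cst gG (patch_tame gG pP Uy)).
- by move=> y Uy; exact: (reg_cst gG (patch_tame gG pP Uy)).
Qed.

Lemma lift_field_base V (y : P) f : is_vfield U V -> U' y -> regular_at (base y) f ->
  lift_field V y (fun y' => f (base y')) = V (base y) f.
Proof. by move=> vV Uy; apply: lift_base => //; have [] := vV _ Uy.1. Qed.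

Lemma lift_field_slope V (y : P) : is_vfield U V -> U' y -> lift_field V y sl = 0.
Proof. by move=> vV Uy; apply: lift_slope => //; have [] := vV _ Uy.1. Qed.

Lemma line_field_base (y : P) f : U' y -> regular_at (base y) f ->
  line_field y (fun y' => f (base y')) = A (base y) f + sl y * B (base y) f.
Proof. by move=> Uy rf; apply: (lift_base 0 Uy (line_vec_tangent Uy) rf). Qed.

Lemma line_field_slope (y : P) : U' y -> line_field y sl = 0.
Proof. by move=> Uy; apply: lift_slope => //; exact: line_vec_tangent. Qed.

Lemma fibre_field_base (y : P) f : U' y -> regular_at (base y) f ->
  fibre_field y (fun y' => f (base y')) = 0.
Proof. by move=> Uy rf; apply: (lift_base 1 Uy (tangent_tzero _) rf). Qed.

Lemma fibre_field_slope (y : P) : U' y -> fibre_field y sl = 1.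
Proof. by move=> Uy; apply: lift_slope => //; exact: tangent_tzero. Qed.

(** A vector of the prolonged distribution is determined by the factor of its projection to the
    line, which is its coefficient on [line_field], and by its value on the slope, its coefficient
    on [fibre_field]. *)
Lemma prolong_framing :
  framing (U' : set (prolong D)) line_field fibre_field (fun y => fA (base y)) sl.
Proof.
have rA y : U' y -> regular_at (base y) fA by move=> [Uy _]; exact: (fr_fA fr).
split.
- exact: line_field_vfield.
- exact: fibre_field_vfield.
- move=> y v Uy; have [tX _] := line_field_vfield Uy; have [tN _] := fibre_field_vfield Uy.
  have lvt := line_vec_tangent Uy.
  split=> [[tv]|[a [b ->]]].
    rewrite /proj_line (slope_line fr Uy) => -[c ec]; exists c, (v sl).
    apply: (prolong_tangent_eq Uy tv); first exact: tangent_comb2.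
      move=> f rf; rewrite -(push_baseE _ rf) ec line_field_base // fibre_field_base //.
      by rewrite mulr0 addr0.
    by rewrite line_field_slope // fibre_field_slope // mulr0 add0r mulr1.
  have tc := tangent_comb2 a b tX tN; split => //.
  rewrite /proj_line (slope_line fr Uy); exists a.
  apply: (tangent_eq (x := base y)); first exact: push_base_tangent.
    have := tangent_comb2 a 0 lvt lvt; congr is_tangent; apply/funext => f.
    by rewrite mul0r addr0.
  move=> f rf; rewrite push_baseE // line_field_base // fibre_field_base //.
  by rewrite mulr0 addr0.
- by move=> y Uy; apply: base_regular => //; exact: rA.
- by move=> y Uy; exact: slope_regular.
- move=> y Uy; rewrite line_field_base //; last exact: rA.
  by rewrite (fr_AA fr Uy.1) (fr_BA fr Uy.1) mulr0 addr0.
- by move=> y Uy; rewrite line_field_slope.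
- by move=> y Uy; rewrite fibre_field_base //; exact: rA.
- by move=> y Uy; rewrite fibre_field_slope.
Qed.

End Lifts.

(** * Lie brackets of lifted fields *)

Section Brackets.
Variable (G : geometry).
Hypothesis gG : good G.
Local Notation K := (scalars G).

Lemma lieE (X : fspace K) (V W : vfield X) x f : regular_at x f ->
  lie V W x f = V x (fun y => W y f) - W x (fun y => V y f).
Proof. by move=> rf; rewrite /lie; case: asboolP. Qed.

Lemma lie_tangent (X : fspace K) (U : set X) (V W : vfield X) x : tame (G := G) x ->
  around x U -> is_vfield U V -> is_vfield U W -> is_tangent x (lie V W x).
Proof.
move=> tx nU vV vW; have Ux := around_self nU.
have [tV rV] := vV _ Ux; have [tW rW] := vW _ Ux.
have nR f : regular_at x f -> around x (fun y => U y /\ regular_at y f).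
  by move=> rf; exact: (aroundI tx nU (reg_open tx rf)).
split.
- by move=> f nf; rewrite /lie; case: asboolP.
- move=> f g rf rg e; rewrite !lieE //; congr (_ - _).
    apply: (tangent_ext tx tV); first exact: rW.
    apply: (around_sub (aroundI tx (around_open e) (aroundI tx (nR f rf) (nR g rg)))) => y [ey [[Uy rfy] [_ rgy]]].
    by have [[_ h _ _] _] := vW _ Uy; exact: h.
  apply: (tangent_ext tx tW); first exact: rV.
  apply: (around_sub (aroundI tx (around_open e) (aroundI tx (nR f rf) (nR g rg)))) => y [ey [[Uy rfy] [_ rgy]]].
  by have [[_ h _ _] _] := vV _ Uy; exact: h.
- move=> c f g rf rg.
  have rc : regular_at x (fun y => c * f y + g y).
    by apply: (reg_add gG tx) => //; apply: (reg_mul gG tx) => //; exact: (reg_cst gG tx).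
  have key (V' W' : vfield X) : is_vfield U V' -> is_vfield U W' ->
     V' x (fun y => W' y (fun y => c * f y + g y)) = c * V' x (fun y => W' y f) + V' x (fun y => W' y g).
    move=> v1 v2; have [t1 r1] := v1 _ Ux; have [t2 r2] := v2 _ Ux; have [_ _ h _] := t1.
    rewrite -h; [|exact: r2|exact: r2]; apply: (tangent_ext tx t1); first exact: r2.
    apply: (around_sub (aroundI tx (nR f rf) (nR g rg))) => y [[Uy rfy] [_ rgy]].
    by have [[_ _ h' _] _] := v2 _ Uy; exact: h'.
  rewrite !lieE // !key //; ring.
- move=> f g rf rg.
  have rc : regular_at x (fun y => f y * g y) by exact: (reg_mul gG tx).
  have key (V' W' : vfield X) : is_vfield U V' -> is_vfield U W' ->
     V' x (fun y => W' y (fun y => f y * g y)) =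
     f x * V' x (fun y => W' y g) + V' x f * W' x g + (W' x f * V' x g + V' x (fun y => W' y f) * g x).
    move=> v1 v2; have [t1 r1] := v1 _ Ux; have [t2 r2] := v2 _ Ux.
    rewrite (tangent_ext tx t1 (r2 _ rc) (g := fun y => f y * W' y g + W' y f * g y)).
      rewrite (tangentD t1) ?(tangentM t1) //; try exact: r2.
        by apply: (reg_mul gG tx) => //; exact: r2.
      by apply: (reg_mul gG tx) => //; exact: r2.
    apply: (around_sub (aroundI tx (nR f rf) (nR g rg))) => y [[Uy rfy] [_ rgy]].
    by have [[_ _ _ h'] _] := v2 _ Uy; exact: h'.
  rewrite !lieE // !key //; ring.
Qed.

Variables (D : dspace K) (U : set D) (n : nat) (phi : D -> 'rV[K]_n).
Hypothesis pU : coords U phi.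
Variables (A B : vfield D) (fA fB : D -> K).
Hypothesis fr : framing U A B fA fB.

Local Notation P := (proj_space D).
Local Notation U' := (slope_dom U B : set P).
Local Notation sl := (slope A B : P -> K).
Local Notation phi' := (slope_coord phi A B : P -> 'rV[K]_(n + 1)).
Local Notation X' := (line_field phi A B).
Local Notation N' := (fibre_field phi A B).
Local Notation lf V := (lift_field phi A B V).
Let pP : coords (U' : set P) phi' := prolong_patch gG pU fr.
Let vX := line_field_vfield gG pU fr.
Let vN := fibre_field_vfield gG pU fr.

Lemma lift_scale (y : P) (v : tvec D) c : U' y -> is_tangent (base y) v ->
  vlift phi A B (fun f => c * v f) 0 y = fun f => c * vlift phi A B v 0 y f.
Proof.
move=> Uy tv; have tcv : is_tangent (base y) (fun f => c * v f).
  have := tangent_comb2 c 0 tv tv; congr is_tangent; apply/funext => f.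
  by rewrite mul0r addr0.
have tl := lift_tangent gG pU fr 0 Uy tv.
apply: (prolong_tangent_eq gG pU fr Uy).
- exact: (lift_tangent gG pU fr).
- have := tangent_comb2 c 0 tl tl; congr is_tangent; apply/funext => f.
  by rewrite mul0r addr0.
- by move=> f rf; rewrite !(lift_base gG pU fr).
- by rewrite !(lift_slope gG pU fr) // mulr0.
Qed.

Lemma lift_tzero (y : P) : U' y -> vlift phi A B (tzero (X := D)) 0 y = tzero (X := P).
Proof.
move=> Uy; apply: (prolong_tangent_eq gG pU fr Uy).
- by apply: (lift_tangent gG pU fr) => //; exact: tangent_tzero.
- exact: tangent_tzero.
- by move=> f rf; rewrite (lift_base gG pU fr) //; exact: tangent_tzero.
- by rewrite (lift_slope gG pU fr) //; exact: tangent_tzero.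
Qed.

Let near_base (y : P) f : U' y -> regular_at (base y) f ->
  around y (fun y' : P => U' y' /\ regular_at (base y') f).
Proof.
move=> Uy rf; have ty := patch_tame gG pP Uy.
apply: (aroundI ty (patch_self gG pP Uy)).
exact: (base_near gG pU fr Uy (reg_open (patch_tame gG pU Uy.1) rf)).
Qed.

Let vfield_ext (y : P) (V : vfield P) f g : is_vfield U' V -> U' y -> regular_at y f ->
  around y (fun y' : P => f y' = g y') -> V y f = V y g.
Proof. by move=> vV Uy rf e; apply: (tangent_ext (patch_tame gG pP Uy)) => //; have [] := vV _ Uy. Qed.

Let vfield_cst (y : P) (V : vfield P) g c : is_vfield U' V -> U' y ->
  around y (fun y' : P => c = g y') -> V y g = 0.
Proof.
move=> vV Uy e; have ty := patch_tame gG pP Uy.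
rewrite -(vfield_ext vV Uy (reg_cst gG ty c) e).
by apply: (tangent_cst gG ty); have [] := vV _ Uy.
Qed.

(** In terms of the slope s this is the identity [d/ds, A + s B] = B. *)
Lemma lie_fibre_line (y : P) : U' y -> lie N' X' y = lf B y.
Proof.
move=> Uy; have ty := patch_tame gG pP Uy; have vB := fr_B fr; have vA := fr_A fr.
have nU := patch_self gG pP Uy; have rs := slope_regular gG pU fr Uy.
have [tN rN] := vN Uy; have [tX rX] := vX Uy.
apply: (prolong_tangent_eq gG pU fr Uy).
- exact: (lie_tangent ty nU vN vX).
- by have [] := lift_field_vfield gG pU fr vB Uy.
- move=> f rf; have rfb := base_regular gG pU fr Uy rf.
  have rAf : regular_at (base y) (fun x => A x f) by have [_ h] := vA _ Uy.1; exact: h.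
  have rBf : regular_at (base y) (fun x => B x f) by have [_ h] := vB _ Uy.1; exact: h.
  have rA' := base_regular gG pU fr Uy rAf; have rB' := base_regular gG pU fr Uy rBf.
  have rm := reg_mul gG ty rs rB'.
  rewrite lieE // (vfield_ext (f := fun y' => X' y' (fun y' : P => f (base y')))
     (g := fun y' => A (base y') f + sl y' * B (base y') f) vN Uy); last 2 first.
  + exact: rX.
  + by apply: (around_sub (near_base Uy rf)) => y' [Uy' rf']; rewrite (line_field_base gG pU fr).
  rewrite (tangentD tN) // (tangentM tN) // (fibre_field_base gG pU fr Uy rAf) (fibre_field_base gG pU fr Uy rBf).
  rewrite (fibre_field_slope gG pU fr Uy) (@vfield_cst _ X' _ 0 vX Uy); last first.
    by apply: (around_sub (near_base Uy rf)) => y' [Uy' rf']; rewrite (fibre_field_base gG pU fr).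
  by rewrite (lift_field_base gG pU fr vB Uy rf) mulr0 !add0r mul1r subr0.
- rewrite lieE // (@vfield_cst _ N' _ 0 vN Uy); last first.
    by apply: (around_sub nU) => y' Uy'; rewrite (line_field_slope gG pU fr).
  rewrite (@vfield_cst _ X' _ 1 vX Uy); last first.
    by apply: (around_sub nU) => y' Uy'; rewrite (fibre_field_slope gG pU fr).
  by rewrite (lift_field_slope gG pU fr vB Uy) subr0.
Qed.

Lemma lie_fibre_lift V (y : P) : is_vfield U V -> U' y -> lie N' (lf V) y = tzero (X := P).
Proof.
move=> vV Uy; have ty := patch_tame gG pP Uy; have vlV := lift_field_vfield gG pU fr vV.
have nU := patch_self gG pP Uy; have rs := slope_regular gG pU fr Uy.
apply: (prolong_tangent_eq gG pU fr Uy).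
- exact: (lie_tangent ty nU vN vlV).
- exact: tangent_tzero.
- move=> f rf; have rfb := base_regular gG pU fr Uy rf.
  have rVf : regular_at (base y) (fun x => V x f) by have [_ h] := vV _ Uy.1; exact: h.
  rewrite lieE // (vfield_ext (f := fun y' => lf V y' (fun y' : P => f (base y')))
     (g := fun y' => V (base y') f) vN Uy); last 2 first.
  + by have [_ h] := vlV _ Uy; exact: h.
  + by apply: (around_sub (near_base Uy rf)) => y' [Uy' rf']; rewrite (lift_field_base gG pU fr).
  rewrite (fibre_field_base gG pU fr Uy rVf) (@vfield_cst _ (lf V) _ 0 vlV Uy) ?subr0 //.
  by apply: (around_sub (near_base Uy rf)) => y' [Uy' rf']; rewrite (fibre_field_base gG pU fr).
- rewrite lieE // (@vfield_cst _ N' _ 0 vN Uy); last first.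
    by apply: (around_sub nU) => y' Uy'; rewrite (lift_field_slope gG pU fr).
  rewrite (@vfield_cst _ (lf V) _ 1 vlV Uy) ?subr0 //.
  by apply: (around_sub nU) => y' Uy'; rewrite (fibre_field_slope gG pU fr).
Qed.

Lemma lie_line_lift V (y : P) : is_vfield U V -> U' y ->
  lie X' (lf V) y = vlift phi A B (fun f => lie A V (base y) f + sl y * lie B V (base y) f) 0 y.
Proof.
move=> vV Uy; have ty := patch_tame gG pP Uy; have vlV := lift_field_vfield gG pU fr vV.
have nU := patch_self gG pP Uy; have rs := slope_regular gG pU fr Uy.
have tb := patch_tame gG pU Uy.1; have nUb := patch_self gG pU Uy.1.
have vA := fr_A fr; have vB := fr_B fr.
have tl : is_tangent (base y) (fun f => lie A V (base y) f + sl y * lie B V (base y) f).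
  have := tangent_comb2 1 (sl y) (lie_tangent tb nUb vA vV) (lie_tangent tb nUb vB vV).
  by congr is_tangent; apply/funext => f; rewrite mul1r.
have [tlV rlV] := vlV _ Uy; have [tX rX] := vX Uy.
apply: (prolong_tangent_eq gG pU fr Uy).
- exact: (lie_tangent ty nU vX vlV).
- exact: (lift_tangent gG pU fr).
- move=> f rf; have rfb := base_regular gG pU fr Uy rf.
  have rVf : regular_at (base y) (fun x => V x f) by have [_ h] := vV _ Uy.1; exact: h.
  have rAf : regular_at (base y) (fun x => A x f) by have [_ h] := vA _ Uy.1; exact: h.
  have rBf : regular_at (base y) (fun x => B x f) by have [_ h] := vB _ Uy.1; exact: h.
  have rA' := base_regular gG pU fr Uy rAf; have rB' := base_regular gG pU fr Uy rBf.
  have rm := reg_mul gG ty rs rB'.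
  rewrite lieE // (vfield_ext (f := fun y' => lf V y' (fun y' : P => f (base y')))
     (g := fun y' => V (base y') f) vX Uy); last 2 first.
  + exact: rlV.
  + by apply: (around_sub (near_base Uy rf)) => y' [Uy' rf']; rewrite (lift_field_base gG pU fr).
  rewrite (line_field_base gG pU fr Uy rVf) (vfield_ext (f := fun y' => X' y' (fun y' : P => f (base y')))
     (g := fun y' => A (base y') f + sl y' * B (base y') f) vlV Uy); last 2 first.
  + exact: rX.
  + by apply: (around_sub (near_base Uy rf)) => y' [Uy' rf']; rewrite (line_field_base gG pU fr).
  rewrite (tangentD tlV) // (tangentM tlV) // (lift_field_base gG pU fr vV Uy rAf) (lift_field_base gG pU fr vV Uy rBf).
  rewrite (lift_field_slope gG pU fr vV Uy) (lift_base gG pU fr 0 Uy tl rf) !lieE //; ring.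
- rewrite lieE // (@vfield_cst _ X' _ 0 vX Uy); last first.
    by apply: (around_sub nU) => y' Uy'; rewrite (lift_field_slope gG pU fr).
  rewrite (@vfield_cst _ (lf V) _ 0 vlV Uy); last first.
    by apply: (around_sub nU) => y' Uy'; rewrite (line_field_slope gG pU fr).
  by rewrite (lift_slope gG pU fr 0 Uy tl) subr0.
Qed.

End Brackets.

(** * Adapted coordinates on the monster tower *)

Section Stages.
Variable (G : geometry).
Hypothesis gG : good G.
Local Notation K := (scalars G).
Local Notation areg n z F := (@regular_at K (affine G n) z F).
Local Notation anear n z P := (@around K (affine G n) z P).
Variable S : fspace K.

Definition weight (X : Type) k (v : nat -> bool) (t : nat -> X -> K) j x : K :=
  \prod_(j.+1 <= l < k.+1) (if v l then t l x else 1).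

(* Along the tower, t_k is the affine coordinate of the last line, N its
   coordinate field, and X the lift of the line represented by the point. When
   [vert l] holds, p lies on I_l and t_l is an equation of I_l. The weight of j is
   the product of the t_l with l > j and [vert l]. [st_repl] (the coordinate t_j
   can be set to 0 inside the domain) gives local equations by division, and
   [st_image] presents the domain near p as the zeros of c functions that w, t_0,
   ..., t_k complete to coordinates. *)
Record stage k (p : monster S k) := Stage {
  dimn : nat;
  dom : set (monster S k);
  coord : monster S k -> 'rV[K]_dimn;
  fX : vfield (monster S k);
  fN : vfield (monster S k);
  dX : monster S k -> K;
  fB : nat -> vfield (monster S k);
  cw : monster S k -> K;
  ct : nat -> monster S k -> K;
  vert : nat -> bool;
  sgn : nat -> K;
  st_p : dom p;
  st_coords : coords dom coord;
  st_inj : forall x x', dom x -> dom x' -> coord x = coord x' -> x = x';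
  st_frame : framing dom fX fN dX (ct k);
  st_B : forall j, (j <= k)%N -> is_vfield dom (fB j);
  st_w : regular_on dom cw;
  st_t : forall j, (j <= k)%N -> regular_on dom (ct j);
  st_Xw : forall x, dom x -> fX x cw = weight k vert ct 0 x;
  st_Nw : forall x, dom x -> fN x cw = 0;
  st_Xt : forall j x, (j < k)%N -> dom x ->
    fX x (ct j) = weight k vert ct j.+1 x * (if vert j.+1 then 1 else ct j.+1 x);
  st_Nt : forall j x, (j < k)%N -> dom x -> fN x (ct j) = 0;
  st_NX : forall x, dom x -> lie fN fX x = fB k x;
  st_NB : forall j x, (j <= k)%N -> dom x -> lie fN (fB j) x = tzero (X := monster S k);
  st_XB : forall j x, (0 < j <= k)%N -> dom x ->
    lie fX (fB j) x = fun f => sgn j * weight k vert ct j x * fB j.-1 x f;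
  st_B0 : forall x, dom x -> fB 0 x = tzero (X := monster S k);
  st_sgn : forall j, sgn j != 0;
  st_indep : forall x a b (c : nat -> K), dom x ->
    (forall f, a * fX x f + b * fN x f + \sum_(1 <= j < k.+1) c j * fB j x f = 0) ->
    [/\ a = 0, b = 0 & forall j, (0 < j <= k)%N -> c j = 0];
  st_det : forall x u, dom x -> is_tangent x u -> u cw = 0 ->
    (forall j, (j <= k)%N -> u (ct j) = 0) -> u = tzero (X := monster S k);
  st_inf : forall j, (1 < j <= k)%N -> (vert j <-> infinity j p) /\
    (vert j -> ct j p = 0 /\ forall x, dom x -> (infinity j x <-> ct j x = 0));
  st_repl : forall j, (0 < j <= k)%N -> exists l,
    (forall x, dom x -> coord x 0 l = ct j x) /\
    forall x, dom x -> exists x', dom x' /\ coord x' = setc (coord x) l 0;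
  st_vertical : (0 < k)%N -> forall y : monster S k.+1, dom (base y) ->
    (@vertical G S k y <-> line y (fN (base y)));
  st_image : exists c (Gam : 'I_c -> 'rV[K]_dimn -> K) (W : 'rV[K]_dimn -> K) (T : nat -> 'rV[K]_dimn -> K),
    [/\ (dimn = c + k.+1 + 1)%N,
      (forall i, areg _ (coord p) (Gam i)) /\
      anear _ (coord p) (fun z => (coord @` dom) z <-> forall i, Gam i z = 0),
      areg _ (coord p) W /\ around p (fun x => cw x = W (coord x)),
      forall j, (j <= k)%N -> areg _ (coord p) (T j) /\ around p (fun x => ct j x = T j (coord x)) &
      forall u, (forall i, dvec (G := G) u (coord p) (Gam i) = 0) ->
        dvec (G := G) u (coord p) W = 0 ->
        (forall j, (j <= k)%N -> dvec (G := G) u (coord p) (T j) = 0) -> u = 0] }.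

Lemma dvec_coord n (u z : 'rV[K]_n) l : dvec (G := G) u z (fun y : 'rV[K]_n => y 0 l) = u 0 l.
Proof.
rewrite dvecE; last exact: aff_coord.
rewrite (bigD1 l) //= (pdv_coord gG) eqxx mulr1 big1 ?addr0 // => j jl.
by rewrite (pdv_coord gG) eq_sym (negPf jl) mulr0.
Qed.

Definition lpart n (z : 'rV[K]_(n + 1)) : 'rV[K]_n := \row_l z 0 (lshift 1 l).

Lemma dvec_lpart n (u z : 'rV[K]_(n + 1)) (F : 'rV[K]_n -> K) : areg n (lpart z) F ->
  dvec (G := G) u z (fun y => F (lpart y)) = dvec (G := G) (lpart u) (lpart z) F.
Proof.
move=> rF; have tz := aff_tame gG z; have tu := dvec_tangent gG u z.
have := @tangent_comp G gG (affine G (n + 1)) z _ n (fun l (y : 'rV[K]_(n + 1)) => y 0 (lshift 1 l)) F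
  (lpart z) tz tu.
rewrite -/(lpart z) => -> //; last by move=> j; exact: aff_coord.
by rewrite dvecE //; apply: eq_bigr => j _; rewrite dvec_coord mxE.
Qed.

Lemma reg_lpart n (z : 'rV[K]_(n + 1)) (F : 'rV[K]_n -> K) : areg n (lpart z) F ->
  areg (n + 1) z (fun y => F (lpart y)).
Proof.
move=> rF; apply: (@aff_comp G gG n (n + 1) (fun l y => y 0 (lshift 1 l)) z _ F _ _ _ rF) => // j.
exact: aff_coord.
Qed.

Lemma near_lpart n (z : 'rV[K]_(n + 1)) (Q : set 'rV[K]_n) : anear n (lpart z) Q ->
  anear (n + 1) z (fun y => Q (lpart y)).
Proof.
move=> nQ; apply: (@aff_near G gG n (n + 1) (fun l y => y 0 (lshift 1 l)) z _ Q _ _ _ nQ) => // j.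
exact: aff_coord.
Qed.

Lemma lpart_slope (D : dspace K) n (phi : D -> 'rV[K]_n) A B (y : proj_space D) :
  lpart (slope_coord phi A B y) = phi (base y).
Proof. by apply/rowP => l; rewrite mxE slope_coordL. Qed.

Lemma lie_self (X : fspace K) (V : vfield X) x : lie V V x = tzero (X := X).
Proof. by apply/funext => f; rewrite /lie subrr if_same. Qed.

Lemma lie_anti (X : fspace K) (V W : vfield X) x : lie V W x = fun f => -1 * lie W V x f.
Proof.
by apply/funext => f; rewrite /lie; case: asboolP => _; rewrite ?mulr0 // mulN1r opprB.
Qed.

Lemma weightS (X Y : Type) k v v' (t : nat -> X -> K) (t' : nat -> Y -> K) j x y :
  (j <= k)%N -> (forall l, (l <= k)%N -> v' l = v l /\ t' l y = t l x) ->
  weight k.+1 v' t' j y = weight k v t j x * (if v' k.+1 then t' k.+1 y else 1).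
Proof.
move=> jk h; rewrite /weight big_nat_recr //=; congr (_ * _).
by apply: eq_big_nat => l /andP[_ lk]; have [-> ->] := h l lk.
Qed.

Lemma weight_top (X : Type) k v (t : nat -> X -> K) x : weight k v t k x = 1.
Proof. by rewrite /weight big_geq. Qed.

(** * From level k to level k + 1 *)

Section Step.
Variables (k : nat) (p : monster S k.+1) (st : stage (base (D := monster S k) p)).
Local Notation D := (monster S k).
(** This condition selects the affine chart for the new line: when p represents the line of N, the
    new X is N + s X with slope s = 0 at p; otherwise it is X + s N. *)
Local Notation v0 := (`[< line (D := D) p (fN st (base (D := D) p)) >]).
Local Notation A := (if v0 then fN st else fX st).
Local Notation B := (if v0 then fX st else fN st).
Local Notation dA := (if v0 then ct st k else dX st).
Local Notation dB := (if v0 then dX st else ct st k).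
Local Notation phi := (coord st).
Local Notation U := (dom st).

Let fr : framing U A B dA dB.
Proof. by case: asboolP => _; [apply: framing_swap|]; exact: st_frame. Qed.

Let pU : coords U phi := st_coords st.
Local Notation P := (monster S k.+1).
Local Notation U' := (slope_dom U B : set P).
Local Notation sl := (slope A B : P -> K).
Local Notation phi' := (slope_coord phi A B : P -> 'rV[K]_(dimn st + 1)).
Local Notation X' := (line_field phi A B : vfield P).
Local Notation N' := (fibre_field phi A B : vfield P).
Local Notation lf V := (lift_field phi A B V : vfield P).
Let pP : coords U' phi' := prolong_patch gG pU fr.
Local Notation bs := (base (D := D)).
Let t' j (y : P) : K := if (j <= k)%N then ct st j (bs y) else sl y.
Let v' j := if j == k.+1 then v0 else vert st j.
Let B' j : vfield P := if (j <= k)%N then lf (fB st j) else lf B.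
(** The top field [B' k.+1] lifts [B], and [A, B] is [N, X] when [v0] holds and [X, N] otherwise:
    hence the sign. *)
Let e' j : K := if j == k.+1 then (if v0 then 1 else -1) else sgn st j.
Let w' (y : P) : K := cw st (bs y).

Let t'S : t' k.+1 = sl. Proof. by apply/funext => y; rewrite /t' ltnn. Qed.
Let t'L j : (j <= k)%N -> t' j = fun y => ct st j (bs y).
Proof. by move=> jk; apply/funext => y; rewrite /t' jk. Qed.
Let v'S : v' k.+1 = v0. Proof. by rewrite /v' eqxx. Qed.
Let v'L j : (j <= k)%N -> v' j = vert st j.
Proof. by move=> jk; rewrite /v' ltn_eqF. Qed.
Let B'S : B' k.+1 = lf B. Proof. by rewrite /B' ltnn. Qed.
Let B'L j : (j <= k)%N -> B' j = lf (fB st j). Proof. by rewrite /B' => ->. Qed.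

Let wS j y : (j <= k)%N ->
  weight k.+1 v' t' j y = weight k (vert st) (ct st) j (bs y) * (if v0 then sl y else 1).
Proof.
move=> jk; rewrite (@weightS D P k (vert st) v' (ct st) t' j (bs y) y jk) ?v'S ?t'S // => l lk.
by rewrite v'L // t'L.
Qed.

Let rt j y : (j <= k)%N -> U' y -> regular_at (bs y) (ct st j).
Proof. by move=> jk [Uy _]; exact: (st_t jk Uy). Qed.
Let rw y : U' y -> regular_at (bs y) (cw st).
Proof. by move=> [Uy _]; exact: (st_w Uy). Qed.

Let Up : U' p.
Proof.
have Ub := st_p st; split => //.
have := @line_comb G D U (fX st) (fN st) _ _ (st_frame st) p Ub.
have fr0 := st_frame st; case: asboolP => // h [a [b [_ e]]] h'.
move: h h'; rewrite e => -[c ec] [d ed].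
have e1 := congr1 (fun v => v (dX st)) ec; have e2 := congr1 (fun v => v (ct st k)) ec.
have e3 := congr1 (fun v => v (dX st)) ed; have e4 := congr1 (fun v => v (ct st k)) ed.
move: e1 e2 e3 e4; rewrite /= (fr_AA fr0 Ub) (fr_BA fr0 Ub) (fr_AB fr0 Ub) (fr_BB fr0 Ub).
rewrite !mulr0 !addr0 !add0r !mulr1 => e1 e2 e3 e4.
have : c * a * (d * b) = 1 by rewrite mulrACA [a * b]mulrC mulrACA -e2 -e3 mulr1.
by rewrite -e1 mul0r => /esym/eqP; rewrite oner_eq0.
Qed.

Let slope_N y : v0 -> U' y -> (line (D := D) y (fN st (bs y)) <-> sl y = 0).
Proof.
move=> v0T Uy; have Ub := Uy.1.
have fNy : fibre D (bs y) (fN st (bs y)).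
  apply/(fr_fibre (st_frame st) _ Ub); exists 0, 1.
  by apply/funext => f; rewrite mul1r mul0r add0r.
have [-> _] := slope_other fr 0 Uy fNy fNy.
have fr0 := st_frame st.
by move: (v0T) => /asboolP; rewrite v0T (fr_BB fr0 Ub) (fr_BA fr0 Ub) mul1r subr0.
Qed.

Let f_inj y y' : U' y -> U' y' -> phi' y = phi' y' -> y = y'.
Proof. by apply: slope_coord_inj fr _ _ _; exact: st_inj. Qed.

Let f_frame : framing U' X' N' (fun y : P => dA (bs y)) (t' k.+1).
Proof. by rewrite t'S; exact: (prolong_framing gG pU fr). Qed.

Let f_B j : (j <= k.+1)%N -> is_vfield U' (B' j).
Proof.
rewrite leq_eqVlt => /orP[/eqP ->|]; last first.
  by rewrite ltnS => jk; rewrite (B'L jk); apply: (lift_field_vfield gG pU fr); exact: st_B.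
by rewrite B'S; apply: (lift_field_vfield gG pU fr); exact: fr_B fr.
Qed.

Let f_w : regular_on U' w'.
Proof. by move=> y Uy; apply: (base_regular gG pU fr Uy); exact: rw. Qed.

Let f_t j : (j <= k.+1)%N -> regular_on U' (t' j).
Proof.
rewrite leq_eqVlt => /orP[/eqP -> y Uy|].
  by rewrite t'S; exact: (slope_regular gG pU fr Uy).
rewrite ltnS => jk y Uy; rewrite (t'L jk); apply: (base_regular gG pU fr Uy); exact: rt.
Qed.

Let AB_val (y : P) f : A (bs y) f + sl y * B (bs y) f =
  if v0 then fN st (bs y) f + sl y * fX st (bs y) f else fX st (bs y) f + sl y * fN st (bs y) f.
Proof. by case: asboolP. Qed.

Let f_Xw y : U' y -> X' y w' = weight k.+1 v' t' 0 y.
Proof.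
move=> Uy; rewrite (line_field_base gG pU fr Uy (rw Uy)) wS // AB_val.
rewrite (st_Nw (s := st) Uy.1) (st_Xw (s := st) Uy.1).
by move: (slope _ _ y) => s; case: ifP => _; rewrite ?add0r ?mulr0 ?addr0 ?mulr1 // mulrC.
Qed.

Let f_Nw y : U' y -> N' y w' = 0.
Proof. by move=> Uy; exact: (fibre_field_base gG pU fr Uy (rw Uy)). Qed.

(** N + s X multiplies the old X t_j by s for j < k, because N t_j = 0, and takes t_k to 1; X + s N
    keeps the old X t_j and takes t_k to s. *)
Let f_Xt j y : (j < k.+1)%N -> U' y ->
  X' y (t' j) = weight k.+1 v' t' j.+1 y * (if v' j.+1 then 1 else t' j.+1 y).
Proof.
rewrite ltnS leq_eqVlt => /orP[/eqP ->|jk] Uy; have fr0 := st_frame st; have Ub := Uy.1.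
  rewrite (t'L (leqnn k)) (line_field_base gG pU fr Uy (rt (leqnn k) Uy)) AB_val weight_top mul1r v'S t'S.
  rewrite (fr_AB fr0 Ub) (fr_BB fr0 Ub).
  by move: (slope _ _ y) => s; case: ifP => _; rewrite ?mulr0 ?mulr1 ?addr0 ?add0r.
rewrite (t'L (ltnW jk)) (line_field_base gG pU fr Uy (rt (ltnW jk) Uy)) AB_val wS // (v'L jk) (t'L jk).
rewrite (st_Nt jk Ub) (st_Xt jk Ub).
by move: (slope _ _ y) => s; case: ifP => _; rewrite ?mulr0 ?mulr1 ?addr0 ?add0r //; ring.
Qed.

Let f_Nt j y : (j < k.+1)%N -> U' y -> N' y (t' j) = 0.
Proof.
rewrite ltnS => jk Uy; rewrite (t'L jk).
exact: (fibre_field_base gG pU fr Uy (rt jk Uy)).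
Qed.

Let f_NX y : U' y -> lie N' X' y = B' k.+1 y.
Proof. by move=> Uy; rewrite B'S; exact: (lie_fibre_line gG pU fr Uy). Qed.

Let f_NB j y : (j <= k.+1)%N -> U' y -> lie N' (B' j) y = tzero (X := P).
Proof.
rewrite leq_eqVlt => /orP[/eqP ->|] => [|jk] Uy.
  by rewrite B'S; apply: (lie_fibre_lift gG pU fr _ Uy); exact: fr_B fr.
by rewrite (B'L jk); apply: (lie_fibre_lift gG pU fr _ Uy); exact: st_B.
Qed.

Let lieAB (V : vfield D) x f : lie A V x f = (if v0 then lie (fN st) V x f else lie (fX st) V x f) /\
  lie B V x f = (if v0 then lie (fX st) V x f else lie (fN st) V x f).
Proof. by case: asboolP. Qed.

Let f_XB j y : (0 < j <= k.+1)%N -> U' y ->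
  lie X' (B' j) y = fun f => e' j * weight k.+1 v' t' j y * B' j.-1 y f.
Proof.
move=> /andP[j0]; rewrite leq_eqVlt => /orP[/eqP ->|] => [|jk] Uy; have Ub := Uy.1.
  rewrite B'S (lie_line_lift gG pU fr (fr_B fr) Uy) weight_top mulr1 /= (B'L (leqnn k)) /e' eqxx.
  have [tBk _] := st_B (leqnn k) Ub.
  rewrite -(lift_scale gG pU fr _ Uy tBk); congr (vlift _ _ _ _ _ _); apply/funext => f.
  rewrite lie_self /tzero mulr0 addr0 -(st_NX (s := st) Ub).
  by case: asboolP => _; rewrite ?mul1r // lie_anti.
rewrite ltnS in jk; have jk' : (j.-1 <= k)%N by apply: leq_trans (leq_pred _) jk.
have jj : (0 < j <= k)%N by rewrite j0.
rewrite (B'L jk) (lie_line_lift gG pU fr (st_B jk) Uy) (B'L jk') wS // /e' ltn_eqF //.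
have [tBk _] := st_B jk' Ub.
rewrite -(lift_scale gG pU fr _ Uy tBk); congr (vlift _ _ _ _ _ _); apply/funext => f.
have [-> ->] := lieAB (fB st j) (bs y) f.
rewrite (st_NB jk Ub) (st_XB jj Ub) /tzero; move: (slope _ _ y) => s.
case: ifP => _; ring.
Qed.

Let f_B0 y : U' y -> B' 0 y = tzero (X := P).
Proof.
move=> Uy; rewrite (B'L (leq0n k)) /lift_field (st_B0 (s := st) Uy.1).
exact: (lift_tzero gG pU fr Uy).
Qed.

Let f_sgn j : e' j != 0.
Proof.
rewrite /e'; case: ifP => _; last exact: st_sgn.
by case: asboolP => _; rewrite ?oppr_eq0 oner_neq0.
Qed.

(** Evaluation on the slope isolates b. On functions of the base there remains a relation between
    the old fields, in which [A] has coefficient a and [B] has a times the slope plus c_(k+1). *)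
Let f_indep y a b (c : nat -> K) : U' y ->
  (forall f, a * X' y f + b * N' y f + \sum_(1 <= j < k.+2) c j * B' j y f = 0) ->
  [/\ a = 0, b = 0 & forall j, (0 < j <= k.+1)%N -> c j = 0].
Proof.
move=> Uy h; have Ub := Uy.1; have fr0 := st_frame st.
have b0 : b = 0.
  have := h sl; rewrite (line_field_slope gG pU fr Uy) (fibre_field_slope gG pU fr Uy) mulr0 add0r mulr1.
  rewrite big_nat big1 ?addr0 // => j /andP[j0]; rewrite ltnS leq_eqVlt => /orP[/eqP ->|].
    by rewrite B'S (lift_field_slope gG pU fr (fr_B fr) Uy) mulr0.
  by rewrite ltnS => jk; rewrite (B'L jk) (lift_field_slope gG pU fr (st_B jk) Uy) mulr0.
pose cX := if v0 then a * sl y + c k.+1 else a.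
pose cN := if v0 then a else a * sl y + c k.+1.
have hyp : forall f, cX * fX st (bs y) f + cN * fN st (bs y) f + \sum_(1 <= j < k.+1) c j * fB st j (bs y) f = 0.
  move=> f; have [rf|nrf] := pselect (regular_at (bs y) f); last first.
    have [[h1 _ _ _] _] := fr_A fr0 Ub; have [[h2 _ _ _] _] := fr_B fr0 Ub.
    rewrite h1 // h2 // !mulr0 !add0r big_nat big1 // => j /andP[_ jk].
    by have [[h3 _ _ _] _] := st_B (s := st) (j := j) jk Ub; rewrite h3 // mulr0.
  have := h (fun y' => f (bs y')).
  rewrite (line_field_base gG pU fr Uy rf) (fibre_field_base gG pU fr Uy rf) b0 mul0r addr0.
  rewrite big_nat_recr //= B'S (lift_field_base gG pU fr (fr_B fr) Uy rf) => e.
  rewrite -[RHS]e; have -> : \sum_(1 <= i < k.+1) c i * B' i y (fun y' : P => f (bs y')) =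
      \sum_(1 <= j < k.+1) c j * fB st j (bs y) f.
    apply: eq_big_nat => j /andP[_ jk].
    by rewrite (B'L (j := j) jk) (lift_field_base gG pU fr (st_B (s := st) (j := j) jk) Uy rf).
  rewrite AB_val /cX /cN; case: asboolP => _; ring.
have [cX0 cN0 hc] := st_indep Ub hyp.
have a0 : a = 0 by move: cX0 cN0; rewrite /cX /cN; case: asboolP.
split => // j /andP[j0]; rewrite leq_eqVlt => /orP[/eqP ->|]; last by rewrite ltnS => jk; apply: hc; rewrite j0.
by move: cX0 cN0; rewrite /cX /cN a0 mul0r add0r; case: asboolP.
Qed.

Let f_det y u : U' y -> is_tangent y u -> u w' = 0 ->
  (forall j, (j <= k.+1)%N -> u (t' j) = 0) -> u = tzero (X := P).
Proof.
move=> Uy tu uw ut; have Ub := Uy.1; have tp := push_base_tangent gG pU fr Uy tu.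
have pz : push (@proj_base G D) y u = tzero (X := D).
  apply: (st_det Ub tp).
    by rewrite (push_baseE _ (rw Uy)); exact: uw.
  move=> j jk; rewrite (push_baseE _ (rt jk Uy)).
  by have := ut j (leqW jk); rewrite (t'L jk).
apply: (prolong_tangent_eq gG pU fr Uy tu); first exact: tangent_tzero.
  by move=> f rf; rewrite -(push_baseE _ rf) pz.
by have := ut k.+1 (leqnn _); rewrite t'S.
Qed.

Let f_inf j : (1 < j <= k.+1)%N -> (v' j <-> infinity j p) /\
    (v' j -> t' j p = 0 /\ forall y, U' y -> (infinity j y <-> t' j y = 0)).
Proof.
move=> /andP[j1]; rewrite leq_eqVlt => /orP[/eqP ej|jk].
  subst j; have k0 : (0 < k)%N by [].
  have iE (y : P) : infinity k.+1 y = @vertical G S k y by rewrite /= eqxx.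
  rewrite v'S t'S iE (st_vertical (s := st) k0 (st_p st)); split.
    by split=> [/asboolP|h] //; apply/asboolP.
  move=> hv; split; first by apply/(slope_N hv Up)/asboolP.
  by move=> y Uy; rewrite iE (st_vertical (s := st) k0 Uy.1); exact: slope_N.
have jk1 : (1 < j <= k)%N by rewrite j1.
have iE (y : P) : infinity j y = infinity (k := k) j (bs y).
  by rewrite /= ltn_eqF.
have [h1 h2] := st_inf st jk1.
rewrite (v'L (j := j) jk) (t'L (j := j) jk) iE; split => // /h2[h3 h4]; split => // y Uy.
by rewrite iE; exact: h4 _ Uy.1.
Qed.

Let f_repl j : (0 < j <= k.+1)%N -> exists l,
    (forall y, U' y -> phi' y 0 l = t' j y) /\
    forall y, U' y -> exists y', U' y' /\ phi' y' = setc (phi' y) l 0.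
Proof.
move=> /andP[j1]; rewrite leq_eqVlt => /orP[/eqP ej|jk].
  rewrite ej t'S; exists (rshift (dimn st) ord0); split=> [y Uy|y Uy]; first by rewrite slope_coordR.
  have [y' [Uy' eb es]] := slope_ex fr 0 Uy.1; exists y'; split => //.
  apply/rowP => i; rewrite [RHS]mxE; case: (split_ordP i) => l ->.
    by rewrite eq_lrshift !slope_coordL eb.
  by rewrite (ord1 l) eqxx slope_coordR.
have jk1 : (0 < j <= k)%N by rewrite j1.
have [l [hl hr]] := st_repl st jk1.
exists (lshift 1 l); rewrite (t'L (j := j) jk); split=> [y Uy|y Uy].
  by rewrite slope_coordL; exact: hl Uy.1.
have [x' [Ux' ex]] := hr _ Uy.1.
have [y' [Uy' eb es]] := slope_ex fr (sl y) Ux'; exists y'; split => //.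
apply/rowP => i; rewrite [RHS]mxE; case: (split_ordP i) => m ->.
  by rewrite (inj_eq (@lshift_inj _ _)) !slope_coordL eb ex mxE.
by rewrite eq_rlshift (ord1 m) !slope_coordR es.
Qed.

(** A vector a X' + b N' projects to a (A + s B), so the vertical line is the one with a = 0. *)
Let f_vertical : (0 < k.+1)%N -> forall z : monster S k.+2, U' (base (D := P) z) ->
    (@vertical G S k.+1 z <-> line (D := P) z (N' (base (D := P) z))).
Proof.
move=> _ z Uy; set y := base (D := P) z in Uy *; have Ub := Uy.1.
have frn := f_frame.
have [a [b [ab e]]] := @line_comb G P U' X' N' _ _ frn z Uy.
have pX f : regular_at (bs y) f -> push (@proj_base G D) y (fun f => a * X' y f + b * N' y f) f =
    a * (A (bs y) f + sl y * B (bs y) f).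
  move=> rf; rewrite (push_baseE _ rf) (line_field_base gG pU fr Uy rf) (fibre_field_base gG pU fr Uy rf).
  by rewrite mulr0 addr0.
split=> [h|].
  have hl : line (D := P) z (fun f => a * X' y f + b * N' y f).
    by rewrite e; exists 1; apply/funext => f; rewrite mul1r.
  have := h _ hl; rewrite -/(bs y) => e1.
  have := congr1 (fun v => v dA) e1; rewrite /monster_proj pX; last exact: (fr_fA fr Ub).
  rewrite (fr_AA fr Ub) (fr_BA fr Ub) mulr0 addr0 mulr1 => a0.
  have b0 : b != 0 by move: ab; rewrite a0 eqxx.
  rewrite e; exists b^-1; apply/funext => f.
  by rewrite a0 mul0r add0r mulKf.
rewrite e => -[c ec].
have e1 := congr1 (fun v => v (fun y : P => dA (bs y))) ec; have e2 := congr1 (fun v => v (t' k.+1)) ec.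
rewrite /= (fr_AA frn Uy) (fr_BA frn Uy) mulr0 addr0 mulr1 in e1.
rewrite /= (fr_AB frn Uy) (fr_BB frn Uy) mulr0 mulr1 add0r in e2.
have a0 : a = 0.
  apply/eqP; move/esym/eqP: e1; rewrite mulf_eq0 => /orP[/eqP c0|//].
  by move/eqP: e2; rewrite c0 mul0r oner_eq0.
suff key v : line (D := P) z v -> push (@monster_proj G S k) y v = tzero (X := D) by exact: key.
rewrite e => -[d ->].
apply: (tangent_eq (x := bs y)).
- apply: (push_base_tangent gG pU fr Uy).
  have [tX _] := fr_A frn Uy; have [tN _] := fr_B frn Uy.
  have := tangent_comb2 (d * a) (d * b) tX tN; congr is_tangent; apply/funext => f.
  by rewrite mulrDr !mulrA.
- exact: tangent_tzero.
- move=> f rf; rewrite /monster_proj (push_baseE _ rf) (line_field_base gG pU fr Uy rf).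
  by rewrite (fibre_field_base gG pU fr Uy rf) a0 mul0r mulr0 addr0 mulr0.
Qed.

Let f_image : exists c (Gam : 'I_c -> 'rV[K]_(dimn st + 1) -> K) (W : 'rV[K]_(dimn st + 1) -> K)
     (T : nat -> 'rV[K]_(dimn st + 1) -> K),
    [/\ (dimn st + 1 = c + k.+2 + 1)%N,
      (forall i, areg _ (phi' p) (Gam i)) /\
      anear _ (phi' p) (fun z => (phi' @` U') z <-> forall i, Gam i z = 0),
      areg _ (phi' p) W /\ around p (fun y : P => w' y = W (phi' y)),
      forall j, (j <= k.+1)%N -> areg _ (phi' p) (T j) /\ around p (fun y : P => t' j y = T j (phi' y)) &
      forall u, (forall i, dvec (G := G) u (phi' p) (Gam i) = 0) ->
        dvec (G := G) u (phi' p) W = 0 ->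
        (forall j, (j <= k.+1)%N -> dvec (G := G) u (phi' p) (T j) = 0) -> u = 0].
Proof.
have [c [Gam [W [T [en [rG nG] [rW nW] rT inj]]]]] := st_image st.
have lp (y : P) : lpart (phi' y) = phi (bs y) := lpart_slope _ _ _ y.
exists c, (fun i z => Gam i (lpart z)), (fun z => W (lpart z)),
  (fun j z => if (j <= k)%N then T j (lpart z) else z 0 (rshift (dimn st) 0)).
have nb Q : around (bs p) Q -> around p (fun y : P => Q (bs y)).
  by move=> nQ; exact: (base_near gG pU fr Up nQ).
split.
- by rewrite en !addn1 !addnS.
- split; first by move=> i; apply: reg_lpart; rewrite lp.
  have h : anear (dimn st) (lpart (phi' p)) (fun z => (phi @` U) z <-> forall i, Gam i z = 0) by rewrite lp.
  apply: (around_sub (near_lpart h)) => z [h1 h2]; split.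
    by move=> hz; apply: h1; move: hz => [y Uy <-]; exists (bs y); [exact: Uy.1|rewrite lp].
  move=> /h2[x Ux ex]; have [y [Uy eb es]] := slope_ex fr (z 0 (rshift (dimn st) 0)) Ux.
  exists y => //; apply/rowP => i; case: (split_ordP i) => l ->.
    by rewrite slope_coordL eb ex mxE.
  by rewrite (ord1 l) slope_coordR.
- split; first by apply: reg_lpart; rewrite lp.
  by apply: (around_sub (nb _ nW)) => y h; rewrite lp.
- move=> j; rewrite leq_eqVlt => /orP[/eqP ->|jk].
    rewrite ltnn t'S; split; first exact: aff_coord.
    by apply: (around_sub (patch_self gG pP Up)) => y _; rewrite slope_coordR.
  have jk' : (j <= k)%N by [].
  have [r1 n1] := rT j jk'; rewrite jk' (t'L jk'); split; first by apply: reg_lpart; rewrite lp.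
  by apply: (around_sub (nb _ n1)) => y h; rewrite lp.
move=> u uG uW uT.
have u1 : lpart u = 0.
  apply: inj.
  - by move=> i; have := uG i; rewrite dvec_lpart lp.
  - by have := uW; rewrite dvec_lpart lp.
  - by move=> j jk; have := uT j (leqW jk); rewrite jk dvec_lpart lp //; case: (rT j jk).
have := uT k.+1 (leqnn _); rewrite ltnn dvec_coord => u2.
apply/rowP => i; case: (split_ordP i) => l ->.
  by have := congr1 (fun M : 'rV[K]_(dimn st) => M 0 l) u1; rewrite !mxE.
by rewrite (ord1 l) u2 mxE.
Qed.

Definition stage_step : stage p := @Stage k.+1 p _ U' phi' X' N' _ B' w' t' v' e' Up pP f_inj f_frame f_B
  f_w f_t f_Xw f_Nw f_Xt f_Nt f_NX f_NB f_XB f_B0 f_sgn f_indep f_det f_inf f_repl f_vertical f_image.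

End Step.
End Stages.

Lemma row_free_complete (K : fieldType) c d (J : 'M[K]_(c, c + d)) : row_free J ->
  exists E : 'M[K]_(d, c + d), col_mx J E \in unitmx.
Proof.
move=> fJ; have rC : \rank (J^C)%MS = d.
  by rewrite mxrank_compl (eqP fJ) addKn.
exists (castmx (rC, erefl) (row_base (J^C)%MS)).
rewrite -row_full_unit -sub1mx; apply: submx_trans (_ : ((J + J^C)%MS <= _)%MS).
  by have := addsmx_compl_full J; rewrite -sub1mx.
have e : (castmx (rC, erefl (c + d)%N) (row_base (J^C)%MS) :=: J^C)%MS.
  by apply: eqmx_trans (eqmx_cast _ _) (eq_row_base _).
apply: submx_trans (_ : ((J + castmx (rC, erefl (c + d)%N) (row_base (J^C)%MS))%MS <= _)%MS).
  by rewrite (adds_eqmx (eqmx_refl J) e).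
by rewrite addsmxE.
Qed.

(** * Frames from charts and the start of the tower *)

Section Charts.
Variable (G : geometry).
Hypothesis gG : good G.
Local Notation K := (scalars G).
Local Notation areg n z F := (@regular_at K (affine G n) z F).
Local Notation anear n z P := (@around K (affine G n) z P).

Lemma coords_sub (X : fspace K) (U U0 : set X) n (phi : X -> 'rV[K]_n) : coords U phi ->
  U0 `<=` U -> (forall x, U0 x -> around x U0) -> coords U0 phi.
Proof.
move=> pU sU aU; split; last by move=> x f /sU Ux; exact: (patch_reg pU).
move=> x P Ux; have tx := patch_tame gG pU (sU _ Ux); split.
  by move=> /(patch_near pU _ (sU _ Ux))[Q [nQ hQ]]; exists Q; split => // y /sU; exact: hQ.
move=> [Q [nQ hQ]].
by apply: (around_sub (aroundI tx (aU _ Ux) (patch_pull pU (sU _ Ux) nQ))) => y [Uy]; exact: hQ.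
Qed.

Lemma chart_coords d (X : fspace K) (U : set X) c (phi : X -> 'rV[K]_(c + d)) :
  (forall U V, opn X U -> opn X V -> opn X (U `&` V)) -> chart (G := G) U phi -> coords U phi.
Proof.
move=> hI [oU inj hO hR _].
have near x (P : set X) : U x -> (around x P <-> exists Q : set 'rV[K]_(c + d),
    anear (c + d) (phi x) Q /\ forall y, U y -> Q (phi y) -> P y).
  move=> Ux; split.
    move=> [O [oO Ox OP]]; have [|h _] := hO (U `&` O); first by move=> y [].
    have [V oV eV] := h (hI _ _ oU oO); exists V; split.
      exists V; split => //; have : (U `&` O) x by []; rewrite eV; by case.
    by move=> y Uy Vy; apply: OP; have : (U `&` phi @^-1` V) y by []; rewrite -eV; case.
  move=> [Q [[V [oV Vx VQ]] hQ]]; exists (U `&` phi @^-1` V); split => //.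
    by apply/hO; [move=> y []|exists V].
  by move=> y [Uy /VQ]; exact: hQ.
split => // x f Ux; have tz := aff_tame gG (phi x); rewrite (hR x f Ux); split.
  move=> [V [F [oV Vx rF e]]]; exists F; split; first exact: rF.
  by apply/(near _ _ Ux); exists V; split => //; exists V; split.
move=> [F [rF /(near _ _ Ux)[Q [nQ hQ]]]].
have [V [oV Vx VQ]] := aroundI tz nQ (reg_open tz rF).
exists V, F; split => //; first by move=> z /VQ[].
by move=> y Uy /VQ[h _]; exact: hQ.
Qed.

(** The equations g of the image near p are completed by linear functions ell to a system with
    invertible Jacobian; the fields dual to the ell kill the g and are therefore tangent to the
    image. *)
Lemma chart_frame d (X : fspace K) (U : set X) c (phi : X -> 'rV[K]_(c + d)) (p : X) :
  (forall U V, opn X U -> opn X V -> opn X (U `&` V)) -> chart (G := G) U phi -> U p ->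
  exists (U0 : set X) (w : 'I_d -> X -> K) (e : 'I_d -> vfield X)
      (g : 'I_c -> 'rV[K]_(c + d) -> K) (ell : 'I_d -> 'rV[K]_(c + d) -> K),
    [/\ [/\ U0 p, U0 `<=` U & forall x, U0 x -> around x U0],
        forall i, is_vfield U0 (e i) /\ regular_on U0 (w i),
        forall i j x, U0 x -> e i x (w j) = (j == i)%:R,
        forall x v, U0 x -> is_tangent x v -> (forall i, v (w i) = 0) -> v = tzero (X := X)
      & [/\ forall i, areg (c + d) (phi p) (g i) /\ g i (phi p) = 0,
            anear (c + d) (phi p) (fun z => (phi @` U0) z <-> forall i, g i z = 0),
            forall i, areg (c + d) (phi p) (ell i),
            forall i x, w i x = ell i (phi x)
          & forall u, (forall i, dvec (G := G) u (phi p) (g i) = 0) ->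
              (forall i, dvec (G := G) u (phi p) (ell i) = 0) -> u = 0]].
Proof.
move=> hI cU Up; have pU : coords U phi := chart_coords hI cU.
have [oU inj _ _ hloc] := cU.
have [V [g [[oV Vp] rg gV gid gind]]] := hloc p Up.
have gz x : U x -> V (phi x) -> forall i, g i (phi x) = 0.
  by move=> Ux Vx; apply/(gV _ Vx); exists x.
have tp := aff_tame gG (phi p).
pose J : 'M[K]_(c, c + d) := \matrix_(i, l) pdv l (g i) (phi p).
have fJ : row_free J.
  rewrite -kermx_eq0; apply/eqP/row_matrixP => i; rewrite row0.
  have h : row i (kermx J) *m J = 0 by rewrite -row_mul mulmx_ker row0.
  apply/rowP => j; rewrite [RHS]mxE; apply: (gind (fun j => row i (kermx J) 0 j)) => v tv.
  rewrite (affine_tangent gG tv).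
  under eq_bigr => l _ do rewrite (dvecE _ (rg l _ Vp)) mulr_sumr.
  rewrite exchange_big big1 // => l _ /=.
  under eq_bigr => k _ do rewrite mulrCA.
  rewrite -mulr_sumr; have := congr1 (fun M : 'rV[K]_(c + d) => M 0 l) h; rewrite !mxE => e.
  rewrite (eq_bigr (fun k => row i (kermx J) 0 k * J k l)) ?e ?mulr0 // => k _.
  by rewrite [J _ _]mxE.
have [E uE] := row_free_complete fJ.
pose ell (i : 'I_d) (z : 'rV[K]_(c + d)) : K := \sum_l z 0 l * E i l.
have rell i z : areg (c + d) z (ell i).
  apply: (reg_sum gG (aff_tame gG z)) => l _.
  by apply: (reg_mul gG (aff_tame gG z)); [exact: aff_coord|exact: aff_cst].
have dell i u z : dvec (G := G) u z (ell i) = \sum_l u 0 l * E i l.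
  have tz := aff_tame gG z; have tu := dvec_tangent gG u z.
  rewrite (tangent_sum gG tz _ tu); last first.
    by move=> l _; apply: (reg_mul gG tz); [exact: aff_coord|exact: aff_cst].
  apply: eq_bigr => l _; rewrite (tangentM tu); [|exact: aff_coord|exact: aff_cst].
  by rewrite (tangent_cst gG tz _ tu) mulr0 add0r dvec_coord.
pose gs (i : 'I_(c + d)) := match fintype.split i with inl j => g j | inr j => ell j end.
have gsl i : gs (lshift d i) = g i by rewrite /gs (unsplitK (inl i)).
have gsr i : gs (rshift c i) = ell i by rewrite /gs (unsplitK (inr i)).
have rgs z i : V z -> areg (c + d) z (gs i).
  by move=> Vz; rewrite /gs; case: (fintype.split i) => j; [exact: rg|exact: rell].
pose M (z : 'rV[K]_(c + d)) : 'M[K]_(c + d) := \matrix_(l, i) pdv l (gs i) z.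
have rM z l i : V z -> areg (c + d) z (fun z => M z l i).
  by move=> Vz; under eq_fun do rewrite mxE; apply: (reg_pdv gG); exact: rgs.
have uM z (u : 'rV[K]_(c + d)) i : V z -> (u *m M z) 0 i = dvec (G := G) u z (gs i).
  move=> Vz; rewrite mxE dvecE; last exact: rgs.
  by apply: eq_bigr => l _; rewrite mxE.
have Mp : M (phi p) \in unitmx.
  rewrite -unitmx_tr (_ : (M (phi p))^T = col_mx J E) //.
  apply/matrixP => i l; rewrite 2!mxE; case: (split_ordP i) => j ->.
    by rewrite gsl col_mxEu mxE.
  rewrite gsr col_mxEd; have := dell j (delta_mx 0 l) (phi p); rewrite dvecE //.
  rewrite (bigD1 l) //= big1 ?addr0 => [|m ml]; last by rewrite mxE (negPf ml) andbF mul0r.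
  rewrite (bigD1 l) //= [X in _ = _ + X -> _]big1 ?addr0 => [|m ml]; last by rewrite mxE (negPf ml) andbF mul0r.
  by rewrite mxE !eqxx !mul1r.
pose W0 := [set z : 'rV[K]_(c + d) | V z /\ M z \in unitmx].
have aW0 z : W0 z -> anear (c + d) z W0.
  move=> [Vz Mz]; have tz := aff_tame gG z.
  have [_ n1] := reg_invmx gG tz (fun l i => rM z l i Vz) Mz.
  by apply: (aroundI tz _ n1); exists V; split.
pose U0 := [set x | U x /\ W0 (phi x)].
have sU0 : U0 `<=` U by move=> x [].
have aU0 x : U0 x -> around x U0.
  move=> [Ux Wx]; exact: (aroundI (patch_tame gG pU Ux) (patch_self gG pU Ux) (patch_pull pU Ux (aW0 _ Wx))).
have pU0 := coords_sub pU sU0 aU0.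
have U0p : U0 p by [].
(* The g are known to generate the ideal of the image at p, while tangency at a nearby x is tested
   on the ideal there. The chart supplies generators g' at x, and g = H g' with H square and
   invertible, because the g still have independent differentials at x; so u kills the g' as
   well. *)
have adm x u : U0 x -> (forall i, dvec (G := G) u (phi x) (g i) = 0) -> admissible phi x u.
  move=> [Ux [Vx Mx]] hu F rF eF; have tz := aff_tame gG (phi x); have tu := dvec_tangent gG u (phi x).
  have [V' [g' [[oV' Vx'] rg' gV' gid' gind']]] := hloc x Ux.
  have img (H : 'rV[K]_(c + d) -> K) : around x (fun y => H (phi y) = 0) ->
      anear (c + d) (phi x) (fun z => (phi @` U) z -> H z = 0).
    move=> /(patch_near pU _ Ux)[Q [nQ hQ]]; apply: (around_sub nQ) => z Qz [y Uy ey].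
    by move: Qz; rewrite -ey; exact: hQ.
  have g'x j : g' j (phi x) = 0 by move: j; apply/(gV' _ Vx'); exists x.
  have rep (H : 'rV[K]_(c + d) -> K) (h : 'I_c -> 'rV[K]_(c + d) -> K) v : areg (c + d) (phi x) H ->
      is_tangent (X := affine G (c + d)) (phi x) v ->
      (forall j, areg (c + d) (phi x) (h j)) -> anear (c + d) (phi x) (fun z => H z = \sum_j h j z * g' j z) ->
      v H = \sum_j h j (phi x) * v (g' j).
    move=> rH tv rh eH; rewrite (tangent_ext tz tv rH eH) (tangent_sum gG tz _ tv); last first.
      by move=> j _; apply: (reg_mul gG tz) => //; exact: rg'.
    by apply: eq_bigr => j _; rewrite (tangentM tv) ?g'x ?mulr0 ?addr0 //; exact: rg'.
  have /choice[H hH] : forall i, exists h : 'I_c -> 'rV[K]_(c + d) -> K, (forall j, areg _ (phi x) (h j)) /\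
      anear _ (phi x) (fun z => g i z = \sum_j h j z * g' j z).
    move=> i; apply: gid'; first exact: rg.
    apply: img; apply: (around_sub (aroundI (patch_tame gG pU Ux) (patch_self gG pU Ux) (patch_pull pU Ux (aW0 _ (conj Vx Mx))))).
    by move=> y [Uy [Vy _]]; exact: gz.
  pose HM : 'M[K]_c := \matrix_(i, j) H i j (phi x).
  have uH : HM \in unitmx.
    apply: inj_unit => a aH; apply/rowP => i; rewrite [RHS]mxE.
    have ha (v : tvec (affine G (c + d))) : is_tangent (X := affine G (c + d)) (phi x) v -> \sum_i a 0 i * v (g i) = 0.
      move=> tv; under eq_bigr => j _ do rewrite (rep _ (H j) v (rg j _ Vx) tv (hH j).1 (hH j).2) mulr_sumr.
      rewrite exchange_big big1 // => j _ /=; under eq_bigr => k _ do rewrite mulrA.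
      rewrite -mulr_suml; have := congr1 (fun M : 'rV[K]_c => M 0 j) aH; rewrite !mxE => e.
      rewrite (eq_bigr (fun k => a 0 k * HM k j)) ?e ?mul0r // => k _.
      by rewrite [HM _ _]mxE.
    pose b : 'cV[K]_(c + d) := col_mx a^T 0.
    have Mb : M (phi x) *m b = 0.
      apply/colP => l; rewrite !mxE big_split_ord /= [X in _ + X]big1 ?addr0; last first.
        by move=> k _; rewrite col_mxEd [X in _ * X]mxE mulr0.
      have := ha _ (dvec_tangent gG (delta_mx 0 l) (phi x)) => e; rewrite -[RHS]e.
      apply: eq_bigr => k _; rewrite col_mxEu [X in _ * X]mxE mulrC; congr (_ * _).
      rewrite mxE gsl (dvecE _ (rg k _ Vx)) (bigD1 l) //= big1 ?addr0 => [|m ml].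
        by rewrite mxE !eqxx mul1r.
      by rewrite mxE (negPf ml) andbF mul0r.
    have b0 : b = 0 by rewrite -[b](mulKmx Mx) Mb mulmx0.
    by have := congr1 (fun M : 'cV[K]_(c + d) => M (lshift d i) 0) b0; rewrite /b col_mxEu !mxE.
  have d0 : HM *m \col_j dvec (G := G) u (phi x) (g' j) = 0.
    apply/colP => i; rewrite !mxE -[RHS](hu i) (rep _ (H i) _ (rg i _ Vx) tu (hH i).1 (hH i).2).
    by apply: eq_bigr => j _; rewrite !mxE.
  have d1 j : dvec (G := G) u (phi x) (g' j) = 0.
    have := mulKmx uH (\col_j dvec (G := G) u (phi x) (g' j)); rewrite d0 mulmx0 => /esym e.
    by have := congr1 (fun M : 'cV[K]_c => M j 0) e; rewrite !mxE.
  have [h [rh eh]] := gid' F rF (img _ eF).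
  rewrite (rep _ h _ rF tu rh eh) big1 // => j _; by rewrite d1 mulr0.
pose uu (i : 'I_d) (z : 'rV[K]_(c + d)) := row (rshift c i) (invmx (M z)).
have duu i x j : U0 x -> dvec (G := G) (uu i (phi x)) (phi x) (gs j) = (j == rshift c i)%:R.
  move=> [Ux [Vx Mx]]; rewrite -uM // -row_mul mulVmx // !mxE eq_sym //.
have vuu i : is_vfield U0 (fun x => ptan phi x (uu i (phi x))).
  apply: (ptan_vfield gG pU0 (u := fun x => uu i (phi x))).
    move=> x Ux; apply: adm => // j; have := duu i x (lshift d j) Ux.
    by rewrite gsl eq_lrshift.
  move=> x l [Ux [Vx Mx]]; have tz := aff_tame gG (phi x).
  have [rI _] := reg_invmx gG tz (fun l i => rM _ l i Vx) Mx.
  have e : (fun y => uu i (phi y) 0 l) = fun y => invmx (M (phi y)) (rshift c i) l.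
    by apply/funext => y; rewrite mxE.
  by rewrite e; exact: (patch_regF gG pU Ux (rI _ _)).
pose w i (x : X) : K := ell i (phi x).
have rw i x : U0 x -> regular_at x (w i).
  by move=> Ux; apply: (patch_regF gG pU0 Ux); exact: rell.
have vw i j x : U0 x -> ptan phi x (uu i (phi x)) (w j) = (j == i)%:R.
  move=> Ux; rewrite (ptanE gG pU0 Ux (F := ell j)) //.
  - have := duu i x (rshift c j) Ux; rewrite gsr => ->.
    by rewrite (inj_eq (@rshift_inj _ _)).
  - apply: adm => // l; have := duu i x (lshift d l) Ux.
    by rewrite gsl eq_lrshift.
  - by apply: (around_sub (aU0 _ Ux)).
have det x v : U0 x -> is_tangent x v -> (forall i, v (w i) = 0) -> v = tzero (X := X).
  move=> Ux tv hv; have [Ux' [Vx Mx]] := Ux.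
  have tx := patch_tame gG pU0 Ux.
  have u0 : \row_l v (fun y => phi y 0 l) = 0.
    apply: (can_inj (mulmxK Mx)); rewrite mul0mx; apply/rowP => i; rewrite uM // [RHS]mxE.
    rewrite -(tangentE gG pU0 Ux tv (rgs _ i Vx)).
    rewrite /gs; case: (fintype.split i) => j; last exact: hv.
    rewrite (tangent_ext (g := fun=> 0) tx tv).
    - exact: (tangent_cst gG tx).
    - by apply: (patch_regF gG pU0 Ux); exact: rg.
    - by apply: (around_sub (aU0 _ Ux)) => y [Uy [Vy _]]; exact: gz.
  apply: (tangent_det gG pU0 Ux tv (tangent_tzero _)) => l.
  by have := congr1 (fun M : 'rV[K]_(c + d) => M 0 l) u0; rewrite !mxE.
exists U0, w, (fun i x => ptan phi x (uu i (phi x))), g, ell; split => //.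
- by move=> i; split; [exact: vuu|exact: rw].
split => //.
- by move=> i; split; [exact: rg|exact: gz].
- apply: (around_sub (aW0 _ (conj Vp Mp))) => z [Vz Mz]; rewrite -(gV _ Vz); split.
    by move=> [x [Ux _] <-]; exists x.
  move=> [x Ux ex]; exists x => //; split => //.
  by rewrite ex; split.
move=> u ug u0; apply: (can_inj (mulmxK Mp)); rewrite mul0mx; apply/rowP => i.
by rewrite uM // [RHS]mxE /gs; case: (fintype.split i) => j; [exact: ug|exact: u0].
Qed.

Section Zero.
Variable S : fspace K.
Hypothesis hS : manifold (G := G) 2 S.

(** On S(0) the two coordinate fields commute, so B_0 = 0. This zero is carried up the tower and
    ends the chain of brackets: X and B_1 commute. *)
Lemma stage_zero (p : monster S 0) : inhabited (stage p).
Proof.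
have [[hT hI hU] hC _ _] := hS.
have [U [c [phi [cU Up]]]] := hC p.
have pU : coords U phi := chart_coords hI cU.
have [oU inj _ _ _] := cU.
have [U0 [w [e [g [ell [[U0p sU0 aU0] ve vw det [rg gV rell ew ginj]]]]]]] := chart_frame hI cU Up.
have pU0 := coords_sub pU sU0 aU0.
have rw i x : U0 x -> regular_at x (w i) by move=> Ux; have [_] := ve i; exact.
have vuu i : is_vfield U0 (e i) by have [] := ve i.
pose i1 : 'I_2 := lift ord0 ord0.
pose X : vfield (monster S 0) := e 0.
pose N : vfield (monster S 0) := e i1.
have ord2 (i : 'I_2) : i = 0 \/ i = i1 by case: i => -[|[|//]] hi; [left|right]; exact/val_inj.
have fr : framing (D := monster S 0) U0 X N (w 0) (w i1).
  split; try exact: vuu; try exact: rw; try (by move=> x Ux; rewrite /X /N vw).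
  move=> x v Ux; have [tX _] := vuu 0 x Ux; have [tN _] := vuu i1 x Ux.
  split=> [tv|[a [b ->]]]; last exact: tangent_comb2.
  exists (v (w 0)), (v (w i1)).
  have tc := tangent_comb2 (v (w 0)) (v (w i1)) tX tN.
  have td := tangent_comb2 1 (-1) tv tc.
  have dz : (fun f => 1 * v f + -1 * (v (w 0) * X x f + v (w i1) * N x f)) = tzero (X := S).
    apply: (det x _ Ux td) => i; rewrite mul1r mulN1r /X /N !vw //.
    by case: (ord2 i) => ->; rewrite eqxx /= ?mulr1 ?mulr0 ?addr0 ?add0r subrr.
  apply/funext => f; have := congr1 (fun v => v f) dz; rewrite /tzero mul1r mulN1r => /eqP.
  by rewrite subr_eq0 => /eqP.
pose t (j : nat) : monster S 0 -> K := w i1.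
constructor.
apply: (@Stage G S 0 p (c + 2) U0 phi X N (w 0) (fun _ _ => tzero (X := S)) (w 0) t (fun=> false) (fun=> 1)) => //.
- by move=> x x' Ux Ux'; apply: inj; exact: sU0.
- by move=> j _ x Ux; split; [exact: tangent_tzero|move=> f rf; exact: (reg_cst gG (patch_tame gG pU0 Ux))].
- by move=> x Ux; exact: (rw 0 x Ux).
- by move=> j _ x Ux; exact: (rw i1 x Ux).
- by move=> x Ux; rewrite /X vw // weight_top.
- by move=> x Ux; rewrite /N vw.
- move=> x Ux; have tx := patch_tame gG pU0 Ux; have nU := aU0 _ Ux.
  apply: (det x _ Ux (lie_tangent gG tx nU (vuu i1) (vuu 0))) => i.
  rewrite lieE; last exact: rw.
  have cst j : e j x (fun y => e 0 y (w i)) = 0 /\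
      e j x (fun y => e i1 y (w i)) = 0.
    have [tj rj] := vuu j x Ux.
    have key m : e j x (fun y => e m y (w i)) = 0.
      rewrite (tangent_ext (g := fun=> (i == m)%:R) tx tj).
      - exact: (tangent_cst gG tx).
      - by have [_ rm] := vuu m x Ux; apply: rm; exact: rw.
      - by apply: (around_sub nU) => y Uy; rewrite vw.
    by split; exact: key.
  by rewrite (cst i1).1 (cst 0).2 subrr.
- move=> j x _ Ux; apply/funext => f; rewrite /lie; case: asboolP => // rf.
  have tx := patch_tame gG pU0 Ux; have [tN _] := vuu i1 x Ux.
  by rewrite /N (tangent_cst gG tx _ tN) subrr.
- by move=> j x; rewrite leqn0 => /andP[j0 /eqP ej]; rewrite ej in j0.
- by move=> j; exact: oner_neq0.
- move=> x a b c0 Ux h; split.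
  + have := h (w 0); rewrite big_geq // addr0 /X /N !vw //=.
    by rewrite mulr1 mulr0 addr0.
  + have := h (w i1); rewrite big_geq // addr0 /X /N !vw //=.
    by rewrite mulr1 mulr0 add0r.
  + by move=> j; rewrite leqn0 => /andP[j0 /eqP ej]; rewrite ej in j0.
- move=> x u Ux tu h0 h1; apply: (det x _ Ux tu) => i.
  by case: (ord2 i) => ->; [exact: h0|exact: (h1 0%N)].
- by move=> j; rewrite leqn0 => /andP[j0 /eqP ej]; rewrite ej in j0.
exists c, g, (ell 0), (fun=> ell i1); split.
- by rewrite -addnA.
- by split=> // i; have [] := rg i.
- by split => //; apply: (around_sub (aU0 _ U0p)) => x _; exact: ew.
- by move=> j _; split => //; apply: (around_sub (aU0 _ U0p)) => x _; exact: ew.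
move=> u ug u0 u1; apply: ginj => // i.
by case: (ord2 i) => ->; [exact: u0|exact: (u1 0%N)].
Qed.

Lemma stage_ex k (p : monster S k) : inhabited (stage p).
Proof.
elim: k p => [|k ih] p; first exact: stage_zero.
have [st] := ih (base (D := monster S k) p).
by constructor; exact: (stage_step gG st).
Qed.

End Zero.
End Charts.

(** * Orders of vanishing along a pair of fields *)

Section Order.
Variable (G : geometry).
Hypothesis gG : good G.
Local Notation K := (scalars G).
Variables (D : fspace K) (p : D) (U : set D) (X N : vfield D).
Hypotheses (tU : forall x, U x -> tame (G := G) x) (nU : around p U) (vX : is_vfield U X) (vN : is_vfield U N).

Let Up : U p := around_self nU.
Let tp := tU Up.

(* All words of length < n in X and N applied to f vanish at p. *)
Fixpoint vanish n (f : D -> K) : Prop :=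
  if n is n'.+1 then [/\ regular_at p f, f p = 0, vanish n' (fun y => X y f) & vanish n' (fun y => N y f)]
  else regular_at p f.

(* f vanishes to order n along Z = X + N with Z^n f = n! c at p; the factor n!
   makes c multiplicative. *)
Fixpoint lead n (f : D -> K) (c : K) : Prop :=
  if n is n'.+1 then [/\ regular_at p f, f p = 0 & lead n' (fun y => X y f + N y f) (n%:R * c)]
  else regular_at p f /\ f p = c.

(** Order exactly n: the lower bound holds along all words and is attained along X + N. Attainment
    is asked of this one field so that a single curve detects it. *)
Definition sharp n f := vanish n f /\ exists2 c, c != 0 & lead n f c.

Let regN f : regular_at p f -> around p (fun y => U y /\ regular_at y f).
Proof. by move=> rf; exact: (aroundI tp nU (reg_open tp rf)). Qed.

Lemma vfield_reg V f : is_vfield U V -> regular_at p f -> regular_at p (fun y => V y f).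
Proof. by move=> vV rf; have [_] := vV _ Up; exact. Qed.

Lemma vfield_near V f g : is_vfield U V -> regular_at p f -> around p (fun y => f y = g y) ->
  around p (fun y => V y f = V y g).
Proof.
move=> vV rf e; have rg := reg_ext tp e rf.
apply: (around_sub (aroundI tp (around_open e) (aroundI tp (regN rf) (regN rg)))).
by move=> y [ey [[Uy ry] [_ ry']]]; have [[_ h _ _] _] := vV _ Uy; exact: h.
Qed.

Lemma vfield_nearD V f g : is_vfield U V -> regular_at p f -> regular_at p g ->
  around p (fun y => V y f + V y g = V y (fun z => f z + g z)).
Proof.
move=> vV rf rg; apply: (around_sub (aroundI tp (regN rf) (regN rg))) => y [[Uy ry] [_ ry']].
by have [tV _] := vV _ Uy; rewrite (tangentD tV).
Qed.

Lemma vfield_nearM V f g : is_vfield U V -> regular_at p f -> regular_at p g ->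
  around p (fun y => f y * V y g + V y f * g y = V y (fun z => f z * g z)).
Proof.
move=> vV rf rg; apply: (around_sub (aroundI tp (regN rf) (regN rg))) => y [[Uy ry] [_ ry']].
by have [tV _] := vV _ Uy; rewrite (tangentM tV).
Qed.

Lemma vfield_cst V c : is_vfield U V -> around p (fun y => 0 = V y (fun=> c)).
Proof.
move=> vV; have rc : regular_at p (fun=> c) := reg_cst gG tp c.
apply: (around_sub (regN rc)) => y [Uy ry]; have [tV _] := vV _ Uy.
by rewrite (tangent_cst gG (tU Uy) _ tV).
Qed.

Lemma vanish_reg n f : vanish n f -> regular_at p f.
Proof. by case: n => [|n] // [h _ _ _]. Qed.

Lemma vanish_ext n f g : around p (fun y => f y = g y) -> vanish n f -> vanish n g.
Proof.
elim: n f g => [|n ih] f g e /=; first exact: (reg_ext tp e).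
move=> [rf f0 hX hN]; split.
- exact: (reg_ext tp e rf).
- by rewrite -(around_self e).
- exact: (ih _ _ (vfield_near vX rf e)).
- exact: (ih _ _ (vfield_near vN rf e)).
Qed.

Lemma vanish_le m n f : (m <= n)%N -> vanish n f -> vanish m f.
Proof.
elim: n m f => [|n ih] [|m] f // mn; first by move=> [].
by move=> [rf f0 hX hN]; split => //; apply: ih.
Qed.

Lemma vanish_D n f g : vanish n f -> vanish n g -> vanish n (fun y => f y + g y).
Proof.
elim: n f g => [|n ih] f g /=; first exact: (reg_add gG tp).
move=> [rf f0 fX fN] [rg g0 gX gN]; split.
- exact: (reg_add gG tp).
- by rewrite f0 g0 addr0.
- exact: vanish_ext (vfield_nearD vX rf rg) (ih _ _ fX gX).
- exact: vanish_ext (vfield_nearD vN rf rg) (ih _ _ fN gN).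
Qed.

Lemma vanish_deriv n f : vanish n f -> vanish n.-1 (fun y => X y f) /\ vanish n.-1 (fun y => N y f).
Proof.
case: n => [|n] /=; last by move=> [].
by move=> rf; split; apply: vfield_reg.
Qed.

Lemma vanish_val n f : (0 < n)%N -> vanish n f -> f p = 0.
Proof. by case: n => [|n] // _ [_ h _ _]. Qed.

Lemma vanish_M q n m f g : (q <= n + m)%N -> vanish n f -> vanish m g -> vanish q (fun y => f y * g y).
Proof.
elim: q n m f g => [|q ih] n m f g qnm hf hg; have rf := vanish_reg hf; have rg := vanish_reg hg.
  exact: (reg_mul gG tp).
have [fX fN] := vanish_deriv hf; have [gX gN] := vanish_deriv hg.
have i1 : (q <= n + m.-1)%N by case: m qnm {hg gX gN} => [|m]; rewrite ?addnS //= => /ltnW.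
have i2 : (q <= n.-1 + m)%N by case: n qnm {hf fX fN i1} => [|n]; rewrite ?addSn //= => /ltnW.
split; first exact: (reg_mul gG tp).
- case: n qnm hf {fX fN i1 i2} => [|n] qnm hf; last by rewrite (vanish_val _ hf) ?mul0r.
  by rewrite (vanish_val _ hg) ?mulr0 //; apply: leq_trans qnm.
- apply: vanish_ext (vfield_nearM vX rf rg) _; apply: vanish_D; [exact: ih i1 _ _|exact: ih i2 _ _].
- apply: vanish_ext (vfield_nearM vN rf rg) _; apply: vanish_D; [exact: ih i1 _ _|exact: ih i2 _ _].
Qed.

Lemma vanish_cst0 n : vanish n (fun=> 0).
Proof.
elim: n => [|n ih] /=; first exact: (reg_cst gG tp).
split => //; first exact: (reg_cst gG tp).
  exact: vanish_ext (vfield_cst 0 vX) ih.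
exact: vanish_ext (vfield_cst 0 vN) ih.
Qed.

Lemma vanish_N n f : vanish n f -> vanish n (fun y => - f y).
Proof.
move=> hf; have := @vanish_M n 0 n (fun=> -1) f (leqnn _) (reg_cst gG tp (-1)) hf.
by apply: vanish_ext; apply: (around_sub nU) => y _; rewrite mulN1r.
Qed.

Lemma vanish_mulr n f g : regular_at p f -> vanish n g -> vanish n (fun y => f y * g y).
Proof. by move=> rf hg; apply: (@vanish_M n 0 n). Qed.

Lemma vanish_sum n (I : Type) (r : seq I) (P : pred I) (f : I -> D -> K) :
  (forall i, P i -> vanish n (f i)) -> vanish n (fun y => \sum_(i <- r | P i) f i y).
Proof.
move=> h; elim: r => [|i r ih].
  by apply: vanish_ext (vanish_cst0 n); apply: (around_sub nU) => y _; rewrite big_nil.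
case Pi: (P i).
  by apply: vanish_ext (vanish_D (h i Pi) ih); apply: (around_sub nU) => y _; rewrite big_cons Pi.
by apply: vanish_ext ih; apply: (around_sub nU) => y _; rewrite big_cons Pi.
Qed.

Lemma lead_reg n f c : lead n f c -> regular_at p f.
Proof. by case: n => [|n] []. Qed.

Let reg_Z f : regular_at p f -> regular_at p (fun y => X y f + N y f).
Proof. by move=> rf; apply: (reg_add gG tp); apply: vfield_reg. Qed.

Lemma lead_ext n f g c : around p (fun y => f y = g y) -> lead n f c -> lead n g c.
Proof.
elim: n f g c => [|n ih] f g c e /=.
  by move=> [rf <-]; split; [exact: (reg_ext tp e)|rewrite (around_self e)].
move=> [rf f0 h]; split; first exact: (reg_ext tp e rf).
  by rewrite -(around_self e).
apply: ih h; apply: (around_sub (aroundI tp (vfield_near vX rf e) (vfield_near vN rf e))).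
by move=> y [-> ->].
Qed.

Lemma lead_D n f g c d : lead n f c -> lead n g d -> lead n (fun y => f y + g y) (c + d).
Proof.
elim: n f g c d => [|n ih] f g c d /=.
  by move=> [rf <-] [rg <-]; split => //; exact: (reg_add gG tp).
move=> [rf f0 hf] [rg g0 hg]; split; first exact: (reg_add gG tp).
  by rewrite f0 g0 addr0.
rewrite mulrDr; apply: lead_ext (ih _ _ _ _ hf hg).
apply: (around_sub (aroundI tp (vfield_nearD vX rf rg) (vfield_nearD vN rf rg))) => y [<- <-].
ring.
Qed.

Lemma lead_vanish n f : vanish n.+1 f -> lead n f 0.
Proof.
elim: n f => [|n ih] f [rf f0 hX hN] /=; first by [].
by split => //; rewrite mulr0; apply: ih; exact: vanish_D.
Qed.

Lemma lead_lower n f c : lead n.+1 f c -> lead n f 0.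
Proof.
elim: n f c => [|n ih] f c [rf f0 h]; first by [].
by split => //; rewrite mulr0; exact: ih h.
Qed.

(** Leibniz' rule for Z: by the factorial normalization one differentiation turns c into n c, and (n
    + m) c d = c (m d) + (n c) d. *)
Lemma lead_M n m f g c d : lead n f c -> lead m g d -> lead (n + m) (fun y => f y * g y) (c * d).
Proof.
have [q] := ubnP (n + m); elim: q n m f g c d => // q ih n m f g c d; rewrite ltnS => qnm hf hg.
have rf := lead_reg hf; have rg := lead_reg hg.
have nZ : around p (fun y => f y * (X y g + N y g) + (X y f + N y f) * g y =
    X y (fun z => f z * g z) + N y (fun z => f z * g z)).
  apply: (around_sub (aroundI tp (vfield_nearM vX rf rg) (vfield_nearM vN rf rg))) => y [<- <-].
  ring.
have rfg := reg_mul gG tp rf rg.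
case: n m qnm hf hg => [|n] [|m] qnm hf hg.
- by move: hf hg => [_ <-] [_ <-].
- have [_ g0 hg'] := hg; rewrite add0n; split => //; first by rewrite g0 mulr0.
  apply: lead_ext nZ _; have -> : m.+1%:R * (c * d) = c * (m.+1%:R * d) + (X p f + N p f) * 0 by ring.
  apply: lead_D; first exact: (ih 0 m).
  apply: (ih 0 m) => //; first by split => //; exact: reg_Z.
  exact: lead_lower hg.
- have [_ f0 hf'] := hf; rewrite addn0; rewrite addn0 in qnm; split => //; first by rewrite f0 mul0r.
  apply: lead_ext nZ _; have -> : n.+1%:R * (c * d) = 0 * (X p g + N p g) + n.+1%:R * c * d by ring.
  apply: lead_D; rewrite -{1}(addn0 n).
    apply: (ih n 0); rewrite ?addn0 //; first exact: lead_lower hf.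
    by split => //; exact: reg_Z.
  by apply: (ih n 0); rewrite ?addn0.
- have [_ f0 hf'] := hf; have [_ g0 hg'] := hg; rewrite addSn; split => //; first by rewrite f0 mul0r.
  apply: lead_ext nZ _; have -> : (n + m.+1).+1%:R * (c * d) = c * (m.+1%:R * d) + n.+1%:R * c * d.
    by rewrite -addSn natrD; ring.
  apply: lead_D; last exact: (ih n m.+1).
  by rewrite -addSnnS; apply: (ih n.+1 m) => //; rewrite addSnnS.
Qed.

Lemma sharp_ext n f g : around p (fun y => f y = g y) -> sharp n f -> sharp n g.
Proof.
move=> e [h [c c0 hc]]; split; first exact: vanish_ext e h.
by exists c => //; exact: lead_ext e hc.
Qed.

Lemma sharp_M n m f g : sharp n f -> sharp m g -> sharp (n + m) (fun y => f y * g y).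
Proof.
move=> [hf [c c0 hc]] [hg [d d0 hd]]; split; first exact: vanish_M (leqnn _) hf hg.
by exists (c * d); [exact: mulf_neq0|exact: lead_M].
Qed.

Lemma sharp_unit f : regular_at p f -> f p != 0 -> sharp 0 f.
Proof. by move=> rf f0; split => //; exists (f p). Qed.

(** Integration raises the order by one; in the normalization of [lead] the coefficient is divided
    by n + 1, which is nonzero in characteristic 0. *)
Lemma sharp_prim n f c : regular_at p f -> f p = 0 -> vanish n (fun y => X y f) ->
  vanish n (fun y => N y f) -> c != 0 -> lead n (fun y => X y f + N y f) c -> sharp n.+1 f.
Proof.
move=> rf f0 hX hN c0 hc; split; first by [].
exists (n.+1%:R^-1 * c); first by rewrite mulf_neq0 // invr_neq0 // (char0 gG).
by split => //; rewrite mulVKf // (char0 gG).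
Qed.

End Order.

(** * Small growth *)

Lemma sum_first3 (R : nmodType) k (F : nat -> R) : (0 < k)%N ->
  \sum_(n < k.+2) F n = F 0%N + F 1%N + F 2 + \sum_(i < k.-1) F i.+3.
Proof. by case: k => // k _; rewrite !big_ord_recl /= !addrA; congr (_ + _); apply: eq_bigr. Qed.

Lemma sum_first2_last (R : nmodType) k (F : nat -> R) : (0 < k)%N ->
  \sum_(n < k.+2) F n = F 0%N + F 1%N + (\sum_(i < k.-1) F i.+2 + F k.+1).
Proof.
by case: k => // k _; rewrite 2!big_ord_recl big_ord_recr /= -addrA.
Qed.

Lemma span_dim_unique (K : fieldType) (X : fspace K) (E : set (tvec X)) n m :
  span_dim E n -> span_dim E m -> n = m.
Proof.
have le a b : span_dim E a -> span_dim E b -> (a <= b)%N.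
  move=> [e [eE ie _]] [e' [_ _ se]].
  have /choice[C hC] := fun i => se _ (eE i).
  pose M : 'M[K]_(a, b) := \matrix_(i, j) C i j.
  have : row_free M.
    rewrite -kermx_eq0; apply/eqP/row_matrixP => i; rewrite row0.
    have h : row i (kermx M) *m M = 0 by rewrite -row_mul mulmx_ker row0.
    apply/rowP => j; rewrite [RHS]mxE; apply: (ie (fun j => row i (kermx M) 0 j)) => f.
    under eq_bigr => l _ do rewrite hC mulr_sumr.
    rewrite exchange_big big1 // => l _ /=.
    under eq_bigr => r _ do rewrite mulrA.
    rewrite -mulr_suml; have := congr1 (fun A : 'rV[K]_b => A 0 l) h; rewrite !mxE => e0.
    rewrite (eq_bigr (fun r => row i (kermx M) 0 r * M r l)) ?e0 ?mul0r // => r _.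
    by rewrite [M _ _]mxE.
  by rewrite /row_free => /eqP <-; exact: rank_leq_col.
by move=> h1 h2; apply/eqP; rewrite eqn_leq !le.
Qed.

Section Growth.
Variable (G : geometry).
Hypothesis gG : good G.
Local Notation K := (scalars G).
Variables (S : fspace K) (k : nat) (p : monster S k) (st : stage p).
Hypothesis k0 : (0 < k)%N.
Local Notation D := (monster S k).
Local Notation U := (dom st).
Local Notation X := (fX st).
Local Notation N := (fN st).
Local Notation t := (ct st).
Local Notation v := (vert st).
Local Notation wt := (weight k v t).
Let Up : U p := st_p st.
Let tU x : U x -> tame (G := G) x := @patch_tame G gG _ _ _ _ (st_coords st) x.
Let tp := tU Up.
Let nU : forall x, U x -> around x U := @patch_self G gG _ _ _ _ (st_coords st).
Let vX : is_vfield U X := fr_A (st_frame st).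
Let vN : is_vfield U N := fr_B (st_frame st).
Local Notation van := (vanish p X N).
Local Notation ld := (lead p X N).
Local Notation ex := (sharp p X N).

Lemma weight_reg x j : U x -> regular_at x (wt j).
Proof.
move=> Ux; have tx := tU Ux.
have e : wt j = fun y => \prod_(j.+1 <= l < k.+1 | (l <= k)%N) (if v l then t l y else 1).
  apply/funext => y; rewrite /weight big_nat [RHS]big_nat_cond.
  by apply: eq_bigl => l; rewrite ltnS; case: (l <= k)%N; rewrite ?andbF ?andbT.
rewrite e; apply: (reg_prod gG tx) => l lk; case: (v l); last exact: (reg_cst gG tx).
exact: (st_t lk Ux).
Qed.

(** Descending induction on j: for j < k, X t_j is a product of t_l with l > j and N t_j = 0, so
    unless t_j is a unit its order exceeds by one that of a product already treated. *)
Lemma coord_order_ex : exists nn : nat -> nat, forall j, (j <= k)%N -> ex (nn j) (t j).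
Proof.
suff h j : exists n, (j <= k)%N -> ex n (t j) by have /choice[nn hnn] := h; exists nn.
have [jk|jk] := leqP j k; last by exists 0%N.
suff [n hn] : exists n, ex n (t j) by exists n.
have [d] := ubnP (k - j); elim: d j jk => // d ih j jk; rewrite ltnS => hd.
have rt := st_t jk Up.
have [tj0|tj0] := eqVneq (t j p) 0; last by exists 0%N; exact: sharp_unit.
move: jk; rewrite leq_eqVlt => /orP[/eqP ej|jk].
  (* The top coordinate: X t_k = 0 and N t_k = 1. *)
  exists 1%N; apply: (sharp_prim gG (n := 0) (c := 1)) => //=.
  - by have [_] := vX Up; exact.
  - by have [_] := vN Up; exact.
  - exact: oner_neq0.
  - split; last by rewrite ej (fr_AB (st_frame st) Up) (fr_BB (st_frame st) Up) add0r.
    by apply: (reg_add gG tp); [have [_] := vX Up|have [_] := vN Up]; exact.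
have sub l : (j < l <= k)%N -> exists n, ex n (t l).
  by move=> /andP[jl lk]; apply: ih => //; lia.
have rest : exists n, ex n (fun y => if v j.+1 then 1 else t j.+1 y).
  case: (v j.+1); last by apply: sub; rewrite ltnSn.
  by exists 0%N; apply: sharp_unit; [exact: (reg_cst gG tp)|exact: oner_neq0].
have wex : exists n, ex n (wt j.+1).
  have : forall s : seq nat, all (fun l => j < l <= k)%N s ->
      exists n, ex n (fun y => \prod_(l <- s) (if v l then t l y else 1)).
    elim=> [|l s ihs] /=.
      exists 0%N; apply: (sharp_ext (f := fun=> 1) tU (nU Up) vX vN).
        by apply: (around_sub (nU Up)) => y _; rewrite big_nil.
      by apply: sharp_unit; [exact: (reg_cst gG tp)|exact: oner_neq0].
    move=> /andP[jl /ihs[m hm]].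
    have [n hn] : exists n, ex n (fun y => if v l then t l y else 1).
      case: (v l); first exact: sub.
      by exists 0%N; apply: sharp_unit; [exact: (reg_cst gG tp)|exact: oner_neq0].
    exists (n + m)%N; apply: (sharp_ext tU (nU Up) vX vN _ (sharp_M gG tU (nU Up) vX vN hn hm)).
    by apply: (around_sub (nU Up)) => y _; rewrite big_cons.
  apply; apply/allP => l; rewrite mem_index_iota => /andP[h1 h2]; apply/andP; split; first exact: ltnW.
  by rewrite -ltnS.
have [n hn] := wex; have [m hm] := rest.
have [hv [c c0 hc]] : ex (n + m) (fun y => X y (t j)).
  apply: (sharp_ext tU (nU Up) vX vN _ (sharp_M gG tU (nU Up) vX vN hn hm)).
  by apply: (around_sub (nU Up)) => y Uy; rewrite (st_Xt jk Uy).
have nN : around p (fun y => 0 = N y (t j)).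
  by apply: (around_sub (nU Up)) => y Uy; rewrite (st_Nt jk Uy).
exists (n + m).+1; apply: (sharp_prim gG (c := c)) => //.
- exact: (vanish_ext tU (nU Up) vX vN nN (vanish_cst0 gG tU (nU Up) vX vN _)).
- apply: (lead_ext tU (nU Up) vX vN _ hc).
  by apply: (around_sub nN) => y <-; rewrite addr0.
Qed.

Variable nn : nat -> nat.
Hypothesis hnn : forall j, (j <= k)%N -> ex (nn j) (t j).

Definition wo j := (\sum_(j.+1 <= l < k.+1) (if v l then nn l else 0))%N.

Lemma weight_sharp j : ex (wo j) (wt j).
Proof.
have : forall s : seq nat, all (fun l => l <= k)%N s ->
    ex (\sum_(l <- s) (if v l then nn l else 0))%N (fun y => \prod_(l <- s) (if v l then t l y else 1)).
  elim=> [|l s ihs] /=.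
    move=> _; rewrite big_nil; apply: (sharp_ext (f := fun=> 1) tU (nU Up) vX vN).
      by apply: (around_sub (nU Up)) => y _; rewrite big_nil.
    by apply: sharp_unit; [exact: (reg_cst gG tp)|exact: oner_neq0].
  move=> /andP[lk /ihs hm].
  have hn : ex (if v l then nn l else 0)%N (fun y => if v l then t l y else 1).
    case: (v l); first exact: hnn.
    by apply: sharp_unit; [exact: (reg_cst gG tp)|exact: oner_neq0].
  rewrite big_cons; apply: (sharp_ext tU (nU Up) vX vN _ (sharp_M gG tU (nU Up) vX vN hn hm)).
  by apply: (around_sub (nU Up)) => y _; rewrite big_cons.
apply; apply/allP => l; rewrite mem_index_iota => /andP[h1 h2].
by rewrite -ltnS.
Qed.

(** The frame in the order in which its members enter the growth: X, N, then B_k, ..., B_1 as n runs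
    from 2 to k + 1. *)
Definition fe n : vfield D := if n == 0%N then X else if n == 1%N then N else fB st (k.+2 - n).

Lemma fe_vfield n : is_vfield U (fe n).
Proof.
rewrite /fe; case: eqP => // n0; case: eqP => // n1.
apply: (st_B (s := st)); lia.
Qed.

Let tfe n x : U x -> is_tangent x (fe n x).
Proof. by move=> Ux; have [] := fe_vfield n Ux. Qed.

Lemma fe_indep (c : nat -> K) : (forall f, \sum_(n < k.+2) c n * fe n p f = 0) ->
  forall n, (n < k.+2)%N -> c n = 0.
Proof.
move=> h.
have [|h0 h1 h2] := @st_indep _ _ _ _ st p (c 0%N) (c 1%N) (fun j => c (k.+2 - j)%N) Up.
  move=> f; have := h f; rewrite !big_ord_recl /= => e; rewrite -[RHS]e addrA; congr (_ + _).
  rewrite big_add1 big_nat_rev big_mkord; apply: eq_bigr => i _.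
  have e1 : (k.+2 - (0 + k - i.+1).+1 = i.+2)%N by have := ltn_ord i; lia.
  have e2 : ((0 + k - i.+1).+1 = k.+2 - i.+2)%N by have := ltn_ord i; lia.
  by rewrite e1 e2 /fe.
move=> [|[|n]] hn //.
have := h2 (k.+2 - n.+2)%N; rewrite subKn; last by lia.
by apply; lia.
Qed.

(** Structure function of the frame: for 1 < j <= k the bracket of X with [fe j] is [sl j] times
    [fe j.+1]. *)
Definition sl j (y : D) := sgn st (k.+2 - j) * wt (k.+2 - j) y.

Lemma fe2 : fe 2 = fB st k. Proof. by rewrite /fe /= !subSS subn0. Qed.
Lemma feS j : (1 < j)%N -> fe j = fB st (k.+2 - j). Proof. by case: j => [|[|j]]. Qed.

Lemma lie_fe0 x : U x -> lie X (fe 0) x = tzero (X := D) /\ lie N (fe 0) x = fe 2 x.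
Proof. by move=> Ux; rewrite fe2 -(st_NX (s := st) Ux); split => //; exact: lie_self. Qed.

Lemma lie_fe1 x : U x -> lie X (fe 1) x = (fun f => -1 * fe 2 x f) /\ lie N (fe 1) x = tzero (X := D).
Proof.
by move=> Ux; rewrite fe2 -(st_NX (s := st) Ux); split; [exact: lie_anti|exact: lie_self].
Qed.

Lemma lie_feS j x : (1 < j <= k)%N -> U x ->
  lie X (fe j) x = (fun f => sl j x * fe j.+1 x f) /\ lie N (fe j) x = tzero (X := D).
Proof.
move=> hj Ux; rewrite !feS; [|lia..].
have h1 : (0 < k.+2 - j <= k)%N by lia.
have h2 : (k.+2 - j <= k)%N by lia.
rewrite (st_XB h1 Ux) (st_NB h2 Ux); split => //.
by have -> : (k.+2 - j).-1 = (k.+2 - j.+1)%N by lia.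
Qed.

Lemma lie_fe_last x : U x -> lie X (fe k.+1) x = tzero (X := D) /\ lie N (fe k.+1) x = tzero (X := D).
Proof.
move=> Ux; rewrite !feS; [|lia..]; rewrite subSnn.
have h1 : (0 < 1 <= k)%N by lia.
rewrite (st_XB h1 Ux) (st_NB k0 Ux); split => //.
by rewrite (st_B0 (s := st) Ux); apply/funext => f; rewrite /tzero mulr0.
Qed.

(** Coefficients of [V, W] for V = a_0 X + a_1 N and W the combination of the [fe j] with
    coefficients b_j: the derivative of b_n along V, minus that of a_n along W, plus the brackets of
    the frame, which enter for n = 2 through [N, X] and for n > 2 through X and [fe n.-1]. *)
Definition gcoef (a b : nat -> D -> K) n (y : D) : K :=
  (a 0%N y * X y (b n) + a 1%N y * N y (b n)) - \sum_(j < k.+2) b j y * fe j y (a n) +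
  (if n == 2%N then a 1%N y * b 0%N y - a 0%N y * b 1%N y
   else if (2 < n)%N then a 0%N y * b n.-1 y * sl n.-1 y else 0).

Lemma lie_comb (x : D) (a b : nat -> D -> K) (V W : vfield D) : U x ->
  (forall n, (n < k.+2)%N -> regular_at x (a n)) -> (forall n, (n < k.+2)%N -> regular_at x (b n)) ->
  (forall n, (1 < n)%N -> a n = fun=> 0) ->
  around x (fun y => forall f, V y f = \sum_(n < k.+2) a n y * fe n y f) ->
  around x (fun y => forall f, W y f = \sum_(n < k.+2) b n y * fe n y f) ->
  forall f, lie V W x f = \sum_(n < k.+2) gcoef a b n x * fe n x f.
Proof.
move=> Ux ra rb a0 eV eW f; have tx := tU Ux.
rewrite /lie; case: asboolP => [rf|nf]; last first.
  by rewrite big1 // => n _; have [-> //] := tfe n Ux; rewrite mulr0.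
have rfe n : regular_at x (fun y => fe n y f) by have [_] := fe_vfield n Ux; exact.
have Vx := around_self eV; have Wx := around_self eW.
have dW n : fe n x (fun y => W y f) = \sum_(m < k.+2) (b m x * fe n x (fun y => fe m y f) + fe n x (b m) * fe m x f).
  have rs : regular_at x (fun y => \sum_(m < k.+2) b m y * fe m y f).
    by apply: (reg_sum gG tx) => m _; apply: (reg_mul gG tx) => //; exact: rb.
  have e : around x (fun y => \sum_(m < k.+2) b m y * fe m y f = W y f).
    by apply: (around_sub eW) => y ->.
  rewrite -(tangent_ext tx (tfe n Ux) rs e) (tangent_sum gG tx _ (tfe n Ux)); last first.
    by move=> m _; apply: (reg_mul gG tx) => //; exact: rb.
  by apply: eq_bigr => m _; rewrite (tangentM (tfe n Ux)) //; exact: rb.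
have dV n : fe n x (fun y => V y f) = \sum_(m < k.+2) (a m x * fe n x (fun y => fe m y f) + fe n x (a m) * fe m x f).
  have rs : regular_at x (fun y => \sum_(m < k.+2) a m y * fe m y f).
    by apply: (reg_sum gG tx) => m _; apply: (reg_mul gG tx) => //; exact: ra.
  have e : around x (fun y => \sum_(m < k.+2) a m y * fe m y f = V y f).
    by apply: (around_sub eV) => y ->.
  rewrite -(tangent_ext tx (tfe n Ux) rs e) (tangent_sum gG tx _ (tfe n Ux)); last first.
    by move=> m _; apply: (reg_mul gG tx) => //; exact: ra.
  by apply: eq_bigr => m _; rewrite (tangentM (tfe n Ux)) //; exact: ra.
have V2 (h : nat -> K) : \sum_(n < k.+2) a n x * h n = a 0%N x * h 0%N + a 1%N x * h 1%N.
  rewrite !big_ord_recl /= [X in _ + (_ + X)]big1 ?addr0 // => i _.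
  by rewrite a0 // mul0r.
have lieij (i j : nat) : lie (fe i) (fe j) x f = fe i x (fun y => fe j y f) - fe j x (fun y => fe i y f) by rewrite lieE.
(* Bilinear expansion of the bracket: the second-order terms combine to brackets of frame fields,
   the others differentiate the coefficients. *)
transitivity (\sum_(i < k.+2) \sum_(j < k.+2) a i x * (b j x * lie (fe i) (fe j) x f)
   + \sum_(i < k.+2) \sum_(j < k.+2) a i x * (fe i x (b j) * fe j x f)
   - \sum_(i < k.+2) \sum_(j < k.+2) b j x * (fe j x (a i) * fe i x f)).
  rewrite Vx Wx.
  under eq_bigr => i _ do rewrite dW mulr_sumr.
  under [X in _ - X]eq_bigr => j _ do rewrite dV mulr_sumr.
  rewrite [X in _ - X]exchange_big /= -big_split /= -!sumrB; apply: eq_bigr => i _.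
  rewrite -big_split /= -!sumrB; apply: eq_bigr => j _; rewrite lieij; ring.
under [X in X + _ - _]eq_bigr => i _ do rewrite -mulr_sumr.
rewrite (V2 (fun i => \sum_(j < k.+2) b j x * lie (fe i) (fe j) x f)).
rewrite [X in _ + X - _]exchange_big /=.
under [X in _ + X - _]eq_bigr => j _ do rewrite (V2 (fun i => fe i x (b j) * fe j x f)).
rewrite /gcoef; under [RHS]eq_bigr => n _ do rewrite mulrDl mulrBl.
rewrite [RHS]big_split /= [in RHS]sumrB.
have -> : \sum_(i < k.+2) (a 0%N x * (fe 0 x (b i) * fe i x f) + a 1%N x * (fe 1 x (b i) * fe i x f)) =
    \sum_(i < k.+2) (a 0%N x * X x (b i) + a 1%N x * N x (b i)) * fe i x f.
  by apply: eq_bigr => i _; rewrite /fe /=; ring.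
have -> : \sum_(i < k.+2) \sum_(j < k.+2) b j x * (fe j x (a i) * fe i x f) =
    \sum_(i < k.+2) (\sum_(j < k.+2) b j x * fe j x (a i)) * fe i x f.
  by apply: eq_bigr => i _; rewrite mulr_suml; apply: eq_bigr => j _; rewrite mulrA.
set R1 := \sum_(i < k.+2) (_ + _) * _; set R2 := \sum_(i < k.+2) (\sum_(j < k.+2) _) * _.
suff -> : a 0%N x * (\sum_(j < k.+2) b j x * lie (fe 0) (fe j) x f) +
   a 1%N x * (\sum_(j < k.+2) b j x * lie (fe 1) (fe j) x f) =
  \sum_(i < k.+2) (if i == 2 :> nat then a 1%N x * b 0%N x - a 0%N x * b 1%N x else
      if (2 < i)%N then a 0%N x * b i.-1 x * sl i.-1 x else 0) * fe i x f by ring.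
rewrite (sum_first2_last (fun j => b j x * lie (fe 0) (fe j) x f) k0).
rewrite (sum_first2_last (fun j => b j x * lie (fe 1) (fe j) x f) k0).
rewrite (sum_first3 (fun i => (if i == 2 :> nat then a 1%N x * b 0%N x - a 0%N x * b 1%N x else
      if (2 < i)%N then a 0%N x * b i.-1 x * sl i.-1 x else 0) * fe i x f) k0).
have eX j : lie (fe 0) (fe j) x = lie X (fe j) x by [].
have eN j : lie (fe 1) (fe j) x = lie N (fe j) x by [].
rewrite !eX !eN.
have hlast := lie_fe_last Ux; have h1 := lie_fe1 Ux; have h0 := lie_fe0 Ux.
rewrite hlast.1 hlast.2 h1.1 h1.2 h0.1 h0.2.
have hS (i : 'I_k.-1) : (1 < i.+2 <= k)%N by have := ltn_ord i; lia.
have z1 : \sum_(i < k.-1) b i.+2 x * lie (fe 1) (fe i.+2) x f = 0.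
  by rewrite big1 // => i _; rewrite eN (lie_feS (hS i) Ux).2 /tzero mulr0.
have z2 : a 0%N x * \sum_(i < k.-1) b i.+2 x * lie (fe 0) (fe i.+2) x f =
    \sum_(i < k.-1) a 0%N x * b i.+2 x * sl i.+2 x * fe i.+3 x f.
  rewrite mulr_sumr; apply: eq_bigr => i _; rewrite eX (lie_feS (hS i) Ux).1; ring.
rewrite z1 /= /tzero !mulrDr z2 !mulr0 !mul0r; ring.
Qed.

(** Indexed by m = n - 2, which makes the recursion structural; the summand [wo (k - m')] is the
    order of the structure function [sl m'.+2]. *)
Fixpoint bvr m : nat := if m is m'.+1 then (bvr m' + wo (k - m')).+1 else 2.
Definition bv n := bvr (n - 2).

Lemma bv2 : bv 2 = 2%N. Proof. by []. Qed.

Lemma bvS n : (1 < n)%N -> bv n.+1 = (bv n + wo (k.+2 - n)).+1.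
Proof. by case: n => [|[|n]] // _; rewrite /bv !subSS !subn0 /=. Qed.

Lemma bv_ge n : (1 < n)%N -> (n <= bv n)%N.
Proof.
elim: n => // n ih; rewrite ltnS leq_eqVlt => /orP[/eqP <- //|n1].
by rewrite bvS // ltnS; apply: leq_trans (ih n1) (leq_addr _ _).
Qed.

Lemma bv_lt m n : (1 < m)%N -> (m < n)%N -> (bv m < bv n)%N.
Proof.
move=> m1; elim: n => // n ih; rewrite ltnS leq_eqVlt => /orP[/eqP <-|mn].
  by rewrite bvS // ltnS leq_addr.
rewrite bvS; last by apply: ltn_trans mn.
by apply: ltn_trans (ih mn) _; rewrite ltnS leq_addr.
Qed.

Let vanD := vanish_D gG tU (nU Up) vX vN.
Let vanM := vanish_M gG tU (nU Up) vX vN.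
Let van_mulr := vanish_mulr gG tU (nU Up) vX vN.
Let van0 := vanish_cst0 gG tU (nU Up) vX vN.
Let vanN := vanish_N gG tU (nU Up) vX vN.
Let van_ext := vanish_ext tU (nU Up) vX vN.

Lemma sl_reg j x : U x -> regular_at x (sl j).
Proof.
by move=> Ux; apply: (reg_mul gG (tU Ux)); [exact: (reg_cst gG (tU Ux))|exact: weight_reg].
Qed.

Lemma sl_vanish j : van (wo (k.+2 - j)) (sl j).
Proof. by apply: van_mulr; [exact: (reg_cst gG tp)|have [] := weight_sharp (k.+2 - j)]. Qed.

Lemma gcoef_reg x a b n : U x -> (forall n, regular_at x (a n)) -> (forall n, regular_at x (b n)) ->
  regular_at x (gcoef a b n).
Proof.
move=> Ux ra rb; have tx := tU Ux.
have rf m f : regular_at x f -> regular_at x (fun y => fe m y f).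
  by have [_] := fe_vfield m Ux; exact.
apply: (reg_add gG tx).
  apply: (reg_sub gG tx).
    by apply: (reg_add gG tx); apply: (reg_mul gG tx) => //; [exact: (rf 0%N)|exact: (rf 1%N)].
  by apply: (reg_sum gG tx) => j _; apply: (reg_mul gG tx) => //; exact: rf.
case: (n == 2%N).
  by apply: (reg_sub gG tx); apply: (reg_mul gG tx).
case: (2 < n)%N; last exact: (reg_cst gG tx).
by apply: (reg_mul gG tx); [apply: (reg_mul gG tx)|exact: sl_reg].
Qed.

(** One more bracket costs one order: differentiating b_n lowers its order by one, the a_n are
    identically 0 for n > 1, and a_0 b_(n-1) sl_(n-1) has order at least the sum of bv (n-1) - h and
    the order of sl_(n-1), which suffices by the recursion for bv. *)
Lemma gcoef_vanish a b h n : (0 < h)%N -> (forall n, regular_at p (a n)) -> (forall n, regular_at p (b n)) ->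
  (forall n, (1 < n)%N -> a n = fun=> 0) -> (forall n, (1 < n < k.+2)%N -> van (bv n - h) (b n)) ->
  (1 < n < k.+2)%N -> van (bv n - h.+1) (gcoef a b n).
Proof.
move=> h0 ra rb a0 vb hn; have [bX bN] := vanish_deriv (nU Up) vX vN (vb n hn).
rewrite -subnS in bX; rewrite -subnS in bN.
apply: vanD.
  apply: vanD; first by apply: vanD; apply: van_mulr.
  apply: vanN; apply: (vanish_sum gG tU (nU Up) vX vN) => j _; apply: van_mulr => //.
  have e := vfield_cst gG tU (nU Up) 0 (fe_vfield j); rewrite a0; last by case/andP: hn.
  exact: van_ext e (van0 _).
have [->|n2] := eqVneq n 2%N.
  have -> : (bv 2 - h.+1 = 0)%N by rewrite bv2; lia.
  by apply: (reg_sub gG tp); apply: (reg_mul gG tp).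
have n3 : (2 < n)%N by lia.
rewrite n3; have hn1 : (1 < n.-1 < k.+2)%N by lia.
have eb : bv n = (bv n.-1 + wo (k.+2 - n.-1)).+1 by rewrite -bvS ?prednK //; lia.
apply: (@vanM _ (bv n.-1 - h) (wo (k.+2 - n.-1))); first by rewrite eb; lia.
  by apply: van_mulr => //; exact: vb.
exact: sl_vanish.
Qed.

(* Sections of Delta^h have expansions in the frame whose coefficient of fe n
   vanishes to order bv n - h: this bounds SG_h from above. *)
Definition expansion h (V : vfield D) := exists g : nat -> D -> K,
  [/\ forall n, regular_at p (g n), forall n, (1 < n < k.+2)%N -> van (bv n - h) (g n) &
    around p (fun y => forall f, V y f = \sum_(n < k.+2) g n y * fe n y f)].

Lemma expansion_le h h' V : (h <= h')%N -> expansion h V -> expansion h' V.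
Proof.
move=> hh [g [rg vg eg]]; exists g; split => // n hn.
by apply: vanish_le (vg n hn); exact: leq_sub2l.
Qed.

Lemma section_expansion O V : opn D O -> O p -> is_section O V -> exists g : nat -> D -> K,
  [/\ forall n, regular_at p (g n), forall n, (1 < n)%N -> g n = fun=> 0 &
    around p (fun y => forall f, V y f = \sum_(n < k.+2) g n y * fe n y f)].
Proof.
move=> oO Op [vV sV]; have nO : around p O by exists O; split.
have fr := st_frame st.
exists (fun n => if n == 0%N then fun y => V y (dX st) else if n == 1%N then fun y => V y (t k) else fun=> 0); split.
- move=> n; have [_ rV] := vV _ Op; case: ifP => _; first by apply: rV; exact: (fr_fA fr Up).
  by case: ifP => _; [apply: rV; exact: (fr_fB fr Up)|exact: (reg_cst gG tp)].
- by case=> [|[|n]].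
apply: (around_sub (aroundI tp nO (nU Up))) => y [Oy Uy] f.
have [a [b e]] := (fr_fibre fr _ Uy).1 (sV _ Oy).
rewrite !big_ord_recl /= [X in _ + (_ + X)]big1 ?addr0; last by move=> i _; rewrite mul0r.
by rewrite e (fr_AA fr Uy) (fr_BA fr Uy) (fr_AB fr Uy) (fr_BB fr Uy) !mulr0 !mulr1 addr0 add0r.
Qed.

Lemma delta_expansion h O V : opn D O -> O p -> iter h (@bracket_sheaf K D) (@is_section K D) O V ->
  expansion h.+1 V.
Proof.
elim: h O V => [|h ih] O V oO Op.
  move=> /(section_expansion oO Op)[g [rg g0 eg]]; exists g; split => // n /andP[n1 _].
  by rewrite g0.
rewrite iterS => -[vV hV].
have [O' [oO' Op' _ [m [a [A [ra hA eV]]]]]] := hV p Op.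
have exA i : expansion h.+2 (A i).
  case: (hA i) => [|[B [C [sB sC ->]]]]; first by move=> /(ih _ _ oO' Op'); apply: expansion_le.
  have [ga [rga ga0 ea]] := section_expansion oO' Op' sB.
  have [gb [rgb vgb eb]] := ih _ _ oO' Op' sC.
  exists (gcoef ga gb); split.
  - by move=> n; exact: gcoef_reg.
  - by move=> n hn; exact: gcoef_vanish.
  have nr (g : nat -> D -> K) : (forall n, regular_at p (g n)) -> around p (fun y => forall n : 'I_k.+2, regular_at y (g n)).
    by move=> rg; apply: (around_forall tp) => n; exact: (reg_open tp).
  apply: (around_sub (aroundI tp (aroundI tp (nU Up) (aroundI tp (nr _ rga) (nr _ rgb)))
     (aroundI tp (around_open ea) (around_open eb)))) => y [[Uy [ray rby]] [eay eby]] f.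
  apply: (lie_comb Uy _ _ ga0 eay eby) => n hn; first exact: (ray (Ordinal hn)).
  exact: (rby (Ordinal hn)).
have /choice[g hg] := exA.
exists (fun n y => \sum_i a i y * g i n y); split.
- move=> n; apply: (reg_sum gG tp) => i _; apply: (reg_mul gG tp); first exact: ra.
  by have [h1 _ _] := hg i.
- move=> n hn; apply: (vanish_sum gG tU (nU Up) vX vN) => i _; apply: van_mulr; first exact: ra.
  by have [_ h2 _] := hg i; exact: h2.
have nO' : around p O' by exists O'; split.
have near : around p (fun y => forall i f, A i y f = \sum_(n < k.+2) g i n y * fe n y f).
  by apply: (around_forall tp) => i; have [_ _ h3] := hg i.
apply: (around_sub (aroundI tp nO' near)) => y [Oy hy] f; rewrite (eV y f Oy).
under eq_bigr => i _ do rewrite hy mulr_sumr.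
rewrite exchange_big; apply: eq_bigr => n _; rewrite mulr_suml.
by apply: eq_bigr => i _; rewrite mulrA.
Qed.

Definition fZ : vfield D := fun y f => X y f + N y f.
(** ad_Z^m [N, X] for Z = X + N, a section of Delta^(m+2). Together with X and N these fields
    already span every Delta^h at p. *)
Fixpoint adZ m : vfield D := if m is m'.+1 then lie fZ (adZ m') else fB st k.

Definition cZ n : D -> K := if (n < 2)%N then fun=> 1 else fun=> 0.
Fixpoint cA m : nat -> D -> K :=
  if m is m'.+1 then gcoef cZ (cA m') else fun n => fun=> (n == 2%N)%:R.

Let rcZ n x : U x -> regular_at x (cZ n).
Proof. by move=> Ux; rewrite /cZ; case: (n < 2)%N; exact: (reg_cst gG (tU Ux)). Qed.
Let cZ0 n : (1 < n)%N -> cZ n = fun=> 0.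
Proof. by case: n => [|[|n]]. Qed.

Lemma cA_reg m n x : U x -> regular_at x (cA m n).
Proof.
move=> Ux; elim: m n => [|m ih] n /=; first exact: (reg_cst gG (tU Ux)).
by apply: gcoef_reg => // j; exact: rcZ.
Qed.

Lemma adZ_expr m x f : U x -> adZ m x f = \sum_(n < k.+2) cA m n x * fe n x f.
Proof.
elim: m x f => [|m ih] x f Ux.
  rewrite /= (sum_first3 (fun n => (n == 2%N)%:R * fe n x f) k0) /= !mul0r !add0r mul1r fe2 big1 ?addr0 // => i _.
  by rewrite mul0r.
rewrite /=; apply: (lie_comb Ux).
- by move=> n _; exact: rcZ.
- by move=> n _; exact: cA_reg.
- by move=> n; exact: cZ0.
- apply: (around_sub (nU Ux)) => y Uy g; rewrite !big_ord_recl /= /cZ /= !mul1r /fZ big1 ?addr0 // => i _.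
  by rewrite mul0r.
- by apply: (around_sub (nU Ux)) => y Uy g; exact: ih.
Qed.

Lemma cA_vanish m n : (1 < n < k.+2)%N -> van (bv n - m.+2) (cA m n).
Proof.
elim: m n => [|m ih] n hn /=; last first.
  by apply: gcoef_vanish => // j; first [exact: rcZ|exact: cA_reg|exact: cZ0|exact: ih].
have [->|n2] := eqVneq n 2%N; first by rewrite bv2; exact: (reg_cst gG tp).
exact: van0.
Qed.

(* The coefficient of fe n in ad_Z^m [N, X] has a leading term that is a positive
   integer multiple of lam n: as the characteristic is 0, nothing cancels. *)
Lemma cA_lead : exists2 lam : nat -> K, forall n, lam n != 0 &
  forall m n, (1 < n < k.+2)%N -> (m.+2 <= bv n)%N ->
  exists2 q : nat, ((n <= m.+2)%N -> (0 < q)%N) & ld (bv n - m.+2) (cA m n) (q%:R * lam n).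
Proof.
have [sc hsc] : exists sc : nat -> K, forall j, sc j != 0 /\ ld (wo (k.+2 - j)) (sl j) (sc j).
  suff h j : exists c, c != 0 /\ ld (wo (k.+2 - j)) (sl j) c by have /choice[sc hsc] := h; exists sc.
  have [_ [c c0 hc]] := weight_sharp (k.+2 - j); exists (sgn st (k.+2 - j) * c); split.
    by rewrite mulf_neq0 // st_sgn.
  rewrite -[X in ld X]add0n; apply: (lead_M gG tU (nU Up) vX vN) => //; split => //.
  exact: (reg_cst gG tp).
(* The scalar collected on the way from [fe 2] to [fe n]: one leading coefficient for each structure
   function passed. *)
pose lam n := \prod_(j < n - 2) sc j.+2.
have lamS n : (2 < n)%N -> lam n = lam n.-1 * sc n.-1.
  by case: n => [|[|[|n]]] // _; rewrite /lam /= !subSS !subn0 big_ord_recr.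
exists lam; first by move=> n; apply/prodf_neq0 => j _; have [] := hsc j.+2.
elim=> [|m ih] n hn hb.
  have [->|n2] := eqVneq n 2%N.
    exists 1%N => //; change (ld 0 (cA 0 2) (1%:R * lam 2%N)); split; first exact: (reg_cst gG tp).
    by rewrite /lam big_ord0 mulr1.
  exists 0%N; first by lia.
  rewrite mul0r; apply: (lead_vanish gG tU (nU Up) vX vN).
  by rewrite /= (negPf n2); exact: (van0 (bv n - 2).+1).
have n3 : (2 < n)%N.
  by have [e|] := eqVneq n 2%N; [move: hb; rewrite e bv2|lia].
have eb : bv n = (bv n.-1 + wo (k.+2 - n.-1)).+1 by rewrite -bvS ?prednK //; lia.
have hn1 : (1 < n.-1 < k.+2)%N by lia.
have [q1 hq1 l1] := ih n hn (ltnW hb).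
pose d := (bv n - m.+3)%N.
have ed : (bv n - m.+2 = d.+1)%N by rewrite /d; lia.
rewrite ed in l1; have [_ _ l1'] := l1.
have hS : ld d (fun y => - \sum_(j < k.+2) cA m j y * fe j y (cZ n)) 0.
  apply: (lead_vanish gG tU (nU Up) vX vN); apply: vanN.
  apply: (vanish_sum gG tU (nU Up) vX vN) => j _; apply: van_mulr; first exact: cA_reg.
  have e := vfield_cst gG tU (nU Up) 0 (fe_vfield j); rewrite cZ0; last by case/andP: hn.
  exact: van_ext e (van0 _).
have [q2 hq2 l2] : exists2 q2 : nat, (n = m.+3 -> (0 < q2)%N) &
    ld d (fun y => cA m n.-1 y * sl n.-1 y) (q2%:R * lam n).
  have [hb1|hb1] := leqP m.+2 (bv n.-1).
    have [q2 hq2 l2] := ih n.-1 hn1 hb1; exists q2; first by move=> e; apply: hq2; rewrite e.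
    rewrite lamS // mulrA; have -> : d = (bv n.-1 - m.+2 + wo (k.+2 - n.-1))%N by rewrite /d eb; lia.
    by apply: (lead_M gG tU (nU Up) vX vN) => //; have [] := hsc n.-1.
  exists 0%N; first by move=> e; have := bv_ge (n := n.-1); rewrite e /= => /(_ isT); move: hb1; rewrite e /=; lia.
  rewrite mul0r; apply: (lead_vanish gG tU (nU Up) vX vN).
  apply: (@vanM _ 0 (wo (k.+2 - n.-1))); first by rewrite /d eb; lia.
    exact: cA_reg.
  exact: sl_vanish.
(* Differentiation along Z multiplies the normalized coefficient by the order d.+1, and the bracket
   with [fe n.-1] adds q2; both are nonnegative multiples of the same [lam n]. *)
exists (d.+1 * q1 + q2)%N.
  move=> nm; have [e|ne] := eqVneq n m.+3; first by rewrite addn_gt0 hq2 ?orbT.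
  by rewrite addn_gt0 muln_gt0 hq1 //; lia.
have -> : (d.+1 * q1 + q2)%:R * lam n = d.+1%:R * (q1%:R * lam n) + 0 + q2%:R * lam n.
  by rewrite natrD natrM; ring.
have := lead_D gG tU (nU Up) vX vN (lead_D gG tU (nU Up) vX vN l1' hS) l2.
apply: (lead_ext tU (nU Up) vX vN); apply: (around_sub (nU Up)) => y _.
rewrite /= /gcoef /cZ /= !mul1r; have -> : (n == 2%N) = false by apply/eqP; lia.
by rewrite n3.
Qed.

Lemma vfield_comb (O : set D) (V W : vfield D) a b : O `<=` U -> is_vfield O V -> is_vfield O W ->
  is_vfield O (fun y f => a * V y f + b * W y f).
Proof.
move=> OU vV vW x Ox; have tx := tU (OU _ Ox).
have [tV rV] := vV _ Ox; have [tW rW] := vW _ Ox; split; first exact: tangent_comb2.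
move=> f rf; apply: (reg_add gG tx); apply: (reg_mul gG tx); try exact: (reg_cst gG tx).
  exact: rV.
exact: rW.
Qed.

Lemma adZ_vfield m : is_vfield U (adZ m).
Proof.
elim: m => [|m ih] /=; first exact: (st_B (s := st) (leqnn k)).
have vZ : is_vfield U fZ.
  have := vfield_comb 1 1 (@subset_refl D U) vX vN; congr is_vfield.
  by apply/funext => y; apply/funext => f; rewrite !mul1r.
move=> x Ux; have tx := tU Ux; split; first exact: (lie_tangent gG tx (nU Ux) vZ ih).
move=> f rf; have [_ rZ] := vZ _ Ux; have [_ rA] := ih _ Ux.
have r := reg_sub gG tx (rZ _ (rA _ rf)) (rA _ (rZ _ rf)).
by apply: (reg_ext tx _ r); apply: (around_sub (reg_open tx rf)) => y ry; rewrite lieE.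
Qed.

Definition low h a b (c : nat -> K) : vfield D :=
  fun y f => a * X y f + b * N y f + \sum_(m < h) c m * adZ m y f.

Lemma low_vfield h a b c : is_vfield U (low h a b c).
Proof.
elim: h => [|h ih].
  have := vfield_comb a b (@subset_refl D U) vX vN; congr is_vfield.
  by apply/funext => y; apply/funext => f; rewrite /low big_ord0 addr0.
have := vfield_comb 1 (c h) (@subset_refl D U) ih (adZ_vfield h); congr is_vfield.
by apply/funext => y; apply/funext => f; rewrite /low big_ord_recr /= mul1r addrA.
Qed.

Lemma low_delta h a b c O : opn D O -> O `<=` U ->
  iter h (@bracket_sheaf K D) (@is_section K D) O (low h a b c).
Proof.
move=> oO OU; elim: h a b c => [|h ih] a b c.
  split; first by move=> x /OU; exact: low_vfield.
  move=> x /OU Ux; apply/(fr_fibre (st_frame st) _ Ux); exists a, b.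
  by apply/funext => f; rewrite /low big_ord0 addr0.
have secXN a' b' : is_section O (fun y f => a' * X y f + b' * N y f).
  split; first by apply: vfield_comb => // x /OU; [exact: vX|exact: vN].
  by move=> x /OU Ux; apply/(fr_fibre (st_frame st) _ Ux); exists a', b'.
have eX : (fun y f => 1 * X y f + 0 * N y f) = X.
  by apply/funext => y; apply/funext => f; rewrite mul1r mul0r addr0.
have eN : (fun y f => 0 * X y f + 1 * N y f) = N.
  by apply/funext => y; apply/funext => f; rewrite mul1r mul0r add0r.
have eZ : (fun y f => 1 * X y f + 1 * N y f) = fZ.
  by apply/funext => y; apply/funext => f; rewrite !mul1r.
rewrite iterS; split; first by move=> x /OU; exact: low_vfield.
move=> x Ox; exists O; split => //.
(* The first new bracket is [N, X]; all later ones are taken with Z. *)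
pose B : vfield D := if h is h'.+1 then fZ else N.
pose C : vfield D := if h is h'.+1 then adZ h' else X.
exists 2%N, (fun i y => if i == 0 then 1 else c h), (fun i => if i == 0 then low h a b c else lie B C); split.
- by move=> i y /OU Uy; case: (i == 0); exact: (reg_cst gG (tU Uy)).
- move=> i; case: (i == 0); first by left; exact: ih.
  right; exists B, C; split => //.
    by rewrite /B; case: (h) => [|_]; [rewrite -eN|rewrite -eZ]; exact: secXN.
  rewrite /C; case: (h) ih => [|h'] ih'; first by rewrite -eX; exact: secXN.
  have -> : adZ h' = low h'.+1 0 0 (fun m => (m == h')%:R).
    apply/funext => y; apply/funext => f; rewrite /low !mul0r !add0r big_ord_recr /= eqxx mul1r.
    by rewrite big1 ?add0r // => i0 _; rewrite ltn_eqF // mul0r.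
  exact: ih'.
move=> y f /OU Uy; rewrite !big_ord_recl big_ord0 /= addr0 mul1r /low big_ord_recr /= addrA.
congr (_ + _ * _); rewrite /B /C; case: (h) => [|h'] //=.
by rewrite (st_NX (s := st) Uy).
Qed.

Definition in_low h (w : tvec D) := exists a b c, w = low h a b c p.

Lemma in_low_comb h (I : finType) (c : I -> K) (w : I -> tvec D) :
  (forall i, in_low h (w i)) -> in_low h (fun f => \sum_i c i * w i f).
Proof.
move=> /choice[a /choice[b /choice[d hw]]].
exists (\sum_i c i * a i), (\sum_i c i * b i), (fun m => \sum_i c i * d i m).
apply/funext => f; rewrite /low !mulr_suml.
under [X in _ = _ + X]eq_bigr => m _ do rewrite mulr_suml.
rewrite [X in _ = _ + X]exchange_big -!big_split /=; apply: eq_bigr => i _.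
rewrite hw /low !mulrDr !mulr_sumr !mulrA; congr (_ + _).
by apply: eq_bigr => m _; rewrite mulrA.
Qed.

(** For m = bv n - 2 the coefficient of [fe n] in ad_Z^m [N, X] has order 0, hence is nonzero at p,
    while those of the later [fe j] vanish at p since bv is increasing. The system is triangular and
    is solved by induction on n. *)
Lemma fe_low h n : (n < k.+2)%N -> (1 < n)%N ==> (bv n <= h.+1)%N -> in_low h (fe n p).
Proof.
have [lam lam0 hlam] := cA_lead.
elim/ltn_ind: n => n ih nk hb.
have [n1|n1] := leqP n 1.
  exists (n == 0%N)%:R, (n == 1%N)%:R, (fun=> 0).
  apply/funext => f; rewrite /low [X in _ = _ + X]big1 ?addr0; last by move=> i _; rewrite mul0r.
  by case: n n1 {ih nk hb} => [|[|]] // _; rewrite /fe /= ?mul1r ?mul0r ?addr0 ?add0r.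
rewrite n1 /= in hb; have hn : (1 < n < k.+2)%N by rewrite n1.
pose m := (bv n - 2)%N; have bn := bv_ge n1.
have em : (m.+2 = bv n)%N by rewrite /m; lia.
have mh : (m < h)%N by lia.
have [|q hq hl] := hlam m n hn; first by rewrite em.
have q0 : (0 < q)%N by apply: hq; rewrite em.
rewrite em subnn /= in hl; have [_ ecA] := hl.
have cn0 : cA m n p != 0.
  rewrite ecA mulf_neq0 //; case: (q) q0 => // q' _; exact: char0 gG q'.
have cz j : (n < j < k.+2)%N -> cA m j p = 0.
  move=> /andP[nj jk]; have hj : (1 < j < k.+2)%N by rewrite jk (ltn_trans n1).
  by apply: (vanish_val _ (cA_vanish m hj)); rewrite em subn_gt0; exact: bv_lt.
have eA f : adZ m p f = \sum_(j < n) cA m j p * fe j p f + cA m n p * fe n p f.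
  rewrite (adZ_expr m f Up) -(big_mkord xpredT (fun j => cA m j p * fe j p f)) (big_cat_nat (n := n.+1)) //=.
  rewrite [X in _ + X]big_nat [X in _ + X]big1 ?addr0; last by move=> j hj; rewrite cz ?mul0r.
  by rewrite big_nat_recr //= big_mkord.
pose w (i : 'I_n.+1) : tvec D := if (i < n)%N then fe i p else adZ m p.
pose d (i : 'I_n.+1) : K := if (i < n)%N then - (cA m n p)^-1 * cA m i p else (cA m n p)^-1.
have -> : fe n p = fun f => \sum_i d i * w i f.
  apply/funext => f; rewrite big_ord_recr /= /d /w /= ltnn eA.
  under eq_bigr => i _ do rewrite ltn_ord -mulrA.
  by rewrite -mulr_sumr mulrDr mulNr addrA addNr add0r mulKf.
apply: in_low_comb => i; rewrite /w; case: ifP => hi.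
  apply: ih => //; first exact: ltn_trans hi nk.
  by apply/implyP => i1; apply: leq_trans hb; exact/ltnW/bv_lt.
exists 0, 0, (fun j => (j == m)%:R); apply/funext => f; rewrite /low !mul0r !add0r.
rewrite (bigD1 (Ordinal mh)) //= eqxx mul1r big1 ?addr0 // => j.
by rewrite -val_eqE /= => /negbTE ->; rewrite mul0r.
Qed.

Definition growth_values h := [set w : tvec D | exists O V, [/\ opn D O, O p, delta h O V & w = V p]].

Definition growth_idx h := [seq n <- iota 0 k.+2 | (1 < n)%N ==> (bv n <= h)%N].

(** [delta_expansion] makes the coefficient of [fe n] vanish at p when bv n > h + 1, and [fe_low]
    produces all the other [fe n]. *)
Lemma growth_span h : span_dim (growth_values h.+1) (size (growth_idx h.+1)).
Proof.
set s := growth_idx h.+1.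
have us : uniq s by rewrite filter_uniq ?iota_uniq.
have ms n : n \in s = ((1 < n)%N ==> (bv n <= h.+1)%N) && (n < k.+2)%N.
  by rewrite mem_filter mem_iota add0n.
have sumS (F : nat -> K) : (forall n, (n < k.+2)%N -> n \notin s -> F n = 0) ->
    \sum_(n < k.+2) F n = \sum_(i < size s) F (nth 0%N s i).
  move=> hF; rewrite -(big_mkord xpredT F) -(big_mkord xpredT (fun i => F (nth 0%N s i))) -(big_nth 0%N xpredT F).
  rewrite /s /growth_idx [RHS]big_filter /index_iota subn0 [RHS]big_mkcond big_seq [RHS]big_seq.
  apply: eq_bigr => n; rewrite mem_iota add0n => /andP[_ hn].
  by case: ifP => // h0; apply: hF => //; rewrite ms h0.
exists (fun i => fe (nth 0%N s i) p); split.
- move=> i; have := mem_nth 0%N (ltn_ord i); rewrite ms => /andP[h1 h2].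
  have [a [b [c e]]] := fe_low h2 h1.
  have [O [oO Op OU]] := nU Up.
  exists O, (low h a b c); split => //; exact: low_delta.
- move=> c hc i; pose c' n := if n \in s then (if insub (index n s) is Some j then c j else 0) else 0.
  have c'i (j : 'I_(size s)) : c' (nth 0%N s j) = c j.
    rewrite /c' mem_nth // index_uniq //.
    by have -> : insub (j : nat) = Some j := valK j.
  rewrite -c'i; apply: fe_indep; last first.
    by have := mem_nth 0%N (ltn_ord i); rewrite ms => /andP[].
  move=> f; rewrite -[RHS](hc f).
  rewrite (sumS (fun n => c' n * fe n p f)); first by apply: eq_bigr => j _; rewrite c'i.
  by move=> n _ /negbTE ns; rewrite /c' ns mul0r.
move=> w [O [V [oO Op dV ->]]].
have [g [rg vg eg]] := delta_expansion oO Op dV.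
exists (fun i => g (nth 0%N s i) p) => f; rewrite (around_self eg f).
rewrite (sumS (fun n => g n p * fe n p f)) // => n hn; rewrite ms hn andbT negb_imply => /andP[n1 hb].
by rewrite (vanish_val _ (vg n _)) ?mul0r ?n1 // subn_gt0 ltnNge.
Qed.

Lemma SG_formula h : SG p h.+1 = (2 + count (fun n => (bv n <= h.+1)%N) (index_iota 2 k.+2))%N.
Proof.
have e : size (growth_idx h.+1) = (2 + count (fun n => (bv n <= h.+1)%N) (index_iota 2 k.+2))%N.
  rewrite size_filter /index_iota !subSS subn0 /=.
  rewrite (eq_in_count (a2 := fun n => (bv n <= h.+1)%N)) // => n.
  by rewrite mem_iota => /andP[n1 _]; rewrite n1.
rewrite -e /SG; case: xgetP => [n _ hn|/(_ (size (growth_idx h.+1)))]; last by case; exact: growth_span.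
exact: span_dim_unique hn (growth_span h).
Qed.

End Growth.

(** * Focal curves *)

Section Powers.
Variable (G : geometry).
Hypothesis gG : good G.
Local Notation K := (scalars G).

Section Ideal.
Variables (X : fspace K) (x : X).
Hypothesis tx : tame (G := G) x.

Lemma in_max_reg n f : in_max_power x n f -> regular_at x f.
Proof. by case: n => [|n] // []. Qed.

Lemma in_max_ext n f g : around x (fun y => f y = g y) -> in_max_power x n f -> in_max_power x n g.
Proof.
case: n => [|n] e /=; first exact: (reg_ext tx e).
move=> [rf [m [u [w [hu hw ef]]]]]; split; first exact: (reg_ext tx e).
exists m, u, w; split => //; apply: (around_sub (aroundI tx e ef)) => y [<- ->] //.
Qed.

Lemma in_max_lower n f : in_max_power x n.+1 f -> in_max_power x n f.
Proof.
elim: n f => [|n ih] f; first by move=> [].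
move=> [rf [m [u [w [hu hw ef]]]]]; split => //.
by exists m, u, w; split => // i; apply: ih.
Qed.

Lemma in_max_le m n f : (m <= n)%N -> in_max_power x n f -> in_max_power x m f.
Proof.
move=> /subnK <-; elim: (n - m)%N => // j ih /in_max_lower; exact: ih.
Qed.

Lemma in_max_mull n g f : regular_at x g -> in_max_power x n f -> in_max_power x n (fun y => g y * f y).
Proof.
elim: n g f => [|n ih] g f rg; first by move=> rf; exact: (reg_mul gG tx).
move=> [rf [m [u [w [hu hw ef]]]]]; split; first exact: (reg_mul gG tx).
exists m, u, (fun i y => g y * w i y); split => //; first by move=> i; exact: ih rg (hw i).
apply: (around_sub ef) => y ->; rewrite mulr_sumr; apply: eq_bigr => i _; ring.
Qed.

Lemma in_max_val n f : (0 < n)%N -> in_max_power x n f -> f x = 0.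
Proof.
case: n => // n _ [rf [m [u [w [hu hw ef]]]]]; rewrite (around_self ef) big1 // => i _.
by rewrite (hu i).2 mul0r.
Qed.

Lemma in_max_exp n s h : regular_at x s -> s x = 0 -> regular_at x h -> in_max_power x n (fun y => s y ^+ n * h y).
Proof.
move=> rs s0 rh; elim: n => [|n ih]; first by apply: (reg_mul gG tx) => //; exact: (reg_exp gG).
split; first by apply: (reg_mul gG tx) => //; exact: (reg_exp gG).
exists 1%N, (fun _ => s), (fun _ y => s y ^+ n * h y); split => //.
by apply: (around_sub (aroundT tx)) => y _; rewrite big_ord1 exprS mulrA.
Qed.

Lemma in_max_sum n (I : Type) (r : seq I) (P : pred I) (f : I -> X -> K) :
  (forall i, P i -> in_max_power x n (f i)) -> in_max_power x n (fun y => \sum_(i <- r | P i) f i y).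
Proof.
have D g h : in_max_power x n g -> in_max_power x n h -> in_max_power x n (fun y => g y + h y).
  case: n {f} => [|n]; first exact: (reg_add gG tx).
  move=> [rf [m [u [w [hu hw ef]]]]] [rg [m' [u' [w' [hu' hw' eg]]]]]; split; first exact: (reg_add gG tx).
  exists (m + m')%N, (fun i => match fintype.split i with inl j => u j | inr j => u' j end),
    (fun i => match fintype.split i with inl j => w j | inr j => w' j end); split.
  - by move=> i; case: (fintype.split i).
  - by move=> i; case: (fintype.split i).
  apply: (around_sub (aroundI tx ef eg)) => y [-> ->]; rewrite big_split_ord /=.
  by congr (_ + _); apply: eq_bigr => i _; rewrite ?(unsplitK (inl i)) ?(unsplitK (inr i)).
have Z0 : in_max_power x n (fun=> 0).
  case: n {f D} => [|n]; first exact: (reg_cst gG tx).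
  split; first exact: (reg_cst gG tx).
  exists 0%N, (fun _ _ => 0), (fun _ _ => 0); split; try by case.
  by apply: (around_sub (aroundT tx)) => y _; rewrite big_ord0.
move=> h; elim: r => [|i r ih].
  by apply: in_max_ext Z0; apply: (around_sub (aroundT tx)) => y _; rewrite big_nil.
case Pi: (P i).
  by apply: in_max_ext (D _ _ (h i Pi) ih); apply: (around_sub (aroundT tx)) => y _; rewrite big_cons Pi.
by apply: in_max_ext ih; apply: (around_sub (aroundT tx)) => y _; rewrite big_cons Pi.
Qed.

Lemma in_max_deriv (U : set X) (V : vfield X) n f : (forall y, U y -> tame (G := G) y) -> around x U -> is_vfield U V ->
  in_max_power x n.+1 f -> in_max_power x n (fun y => V y f).
Proof.
move=> tU nU vV; have Ux := around_self nU; have [tV rV] := vV _ Ux.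
elim: n f => [|n ih] f [rf [m [u [w [hu hw ef]]]]]; first exact: rV.
have rw i : regular_at x (w i) by exact: (@in_max_reg n.+1 _ (hw i)).
have ru i : regular_at x (u i) by case: (hu i).
have ruw i : around x (fun y => regular_at y (u i) /\ regular_at y (w i)).
  by apply: (aroundI tx); apply: (reg_open tx).
have e : around x (fun y => \sum_i (V y (u i) * w i y + u i y * V y (w i)) = V y f).
  apply: (around_sub (aroundI tx nU (aroundI tx (around_open ef) (aroundI tx (around_forall tx ruw) (reg_open tx rf))))).
  move=> y [Uy [ey [ry rfy]]]; have ty := tU _ Uy; have [tVy _] := vV _ Uy.
  rewrite (tangent_ext ty tVy rfy ey) (tangent_sum gG ty _ tVy); last first.
    by move=> i _; apply: (reg_mul gG ty); case: (ry i).
  by apply: eq_bigr => i _; have [ruy rwy] := ry i; rewrite (tangentM tVy ruy rwy) addrC.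
apply: in_max_ext e _; apply: in_max_sum => i _.
have -> : (fun y => V y (u i) * w i y + u i y * V y (w i)) =
  (fun y => \sum_(b : bool) (if b then V y (u i) * w i y else u i y * V y (w i))).
  by apply/funext => y; rewrite big_bool.
apply: in_max_sum => -[] _; first by apply: in_max_mull; [exact: rV|exact: (hw i)].
split; first by apply: (reg_mul gG tx) => //; exact: rV.
exists 1%N, (fun=> u i), (fun _ y => V y (w i)); split => //; first by move=> _; exact: (ih _ (hw i)).
by apply: (around_sub (aroundT tx)) => y _; rewrite big_ord1.
Qed.

End Ideal.

(** * Local parameters on a curve *)

Section Curve.
Variables (X : fspace K) (x : X).
Hypothesis mX : manifold (G := G) 1 X.

(* s is a local parameter of the curve at x, and d the derivation with d s = 1. *)
Record uniformizer (U : set X) (s : X -> K) (d : vfield X) : Prop := Uniformizer {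
  pa_U : around x U;
  pa_tame : forall y, U y -> tame (G := G) y;
  pa_reg : regular_on U s;
  pa_s0 : s x = 0;
  pa_d : is_vfield U d;
  pa_ds : forall y, U y -> d y s = 1;
  pa_gen : forall f, regular_at x f -> f x = 0 ->
    exists h, regular_at x h /\ around x (fun y => f y = s y * h y) }.

(** By [zeros_coord] the equations g and one linear function, shifted by a constant, generate the
    maximal ideal in affine space; on the curve the g vanish, and the shifted function s remains as
    generator. *)
Lemma uniformizer_ex : exists U s d, uniformizer U s d.
Proof.
have [[_ hI _] hC _ _] := mX; have [U [c [phi [cU Ux]]]] := hC x.
have pU := chart_coords gG hI cU.
have [U0 [w [e [g [ell [[U0x sU0 aU0] ve vw det [rg gV rell ew ginj]]]]]]] := chart_frame gG hI cU Ux.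
have pU0 := coords_sub gG pU sU0 aU0; have tU0 := @patch_tame _ gG _ _ _ _ pU0.
have tx := tU0 _ U0x; have [vd rw] := ve 0; have [td rd] := vd _ U0x.
exists U0, (fun y => w 0 y - w 0 x), (e 0); split => //.
- exact: aU0.
- move=> y Uy; apply: (reg_sub gG (tU0 _ Uy)); first exact: rw.
  exact: (reg_cst gG (tU0 _ Uy)).
- by rewrite subrr.
- move=> y Uy; have [tdy _] := vd _ Uy; have ty := tU0 _ Uy.
  rewrite (tangentB gG ty tdy); [|exact: rw|exact: (reg_cst gG ty)].
  by rewrite (tangent_cst gG ty _ tdy) subr0 vw.
move=> f /(patch_reg pU0 _ U0x)[F [rF eF]] fx.
pose z := phi x; have tz := aff_tame gG z.
pose gs (i : 'I_(c + 1)) := match fintype.split i with inl j => g j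
  | inr j => fun y : 'rV[K]_(c + 1) => ell j y - ell j z end.
have rgs i : regular_at (X := affine G (c + 1)) z (gs i).
  rewrite /gs; case: (fintype.split i) => j; first by case: (rg j).
  by apply: (reg_sub gG tz) => //; exact: aff_cst.
have gsz i : gs i z = 0.
  by rewrite /gs; case: (fintype.split i) => j; [case: (rg j)|rewrite subrr].
have Fz : F z = 0 by rewrite -(around_self eF).
have [|h [rh eh]] := @zeros_coord G gG _ z gs rgs gsz _ F rF Fz.
  move=> u hu; apply: ginj => i.
    by have := hu (lshift 1 i); rewrite /gs (unsplitK (inl i)).
  have := hu (rshift c i); rewrite /gs (unsplitK (inr i)).
  rewrite (tangentB gG tz (dvec_tangent gG u z) (rell i)); last exact: aff_cst.
  by rewrite (tangent_cst gG tz _ (dvec_tangent gG u z)) subr0.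
exists (fun y => h (rshift c ord0) (phi y)); split.
  exact: (patch_regF gG pU0 U0x).
apply: (around_sub (aroundI tx (aU0 _ U0x) (aroundI tx eF (aroundI tx (patch_pull pU0 U0x eh) (patch_pull pU0 U0x gV))))).
move=> y [Uy [-> [-> hy]]]; have gy : forall i, g i (phi y) = 0 by apply/hy; exists y.
rewrite big_split_ord /= big1 ?add0r => [|i _]; last by rewrite /gs (unsplitK (inl i)) gy mulr0.
by rewrite big_ord1 /gs (unsplitK (inr ord0)) /= !ew mulrC.
Qed.

Variables (U : set X) (s : X -> K) (d : vfield X).
Hypothesis pa : uniformizer U s d.
Let Ux : U x := around_self (pa_U pa).
Let tx : tame (G := G) x := pa_tame pa Ux.

Let d_near f : regular_at x f -> around x (fun y => U y /\ regular_at y f).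
Proof. by move=> rf; exact: (aroundI tx (pa_U pa) (reg_open tx rf)). Qed.

Let rs : regular_at x s := pa_reg pa Ux.

(** Germs of smooth functions have zero divisors, so only the value at x is claimed: differentiating
    s^(r+1) w = 0 gives s^r ((r+1) w + s dw) = 0, and induction on r yields (r+1) w(x) = 0. *)
Lemma uniformizer_cancel r w : regular_at x w -> around x (fun y => s y ^+ r * w y = 0) -> w x = 0.
Proof.
elim: r w => [|r ih] w rw e; first by have := around_self e; rewrite mul1r.
have [td rd] := pa_d pa Ux.
have : r.+1%:R * w x + s x * d x w = 0.
  apply: (ih (fun y => r.+1%:R * w y + s y * d y w)).
    apply: (reg_add gG tx); apply: (reg_mul gG tx) => //; first exact: (reg_cst gG tx).
    exact: rd.
  apply: (around_sub (aroundI tx (aroundI tx (d_near rw) (d_near rs)) (around_open e))) => y [[[Uy rwy] [_ rsy]] ey].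
  have ty := pa_tame pa Uy; have [tdy _] := pa_d pa Uy.
  have rsX := reg_exp gG r.+1 ty rsy.
  have := tangent_ext ty tdy (reg_mul gG ty rsX rwy) ey.
  rewrite (tangent_cst gG ty _ tdy) (tangentM tdy) // (tangentX gG _ ty tdy rsy) (pa_ds pa Uy) => h.
  rewrite -[RHS]h exprS; ring.
rewrite (pa_s0 pa) mul0r addr0 => /eqP; rewrite mulf_eq0 (negPf (char0 gG r)) /=.
by move/eqP.
Qed.

(** Factors s are extracted one at a time: if f = s^(r+1) h with r < n, comparing df with s^n u and
    cancelling s^r gives (r+1) h(x) = 0, so h is again divisible by s. *)
Lemma uniformizer_prim n f u : regular_at x f -> f x = 0 -> regular_at x u ->
  around x (fun y => d y f = s y ^+ n * u y) ->
  exists h, regular_at x h /\ around x (fun y => f y = s y ^+ n.+1 * h y).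
Proof.
move=> rf f0 ru e.
have step r : (r <= n)%N -> exists h, regular_at x h /\ around x (fun y => f y = s y ^+ r.+1 * h y).
  elim: r => [|r ih] rn.
    by have [h [rh eh]] := pa_gen pa rf f0; exists h; split.
  have [h [rh eh]] := ih (ltnW rn).
  have [td rd] := pa_d pa Ux.
  have h0 : r.+1%:R * h x + s x * (d x h - s x ^+ (n - r.+1) * u x) = 0.
    apply: (@uniformizer_cancel r (fun y => r.+1%:R * h y + s y * (d y h - s y ^+ (n - r.+1) * u y))).
      apply: (reg_add gG tx); apply: (reg_mul gG tx) => //; first exact: (reg_cst gG tx).
      apply: (reg_sub gG tx); first exact: rd.
      by apply: (reg_mul gG tx) => //; exact: (reg_exp gG).
    apply: (around_sub (aroundI tx (aroundI tx (d_near rh) (d_near rs)) (aroundI tx (aroundI tx (d_near rf) e) (around_open eh)))).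
    move=> y [[[Uy rhy] [_ rsy]] [[[_ rfy] ey] ehy]].
    have ty := pa_tame pa Uy; have [tdy _] := pa_d pa Uy.
    have rsX := reg_exp gG r.+1 ty rsy.
    have := tangent_ext ty tdy rfy ehy.
    rewrite ey (tangentM tdy) // (tangentX gG _ ty tdy rsy) (pa_ds pa Uy) => h0.
    have en : s y ^+ n = s y ^+ r * s y * s y ^+ (n - r.+1).
      by rewrite -exprSr -exprD subnKC.
    have : s y ^+ r.+1 * d y h + r.+1%:R * s y ^+ r * 1 * h y - s y ^+ n * u y = 0 by rewrite h0 subrr.
    by rewrite en exprS => h1; rewrite -[RHS]h1; ring.
  move: h0; rewrite (pa_s0 pa) mul0r addr0 => /eqP; rewrite mulf_eq0 (negPf (char0 gG r)) /= => /eqP hx.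
  have [h' [rh' eh']] := pa_gen pa rh hx; exists h'; split => //.
  by apply: (around_sub (aroundI tx eh eh')) => y [-> ->]; rewrite [s y ^+ r.+2]exprSr mulrA.
exact: step.
Qed.

End Curve.
End Powers.

(** * Curves cut out by equations *)

Section Submanifold.
Variable (G : geometry).
Hypothesis gG : good G.
Hypothesis zG : regular_zeros G.
Hypothesis sG : small_subspaces G.
Local Notation K := (scalars G).
Local Notation areg n z F := (@regular_at K (affine G n) z F).
Local Notation anear n z P := (@around K (affine G n) z P).

Lemma aff_open_around n (V : set 'rV[K]_n) : opn (affine G n) V <-> forall z, V z -> anear n z V.
Proof. by split=> [oV z Vz|]; [exists V; split|exact: aff_openL]. Qed.

Variables (X : fspace K) (U : set X) (m : nat) (phi : X -> 'rV[K]_(m + 1)).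
Hypothesis pU : coords U phi.
Hypothesis inj : forall x x', U x -> U x' -> phi x = phi x' -> x = x'.
Variables (V0 : set 'rV[K]_(m + 1)) (g : 'I_m -> 'rV[K]_(m + 1) -> K) (s : 'rV[K]_(m + 1) -> K).
Hypothesis oV0 : opn (affine G (m + 1)) V0.
Hypothesis rg : forall z i, V0 z -> areg (m + 1) z (g i).
Hypothesis rs : forall z, V0 z -> areg (m + 1) z s.
Hypothesis ginj : forall z u, V0 z -> (forall i, dvec (G := G) u z (g i) = 0) ->
  dvec (G := G) u z s = 0 -> u = 0.
Hypothesis img : forall z, V0 z -> (forall i, g i z = 0) -> exists2 x, U x & phi x = z.

Definition curve_pt := {x : X | [/\ U x, V0 (phi x) & forall i, g i (phi x) = 0]}.
Definition curve_coord (c : curve_pt) : 'rV[K]_(m + 1) := phi (sval c).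
Definition curve : fspace K := @FSpace K curve_pt
  [set W | exists2 V, opn (affine G (m + 1)) V & W = curve_coord @^-1` V]
  (fun c => [set f | exists F, areg (m + 1) (curve_coord c) F /\
     exists Q : set 'rV[K]_(m + 1), anear (m + 1) (curve_coord c) Q /\ forall c', Q (curve_coord c') -> f c' = F (curve_coord c')]).

Local Notation psi := (curve_coord : curve -> 'rV[K]_(m + 1)).

Let cU (c : curve) : U (sval c). Proof. by case: (svalP c). Qed.
Let cV (c : curve) : V0 (psi c). Proof. by case: (svalP c). Qed.
Let cg (c : curve) i : g i (psi c) = 0. Proof. by case: (svalP c). Qed.

Lemma curve_coord_inj (c c' : curve) : psi c = psi c' -> c = c'.
Proof.
by move=> /(inj (cU c) (cU c')); case: c c' => [x h] [x' h'] /= e; apply: eq_exist.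
Qed.

Lemma curve_around (c : curve) (P : set curve) : around c P <->
  exists Q : set 'rV[K]_(m + 1), anear (m + 1) (psi c) Q /\ forall c', Q (psi c') -> P c'.
Proof.
split=> [[W [[V oV ->] Vc WP]]|[Q [[V [oV Vc VQ]] hQ]]].
  by exists V; split => //; exists V; split.
by exists (psi @^-1` V); split => //; [exists V|move=> c' /VQ; exact: hQ].
Qed.

Lemma curve_coords : coords (setT : set curve) psi.
Proof.
split=> [c P _|c f _].
  by rewrite curve_around; split=> -[Q [nQ hQ]]; exists Q; split => // c' *; exact: hQ.
split=> -[F [rF hF]]; exists F; split => //; first by apply/curve_around.
by move/curve_around: hF.
Qed.

(** [regular_zeros] at an arbitrary point of the curve: s is shifted by a constant so as to vanish
    there. *)
Lemma curve_ideal (c : curve) F : areg (m + 1) (psi c) F -> around c (fun c' => F (psi c') = 0) ->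
  exists h : 'I_m -> 'rV[K]_(m + 1) -> K, (forall i, areg (m + 1) (psi c) (h i)) /\
    anear (m + 1) (psi c) (fun z => F z = \sum_i h i z * g i z).
Proof.
move=> rF /curve_around[Q [nQ hQ]]; have tz := aff_tame gG (psi c).
have rsc := rs (cV c).
apply: (zG (s := fun z => s z - s (psi c))) => //.
- by move=> i; exact: rg (cV c).
- by apply: (reg_sub gG tz) => //; exact: aff_cst.
- by rewrite subrr.
- move=> u hu; rewrite (tangentB gG tz (dvec_tangent gG u _) rsc); last exact: aff_cst.
  by rewrite (tangent_cst gG tz _ (dvec_tangent gG u _)) subr0; exact: ginj (cV c) hu.
have nV : anear (m + 1) (psi c) V0 by exists V0; split.
apply: (around_sub (aroundI tz nQ nV)) => z [Qz Vz] gz.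
have [x Ux ex] := img Vz gz.
have h : [/\ U x, V0 (phi x) & forall i, g i (phi x) = 0] by rewrite ex.
by have := hQ (exist _ x h : curve); rewrite /curve_coord /= ex; apply.
Qed.

Lemma curve_admissible (c : curve) u : (forall i, dvec (G := G) u (psi c) (g i) = 0) ->
  admissible psi c u.
Proof.
move=> hu F rF eF; have [h [rh eh]] := curve_ideal rF eF.
have tz := aff_tame gG (psi c); have tu := dvec_tangent gG u (psi c).
have rgc i := rg i (cV c).
rewrite (tangent_ext tz tu rF eh) (tangent_sum gG tz _ tu); last first.
  by move=> i _; apply: (reg_mul gG tz).
by rewrite big1 // => i _; rewrite (tangentM tu) // hu cg !mulr0 addr0.
Qed.

Lemma curve_chart : chart (G := G) (d := 1) (setT : set curve) psi.
Proof.
split.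
- exists setT => //; apply/aff_open_around => z _.
  by apply: (around_sub (aroundT (aff_tame gG z))).
- by move=> c c' _ _; exact: curve_coord_inj.
- by move=> W _; split=> -[V oV ->]; exists V; rewrite ?setTI.
- move=> c f _; split=> [[F [rF [Q [nQ hQ]]]]|[V [F [oV Vc rF e]]]].
    have [V [oV Vc VQ]] := aroundI (aff_tame gG _) nQ (reg_open (aff_tame gG _) rF).
    exists V, F; split => //; first by move=> z /VQ[].
    by move=> c' _ /VQ[h _]; exact: hQ.
  exists F; split; first exact: rF.
  by exists V; split; [exists V; split|move=> c' Vc'; exact: e].
move=> c _; have Vc := cV c; exists V0, g; split.
- by split.
- by move=> i z Vz; exact: rg.
- move=> z Vz; split=> [[c' _ <-] i|gz]; first exact: cg.
  have [x Ux ex] := img Vz gz.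
  have h : [/\ U x, V0 (phi x) & forall i, g i (phi x) = 0] by rewrite ex.
  by exists (exist _ x h : curve).
- move=> F rF /= hF; apply: curve_ideal => //; apply/curve_around.
  exists (fun z => [set psi x | x in setT] z -> F z = 0); split => // c'; apply; by exists c'.
(* The relation is tested on the vector dual to g i, a row of the inverse Jacobian of the g and
   s. *)
move=> a ha i; have tz := aff_tame gG (psi c).
pose gs (i : 'I_(m + 1)) := match fintype.split i with inl j => g j | inr _ => s end.
have rgs i' : areg (m + 1) (psi c) (gs i').
  by rewrite /gs; case: (fintype.split i') => j; [exact: rg|exact: rs].
pose M : 'M[K]_(m + 1) := \matrix_(l, i') pdv l (gs i') (psi c).
have uM : M \in unitmx.
  apply: inj_unit => u hu.
  have hu' i' : dvec (G := G) u (psi c) (gs i') = 0.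
    have := congr1 (fun A : 'rV[K]_(m + 1) => A 0 i') hu; rewrite !mxE dvecE // => e; rewrite -[RHS]e.
    by apply: eq_bigr => l _; rewrite mxE.
  apply: (ginj Vc); first by move=> j; have := hu' (lshift 1 j); rewrite /gs (unsplitK (inl j)).
  by have := hu' (rshift m ord0); rewrite /gs (unsplitK (inr ord0)).
pose u := row (lshift 1 i) (invmx M).
have hu j : dvec (G := G) u (psi c) (g j) = (i == j)%:R.
  have : dvec (G := G) u (psi c) (gs (lshift 1 j)) = (u *m M) 0 (lshift 1 j).
    by rewrite mxE dvecE //; apply: eq_bigr => l _; rewrite [M _ _]mxE.
  rewrite /gs (unsplitK (inl j)) => ->; rewrite /u -row_mul mulVmx // mxE mxE.
  by rewrite (inj_eq (@lshift_inj _ _)).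
have := ha _ (dvec_tangent gG u (psi c)); rewrite (bigD1 i) //= hu eqxx mulr1 big1 ?addr0 // => j ji.
by rewrite hu eq_sym (negPf ji) mulr0.
Qed.

Lemma curve_regular_coord (c : curve) l : regular_at c (fun c' : curve => psi c' 0 l).
Proof. exact: (patch_coord gG curve_coords l (I : setT c)). Qed.

Lemma curve_manifold : manifold (G := G) 1 curve.
Proof.
split.
- split.
  + exists setT => //; apply/aff_open_around => z _.
    by apply: (around_sub (aroundT (aff_tame gG z))).
  + move=> _ _ [V oV ->] [V' oV' ->]; exists (V `&` V') => //.
    apply/aff_open_around => z [Vz Vz']; apply: (aroundI (aff_tame gG z)).
      by exists V; split.
    by exists V'; split.
  + move=> C CO; exists (\bigcup_(V in [set V | opn (affine G (m + 1)) V /\ C (psi @^-1` V)]) V).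
      apply/aff_open_around => z [V [oV CV] Vz].
      by exists V; split => // z' Vz'; exists V.
    apply/seteqP; split=> [c [W CW Wc]|c [V [oV CV] Vc]]; last by exists (psi @^-1` V).
    have [V oV eW] := CO _ CW; exists V; first by split; rewrite -?eW.
    by rewrite eW in Wc.
- by move=> c; exists setT, m, psi; split => //; exact: curve_chart.
(* Both charts are arbitrary. A coordinate of the ambient space that differs at the two points is a
   function F1 of the first chart and F2 of the second, and F1 - F2 is nonzero near the pair but
   zero on the diagonal. *)
- move=> U1 U2 c1 c2 p1 p2 ch1 ch2 x1 x2 U1x U2x ne.
  have [l hl] : exists l, psi x1 0 l != psi x2 0 l.
    apply/not_existsP => h; apply: ne; apply: curve_coord_inj; apply/rowP => l.
    by have /negP/negPn/eqP := h l.
  have [_ _ _ r1 _] := ch1; have [_ _ _ r2 _] := ch2.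
  have [V1 [F1 [oV1 V1x rF1 e1]]] := (r1 x1 _ U1x).1 (curve_regular_coord x1 l).
  have [V2 [F2 [oV2 V2x rF2 e2]]] := (r2 x2 _ U2x).1 (curve_regular_coord x2 l).
  exists [set z : 'rV[K]_((c1 + 1) + (c2 + 1)) | [/\ V1 (lsubmx z), V2 (rsubmx z) & F1 (lsubmx z) - F2 (rsubmx z) != 0]].
  split.
  + apply/aff_open_around => z [V1z V2z dz]; have tz := aff_tame gG z.
    have lE (y : 'rV[K]_((c1 + 1) + (c2 + 1))) : lsubmx y = \row_j y 0 (lshift (c2 + 1) j).
      by apply/rowP => j; rewrite !mxE.
    have rE (y : 'rV[K]_((c1 + 1) + (c2 + 1))) : rsubmx y = \row_j y 0 (rshift (c1 + 1) j).
      by apply/rowP => j; rewrite !mxE.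
    have n1 : anear _ z (fun y : 'rV[K]_((c1 + 1) + (c2 + 1)) => V1 (lsubmx y)).
      apply: (@aff_near G gG _ _ (fun j (y : 'rV[K]_((c1 + 1) + (c2 + 1))) => y 0 (lshift (c2 + 1) j)) z _ V1 _ (lE z)).
      * by move=> j; exact: aff_coord.
      * by exists V1; split.
      * by move=> y; rewrite -lE.
    have n2 : anear _ z (fun y : 'rV[K]_((c1 + 1) + (c2 + 1)) => V2 (rsubmx y)).
      apply: (@aff_near G gG _ _ (fun j (y : 'rV[K]_((c1 + 1) + (c2 + 1))) => y 0 (rshift (c1 + 1) j)) z _ V2 _ (rE z)).
      * by move=> j; exact: aff_coord.
      * by exists V2; split.
      * by move=> y; rewrite -rE.
    have rd : areg _ z (fun y : 'rV[K]_((c1 + 1) + (c2 + 1)) => F1 (lsubmx y) - F2 (rsubmx y)).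
      apply: (reg_sub gG tz).
        apply: (@aff_comp G gG _ _ (fun j (y : 'rV[K]_((c1 + 1) + (c2 + 1))) => y 0 (lshift (c2 + 1) j)) z _ F1 _ (lE z)).
        * by move=> j; exact: aff_coord.
        * exact: rF1.
        * by move=> y; rewrite -lE.
      apply: (@aff_comp G gG _ _ (fun j (y : 'rV[K]_((c1 + 1) + (c2 + 1))) => y 0 (rshift (c1 + 1) j)) z _ F2 _ (rE z)).
      * by move=> j; exact: aff_coord.
      * exact: rF2.
      * by move=> y; rewrite -rE.
    by apply: (around_sub (aroundI tz n1 (aroundI tz n2 (around_ne0 gG tz rd dz)))) => y [? [? ?]]; split.
  + by split; rewrite ?row_mxKl ?row_mxKr // -(e1 x1) // -(e2 x2) // subr_eq0.
  + move=> c U1c U2c [V1c V2c]; rewrite row_mxKl row_mxKr in V1c V2c *.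
    by rewrite -(e1 c) // -(e2 c) // subrr eqxx.
- exact: (sG (T := curve_pt) curve_coord).
Qed.

Definition curve_incl (c : curve) : X := sval c.

Lemma curve_incl_reg (c : curve) a : regular_at (curve_incl c) a -> regular_at c (a \o curve_incl).
Proof.
move=> /(patch_reg pU _ (cU c))[F [rF /(patch_near pU _ (cU c))[Q [nQ hQ]]]].
exists F; split => //; exists Q; split => // c'; exact: hQ (cU c').
Qed.

Lemma curve_incl_near (c : curve) Q : around (curve_incl c) Q -> around c (fun c' => Q (curve_incl c')).
Proof.
move=> /(patch_near pU _ (cU c))[R [nR hR]]; apply/curve_around; exists R; split => // c'.
exact: hR (cU c').
Qed.

Lemma curve_incl_morphism : morphism curve_incl.
Proof.
split; last exact: curve_incl_reg.
move=> V oV; exists [set z | exists O, [/\ opn (affine G (m + 1)) O, O z & forall y, U y -> O (phi y) -> V y]].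
  apply/aff_open_around => z [O [oO Oz hO]]; exists O; split => // z' Oz'.
  by exists O; split.
apply/seteqP; split=> [c Vc|c [O [oO Oc hO]]]; last exact: hO (cU c) Oc.
have : around (curve_incl c) V by exists V; split.
move=> /(patch_near pU _ (cU c))[R [[O [oO Oz OR]] hR]]; exists O; split => // y Uy /OR.
exact: hR.
Qed.

Lemma curve_tame (c : curve) : tame (G := G) c.
Proof. exact: (patch_tame gG curve_coords (I : setT c)). Qed.

Lemma curve_push_tangent (c : curve) v : is_tangent c v -> is_tangent (curve_incl c) (push curve_incl c v).
Proof.
apply: (push_tangent gG (curve_tame c)) => [||Q nQ]; last exact: curve_incl_near.
  exact: (patch_tame gG pU (cU c)).
by move=> a; exact: curve_incl_reg.
Qed.

Section Field.
Variable Z : vfield X.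
Hypothesis vZ : is_vfield U Z.
Hypothesis Zg : forall c : curve, forall i, Z (curve_incl c) (fun x => g i (phi x)) = 0.

Definition curve_field : vfield curve :=
  fun c => ptan psi c (\row_l Z (curve_incl c) (fun x => phi x 0 l)).

Let adm (c : curve) : admissible psi c (\row_l Z (curve_incl c) (fun x => phi x 0 l)).
Proof.
apply: curve_admissible => i; have [tZ _] := vZ (cU c).
by rewrite -(tangentE gG pU (cU c) tZ (rg i (cV c))) Zg.
Qed.

Lemma curve_field_vfield : is_vfield setT curve_field.
Proof.
apply: (ptan_vfield gG curve_coords (u := fun c => \row_l Z (curve_incl c) (fun x => phi x 0 l))).
  by move=> c _; exact: adm.
move=> c l _.
have -> : (fun c' : curve => (\row_l0 Z (curve_incl c') (fun x => phi x 0 l0)) 0 l) =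
    (fun x => Z x (fun x => phi x 0 l)) \o curve_incl by apply/funext => c'; rewrite /= mxE.
by apply: curve_incl_reg; have [_] := vZ (cU c); apply; exact: (patch_coord gG pU l (cU c)).
Qed.

Lemma curve_fieldE (c : curve) f : regular_at (curve_incl c) f ->
  curve_field c (f \o curve_incl) = Z (curve_incl c) f.
Proof.
move=> rf; have [tZ _] := vZ (cU c); have [F [rF eF]] := (patch_reg pU _ (cU c)).1 rf.
have tx := patch_tame gG pU (cU c).
rewrite (tangent_ext tx tZ rf eF) (tangentE gG pU (cU c) tZ rF).
apply: (ptanE gG curve_coords (I : setT c) (@adm c) rF).
exact: (curve_incl_near eF).
Qed.

End Field.
End Submanifold.

(** * The integral curve of X + N *)

Section Focal.
Variable (G : geometry).
Hypothesis gG : good G.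
Local Notation K := (scalars G).
Local Notation areg n z F := (@regular_at K (affine G n) z F).
Local Notation anear n z P := (@around K (affine G n) z P).

Lemma reg_horner (X : fspace K) (x : X) f (P : {poly K}) : tame (G := G) x -> regular_at x f ->
  regular_at x (fun y => P.[f y]).
Proof.
move=> tx rf; elim/poly_ind: P => [|P c ih].
  have e : (fun y => (0 : {poly K}).[f y]) = fun=> 0 by apply/funext => y; rewrite horner0.
  by rewrite e; exact: (reg_cst gG tx).
have e : (fun y => (P * 'X + c%:P).[f y]) = fun y => P.[f y] * f y + c.
  by apply/funext => y; rewrite hornerMXaddC.
by rewrite e; apply: (reg_add gG tx); [exact: (reg_mul gG tx)|exact: (reg_cst gG tx)].
Qed.

Lemma tangent_horner (X : fspace K) (x : X) (v : tvec X) f (P : {poly K}) : tame (G := G) x ->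
  is_tangent x v -> regular_at x f -> v (fun y => P.[f y]) = P^`().[f x] * v f.
Proof.
move=> tx tv rf; elim/poly_ind: P => [|P c ih].
  have e : (fun y => (0 : {poly K}).[f y]) = fun=> 0 by apply/funext => y; rewrite horner0.
  by rewrite e (tangent_cst gG tx _ tv) deriv0 horner0 mul0r.
have e : (fun y => (P * 'X + c%:P).[f y]) = fun y => P.[f y] * f y + c.
  by apply/funext => y; rewrite hornerMXaddC.
have rP := reg_horner P tx rf.
rewrite e (tangentD tv); [|exact: (reg_mul gG tx)|exact: (reg_cst gG tx)].
rewrite (tangent_cst gG tx _ tv) addr0 (tangentM tv) // ih.
by rewrite derivD derivM derivX derivC addr0 mulr1 hornerD hornerM hornerX; ring.
Qed.

Lemma poly_primitive (q : {poly K}) c : exists P : {poly K}, P^`() = q /\ P.[0] = c.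
Proof.
exists (c%:P + \poly_(i < (size q).+1) (if i is i'.+1 then q`_i' / i'.+1%:R else 0)); split.
  rewrite derivD derivC add0r; apply/polyP => i; rewrite coef_deriv coef_poly ltnS.
  case: ltnP => h; last by rewrite mul0rn nth_default.
  by rewrite /= -[RHS](divfK (char0 gG i)) mulr_natr.
by rewrite hornerD hornerC horner_coef0 coef_poly addr0.
Qed.

Variables (S : fspace K) (k : nat) (p : monster S k) (st : stage p).
Local Notation D := (monster S k).
Local Notation U := (dom st).
Local Notation X := (fX st).
Local Notation N := (fN st).
Local Notation t := (ct st).
Local Notation v := (vert st).
Local Notation wt := (weight k v t).
Let Up : U p := st_p st.
Let tU x : U x -> tame (G := G) x := @patch_tame G gG _ _ _ _ (st_coords st) x.
Let tp := tU Up.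
Let nU : forall x, U x -> around x U := @patch_self G gG _ _ _ _ (st_coords st).
Let vX : is_vfield U X := fr_A (st_frame st).
Let vN : is_vfield U N := fr_B (st_frame st).

Definition wpoly (Ps : nat -> {poly K}) j : {poly K} := \prod_(j.+1 <= l < k.+1) (if v l then Ps l else 1).

(* X t_j only involves the t_l with l > j, so the system for an integral curve of
   X + N is triangular and has polynomial solutions; this works in the algebraic
   category too. *)
Lemma integral_polys : exists Ps : nat -> {poly K}, [/\ Ps k = 'X + (t k p)%:P,
  forall j, (j < k)%N -> (Ps j)^`() = wpoly Ps j.+1 * (if v j.+1 then 1 else Ps j.+1) &
  forall j, (j <= k)%N -> (Ps j).[0] = t j p].
Proof.
suff h d : exists Ps : nat -> {poly K}, [/\ Ps k = 'X + (t k p)%:P,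
  forall j, (k - d <= j < k)%N -> (Ps j)^`() = wpoly Ps j.+1 * (if v j.+1 then 1 else Ps j.+1) &
  forall j, (k - d <= j <= k)%N -> (Ps j).[0] = t j p].
  have [Ps [h1 h2 h3]] := h k; exists Ps; split => // j jk; [apply: h2|apply: h3]; by rewrite subnn.
elim: d => [|d [Ps [h1 h2 h3]]].
  exists (fun=> 'X + (t k p)%:P); split => // j.
    by rewrite subn0 => /andP[a b]; move: (leq_ltn_trans a b); rewrite ltnn.
  rewrite subn0 => jk; have -> : j = k by apply/eqP; rewrite eqn_leq andbC.
  by rewrite !hornerE.
have [dk|dk] := leqP k d.
  have e : (k - d.+1 = k - d)%N by lia.
  by exists Ps; rewrite e.
pose j0 := (k - d.+1)%N.
have [P [dP P0]] := poly_primitive (wpoly Ps j0.+1 * (if v j0.+1 then 1 else Ps j0.+1)) (t j0 p).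
pose Qs j := if j == j0 then P else Ps j.
have QE j : (j0 < j)%N -> Qs j = Ps j by rewrite /Qs => /gtn_eqF ->.
have wE j : (j0 <= j)%N -> wpoly Qs j.+1 = wpoly Ps j.+1.
  by move=> jj; apply: eq_big_nat => l /andP[jl _]; rewrite QE //; lia.
exists Qs; split; first by rewrite QE // /j0; lia.
- move=> j hj; rewrite wE; last by rewrite /j0; lia.
  rewrite (QE j.+1); last by rewrite /j0; lia.
  have [->|ne] := eqVneq j j0; first by rewrite /Qs eqxx.
  by rewrite /Qs (negPf ne) h2 //; rewrite /j0 in ne; lia.
- move=> j hj; have [->|ne] := eqVneq j j0; first by rewrite /Qs eqxx.
  by rewrite /Qs (negPf ne) h3 //; rewrite /j0 in ne; lia.
Qed.

Hypothesis zG : regular_zeros G.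
Hypothesis sG : small_subspaces G.

(** The dimension is a variable so that it can be rewritten in the form m + 1 required of curves.
    The integral curve is given by equations instead of a parameterization: t_j = P_j(s) for j < k
    and w = PW(s), with s = t_k - t_k(p), together with the equations of the domain. Along it the
    derivative of f o gam is (Z f) o gam, so n derivations recover the leading coefficient of f. *)
Lemma generic_curve_aux n (phi : D -> 'rV[K]_n) c (Gam : 'I_c -> 'rV[K]_n -> K) (W : 'rV[K]_n -> K)
    (T : nat -> 'rV[K]_n -> K) :
  n = (c + k.+1 + 1)%N -> coords U phi -> (forall x x', U x -> U x' -> phi x = phi x' -> x = x') ->
  (forall i, areg _ (phi p) (Gam i)) ->
  anear _ (phi p) (fun z => (phi @` U) z <-> forall i, Gam i z = 0) ->
  areg _ (phi p) W -> around p (fun x => cw st x = W (phi x)) ->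
  (forall j, (j <= k)%N -> areg _ (phi p) (T j) /\ around p (fun x => t j x = T j (phi x))) ->
  (forall u, (forall i, dvec (G := G) u (phi p) (Gam i) = 0) ->
        dvec (G := G) u (phi p) W = 0 ->
        (forall j, (j <= k)%N -> dvec (G := G) u (phi p) (T j) = 0) -> u = 0) ->
  exists (C : fspace K) (t0 : C) (gam : C -> D), focal_curve p t0 gam /\
    forall f n c, lead p X N n f c -> in_max_power t0 n.+1 (f \o gam) -> c = 0.
Proof.
move=> en; subst n => pU inj rG nG rW eW rT Jinj.
have tz := aff_tame gG (phi p).
have [Ps [Pk dP P0]] := integral_polys.
have [PW [dPW PW0]] := poly_primitive (wpoly Ps 0) (cw st p).
pose Sz z := T k z - t k p.
(* One equation for each t_j with j < k; the index j = k carries the equation of w, since t_k gives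
   the parameter. *)
pose gg (i : 'I_(c + k.+1)) z := match fintype.split i with inl i => Gam i z
  | inr j => if (j < k)%N then T j z - (Ps j).[Sz z] else W z - PW.[Sz z] end.
have rS : areg _ (phi p) Sz.
  by apply: (reg_sub gG tz); [case: (rT k (leqnn k))|exact: aff_cst].
have rgg i : areg _ (phi p) (gg i).
  rewrite /gg; case: (fintype.split i) => j //; case jk : (j < k)%N.
    by apply: (reg_sub gG tz); [case: (rT j (ltnW jk))|exact: reg_horner].
  by apply: (reg_sub gG tz) => //; exact: reg_horner.
pose gs (i : 'I_(c + k.+1 + 1)) := match fintype.split i with inl j => gg j | inr _ => Sz end.
have rgs z i : (forall i, areg _ z (gg i)) -> areg _ z Sz -> areg _ z (gs i).
  by rewrite /gs; case: (fintype.split i).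
pose M z : 'M[K]_(c + k.+1 + 1) := \matrix_(l, i) pdv l (gs i) z.
have rM l i : areg _ (phi p) (fun z => M z l i).
  by under eq_fun do rewrite mxE; apply: (reg_pdv gG); apply: rgs.
have MP z u : (forall i, areg _ z (gg i)) -> areg _ z Sz -> (u *m M z = 0 <->
    (forall i, dvec (G := G) u z (gg i) = 0) /\ dvec (G := G) u z Sz = 0).
  move=> r1 r2; have e i : (u *m M z) 0 i = dvec (G := G) u z (gs i).
    by rewrite mxE dvecE; [apply: eq_bigr => l _; rewrite mxE|exact: rgs].
  split=> [h|[h1 h2]].
    have h' i : dvec (G := G) u z (gs i) = 0 by rewrite -e h mxE.
    split; first by move=> i; have := h' (lshift 1 i); rewrite /gs (unsplitK (inl i)).
    by have := h' (rshift (c + k.+1) ord0); rewrite /gs (unsplitK (inr ord0)).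
  by apply/rowP => i; rewrite e [RHS]mxE /gs; case: (fintype.split i).
have Tp j : (j <= k)%N -> T j (phi p) = t j p by move=> jk; have [_ e] := rT j jk; rewrite -(around_self e).
have Sp : Sz (phi p) = 0 by rewrite /Sz Tp // subrr.
have dhorner (Q : {poly K}) F u : areg _ (phi p) F -> dvec (G := G) u (phi p) Sz = 0 ->
    dvec (G := G) u (phi p) (fun z => F z - Q.[Sz z]) = dvec (G := G) u (phi p) F.
  move=> rF dS; have tu := dvec_tangent gG u (phi p).
  rewrite (tangentB gG tz tu rF) ?(tangent_horner _ tz tu rS) ?dS ?mulr0 ?subr0 //.
  exact: reg_horner.
have uM : M (phi p) \in unitmx.
  apply: inj_unit => u /(MP _ _ rgg rS)[h1 h2].
  have tu := dvec_tangent gG u (phi p).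
  apply: Jinj.
  - by move=> i; have := h1 (lshift k.+1 i); rewrite /gg (unsplitK (inl i)).
  - have := h1 (rshift c ord_max); rewrite /gg (unsplitK (inr ord_max)) /= ltnn.
    by rewrite dhorner.
  - move=> j; rewrite leq_eqVlt => /orP[/eqP ->|jk].
      have [rTk _] := rT k (leqnn k).
      move: h2; rewrite (tangentB gG tz tu rTk); last exact: aff_cst.
      by rewrite (tangent_cst gG tz _ tu) subr0.
    have jk' : (j < k.+1)%N by exact: ltnW.
    have := h1 (rshift c (Ordinal jk')); rewrite /gg (unsplitK (inr (Ordinal jk'))) /= jk.
    by rewrite dhorner //; case: (rT j (ltnW jk)).
have [_ nM] := reg_invmx gG tz rM uM.
have neq : anear _ (phi p) (fun z => forall y, U y -> phi y = z ->
    cw st y = W z /\ forall j, (j <= k)%N -> t j y = T j z).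
  have h : around p (fun y => cw st y = W (phi y) /\ forall j : 'I_k.+1, t j y = T j (phi y)).
    apply: (aroundI tp eW); apply: (around_forall tp) => j; have [_ e] := rT j (ltn_ord j).
    exact: e.
  have [Q [nQ hQ]] := (patch_near pU _ Up).1 h.
  apply: (around_sub nQ) => z Qz y Uy ey; rewrite -ey in Qz *.
  by have [h1 h2] := hQ y Uy Qz; split => // j jk; exact: (h2 (Ordinal (jk : (j < k.+1)%N))).
have nrg : anear _ (phi p) (fun z => forall i, areg _ z (gg i)).
  by apply: (around_forall tz) => i; exact: reg_open.
(* V0 is so small that the Jacobian stays invertible and that w and the t_j agree with W and the
   T_j. *)
have [V0 [oV0 Vp hV0]] := aroundI tz (aroundI tz nrg (reg_open tz rS)) (aroundI tz nG (aroundI tz nM neq)).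
have rgV z i : V0 z -> areg _ z (gg i) by move=> /hV0[[]].
have rSV z : V0 z -> areg _ z Sz by move=> /hV0[[]].
have ginjV z u : V0 z -> (forall i, dvec (G := G) u z (gg i) = 0) -> dvec (G := G) u z Sz = 0 -> u = 0.
  move=> Vz h1 h2; have [[r1 r2] [_ [uMz _]]] := hV0 z Vz.
  have : u *m M z = 0 by apply/(MP _ _ r1 r2).
  by move=> e; rewrite -[u](mulmxK uMz) e mul0mx.
have imgV z : V0 z -> (forall i, gg i z = 0) -> exists2 x, U x & phi x = z.
  move=> Vz hz; have [_ [h _]] := hV0 z Vz; apply: h.2 => i.
  by have := hz (lshift k.+1 i); rewrite /gg (unsplitK (inl i)).
have ggp i : gg i (phi p) = 0.
  rewrite /gg; case: (fintype.split i) => j; first by move: j; apply: (around_self nG).1; exists p.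
  rewrite Sp; case jk : (j < k)%N; first by rewrite Tp ?P0 ?subrr // ltnW.
  by rewrite PW0 -(around_self eW) subrr.
pose C := @curve G D U (c + k.+1) phi V0 gg.
pose t0 : C := exist _ p (And3 Up Vp ggp) : @curve G D U (c + k.+1) phi V0 gg.
pose gam : C -> D := @curve_incl G D U (c + k.+1) phi V0 gg.
have cUx (x : C) : U (gam x) by case: (svalP x).
have cVx (x : C) : V0 (phi (gam x)) by case: (svalP x).
have cgx (x : C) i : gg i (phi (gam x)) = 0 by case: (svalP x).
pose s (y : D) := t k y - t k p.
have near_eq x : U x -> V0 (phi x) -> cw st x = W (phi x) /\ forall j, (j <= k)%N -> t j x = T j (phi x).
  by move=> Ux Vx; have [_ [_ [_ h]]] := hV0 _ Vx; exact: h Ux erefl.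
have on_t (x : C) j : (j <= k)%N -> t j (gam x) = (Ps j).[s (gam x)].
  have [_ h] := near_eq _ (cUx x) (cVx x).
  rewrite leq_eqVlt => /orP[/eqP ->|jk]; first by rewrite Pk !hornerE /s subrK.
  have jk' : (j < k.+1)%N by exact: ltnW.
  have := cgx x (rshift c (Ordinal jk')); rewrite /gg (unsplitK (inr (Ordinal jk'))) /= jk => /eqP.
  by rewrite subr_eq0 /Sz -!h // ?ltnW // => /eqP.
have on_w (x : C) : cw st (gam x) = PW.[s (gam x)].
  have [hw h] := near_eq _ (cUx x) (cVx x).
  have := cgx x (rshift c ord_max); rewrite /gg (unsplitK (inr ord_max)) /= ltnn => /eqP.
  by rewrite subr_eq0 /Sz -h // -hw => /eqP.
have on_wt (x : C) j : wt j (gam x) = (wpoly Ps j).[s (gam x)].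
  rewrite /weight /wpoly horner_prod big_nat [RHS]big_nat; apply: eq_bigr => l /andP[_ lk].
  by case: (v l); rewrite ?hornerC // on_t.
pose Z : vfield D := fZ st.
have vZ : is_vfield U Z.
  have := vfield_comb gG (st := st) 1 1 (@subset_refl D U) vX vN; congr is_vfield.
  by apply/funext => y; apply/funext => f; rewrite !mul1r.
have Ztk x : U x -> Z x (t k) = 1.
  by move=> Ux; rewrite /Z /fZ (fr_AB (st_frame st) Ux) (fr_BB (st_frame st) Ux) add0r.
have Zt (x : C) j : (j < k)%N -> Z (gam x) (t j) = (Ps j)^`().[s (gam x)].
  move=> jk; rewrite /Z /fZ (st_Xt jk (cUx x)) (st_Nt jk (cUx x)) addr0 on_wt dP // hornerM.
  by congr (_ * _); case: (v j.+1); rewrite ?hornerC // on_t.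
have Zw (x : C) : Z (gam x) (cw st) = PW^`().[s (gam x)].
  by rewrite /Z /fZ (st_Xw (s := st) (cUx x)) (st_Nw (s := st) (cUx x)) addr0 on_wt dPW.
have rt x j : U x -> (j <= k)%N -> regular_at x (t j) by move=> Ux jk; exact: (st_t jk Ux).
have rs x : U x -> regular_at x s.
  by move=> Ux; apply: (reg_sub gG (tU Ux)); [exact: rt|exact: (reg_cst gG (tU Ux))].
have ds x (u : tvec D) : U x -> is_tangent x u -> u s = u (t k).
  move=> Ux tu; rewrite (tangentB gG (tU Ux) tu); [|exact: rt|exact: (reg_cst gG (tU Ux))].
  by rewrite (tangent_cst gG (tU Ux) _ tu) subr0.
have nVx x : U x -> V0 (phi x) -> around x (fun y => U y /\ V0 (phi y)).
  move=> Ux Vx; apply: (aroundI (tU Ux) (nU Ux)).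
  by apply: (patch_pull pU Ux (Q := V0)); exists V0; split.
(* Z is tangent to the curve: Z s = 1, and the polynomials were chosen so that Z t_j = P_j'(s) and Z
   w = PW'(s) on it. *)
have Zg (x : C) i : Z (gam x) (fun y => gg i (phi y)) = 0.
  have Ux := cUx x; have tx := tU Ux; have [tZ _] := vZ _ Ux.
  have rF := patch_regF gG pU Ux (rgV _ i (cVx x)).
  have nv := nVx _ Ux (cVx x).
  case: (split_ordP i) => j ej.
    rewrite (tangent_ext (g := fun=> 0) tx tZ rF); first exact: (tangent_cst gG tx).
    apply: (around_sub nv) => y [Uy Vy]; rewrite ej /gg (unsplitK (inl j)).
    by have [_ [h _]] := hV0 _ Vy; apply: h.1; exists y.
  have key (f : D -> K) (Q : {poly K}) : regular_at (gam x) f ->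
      around (gam x) (fun y => gg i (phi y) = f y - Q.[s y]) ->
      Z (gam x) f = Q^`().[s (gam x)] -> Z (gam x) (fun y => gg i (phi y)) = 0.
    move=> rf e hf; rewrite (tangent_ext tx tZ rF e) (tangentB gG tx tZ rf); last exact: (reg_horner _ tx (rs _ Ux)).
    by rewrite (tangent_horner _ tx tZ (rs _ Ux)) hf (ds _ _ Ux tZ) Ztk // mulr1 subrr.
  case jk : (j < k)%N.
    apply: (key (t j) (Ps j)); [by apply: rt => //; exact: ltnW| |exact: Zt].
    apply: (around_sub nv) => y [Uy Vy]; have [_ h] := near_eq _ Uy Vy.
    by rewrite ej /gg (unsplitK (inr j)) jk /Sz /s -!h // ltnW.
  apply: (key (cw st) PW); [exact: (st_w Ux)| |exact: Zw].
  apply: (around_sub nv) => y [Uy Vy]; have [hw h] := near_eq _ Uy Vy.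
  by rewrite ej /gg (unsplitK (inr j)) jk /Sz /s -hw -h.
have mC : manifold (G := G) 1 C.
  exact: (curve_manifold gG zG sG inj oV0 rgV rSV ginjV imgV).
pose d := curve_field (U := U) (phi := phi) (V0 := V0) (g := gg) Z : vfield C.
have vd : is_vfield setT d := curve_field_vfield gG zG pU oV0 rgV rSV ginjV imgV vZ Zg.
have dE (x : C) f : regular_at (gam x) f -> d x (f \o gam) = Z (gam x) f.
  exact: (curve_fieldE gG zG pU oV0 rgV rSV ginjV imgV vZ Zg).
have greg (x : C) a : regular_at (gam x) a -> regular_at x (a \o gam).
  exact: (curve_incl_reg pU).
have gnear (x : C) Q : around (gam x) Q -> around x (fun y => Q (gam y)).
  exact: (curve_incl_near pU).
have tC (x : C) : tame (G := G) x := curve_tame gG x.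
have nC (x : C) : around x (setT : set C) := aroundT (tC x).
exists C, t0, gam; split.
- split => //; first exact: (curve_incl_morphism gG pU).
  + move=> x u tu; have Ux := cUx x; have tx := tU Ux.
    have tpu : is_tangent (gam x) (push gam x u) := curve_push_tangent gG pU tu.
    have pE f : regular_at (gam x) f -> push gam x u f = u (f \o gam).
      by move=> rf; rewrite /push; case: asboolP.
    pose e := push gam x u (t k); have [tZ _] := vZ _ Ux.
    have us : u (s \o gam) = e by rewrite -(pE s (rs _ Ux)) (ds _ _ Ux tpu).
    have uf (f : D -> K) (Q : {poly K}) : regular_at (gam x) f -> (forall y : C, f (gam y) = Q.[s (gam y)]) ->
        push gam x u f = Q^`().[s (gam x)] * e.
      move=> rf ef; rewrite (pE f rf).
      have -> : f \o gam = fun y => Q.[(s \o gam) y] by apply/funext => y; rewrite /= ef.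
      by rewrite (tangent_horner _ (tC x) tu) ?us //; apply: greg; exact: rs.
    (* By [st_det] a tangent vector is known from its values on w and the t_j, so each velocity is e
       Z with e its value on t_k, in particular a combination of X and N. *)
    have dz : (fun f => 1 * push gam x u f + - e * Z (gam x) f) = tzero (X := D).
      apply: (st_det Ux (tangent_comb2 1 (- e) tpu tZ)).
        by rewrite (uf _ PW (st_w Ux) on_w) Zw; ring.
      move=> j; rewrite leq_eqVlt => /orP[/eqP ->|jk]; first by rewrite Ztk // -/e; ring.
      by rewrite (uf _ (Ps j) (rt _ _ Ux (ltnW jk))) ?Zt //; [ring|move=> y; rewrite on_t // ltnW].
    apply/(fr_fibre (st_frame st) _ Ux); exists e, e; apply/funext => f.
    have := congr1 (fun w => w f) dz; rewrite /tzero /Z /fZ mul1r mulNr => /eqP.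
    by rewrite subr_eq0 => /eqP ->; ring.
  + have [td _] := vd t0 I; exists (d t0); split => // h.
    have := congr1 (fun w => w (t k)) h.
    rewrite /push; case: asboolP => [r|]; last by case; exact: rt.
    by rewrite dE // Ztk // => /eqP; rewrite oner_eq0.
move=> f n; elim: n f => [|n ih] f cc.
  by move=> [rf <-] /(in_max_val (ltn0Sn 0)).
move=> [rf f0 hl] hm; have := ih (fun y => X y f + N y f) _ hl.
have hd : in_max_power t0 n.+1 (fun x => d x (f \o gam)).
  by apply: (in_max_deriv gG (tC t0) (fun y _ => tC y) (nC t0) vd).
move=> /(_ _)/eqP; rewrite mulf_eq0 (negPf (char0 gG n)) /= => h.
apply/eqP; apply: h; apply: (in_max_ext (tC t0) _ hd).
by apply: (around_sub (gnear t0 _ (reg_open tp rf))) => y ry; rewrite dE.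
Qed.

Lemma generic_curve : exists (C : fspace K) (t0 : C) (gam : C -> D), focal_curve p t0 gam /\
    forall f n c, lead p X N n f c -> in_max_power t0 n.+1 (f \o gam) -> c = 0.
Proof.
have [c [Gam [W [T [en [rG nG] [rW nW] rT inj]]]]] := st_image st.
exact: (generic_curve_aux en (st_coords st) (st_inj (s := st)) rG nG rW nW rT inj).
Qed.

End Focal.

(** * Vertical orders *)

Lemma leastE (A : set nat) m : A m -> (forall m', A m' -> (m <= m')%N) -> least A = m.
Proof.
move=> Am h; apply: xget_unique; first by split.
by move=> y [Ay hy]; apply/eqP; rewrite eqn_leq hy //= h.
Qed.

Lemma index_iota_cat m n r : (m <= n)%N -> (n <= r)%N -> index_iota m r = index_iota m n ++ index_iota n r.
Proof.
move=> mn nr; rewrite /index_iota; have -> : (r - m = (n - m) + (r - n))%N by lia.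
by rewrite iotaD subnKC.
Qed.

Section VerticalOrder.
Variable (G : geometry).
Hypothesis gG : good G.
Hypothesis zG : regular_zeros G.
Hypothesis sG : small_subspaces G.
Local Notation K := (scalars G).
Variables (S : fspace K) (k : nat) (p : monster S k) (st : stage p).
Local Notation D := (monster S k).
Local Notation U := (dom st).
Local Notation X := (fX st).
Local Notation N := (fN st).
Local Notation t := (ct st).
Local Notation v := (vert st).
Let Up : U p := st_p st.
Let tU x : U x -> tame (G := G) x := @patch_tame G gG _ _ _ _ (st_coords st) x.
Let tp := tU Up.
Let nU : forall x, U x -> around x U := @patch_self G gG _ _ _ _ (st_coords st).

Section Pullback.
Variables (C : fspace K) (t0 : C) (gam : C -> D).
Hypothesis fgam : focal_curve p t0 gam.

Lemma focal_near Q : around p Q -> around t0 (fun y => Q (gam y)).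
Proof.
have [_ [mo1 _] gp _ _] := fgam; rewrite -gp => -[V [oV Vx VQ]].
by exists (gam @^-1` V); split=> [||y /VQ //]; [exact: mo1|].
Qed.

Lemma focal_reg f : regular_at p f -> regular_at t0 (f \o gam).
Proof. by have [_ [_ mo2] gp _ _] := fgam; rewrite -gp; exact: mo2. Qed.

Lemma focal_tame : tame (G := G) t0.
Proof.
have [mC _ _ _ _] := fgam; have [W [s [d pa]]] := uniformizer_ex gG t0 mC.
exact: (pa_tame pa (around_self (pa_U pa))).
Qed.

(* The velocity of a focal curve is a X + b N, so the derivative of f \o gam is a
   combination of X f and N f along the curve. *)
Lemma focal_vanish n f : vanish p X N n f -> in_max_power t0 n (f \o gam).
Proof.
have [mC _ gp hf _] := fgam; have [W [s [d pa]]] := uniformizer_ex gG t0 mC.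
have Wt := around_self (pa_U pa); have tt := pa_tame pa Wt.
have nW : around t0 (fun y => W y /\ U (gam y)).
  exact: (aroundI tt (pa_U pa) (focal_near (nU Up))).
suff key m g : vanish p X N m g -> exists h, regular_at t0 h /\ around t0 (fun y => g (gam y) = s y ^+ m * h y).
  move=> /key[h [rh e]]; have hm := in_max_exp gG tt n (pa_reg pa Wt) (pa_s0 pa) rh.
  by apply: (in_max_ext tt _ hm); apply: (around_sub e) => y /= ->.
elim: m g => [|m ih] g.
  move=> rg; exists (g \o gam); split; first exact: focal_reg.
  by apply: (around_sub (aroundT tt)) => y _; rewrite mul1r.
move=> [rg g0 hX hN].
have [hx [rx ex]] := ih _ hX; have [hn [rn en]] := ih _ hN.
pose al y := d y (dX st \o gam); pose be y := d y (t k \o gam).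
have fr := st_frame st.
have [_ rd] := pa_d pa Wt.
apply: (uniformizer_prim gG pa (f := g \o gam) (u := fun y => al y * hx y + be y * hn y)).
- exact: focal_reg.
- by rewrite /= gp.
- apply: (reg_add gG tt); apply: (reg_mul gG tt) => //; apply: rd; apply: focal_reg.
    exact: (fr_fA fr Up).
  exact: (fr_fB fr Up).
have nrg := focal_near (reg_open tp rg).
apply: (around_sub (aroundI tt nW (aroundI tt nrg (aroundI tt ex en)))) => y [[Wy Uy] [rgy [exy eny]]].
have [td _] := pa_d pa Wy.
have [a [b e]] := (fr_fibre fr (push gam y (d y)) Uy).1 (hf y _ td).
have pE g' : regular_at (gam y) g' -> d y (g' \o gam) = a * X (gam y) g' + b * N (gam y) g'.
  by move=> rg'; have := congr1 (fun w => w g') e; rewrite /push; case: asboolP.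
have -> : al y = a.
  by rewrite /al pE ?(fr_AA fr Uy) ?(fr_BA fr Uy) ?mulr1 ?mulr0 ?addr0 //; exact: (fr_fA fr Uy).
have -> : be y = b.
  by rewrite /be pE ?(fr_AB fr Uy) ?(fr_BB fr Uy) ?mulr1 ?mulr0 ?add0r //; exact: (fr_fB fr Uy).
by rewrite pE // exy eny; ring.
Qed.

Lemma focal_associate n f a g : regular_at p g -> around p (fun x => a x = g x * f x) ->
  in_max_power t0 n (f \o gam) -> in_max_power t0 n (a \o gam).
Proof.
move=> rg e h; apply: (in_max_ext focal_tame _ (in_max_mull gG focal_tame (focal_reg rg) h)).
by apply: (around_sub (focal_near e)) => y /= ->.
Qed.

End Pullback.

(** Every focal curve meets f to order at least n by [focal_vanish], and the integral curve of X + N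
    meets it to order exactly n. Stated for an associate a of f because [VO] admits every local
    equation. *)
Lemma focal_order_sharp n f a g g' : sharp p X N n f -> regular_at p g -> regular_at p g' ->
  around p (fun x => a x = g x * f x) -> around p (fun x => f x = g' x * a x) ->
  focal_order p a = n.
Proof.
move=> [vf [c c0 lf]] rg rg' e e'; apply: leastE.
  have [C [t0 [gam [fgam hgam]]]] := generic_curve gG st zG sG.
  exists C, t0, gam; split => //; split.
    exact: (focal_associate fgam rg e (focal_vanish fgam vf)).
  move=> h; move/eqP: c0; apply; apply: hgam lf _.
  exact: (focal_associate fgam rg' e' h).
move=> m [C [t0 [gam [fgam [_ hm]]]]]; rewrite leqNgt; apply/negP => mn; apply: hm.
apply: (in_max_le mn); exact: (focal_associate fgam rg e (focal_vanish fgam vf)).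
Qed.

(** t_j is a coordinate of affine space, so F minus its restriction to t_j = 0 is divisible by it.
    By [st_repl] the point with this coordinate set to 0 is still in the domain, where it lies on
    I_j; hence the restriction is 0. *)
Lemma local_equation_coord j : (1 < j <= k)%N -> v j -> local_equation p (infinity j) (t j).
Proof.
move=> hj vj; have [_ /(_ vj)[tj0 hI]] := st_inf st hj; have [j1 jk] := andP hj.
have rt := st_t jk Up; split => //.
  by apply: (around_sub (nU Up)) => x Ux /hI; exact.
move=> f rf hf; have [|l [hl hr]] := @st_repl _ _ _ _ st j; first by rewrite (ltnW j1).
have pU := st_coords st; have [F [rF eF]] := (patch_reg pU _ Up).1 rf.
pose z := coord st p; have tz := aff_tame gG z.
have zl : z 0 l = 0 by rewrite /z hl.
have [Q [rQ eQ]] := aff_div gG zl rF.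
have [P [nP hP]] := (patch_near pU _ Up).1 (aroundI tp hf eF).
have nP' := near_setc gG zl nP.
exists (fun x => Q (coord st x)); split; first exact: (patch_regF gG pU Up rQ).
apply: (around_sub (aroundI tp (nU Up) (aroundI tp eF (aroundI tp (patch_pull pU Up nP') (patch_pull pU Up eQ))))).
move=> x [Ux [-> [Px eQx]]]; have [x' [Ux' ex']] := hr _ Ux.
rewrite -ex' in Px eQx; have [h1 h2] := hP _ Ux' Px.
have tx' : t j x' = 0 by rewrite -hl // ex' mxE eqxx.
have := h1 ((hI _ Ux').2 tx'); rewrite h2 => F0.
by move: eQx; rewrite F0 subr0 hl // mulrC.
Qed.

Variable nn : nat -> nat.
Hypothesis hnn : forall j, (j <= k)%N -> sharp p X N (nn j) (t j).

(** Two local equations divide each other, so all of them have the focal order of t_j. *)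
Lemma VO_coord j : (1 < j <= k)%N -> VO p j = if v j then nn j else 0%N.
Proof.
move=> hj; have [hv _] := st_inf st hj; rewrite /VO; case: asboolP => hi; last first.
  by case: ifP => // /hv.
have vj := hv.2 hi; rewrite vj; have le := local_equation_coord hj vj.
have [rt zt gt] := le; have jk : (j <= k)%N by case/andP: hj.
have key a : local_equation p (infinity j) a -> focal_order p a = nn j.
  move=> [ra za ga]; have [g [rg eg]] := gt _ ra za; have [g' [rg' eg']] := ga _ rt zt.
  exact: (focal_order_sharp (hnn jk) rg rg' eg eg').
apply: xget_unique; first by exists (t j); rewrite key.
by move=> n [a [ha ->]]; exact: key.
Qed.

Hypothesis k0 : (0 < k)%N.
Local Notation bv := (bv st nn).

Lemma bv_sum i : (1 < i <= k.+1)%N -> (bv i)%:Z = i%:Z +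
  \sum_(k + 4 - i <= j < k.+1) (i%:Z + j%:Z - k%:Z - 3%:Z) * (VO p j)%:Z.
Proof.
case: i => // i; elim: i => // i ih /andP[_ ik]; case: i ih ik => [|i] ih ik.
  by rewrite bv2 big_geq ?addr0 //; lia.
rewrite bvS // -addn1 !PoszD ih; last by lia.
have eV j : (1 < j <= k)%N -> (if v j then nn j else 0%N) = VO p j by move=> hj; rewrite VO_coord.
have -> : wo st nn (k.+2 - i.+2) = (\sum_(k.+3 - i.+2 <= l < k.+1) VO p l)%N.
  by rewrite /wo -subSn; [apply: eq_big_nat => l hl; rewrite eV //; lia|lia].
have -> : (\sum_(k.+3 - i.+2 <= l < k.+1) VO p l)%N%:Z = \sum_(k + 4 - i.+3 <= l < k.+1) (VO p l)%:Z.
  rewrite (big_morph Posz PoszD erefl); have -> // : (k.+3 - i.+2 = k + 4 - i.+3)%N by lia.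
(* The additional index at the lower end has coefficient 0, so both sums may run over the same
   range, in which the step raises every coefficient by one. *)
have -> : \sum_(k + 4 - i.+2 <= j < k.+1) (i.+2%:Z + j%:Z - k%:Z - 3%:Z) * (VO p j)%:Z =
   \sum_(k + 4 - i.+3 <= j < k.+1) (i.+2%:Z + j%:Z - k%:Z - 3%:Z) * (VO p j)%:Z.
  have [->|i0] := posnP i; first by rewrite !big_geq //; lia.
  rewrite [RHS]big_ltn; last by lia.
  have e : (k + 4 - i.+3).+1 = (k + 4 - i.+2)%N by lia.
  have -> : i.+2%:Z + (k + 4 - i.+3)%N%:Z - k%:Z - 3%:Z = 0 by lia.
  by rewrite mul0r add0r e.
rewrite [in RHS](eq_bigr (fun j => (i.+2%:Z + j%:Z - k%:Z - 3%:Z) * (VO p j)%:Z + (VO p j)%:Z)).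
  by rewrite big_split /=; do 2!move: (\sum_(_ <= _ < _) _) => ?; lia.
by move=> j _; nia.
Qed.

Lemma e_num_eq0 h i : (1 < i <= k.+1)%N -> (e_num p h i == 0) = (bv i <= h)%N.
Proof. by move=> hi; have := bv_sum hi; rewrite /e_num; move: (\sum_(_ <= _ < _) _) => F; lia. Qed.

Lemma count_bv_prefix m h : (0 < m <= k.+1)%N ->
  (forall n, (1 < n <= m)%N -> (bv n <= h)%N) -> (forall n, (m < n <= k.+1)%N -> (h < bv n)%N) ->
  count (fun n => (bv n <= h)%N) (index_iota 2 k.+2) = m.-1.
Proof.
move=> hm h1 h2; rewrite (@index_iota_cat 2 m.+1) ?count_cat; [|lia..].
rewrite (eq_in_count (a2 := predT)); last by move=> n; rewrite mem_index_iota => hn; rewrite h1.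
rewrite [X in (_ + X)%N](eq_in_count (a2 := pred0)).
  by rewrite count_predT count_pred0 size_iota; lia.
by move=> n; rewrite mem_index_iota => hn; apply/negbTE; rewrite -ltnNge h2.
Qed.

Lemma SG_bv i : (1 < i <= k.+1)%N -> SG p (bv i) = i.+1.
Proof.
move=> hi; have := bv_ge st nn (n := i); case/andP: (hi) => -> ik /(_ isT) b.
have e : bv i = (bv i).-1.+1 by lia.
rewrite e (SG_formula gG k0 hnn) -e (count_bv_prefix (m := i)); [lia|lia| |].
  move=> n hn; have [->|ne] := eqVneq n i; first by [].
  by apply: ltnW; apply: bv_lt; lia.
by move=> n hn; apply: bv_lt; lia.
Qed.

Lemma SG_small i h : (0 < h)%N -> (1 < i <= k.+1)%N -> (h < bv i)%N -> (SG p h <= i)%N.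
Proof.
case: h => // h _ hi hb; rewrite (SG_formula gG k0 hnn).
rewrite (@index_iota_cat 2 i) ?count_cat; [|lia..].
rewrite [count _ (index_iota i _)](eq_in_count (a2 := pred0)).
  have := count_size (fun n => (bv n <= h.+1)%N) (index_iota 2 i).
  by rewrite count_pred0 size_iota; lia.
move=> n; rewrite mem_index_iota => hn; apply/negbTE; rewrite -ltnNge.
apply: leq_trans hb _; have [->|ne] := eqVneq n i; first by [].
by apply: ltnW; apply: bv_lt; lia.
Qed.

Lemma small_growth_counts : (forall h : nat, (2 <= h)%N ->
     SG p h = (2 + count (fun i => e_num p h i == 0%R)
                     (index_iota 2 (minn h k.+1).+1))%N) /\
  (forall i : nat, (2 <= i <= k.+1)%N -> beta p i.+1 = b_num p i).
Proof.
split=> [h h2|i hi].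
  have e : h = h.-1.+1 by lia.
  rewrite [in LHS]e (SG_formula gG k0 hnn) -e; congr (2 + _)%N.
  (* Indices above h contribute nothing, because n <= bv n. *)
  rewrite (@index_iota_cat 2 (minn h k.+1).+1) ?count_cat; [|lia..].
  rewrite [count _ (index_iota (minn _ _).+1 _)](eq_in_count (a2 := pred0)) ?count_pred0 ?addn0.
    apply: eq_in_count => n; rewrite mem_index_iota => hn; rewrite e_num_eq0 //; lia.
  move=> n; rewrite mem_index_iota => hn; apply/negbTE; have := bv_ge st nn (n := n); lia.
have bi : (i <= bv i)%N by apply: bv_ge; case/andP: hi.
have -> : beta p i.+1 = bv i.
  apply: leastE; first by split; [lia|exact: SG_bv].
  move=> h [h0 hS]; rewrite leqNgt; apply/negP => hb.
  by have := SG_small h0 hi hb; rewrite hS ltnn.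
apply/esym/leastE; first by split => //; apply/eqP; rewrite e_num_eq0.
by move=> h [_ /eqP]; rewrite e_num_eq0.
Qed.

End VerticalOrder.

Theorem small_growth (G : geometry) (gG : good G) (zG : regular_zeros G) (sG : small_subspaces G)
    (S : fspace (scalars G)) (hS : manifold (G := G) 2 S) (k : nat) (k0 : (0 < k)%N) (p : monster S k) :
  (forall h : nat, (2 <= h)%N ->
     SG p h = (2 + count (fun i => e_num p h i == 0%R)
                     (index_iota 2 (minn h k.+1).+1))%N) /\
  (forall i : nat, (2 <= i <= k.+1)%N -> beta p i.+1 = b_num p i).
Proof.
have [st] := stage_ex gG hS p; have [nn hnn] := coord_order_ex gG st k0.
exact: (small_growth_counts gG zG sG hnn k0).
Qed.

(** * The algebraic category *)

Section AlgebraicGeometry.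
Import mpoly.

(** * Ideals and the Hilbert basis theorem *)

Section Ideals.
Variable R : comNzRingType.
Implicit Types I J : R -> Prop.

Definition ideal I := [/\ I 0, forall x y, I x -> I y -> I (x + y) & forall a x, I x -> I (a * x)].

(** The generated ideal as the intersection of all ideals containing s, so that a consequence of
    membership is proved by naming one ideal. *)
Definition ispan (s : seq R) (x : R) := forall I, ideal I -> (forall y, y \in s -> I y) -> I x.

Lemma ispan_ideal s : ideal (ispan s).
Proof.
split; first by move=> I [].
- by move=> x y hx hy I iI sI; have [_ h _] := iI; apply: h; [exact: hx|exact: hy].
- by move=> a x hx I iI sI; have [_ _ h] := iI; apply: h; exact: hx.
Qed.

Lemma ispan_mem s x : x \in s -> ispan s x. Proof. by move=> xs I _; apply. Qed.

Lemma ideal_opp I x : ideal I -> I x -> I (- x).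
Proof. by move=> [_ _ h] /(h (-1)); rewrite mulN1r. Qed.

Lemma ideal_sum I (T : Type) (s : seq T) (P : pred T) (f : T -> R) : ideal I ->
  (forall i, P i -> I (f i)) -> I (\sum_(i <- s | P i) f i).
Proof. by move=> [h0 hD _] h; elim/big_ind: _. Qed.

Lemma ispan_sum s x : ispan s x -> exists c : nat -> R, x = \sum_(i < size s) c i * s`_i.
Proof.
move=> /(_ (fun x => exists c : nat -> R, x = \sum_(i < size s) c i * s`_i)); apply.
  split; first by exists (fun=> 0); rewrite big1 // => i _; rewrite mul0r.
  - move=> _ _ [c ->] [c' ->]; exists (fun i => c i + c' i); rewrite -big_split /=.
    by apply: eq_bigr => i _; rewrite mulrDl.
  - move=> a _ [c ->]; exists (fun i => a * c i); rewrite mulr_sumr.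
    by apply: eq_bigr => i _; rewrite mulrA.
move=> y ys; exists (fun i => (i == index y s)%:R).
have h : (index y s < size s)%N by rewrite index_mem.
rewrite (bigD1 (Ordinal h)) //= eqxx mul1r nth_index // big1 ?addr0 // => i.
by rewrite -val_eqE /= => /negPf ->; rewrite mul0r.
Qed.

Definition noetherian := forall I, ideal I -> exists2 s : seq R, (forall y, y \in s -> I y) &
  forall x, I x -> ispan s x.

End Ideals.

Lemma noetherian_surj (R S : comNzRingType) (f : {rmorphism R -> S}) :
  (forall y, exists x, f x = y) -> noetherian R -> noetherian S.
Proof.
move=> sf nR I iI; have [h0 hD hM] := iI.
have [|s sI hs] := nR (fun x => I (f x)).
  split; first by rewrite rmorph0.
  - by move=> x y; rewrite rmorphD; exact: hD.
  - by move=> a x; rewrite rmorphM; exact: hM.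
exists (map f s); first by move=> y /mapP[x xs ->]; exact: sI.
move=> y; have [x <-] := sf y => /hs h J [j0 jD jM] sJ.
apply: (h (fun x => J (f x))).
  split; first by rewrite rmorph0.
  - by move=> u v; rewrite rmorphD; exact: jD.
  - by move=> u v; rewrite rmorphM; exact: jM.
by move=> u us; apply: sJ; apply: map_f.
Qed.

Lemma noetherian_field (K : fieldType) : noetherian K.
Proof.
move=> I [h0 hD hM]; have [[x [Ix x0]]|h] := pselect (exists x, I x /\ x != 0).
  exists [:: x]; first by move=> y; rewrite inE => /eqP ->.
  move=> y _ J [_ _ jM] /(_ x (mem_head _ _)) Jx.
  by rewrite -(divfK x0 y); exact: jM.
exists [::] => // x Ix J [j0 _ _] _; have [->//|x0] := eqVneq x 0.
by case: h; exists x.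
Qed.

Section Hilbert.
Variable R : comNzRingType.
Hypothesis nR : noetherian R.

(** Hilbert's argument: L d collects the coefficients in degree d of the members of I of degree at
    most d. These ideals increase with d, so finite generation of their union gives a D beyond which
    nothing new appears, and generators in degrees up to D suffice. *)
Lemma noetherian_poly : noetherian {poly R}.
Proof.
move=> I iI; have [h0 hD hM] := iI.
pose L d a := exists f, [/\ I f, (size f <= d.+1)%N & f`_d = a].
have L_ideal J d : @ideal {poly R} J -> ideal (fun a => exists f, [/\ J f, (size f <= d.+1)%N & f`_d = a]).
  move=> [j0 jD jM]; split; first by exists 0; rewrite size_poly0 coef0.
  - move=> _ _ [f [If sf <-]] [g [Ig sg <-]]; exists (f + g); split; [exact: jD| |by rewrite coefD].
    by apply: leq_trans (size_polyD _ _) _; rewrite geq_max sf.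
  - move=> a _ [f [If sf <-]]; exists (a%:P * f); split; [exact: jM| |by rewrite coefCM].
    by rewrite mul_polyC; apply: leq_trans (size_scale_leq _ _) _.
have LS d a : L d a -> L d.+1 a.
  move=> [f [If sf fa]]; exists ('X * f); split; first exact: hM.
    by rewrite mulrC; apply: leq_trans (size_polyMleq _ _) _; rewrite size_polyX addn2.
  by rewrite coefXM.
have Lle d e a : (d <= e)%N -> L d a -> L e a.
  by move=> /subnK <-; elim: (e - d)%N => // j ih /ih /LS.
have [|s sL hs] := nR (I := fun a => exists d, L d a).
  split; first by exists 0%N; have [] := L_ideal I 0%N iI.
  - move=> x y [d hx] [e hy]; exists (maxn d e); have [_ h _] := L_ideal I (maxn d e) iI.
    by apply: h; [exact: Lle (leq_maxl _ _) hx|exact: Lle (leq_maxr _ _) hy].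
  - by move=> a x [d hx]; exists d; have [_ _ h] := L_ideal I d iI; exact: h.
have [D hD'] : exists D, forall y, y \in s -> L D y.
  elim: s sL {hs} => [|y s ih] sL; first by exists 0%N.
  have [|D hD'] := ih; first by move=> z zs; apply: sL; rewrite inE zs orbT.
  have [e he] := sL y (mem_head _ _); exists (maxn D e) => z; rewrite inE => /orP[/eqP ->|zs].
    exact: Lle (leq_maxr _ _) he.
  exact: Lle (leq_maxl _ _) (hD' z zs).
have LD d a : L d a -> L D a.
  by move=> h; apply: (hs a _ (L D) (L_ideal I D iI)) => //; exists d.
have gens d : exists G : seq {poly R}, (forall f, f \in G -> I f) /\
    forall a, L d a -> exists f, [/\ ispan G f, (size f <= d.+1)%N & f`_d = a].
  have [t tL ht] := nR (L_ideal I d iI).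
  have [G [GI hG]] : exists G : seq {poly R}, (forall f, f \in G -> I f) /\
      forall y, y \in t -> exists f, [/\ f \in G, (size f <= d.+1)%N & f`_d = y].
    elim: t tL {ht} => [|y t ih] tL; first by exists [::].
    have [|G [GI hG]] := ih; first by move=> z zt; apply: tL; rewrite inE zt orbT.
    have [f [If sf fy]] := tL y (mem_head _ _).
    exists (f :: G); split; first by move=> g; rewrite inE => /orP[/eqP ->//|]; exact: GI.
    move=> z; rewrite inE => /orP[/eqP ->|/hG[g [gG sg gz]]].
      by exists f; rewrite mem_head.
    by exists g; rewrite inE gG orbT.
  exists G; split => // a /ht h; apply: h (L_ideal _ d (ispan_ideal G)) _.
  by move=> y /hG[f [fG sf fy]]; exists f; split => //; exact: ispan_mem.
have /choice[G hG] := gens.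
pose GG := flatten [seq G d | d <- iota 0 D.+1].
have GI f : f \in GG -> I f.
  by move=> /flattenP[_ /mapP[d _ ->]]; have [h _] := hG d; exact: h.
have sub d x : (d <= D)%N -> ispan (G d) x -> ispan GG x.
  move=> dD h; apply: h (ispan_ideal GG) _ => y yG; apply: ispan_mem.
  by apply/flattenP; exists (G d) => //; apply: map_f; rewrite mem_iota.
exists GG => // f If; have [n] := ubnP (size f); elim: n f If => // n ih f If.
rewrite ltnS => sf; have [gi0 giD giM] := ispan_ideal GG.
case: n ih sf => [|n] ih sf.
  by move: sf; rewrite leqn0 size_poly_eq0 => /eqP ->.
(* A combination of the generators with the same top coefficient as f; above degree D it is shifted
   by X^(n - D). *)
have [h [hI hs' hc]] : exists h, [/\ ispan GG h, (size h <= n.+1)%N & h`_n = f`_n].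
  have Ln : L n f`_n by exists f.
  have [nD|Dn] := leqP n D.
    by have [_ /(_ _ Ln)[h [hG' hsz hc]]] := hG n; exists h; split => //; exact: sub hG'.
  have [_ /(_ _ (LD _ _ Ln))[h [hG' hsz hc]]] := hG D.
  exists ('X^(n - D) * h); split; first by apply: giM; exact: sub hG'.
    apply: leq_trans (size_polyMleq _ _) _; rewrite size_polyXn addSn /=.
    by apply: leq_trans (leq_add (leqnn _) hsz) _; rewrite addnS subnK // ltnW.
  by rewrite coefXnM ltnNge leq_subr /= subKn // ltnW.
have -> : f = (f - h) + h by rewrite subrK.
have Ih : I h by apply: hI.
apply: giD => //; apply: ih; first by apply: hD => //; exact: ideal_opp.
rewrite ltnS; apply/leq_sizeP => j; rewrite leq_eqVlt => /orP[/eqP <-|nj].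
  by rewrite coefB hc subrr.
rewrite coefB (leq_sizeP _ _ sf) // (leq_sizeP _ _ hs') // subrr //.
Qed.

End Hilbert.

Section MorphEq.
Variables (n : nat) (R : comNzRingType) (S : comNzRingType).

Lemma mpoly_morph_eq (f g : {rmorphism {mpoly R[n]} -> S}) :
  (forall c, f c%:MP = g c%:MP) -> (forall i, f 'X_i = g 'X_i) -> f =1 g.
Proof.
move=> hc hX p; rewrite (mpolyE p) !rmorph_sum; apply: eq_bigr => m _ /=.
rewrite -mul_mpolyC !rmorphM hc; congr (_ * _).
rewrite mpolyXE_id !rmorph_prod; apply: eq_bigr => i _ /=.
by rewrite !rmorphXn hX.
Qed.

End MorphEq.

(** * Linear changes of variables *)

Section Change.
Variables (K : fieldType) (n : nat).
Local Notation A := {mpoly K[n]}.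
Local Notation B := {mpoly K[n.+1]}.
Variable lam : 'I_n -> K.

(** The last variable becomes X and each other x_j becomes x_j + lam_j X. For lam = 0 this views a
    polynomial as one in its last variable; general lam serves Noether normalization. *)
Definition linvar (i : 'I_n.+1) : {poly A} :=
  if unlift ord_max i is Some j then ('X_j)%:P + ((lam j)%:MP)%:P * 'X else 'X.

Definition shear : B -> {poly A} := mmap (polyC \o @mpolyC n K) linvar.
HB.instance Definition _ := GRing.RMorphism.on shear.

Definition unshear_coef : A -> B := mmap (@mpolyC n.+1 K)
  (fun j => 'X_(lift ord_max j) - (lam j)%:MP * 'X_ord_max).
HB.instance Definition _ := GRing.RMorphism.on unshear_coef.

Definition unshear : {poly A} -> B := horner_eval ('X_ord_max : B) \o map_poly unshear_coef.
HB.instance Definition _ := GRing.RMorphism.on unshear.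

Lemma shearC c : shear c%:MP = (c%:MP)%:P. Proof. exact: mmapC. Qed.
Lemma shearX i : shear 'X_i = linvar i. Proof. by rewrite /shear mmapX mmap1U. Qed.
Lemma unshear_coefC c : unshear_coef c%:MP = c%:MP. Proof. exact: mmapC. Qed.
Lemma unshear_coefX j : unshear_coef 'X_j = 'X_(lift ord_max j) - (lam j)%:MP * 'X_ord_max.
Proof. by rewrite /unshear_coef mmapX mmap1U. Qed.
Lemma unshearC a : unshear a%:P = unshear_coef a.
Proof. by rewrite /unshear /= /horner_eval map_polyC hornerC. Qed.
Lemma unshearX : unshear 'X = 'X_ord_max.
Proof. by rewrite /unshear /= /horner_eval map_polyX hornerX. Qed.

Lemma shearK p : unshear (shear p) = p.
Proof.
pose g : {rmorphism B -> B} := (unshear \o shear).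
apply: (@mpoly_morph_eq _ _ _ g idfun) => [c|i].
  by change (unshear (shear c%:MP) = c%:MP); rewrite shearC unshearC unshear_coefC.
change (unshear (shear 'X_i) = 'X_i); rewrite shearX /linvar; case: unliftP => [j ->|->]; last exact: unshearX.
by rewrite rmorphD rmorphM /= !unshearC unshearX unshear_coefX unshear_coefC subrK.
Qed.

Lemma unshearK f : shear (unshear f) = f.
Proof.
have hl a : shear (unshear_coef a) = a%:P.
  pose g : {rmorphism A -> {poly A}} := (shear \o unshear_coef).
  apply: (@mpoly_morph_eq _ _ _ g (@polyC A)) => [c|i].
    by change (shear (unshear_coef c%:MP) = (c%:MP)%:P); rewrite unshear_coefC shearC.
  change (shear (unshear_coef 'X_i) = ('X_i)%:P); rewrite unshear_coefX rmorphB rmorphM /= shearC !shearX /linvar.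
  by rewrite liftK unlift_none addrK.
elim/poly_ind: f => [|f c ih]; first by rewrite !rmorph0.
by rewrite !rmorphD !rmorphM /= ih unshearX shearX unshearC hl /linvar unlift_none.
Qed.

Definition evp (a : 'I_n -> K) : {poly A} -> {poly K} := map_poly (meval a).
HB.instance Definition _ a := GRing.RMorphism.on (evp a).

Lemma shear_eval (a : 'I_n -> K) (t : K) (p : B) :
  (evp a (shear p)).[t] =
  meval (fun i => if unlift ord_max i is Some j then a j + lam j * t else t) p.
Proof.
pose g : {rmorphism B -> K} := (horner_eval t \o (evp a \o shear)).
apply: (@mpoly_morph_eq _ _ _ g (meval _)) => [c|i].
  change ((evp a (shear c%:MP)).[t] = meval (fun i => if unlift ord_max i is Some j then a j + lam j * t else t) c%:MP).
  by rewrite shearC /evp map_polyC /= mevalC hornerC mevalC.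
change ((evp a (shear 'X_i)).[t] = meval (fun i => if unlift ord_max i is Some j then a j + lam j * t else t) 'X_i).
rewrite shearX mevalXU /linvar; case: (unlift ord_max i) => [j|]; last by rewrite /evp map_polyX hornerX.
rewrite rmorphD rmorphM /= /evp !map_polyC /= map_polyX hornerD hornerM !hornerC hornerX.
by rewrite mevalXU mevalC.
Qed.

Definition has_lead (q : {poly A}) d (c : A) := (size q <= d.+1)%N /\ q`_d = c.

Lemma has_leadM p q d e a b : has_lead p d a -> has_lead q e b -> has_lead (p * q) (d + e) (a * b).
Proof.
move=> [sp <-] [sq <-]; split.
  by apply: leq_trans (size_polyMleq _ _) _; rewrite -ltnS -addnS; case: (size p + size q)%N (leq_add sp sq) => //=; rewrite addSn addnS.
rewrite coefM (bigD1 (Ordinal (leq_addr e d : (d < (d + e).+1)%N))) //= addKn big1 ?addr0 // => i.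
rewrite -val_eqE /= => ne; case: (ltngtP i d) ne => // [id|di] _.
  by rewrite (leq_sizeP _ _ sq) ?mulr0 // ltn_subRL ltn_add2r.
by rewrite (leq_sizeP _ _ sp) ?mul0r.
Qed.

Lemma has_leadX p d a k : has_lead p d a -> has_lead (p ^+ k) (k * d) (a ^+ k).
Proof.
move=> h; elim: k => [|k ih]; first by rewrite !expr0; split; rewrite ?size_poly1 // coef1.
by rewrite !exprS mulSn; exact: has_leadM.
Qed.

Definition leadval (i : 'I_n.+1) : K := if unlift ord_max i is Some j then lam j else 1.

Lemma shear_monom (m : 'X_{1..n.+1}) :
  has_lead (mmap1 linvar m) (mdeg m) ((\prod_i leadval i ^+ m i)%:MP).
Proof.
have hl i : has_lead (linvar i) 1 ((leadval i)%:MP).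
  rewrite /linvar /leadval; case: (unlift ord_max i) => [j|]; last first.
    by split; rewrite ?size_polyX // coefX mpolyC1.
  split; last by rewrite coefD coefC coefMX coefC add0r.
  apply: leq_trans (size_polyD _ _) _; rewrite geq_max; apply/andP; split.
    by apply: leq_trans (size_polyC_leq1 _) _.
  apply: leq_trans (size_polyMleq _ _) _; rewrite size_polyX addn2 /= ltnS.
  exact: size_polyC_leq1.
rewrite /mmap1 mdegE rmorph_prod /=; elim/big_rec3: _ => [|i q d c _ h].
  by split; rewrite ?size_poly1 // coef1.
rewrite rmorphXn /=; apply: has_leadM h; have := has_leadX (m i) (hl i).
by rewrite muln1.
Qed.

(** Only monomials of top degree d reach X^d, and each contributes its value at the point (lam, 1):
    the coefficient is the top form of p at that point. *)
Lemma shear_lead (p : B) : has_lead (shear p) (msize p).-1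
  ((\sum_(m <- msupp p | mdeg m == (msize p).-1) p@_m * \prod_i leadval i ^+ m i)%:MP).
Proof.
have mle (m : 'X_{1..n.+1}) : m \in msupp p -> (mdeg m <= (msize p).-1)%N.
  by move=> /msize_mdeg_lt; case: (msize p).
split.
  rewrite /shear /mmap big_seq; apply: leq_trans (size_sum _ _ _) _.
  apply/bigmax_leqP_seq => m mp _; apply: leq_trans (size_polyMleq _ _) _ => /=.
  have [h _] := shear_monom m.
  rewrite -ltnS -[(_ + _).-1.+1]/(_).
  apply: leq_ltn_trans (_ : (_ <= (mdeg m).+1)%N) _; last by rewrite ltnS ltnS; exact: mle.
  have := size_polyC_leq1 ((p@_m)%:MP : A); case: (size _) => [|[|//]] _; rewrite ?add0n ?add1n //=.
  by apply: leq_trans (leq_pred _) _.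
rewrite /shear /mmap coef_sum rmorph_sum /= [RHS]big_mkcond /= !big_seq.
apply: eq_bigr => m mp; rewrite coefCM; have [h1 h2] := shear_monom m.
case: eqP => [<-|/eqP ne]; first by rewrite h2 -mpolyCM.
rewrite (leq_sizeP _ _ h1) ?mulr0 //.
by rewrite ltn_neqAle ne mle.
Qed.

End Change.

Section Noetherian.
Variable K : fieldType.

Lemma noetherian_mpoly n : noetherian {mpoly K[n]}.
Proof.
elim: n => [|n ih].
  pose f : {rmorphism K -> {mpoly K[0]}} := @mpolyC 0 K.
  apply: (@noetherian_surj K {mpoly K[0]} f _ (@noetherian_field K)) => y.
  exists (y@_0%MM); apply/mpolyP => m; rewrite mcoeffC.
  by have -> : m = 0%MM; [apply/mnmP; case|rewrite eqxx mulr1].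
pose f : {rmorphism {poly {mpoly K[n]}} -> {mpoly K[n.+1]}} := @unshear K n (fun=> 0).
apply: (@noetherian_surj {poly {mpoly K[n]}} {mpoly K[n.+1]} f _ (noetherian_poly ih)) => y.
by exists (shear (fun=> 0) y); exact: shearK.
Qed.

End Noetherian.

Lemma poly_widen (A : nzRingType) (f : {poly A}) d : (size f <= d)%N ->
  f = \sum_(j < d) (f`_j)%:P * 'X^j.
Proof.
move=> sf; rewrite -[LHS](_ : \poly_(j < d) f`_j = f).
  by rewrite poly_def; apply: eq_bigr => j _; rewrite mul_polyC.
apply/polyP => j; rewrite coef_poly; case: ltnP => // dj.
by rewrite nth_default //; apply: leq_trans dj.
Qed.

(* If f in J maps to 1, the remainders of the X^i f modulo g give a determinant
   that lies in J and is sent to 1. *)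
Lemma monic_elimination (A : comNzRingType) (K : fieldType) (phi : {rmorphism A -> K})
    (J : {poly A} -> Prop) (g : {poly A}) : ideal J -> J g -> g \is monic ->
  (forall a, J a%:P -> phi a = 0) -> ~ J 1 -> forall f, J f -> map_poly phi f <> 1.
Proof.
move=> iJ Jg gm hphi nJ f Jf fa; have [j0 jD jM] := iJ.
have sg : (0 < size g)%N by rewrite size_poly_gt0 monic_neq0.
have [d sgd] : exists d, size g = d.+1 by exists (size g).-1; rewrite prednK.
have gd : g`_d = 1 by have := monicP gm; rewrite lead_coefE sgd.
have gam : map_poly phi g \is monic by apply: monic_map.
have lca : phi (lead_coef g) != 0 by rewrite (monicP gm) rmorph1 oner_neq0.
have sga : size (map_poly phi g) = d.+1 by rewrite -sgd; exact: (size_map_poly_id0 lca).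
pose r (i : nat) := Pdiv.CommonRing.rmodp ('X^i * f) g.
pose M : 'M[A]_d := \matrix_(i, j) (r i)`_j.
have dq i : 'X^i * f = Pdiv.CommonRing.rdivp ('X^i * f) g * g + r i by exact: Pdiv.RingMonic.rdivp_eq.
have sr i : (size (r i) <= d)%N.
  by rewrite -ltnS -sgd; apply: Pdiv.CommonRing.ltn_rmodpN0; exact: monic_neq0.
have Jr i : J (r i).
  have -> : r i = 'X^i * f + (- Pdiv.CommonRing.rdivp ('X^i * f) g) * g.
    by rewrite {1}dq mulNr addrAC subrr add0r.
  by apply: jD; apply: jM.
have rE (i : 'I_d) : r i = \sum_j (M i j)%:P * 'X^j.
  by rewrite {1}(poly_widen (sr i)); apply: eq_bigr => j _; rewrite mxE.
have [d0|d0] := posnP d.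
  apply: nJ; suff -> : 1 = g by [].
  by rewrite (size1_polyC (eq_leq (etrans sgd (congr1 S d0)))) -d0 gd.
pose i0 : 'I_d := Ordinal d0.
have Jdet : J (\det M)%:P.
  (* Row [i0] of adj M times M is det M in column 0 and 0 elsewhere, so this combination of the
     remainders is the constant det M. *)
  have -> : (\det M)%:P = \sum_i (\adj M i0 i)%:P * r i.
    under eq_bigr => i _ do rewrite rE mulr_sumr.
    rewrite exchange_big /=.
    have e (j : 'I_d) : \sum_i (\adj M i0 i)%:P * ((M i j)%:P * 'X^j) = ((\det M) *+ (i0 == j))%:P * 'X^j.
      have := mul_adj_mx M => /matrixP /(_ i0 j); rewrite !mxE => <-.
      rewrite rmorph_sum mulr_suml; apply: eq_bigr => i _ /=.
      by rewrite polyCM mulrA.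
    rewrite (eq_bigr _ (fun j _ => e j)) (bigD1 i0) // eqxx mulr1n expr0 mulr1 big1 /=; first by rewrite addr0.
    by move=> j /negPf; rewrite eq_sym => ->; rewrite mulr0n polyC0 mul0r.
  by apply: ideal_sum => // i _; apply: jM.
have := hphi _ Jdet; rewrite -det_map_mx.
(* As f maps to 1, the image of the remainder r i is congruent to X^i modulo the image of g, which
   has degree d > i; hence both agree. *)
have -> : map_mx phi M = 1%:M.
  apply/matrixP => i j; rewrite !mxE -coef_map /=.
  have e1 : map_poly phi (r i) = 'X^i.
    have := congr1 (map_poly phi) (dq i).
    rewrite rmorphM /= fa mulr1 rmorphD rmorphM /= map_polyXn => e.
    have h : 'X^i %% map_poly phi g = map_poly phi (r i) %% map_poly phi g.
      by rewrite e modpD modp_mull add0r.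
    rewrite !modp_small ?sga ?size_polyXn ?ltnS // in h.
    by apply: leq_trans (size_poly _ _) (sr i).
  by rewrite e1 coefXn -val_eqE /= eq_sym.
by rewrite det1 => /eqP; rewrite oner_eq0.
Qed.

(** * Hilbert's Nullstellensatz *)

Section Null.
Variable K : closedFieldType.

Lemma closed_root (q : {poly K}) : (1 < size q)%N -> exists x, root q x.
Proof. by move=> sq; apply/closed_rootP; case: (size q) sq => [|[]]. Qed.

(** A nonzero element of least size divides all the others, and since it is no unit it has a
    root. *)
Lemma poly_ideal_root (I : {poly K} -> Prop) : ideal I -> ~ I 1 ->
  exists t, forall f, I f -> f.[t] = 0.
Proof.
move=> [i0 iD iM] nI.
have [[f [If f0]]|h] := pselect (exists f, I f /\ f != 0); last first.
  exists 0 => f If; have [->|f0] := eqVneq f 0; first by rewrite horner0.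
  by case: h; exists f.
have exm : exists N : nat, `[< exists q, [/\ I q, q != 0 & size q = N] >].
  by exists (size f); apply/asboolP; exists f.
have [N /asboolP[q [Iq q0 sq]] Nmin] := ex_minnP exm.
have [|t rt] := @closed_root q.
  rewrite ltnNge; apply/negP => sq1; apply: nI.
  have qc : q = (q`_0)%:P by exact: size1_polyC.
  have c0 : q`_0 != 0 by apply: contra_neq q0 => e; rewrite qc e.
  have <- : ((q`_0)^-1)%:P * q = 1 by rewrite [X in _ * X]qc -polyCM mulVf.
  exact: iM.
exists t => r Ir; have m0 : r %% q = 0.
  apply/eqP; apply: contraT => ne.
  have /Nmin : `[< exists q', [/\ I q', q' != 0 & size q' = size (r %% q)] >].
    apply/asboolP; exists (r %% q); split => //.
    have -> : r %% q = r + (- (r %/ q)) * q.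
      by rewrite {2}(divp_eq r q) mulNr addrAC subrr add0r.
    by apply: iD => //; apply: iM.
  by rewrite -sq leqNgt ltn_modp q0.
by rewrite (divp_eq r q) m0 addr0 hornerM (rootP rt) mulr0.
Qed.

Lemma poly_nonroot (q : {poly K}) : q != 0 -> exists x, q.[x] != 0.
Proof.
move=> q0; have [sq|sq] := leqP (size q) 1.
  by exists 0; rewrite (size1_polyC sq) hornerC -polyC_eq0 -size1_polyC.
have [|x] := @closed_root (q - 1%:P).
  by rewrite size_polyDl ?size_polyN ?size_polyC ?oner_neq0.
by rewrite rootE !hornerE subr_eq0 => /eqP e; exists x; rewrite e oner_neq0.
Qed.

Lemma mpoly_nonroot n (p : {mpoly K[n]}) : p != 0 -> exists v, meval v p != 0.
Proof.
elim: n p => [|n ih] p p0.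
  exists (fun=> 0); apply: contra_neq p0 => e; apply/mpolyP => m; rewrite mcoeff0 -e.
  rewrite mevalE; have -> : m = 0%MM by apply/mnmP; case.
  have pE : p = (p@_0)%:MP.
    apply/mpolyP => m'; rewrite mcoeffC.
    by have -> : m' = 0%MM; [apply/mnmP; case|rewrite eqxx mulr1].
  by rewrite -mevalE pE mevalC mcoeffC eqxx mulr1.
have s0 : shear (fun=> 0) p != 0.
  by apply: contra_neq p0 => e; rewrite -[p](shearK (fun=> 0)) e rmorph0.
have [k ck] : exists k, (shear (fun=> 0) p)`_k != 0.
  by exists (size (shear (fun=> 0) p)).-1; rewrite -/(lead_coef _) lead_coef_eq0.
have [a ha] := ih _ ck.
have e0 : evp a (shear (fun=> 0) p) != 0.
  by apply: contra_neq ha => e; rewrite -coef_map /= -/(evp a) e coef0.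
have [t ht] := poly_nonroot e0.
by exists (fun i => if unlift ord_max i is Some j then a j + 0 * t else t); rewrite -(shear_eval (fun=> 0)).
Qed.

(** Choose v at which the top form and the last coordinate are both nonzero; by homogeneity the top
    form is nonzero at v divided by its last coordinate, a point of the form (lam, 1). *)
Lemma mpoly_normalize n (p : {mpoly K[n.+1]}) : p != 0 ->
  exists lam : 'I_n -> K, exists2 c : K, c != 0 & has_lead (shear lam p) (msize p).-1 c%:MP.
Proof.
move=> p0; pose d := (msize p).-1.
pose h : {mpoly K[n.+1]} := \sum_(m <- msupp p | mdeg m == d) p@_m *: 'X_[m].
have h0 : h != 0.
  have ms : (0 < msize p)%N by rewrite lt0n msize_poly_eq0.
  have [m mp md] : exists2 m, m \in msupp p & mdeg m = d.
    exists (mlead p); first by rewrite mlead_supp.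
    by rewrite /d -mlead_deg.
  apply/eqP => /(congr1 (mcoeff m)); rewrite mcoeff0 /h raddf_sum /=.
  rewrite big_mkcond (bigD1_seq m) ?msupp_uniq //= md eqxx.
  rewrite mcoeffZ mcoeffX eqxx mulr1 big1 ?addr0; last first.
    by move=> m' ne; case: ifP => // _; rewrite mcoeffZ mcoeffX (negPf ne) mulr0.
  by apply/eqP; rewrite -mcoeff_msupp.
have [v hv] : exists v, meval v (h * 'X_ord_max) != 0.
  apply: mpoly_nonroot; rewrite mulf_neq0 //.
  by apply/eqP => /(congr1 (mcoeff U_(ord_max))); rewrite mcoeffXU mcoeff0 eqxx => /eqP; rewrite oner_eq0.
move: hv; rewrite mevalM mevalXU mulf_eq0 negb_or => /andP[hv vn].
exists (fun j => v (lift ord_max j) / v ord_max).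
exists (\sum_(m <- msupp p | mdeg m == (msize p).-1) p@_m *
  \prod_i leadval (fun j => v (lift ord_max j) / v ord_max) i ^+ m i); last exact: shear_lead.
have -> : \sum_(m <- msupp p | mdeg m == (msize p).-1) p@_m *
  \prod_i leadval (fun j => v (lift ord_max j) / v ord_max) i ^+ m i = meval v h / v ord_max ^+ d.
  rewrite /h raddf_sum /= mulr_suml; apply: eq_bigr => m /eqP md.
  rewrite mevalZ mevalX -mulrA; congr (_ * _).
  have lv i : leadval (fun j => v (lift ord_max j) / v ord_max) i = v i / v ord_max.
    by rewrite /leadval; case: unliftP => [j ->|->] //; rewrite divff.
  rewrite (eq_bigr (fun i => v i ^+ m i * (v ord_max)^-1 ^+ m i)); last by move=> i _; rewrite lv exprMn.
  by rewrite big_split /= prodrXr -mdegE md exprVn.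
by rewrite mulf_neq0 // invr_neq0 // expf_neq0.
Qed.

(** Induction on n. After normalization I contains an element monic in the last variable. The
    elements of I free of this variable have a common zero a by induction; over a the ideal stays
    proper by [monic_elimination], and a root of the resulting ideal in one variable is the last
    coordinate. *)
Lemma nullstellensatz_weak n (I : {mpoly K[n]} -> Prop) : ideal I -> ~ I 1 ->
  exists v, forall p, I p -> meval v p = 0.
Proof.
elim: n I => [|n ih] I iI nI; have [h0 hD hM] := iI.
  exists (fun=> 0) => p Ip; have pE : p = (p@_0)%:MP.
    apply/mpolyP => m'; rewrite mcoeffC.
    by have -> : m' = 0%MM; [apply/mnmP; case|rewrite eqxx mulr1].
  have [e|ne] := eqVneq (p@_0%MM) 0; first by rewrite pE e mevalC.
  case: nI; have := hM ((p@_0%MM)^-1)%:MP _ Ip.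
  by rewrite {2}pE -mpolyCM mulVf // mpolyC1.
have [[p [Ip p0]]|h] := pselect (exists p, I p /\ p != 0); last first.
  exists (fun=> 0) => p Ip; have [->|p0] := eqVneq p 0; first by rewrite meval0.
  by case: h; exists p.
have [lam [c c0 [gs gc]]] := mpoly_normalize p0.
pose J (q : {poly {mpoly K[n]}}) := I (unshear lam q).
have iJ : ideal J.
  split; rewrite /J; first by rewrite rmorph0.
  - by move=> x y; rewrite rmorphD; exact: hD.
  - by move=> a x; rewrite rmorphM; exact: hM.
have [j0 jD jM] := iJ.
have nJ : ~ J 1 by rewrite /J rmorph1.
pose g := (c^-1)%:MP%:P * shear lam p.
have Jg : J g by apply: jM; rewrite /J shearK.
have gd : g`_(msize p).-1 = 1 by rewrite coefCM gc -mpolyCM mulVf // mpolyC1.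
have sg : size g = (msize p).-1.+1.
  apply/eqP; rewrite eqn_leq; apply/andP; split.
    by rewrite /g mul_polyC; apply: leq_trans (size_scale_leq _ _) gs.
  rewrite ltnNge; apply/negP => /leq_sizeP /(_ _ (leqnn _)) /eqP.
  by rewrite gd oner_eq0.
set d := (msize p).-1 in gs gc gd sg.
have gm : g \is monic by rewrite monicE lead_coefE sg /= gd.
clearbody g.
have iI0 : ideal (fun a => J a%:P).
  split; first by rewrite polyC0.
  - by move=> x y hx hy; rewrite polyCD; exact: jD.
  - by move=> a x hx; rewrite polyCM; exact: jM.
have [a ha] := ih _ iI0 nJ.
pose Ja (q : {poly K}) := exists2 f, J f & evp a f = q.
have iJa : ideal Ja.
  split; first by exists 0; [exact: j0|exact: (rmorph0 (evp a))].
  - by move=> _ _ [f Jf <-] [f' Jf' <-]; exists (f + f'); [exact: jD|exact: (rmorphD (evp a))].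
  - move=> q _ [f Jf <-]; exists (map_poly (@mpolyC n K) q * f); first exact: jM.
    rewrite (rmorphM (evp a)); congr (_ * _); apply/polyP => i.
    by rewrite /evp !coef_map /= mevalC.
have [ja0 jaD jaM] := iJa.
have nJa : ~ Ja 1.
  by move=> [f Jf fa]; exact: (@monic_elimination _ _ (meval a) J g iJ Jg gm ha nJ f Jf fa).
have [t ht] := poly_ideal_root iJa nJa.
exists (fun i => if unlift ord_max i is Some j then a j + lam j * t else t) => r Ir.
have Jr : J (shear lam r) by rewrite /J shearK.
rewrite -shear_eval; apply: ht; exists (shear lam r); [exact: Jr|reflexivity].
Qed.

(** Rabinowitsch's trick without denominators. If 1 lies in J, then 1 - h (1 - r X) has coefficients
    in I, so h_i is congruent to r^i modulo I for all i; since h_i = 0 for large i, a power of r is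
    in I. Otherwise J has a zero by the weak form, at which r = 0 although r X = 1. *)
Lemma nullstellensatz n (I : {mpoly K[n]} -> Prop) (r : {mpoly K[n]}) : ideal I ->
  (forall v, (forall p, I p -> meval v p = 0) -> meval v r = 0) -> exists N, I (r ^+ N).
Proof.
move=> iI hr; have [h0 hD hM] := iI.
have hS x y : I x -> I y -> I (x - y) by move=> hx hy; apply: hD => //; exact: ideal_opp.
pose J (f : {poly {mpoly K[n]}}) := exists h, forall i, I (f - h * (1 - r%:P * 'X))`_i.
have iJ : ideal J.
  split; first by exists 0 => i; rewrite mul0r subr0 coef0.
  - move=> f g [h hh] [h' hh']; exists (h + h') => i.
    by rewrite mulrDl opprD addrACA coefD; exact: hD.
  - move=> f g [h hh]; exists (f * h) => i; rewrite -mulrA -mulrBr coefM.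
    by apply: ideal_sum => // j _; exact: hM.
have [[h hh]|nJ] := pselect (J 1).
  have e i : I (h`_i - r ^+ i).
    elim: i => [|i ih].
      have := ideal_opp iI (hh 0%N); congr I.
      by rewrite mulrBr mulr1 !(coefD, coefN) mulrA coefMX coef1 expr0 /= oppr0 addr0 opprB.
    have := hD _ _ (ideal_opp iI (hh i.+1)) (hM r _ ih); congr I.
    rewrite mulrBr mulr1 !(coefD, coefN) mulrA coefMX coef1 /= coefMC exprS; ring.
  exists (size h); have := ideal_opp iI (e (size h)).
  by rewrite nth_default // sub0r opprK.
have [|//|v hv] := @nullstellensatz_weak n.+1 (fun p => J (shear (fun=> 0) p)).
  have [j0 jD jM] := iJ; split; first by rewrite rmorph0.
  - by move=> x y; rewrite rmorphD; exact: jD.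
  - by move=> a x; rewrite rmorphM; exact: jM.
- by rewrite rmorph1.
have hv' f : J f -> meval v (unshear (fun=> 0) f) = 0 by move=> Jf; apply: hv; rewrite unshearK.
pose v0 (j : 'I_n) := v (lift ord_max j).
have lowv p : meval v (unshear_coef (fun=> 0) p) = meval v0 p.
  pose g : {rmorphism {mpoly K[n]} -> K} := (meval v \o unshear_coef (fun=> 0)).
  apply: (@mpoly_morph_eq _ _ _ g (meval v0)) => [c|i].
    by change (meval v (unshear_coef (fun=> 0) c%:MP) = meval v0 c%:MP); rewrite unshear_coefC !mevalC.
  change (meval v (unshear_coef (fun=> 0) 'X_i) = meval v0 'X_i).
  by rewrite unshear_coefX mevalB mevalM !mevalXU mevalC mul0r subr0.
have r0 : meval v0 r = 0.
  apply: hr => p Ip; rewrite -lowv -unshearC; apply: hv'; exists 0 => i.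
  by rewrite mul0r subr0 coefC; case: eqP.
have : J (1 - r%:P * 'X) by exists 1 => i; rewrite mul1r subrr coef0.
move=> /hv'; rewrite rmorphB rmorphM rmorph1 /= unshearC mevalB mevalM meval1 lowv r0 mul0r subr0.
by move=> /eqP; rewrite oner_eq0.
Qed.

End Null.

(** * Regular functions on affine spaces *)

Section Algebraic.
Variables (K : closedFieldType).
Hypothesis hK : [pchar K] =i pred0.
Local Notation G := (algebraic_geometry K).
Local Notation areg n z F := (@regular_at K (affine G n) z F).
Local Notation anear n z P := (@around K (affine G n) z P).

Section Fun.
Variable n : nat.
Implicit Types (p q : {mpoly K[n]}) (x y : 'rV[K]_n).

Lemma mpoly_funD p q x : mpoly_fun (p + q) x = mpoly_fun p x + mpoly_fun q x.
Proof. exact: mevalD. Qed.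
Lemma mpoly_funM p q x : mpoly_fun (p * q) x = mpoly_fun p x * mpoly_fun q x.
Proof. exact: mevalM. Qed.
Lemma mpoly_funC c x : mpoly_fun c%:MP x = c. Proof. exact: mevalC. Qed.
Lemma mpoly_fun1 x : mpoly_fun (1 : {mpoly K[n]}) x = 1. Proof. exact: meval1. Qed.
Lemma mpoly_fun0 x : mpoly_fun (0 : {mpoly K[n]}) x = 0. Proof. exact: meval0. Qed.
Lemma mpoly_funX i x : mpoly_fun 'X_i x = x 0 i. Proof. exact: mevalXU. Qed.
Lemma mpoly_fun_sum (I : finType) (f : I -> {mpoly K[n]}) x :
  mpoly_fun (\sum_i f i) x = \sum_i mpoly_fun (f i) x.
Proof. exact: raddf_sum. Qed.

Lemma ag_aroundP x P : anear n x P <->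
  exists q, mpoly_fun q x != 0 /\ forall y, mpoly_fun q y != 0 -> P y.
Proof.
split=> [[U [oU Ux UP]]|[q [qx qP]]].
  by have [q [qx qU]] := oU _ Ux; exists q; split => // y /qU /UP.
by exists [set y | mpoly_fun q y != 0]; split => // y qy; exists q.
Qed.

Lemma ag_aroundI x P Q : anear n x P -> anear n x Q -> anear n x (P `&` Q).
Proof.
move=> /ag_aroundP[p [px pP]] /ag_aroundP[q [qx qQ]]; apply/ag_aroundP; exists (p * q).
rewrite mpoly_funM mulf_neq0 //; split => // y; rewrite mpoly_funM mulf_eq0 negb_or => /andP[py qy].
by split; [exact: pP|exact: qQ].
Qed.

Lemma ag_poly x p : areg n x (mpoly_fun p).
Proof.
by exists p, 1; rewrite mpoly_fun1 oner_neq0; split => // y _; rewrite mpoly_fun1 divr1.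
Qed.

Lemma ag_ext x f g : anear n x (fun y => f y = g y) -> areg n x f -> areg n x g.
Proof.
move=> /ag_aroundP[q [qx qe]] [a [b [bx fe]]]; exists (a * q), (b * q).
rewrite mpoly_funM mulf_neq0 //; split => // y; rewrite !mpoly_funM mulf_eq0 negb_or => /andP[by_ qy].
by rewrite -qe // fe //; field; rewrite qy.
Qed.

Lemma ag_add x f g : areg n x f -> areg n x g -> areg n x (fun y => f y + g y).
Proof.
move=> [a [b [bx fe]]] [c [d [dx ge]]]; exists (a * d + c * b), (b * d).
rewrite mpoly_funM mulf_neq0 //; split => // y; rewrite mpoly_funD !mpoly_funM mulf_eq0 negb_or => /andP[hb hd].
by rewrite fe // ge //; field; rewrite hb hd.
Qed.

Lemma ag_mul x f g : areg n x f -> areg n x g -> areg n x (fun y => f y * g y).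
Proof.
move=> [a [b [bx fe]]] [c [d [dx ge]]]; exists (a * c), (b * d).
rewrite mpoly_funM mulf_neq0 //; split => // y; rewrite !mpoly_funM mulf_eq0 negb_or => /andP[hb hd].
by rewrite fe // ge //; field; rewrite hb hd.
Qed.

Lemma ag_cst x c : areg n x (fun=> c).
Proof.
have e : @mpoly_fun K n c%:MP = (fun=> c) by apply/funext => y; exact: mpoly_funC.
by rewrite -e; exact: ag_poly.
Qed.

Lemma ag_ne0 x f : areg n x f -> f x != 0 -> anear n x (fun y => f y != 0).
Proof.
move=> [a [b [bx fe]]]; rewrite fe // => h; apply/ag_aroundP; exists (a * b).
move: h; rewrite mulf_eq0 negb_or => /andP[ax _].
rewrite mpoly_funM mulf_neq0 //; split => // y; rewrite mpoly_funM mulf_eq0 negb_or => /andP[hb hd].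
by rewrite fe // mulf_neq0 // invr_neq0.
Qed.

Lemma ag_inv x f : areg n x f -> f x != 0 -> areg n x (fun y => (f y)^-1).
Proof.
move=> [a [b [bx fe]]]; rewrite fe // mulf_eq0 negb_or => /andP[ax _].
exists (b * b), (a * b); rewrite mpoly_funM mulf_neq0 //; split => // y.
rewrite !mpoly_funM mulf_eq0 negb_or => /andP[ha hb].
by rewrite fe //; field; rewrite ha hb.
Qed.

Lemma ag_poly_comp m x (f : 'I_m -> 'rV[K]_n -> K) (p : {mpoly K[m]}) :
  (forall j, areg n x (f j)) -> areg n x (fun y => mpoly_fun p (\row_j f j y)).
Proof.
move=> rf.
have e : (fun y => mpoly_fun p (\row_j f j y)) = fun y => \sum_(k <- msupp p) p@_k * \prod_i f i y ^+ k i.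
  apply/funext => y; rewrite /mpoly_fun mevalE; apply: eq_bigr => k _.
  by congr (_ * _); apply: eq_bigr => i _; rewrite mxE.
rewrite e; elim: (msupp p) => [|k s ih].
  by apply: ag_ext (ag_cst x 0); apply/ag_aroundP; exists 1; rewrite mpoly_fun1 oner_neq0; split => // y _; rewrite big_nil.
have rX i : areg n x (fun y => f i y ^+ k i).
  elim: (k i) => [|j ihj]; first exact: ag_cst.
  by under eq_fun do rewrite exprS; exact: ag_mul.
have rP : areg n x (fun y => \prod_i f i y ^+ k i).
  elim: (index_enum _) => [|i t iht].
    by under eq_fun do rewrite big_nil; exact: ag_cst.
  by under eq_fun do rewrite big_cons; exact: ag_mul.
under eq_fun do rewrite big_cons.
by apply: ag_add => //; apply: ag_mul => //; exact: ag_cst.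
Qed.

End Fun.

Lemma ag_tame n (z : affine G n) : tame z.
Proof.
split.
- by apply/ag_aroundP; exists 1; rewrite mpoly_fun1 oner_neq0.
- exact: ag_aroundI.
- move=> f [a [b [bz fe]]]; apply/ag_aroundP; exists b; split => // y hb.
  by exists a, b.
- exact: ag_ext.
- move=> m f F rf [a [b [bz Fe]]].
  have ra := ag_poly_comp a rf; have rb := ag_poly_comp b rf.
  apply: ag_ext (ag_mul ra (ag_inv rb bz)).
  have /ag_aroundP[q [qz qe]] := ag_ne0 rb bz.
  by apply/ag_aroundP; exists q; split => // y /qe h; rewrite Fe.
- move=> m f V rf oV Vz; have [q [qz qV]] := oV _ Vz.
  have /ag_aroundP[r [rz re]] := ag_ne0 (ag_poly_comp q rf) qz.
  by apply/ag_aroundP; exists r; split => // y /re /qV.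
Qed.

Lemma mpoly_div n (i : 'I_n) (p : {mpoly K[n]}) : exists q : {mpoly K[n]},
  forall y, mpoly_fun p y - mpoly_fun p (setc (G := G) y i 0) = y 0 i * mpoly_fun q y.
Proof.
(* The restriction to y_i = 0 is also required to be a polynomial p0, which makes the property
   stable under products. *)
pose P (p : {mpoly K[n]}) := exists (p0 q : {mpoly K[n]}), forall y : 'rV[K]_n,
  mpoly_fun p (setc (G := G) y i 0) = mpoly_fun p0 y /\
  mpoly_fun p y - mpoly_fun p0 y = y 0 i * mpoly_fun q y.
have PC c : P c%:MP.
  by exists c%:MP, 0 => y; rewrite !mpoly_funC ?mpoly_fun0 subrr mulr0.
have PD f g : P f -> P g -> P (f + g).
  move=> [f0 [f1 hf]] [g0 [g1 hg]]; exists (f0 + g0), (f1 + g1) => y.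
  have [e1 e2] := hf y; have [e3 e4] := hg y.
  by rewrite !mpoly_funD e1 e3 mulrDr -e2 -e4; split => //; ring.
have PM f g : P f -> P g -> P (f * g).
  move=> [f0 [f1 hf]] [g0 [g1 hg]]; exists (f0 * g0), (f1 * g + f0 * g1) => y.
  have [e1 e2] := hf y; have [e3 e4] := hg y.
  rewrite !(mpoly_funD, mpoly_funM) e1 e3 mulrDr mulrA -e2 [_ * (_ * mpoly_fun g1 y)]mulrCA -e4.
  by split => //; ring.
have PX j : P 'X_j.
  have [->|ne] := eqVneq j i.
    exists 0, 1 => y; rewrite !mpoly_funX mpoly_fun0 mpoly_fun1 mxE eqxx; split => //; ring.
  by exists 'X_j, 0 => y; rewrite !mpoly_funX mpoly_fun0 mxE (negPf ne) subrr mulr0.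
suff [p0 [q h]] : P p by exists q => y; have [-> ->] := h y.
rewrite (mpolyE p); elim/big_ind: _; [by rewrite -mpolyC0; exact: PC|exact: PD|].
move=> k _; rewrite -mul_mpolyC; apply: (PM) => //; rewrite mpolyXE_id.
elim/big_ind: _; [by rewrite -mpolyC1; exact: PC|exact: PM|].
move=> j _; elim: (k j) => [|a ih]; first by rewrite expr0 -mpolyC1; exact: PC.
by rewrite exprS; exact: PM.
Qed.

Lemma ag_good : good G.
Proof.
split.
- by move=> n; have /pcharf0P h := hK; rewrite h.
- exact: ag_tame.
- move=> n W hW x /hW /ag_aroundP[q [qx qW]]; by exists q.
- by move=> n z c; exact: ag_cst.
- move=> n z i; have := ag_poly z ('X_i); congr regular_at.
  by apply/funext => y; rewrite mpoly_funX.
- move=> z; have := ag_poly z ('X_0 + 'X_1 : {mpoly K[2]}); congr regular_at.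
  by apply/funext => y; rewrite mpoly_funD !mpoly_funX.
- move=> z; have := ag_poly z ('X_0 * 'X_1 : {mpoly K[2]}); congr regular_at.
  by apply/funext => y; rewrite mpoly_funM !mpoly_funX.
- move=> z z0; have := ag_inv (ag_poly z ('X_0 : {mpoly K[1]})).
  rewrite mpoly_funX => /(_ z0); congr regular_at.
  by apply/funext => y; rewrite mpoly_funX.
- by move=> x x0; exists 'X_0; rewrite mpoly_funX; split => // y; rewrite mpoly_funX.
- move=> n z i F zi [a [b [bz Fe]]].
  have [ra ha] := mpoly_div i a; have [rb hb] := mpoly_div i b.
  have zs : setc (G := G) z i 0 = z by apply/rowP => l; rewrite mxE; case: eqP => [->|].
  have rs (p : {mpoly K[n]}) : areg n z (fun y => mpoly_fun p (setc (G := G) y i 0)).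
    apply: (@ag_poly_comp n n z (fun l y => if l == i then 0 else y 0 l) p) => j.
    case: (j == i); first exact: ag_cst.
    have := ag_poly z ('X_j); congr regular_at.
    by apply/funext => y; rewrite mpoly_funX.
  have b0z : mpoly_fun b (setc (G := G) z i 0) != 0 by rewrite zs.
  (* With a_0, b_0 the restrictions to y_i = 0: a/b - a_0/b_0 = ((a - a_0) b_0 - a_0 (b - b_0)) / (b
     b_0), and both differences are divisible by y_i. *)
  exists (fun y => (mpoly_fun ra y * mpoly_fun b (setc (G := G) y i 0) - mpoly_fun a (setc (G := G) y i 0) * mpoly_fun rb y)
    * ((mpoly_fun b y)^-1 * (mpoly_fun b (setc (G := G) y i 0))^-1)); split.
    apply: ag_mul; last by apply: ag_mul; apply: ag_inv => //; exact: ag_poly.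
    apply: ag_add; first by apply: ag_mul => //; exact: ag_poly.
    have e : (fun y => - (mpoly_fun a (setc (G := G) y i 0) * mpoly_fun rb y)) =
      (fun y => -1 * (mpoly_fun a (setc (G := G) y i 0) * mpoly_fun rb y)).
      by apply/funext => y; rewrite mulN1r.
    by rewrite e; apply: ag_mul; [exact: ag_cst|apply: ag_mul => //; exact: ag_poly].
  have n1 : anear n z (fun y => mpoly_fun b y != 0) by apply: ag_ne0 => //; exact: ag_poly.
  have n2 : anear n z (fun y => mpoly_fun b (setc (G := G) y i 0) != 0) by apply: ag_ne0.
  apply: (around_sub (ag_aroundI n1 n2)) => y [b1 b2].
  rewrite !Fe //.
  transitivity (((mpoly_fun a y - mpoly_fun a (setc (G := G) y i 0)) * mpoly_fun b (setc (G := G) y i 0) -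
      mpoly_fun a (setc (G := G) y i 0) * (mpoly_fun b y - mpoly_fun b (setc (G := G) y i 0))) *
      ((mpoly_fun b y)^-1 * (mpoly_fun b (setc (G := G) y i 0))^-1)).
    by field; rewrite b1 b2.
  rewrite ha hb; ring.
- move=> F [a [b [b0 Fe]]] /ag_aroundP[q [q0 qe]].
  (* This product vanishes at every point, hence is the zero polynomial, and all its factors other
     than a are nonzero. *)
  have h : 'X_0 * a * (b * q) = 0 :> {mpoly K[1]}.
    apply/eqP; apply: contraT => /mpoly_nonroot[v].
    pose y : 'rV[K]_1 := \row_i v i.
    have -> : meval v ('X_0 * a * (b * q)) = mpoly_fun ('X_0 * a * (b * q)) y.
      by apply: meval_eq => i; rewrite mxE.
    rewrite !mpoly_funM mpoly_funX; apply: contra_neqT => _.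
    have [->|by0] := eqVneq (mpoly_fun b y) 0; first by rewrite mul0r mulr0.
    have [->|qy0] := eqVneq (mpoly_fun q y) 0; first by rewrite !mulr0.
    have := qe y qy0; rewrite Fe // => /eqP; rewrite !mulf_eq0 invr_eq0 (negPf by0) orbF.
    by move=> /orP[/eqP ->|/eqP ->]; rewrite ?mulr0 ?mul0r.
  have bn : b != 0 by apply: contra_neq b0 => ->; exact: mpoly_fun0.
  have qn : q != 0 by apply: contra_neq q0 => ->; exact: mpoly_fun0.
  have Xn : 'X_0 != 0 :> {mpoly K[1]}.
    by apply/eqP => /(congr1 (mcoeff U_(0))); rewrite mcoeffXU mcoeff0 eqxx => /eqP; rewrite oner_eq0.
  move/eqP: h; rewrite !mulf_eq0 (negPf bn) (negPf qn) (negPf Xn) !orbF /= => /eqP a0.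
  by rewrite Fe // a0 mpoly_fun0 mul0r.
Qed.

(** The polynomials q whose nonvanishing locus is covered by finitely many members of C form an
    ideal. It is finitely generated, and every point of T lies where some such q, hence some
    generator, is nonzero. *)
Lemma ag_small : small_subspaces G.
Proof.
move=> n T f C CO cov.
pose I (q : {mpoly K[n]}) := exists s : seq (set T), (forall W, W \in s -> C W) /\
  forall x, mpoly_fun q (f x) != 0 -> exists2 W, W \in s & W x.
have iI : ideal I.
  split.
  - by exists [::]; split => // x; rewrite mpoly_fun0 eqxx.
  - move=> p q [s [sC hs]] [t [tC ht]]; exists (s ++ t); split.
      by move=> W; rewrite mem_cat => /orP[/sC|/tC].
    move=> x; rewrite mpoly_funD; have [p0|p0 _] := eqVneq (mpoly_fun p (f x)) 0.
      by rewrite p0 add0r => /ht[W Wt Wx]; exists W => //; rewrite mem_cat Wt orbT.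
    by have [W Ws Wx] := hs x p0; exists W => //; rewrite mem_cat Ws.
  - move=> a q [s [sC hs]]; exists s; split => // x; rewrite mpoly_funM mulf_eq0 negb_or.
    by move=> /andP[_ /hs].
have [t tI ht] := @noetherian_mpoly K n I iI.
have [s [sC hs]] : exists s : seq (set T), (forall W, W \in s -> C W) /\
    forall x q, q \in t -> mpoly_fun q (f x) != 0 -> exists2 W, W \in s & W x.
  elim: t tI {ht} => [|q t ih] tI; first by exists [::].
  have [|s [sC hs]] := ih; first by move=> y yt; apply: tI; rewrite inE yt orbT.
  have [s' [sC' hs']] := tI q (mem_head _ _); exists (s ++ s'); split.
    by move=> W; rewrite mem_cat => /orP[/sC|/sC'].
  move=> x y; rewrite inE => /orP[/eqP -> /hs'[W Ws Wx]|/hs h /h [W Ws Wx]];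
    by exists W => //; rewrite mem_cat Ws ?orbT.
exists (size s), (fun i => nth set0 s i); split.
  by move=> i; apply: sC; exact: mem_nth.
move=> x; have [U CU Ux] := cov x; have [V oV eU] := CO _ CU.
have [q [qx qV]] : exists q, mpoly_fun q (f x) != 0 /\ forall y, mpoly_fun q y != 0 -> V y.
  by apply: oV; rewrite eU in Ux.
have Iq : I q.
  exists [:: U]; split; first by move=> W; rewrite inE => /eqP ->.
  by move=> y hy; exists U; rewrite ?mem_head // eU; exact: qV.
have [c e] := ispan_sum (ht _ Iq).
have [i hi] : exists i : 'I_(size t), mpoly_fun t`_i (f x) != 0.
  apply/not_existsP => h; move: qx; rewrite e mpoly_fun_sum big1 ?eqxx // => i _.
  by rewrite mpoly_funM; have /negP/negPn/eqP -> := h i; rewrite mulr0.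
have [W Ws Wx] := hs x _ (mem_nth 0 (ltn_ord i)) hi.
have h : (index W s < size s)%N by rewrite index_mem.
by exists (Ordinal h); rewrite /= nth_index.
Qed.

(** Let J consist of the germs F with s^N F = 0 on the zero set for some N. They vanish at z:
    otherwise s would vanish on the zero set, and by the Nullstellensatz a power of s would lie in
    the ideal of the g, against [zeros_power]. Hence J is contained in s J plus this ideal, and
    Nakayama's lemma puts J, which contains H, into the ideal. *)
Lemma ag_regular_zeros : regular_zeros G.
Proof.
move=> m z g s H rg rs gz sz inj rH hH.
have gG := ag_good; have tz := ag_tame z.
pose gs (i : 'I_(m + 1)) := match fintype.split i with inl j => g j | inr _ => s end.
have gsl i : gs (lshift 1 i) = g i by rewrite /gs (unsplitK (inl i)).
have gsr : gs (rshift m ord0) = s by rewrite /gs (unsplitK (inr ord0)).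
have rgs i : areg _ z (gs i) by rewrite /gs; case: (fintype.split i).
have gsz i : gs i z = 0 by rewrite /gs; case: (fintype.split i).
have ginj (u : 'rV[K]_(m + 1)) : (forall i, dvec (G := G) u z (gs i) = 0) -> u = 0.
  by move=> h; apply: inj => [i|]; [have := h (lshift 1 i); rewrite gsl|have := h (rshift m ord0); rewrite gsr].
pose inG (F : 'rV[K]_(m + 1) -> K) := exists c : 'I_m -> 'rV[K]_(m + 1) -> K,
  (forall i, areg _ z (c i)) /\ anear _ z (fun y => F y = \sum_i c i y * g i y).
have nullst F : areg _ z F -> anear _ z (fun y => (forall i, g i y = 0) -> F y = 0) ->
    exists N, inG (fun y => F y ^+ N).
  move=> [a [b [bz Fe]]] /ag_aroundP[q [qz qe]].
  have /choice[ag hag] := rg; have /choice[bg hbg] := hag.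
  pose I (p : {mpoly K[m + 1]}) := exists c : 'I_m -> {mpoly K[m + 1]}, p = \sum_i c i * ag i.
  have iI : ideal I.
    split; first by exists (fun=> 0); rewrite big1 // => i _; rewrite mul0r.
    - move=> _ _ [c ->] [c' ->]; exists (fun i => c i + c' i); rewrite -big_split /=.
      by apply: eq_bigr => i _; rewrite mulrDl.
    - move=> e _ [c ->]; exists (fun i => e * c i); rewrite mulr_sumr.
      by apply: eq_bigr => i _; rewrite mulrA.
  (* The factors b, q and the denominators bg make the product vanish also at points where the local
     hypotheses say nothing. *)
  have [|N [c ec]] := @nullstellensatz K _ I (a * b * q * \prod_i bg i) iI.
    move=> v hv; pose y : 'rV[K]_(m + 1) := \row_i v i.
    have ev p : meval v p = mpoly_fun p y by apply: meval_eq => i; rewrite mxE.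
    rewrite ev !mpoly_funM.
    have [->|by0] := eqVneq (mpoly_fun b y) 0; first by rewrite mulr0 !mul0r.
    have [->|qy0] := eqVneq (mpoly_fun q y) 0; first by rewrite mulr0 !mul0r.
    have [->|py0] := eqVneq (mpoly_fun (\prod_i bg i) y) 0; first by rewrite mulr0.
    have := qe y qy0; rewrite Fe // => h.
    have /eqP : mpoly_fun a y / mpoly_fun b y = 0.
      apply: h => i; have [_ -> //] := hbg i.
        suff -> : mpoly_fun (ag i) y = 0 by rewrite mul0r.
        rewrite -ev; apply: hv; exists (fun j => (j == i)%:R).
        rewrite (bigD1 i) //= eqxx mul1r big1 ?addr0 // => j /negPf ->.
        by rewrite mul0r.
      apply: contra_neq py0 => e; rewrite (bigD1 i) //= mpoly_funM e mul0r //.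
    by rewrite mulf_eq0 invr_eq0 (negPf by0) orbF => /eqP ->; rewrite !mul0r.
  exists N; pose e (y : 'rV[K]_(m + 1)) := mpoly_fun b y * mpoly_fun b y * mpoly_fun q y * mpoly_fun (\prod_i bg i) y.
  have re : areg _ z e by rewrite /e; do !apply: ag_mul; exact: ag_poly.
  have ez : e z != 0.
    rewrite /e !mulf_neq0 // /mpoly_fun rmorph_prod; apply/prodf_neq0 => i _.
    by have [h _] := hbg i.
  have rbg i : areg _ z (mpoly_fun (bg i)) by exact: ag_poly.
  exists (fun i y => (e y)^-1 ^+ N * (mpoly_fun (c i) y * mpoly_fun (bg i) y)); split.
    move=> i; apply: ag_mul; first by apply: (reg_exp gG _ tz); exact: ag_inv.
    by apply: ag_mul; exact: ag_poly.
  have nb : anear _ z (fun y => forall i, mpoly_fun (bg i) y != 0).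
    by apply: (around_forall tz) => i; apply: ag_ne0 => //; have [h _] := hbg i.
  have nb' : anear _ z (fun y => mpoly_fun b y != 0) by apply: ag_ne0 => //; exact: ag_poly.
  apply: (around_sub (ag_aroundI (ag_ne0 re ez) (ag_aroundI nb nb'))) => y [ey [by1 by2]].
  have := congr1 (fun p => mpoly_fun p y) ec; rewrite mpoly_fun_sum => ec'.
  have -> : F y ^+ N = (e y)^-1 ^+ N * mpoly_fun ((a * b * q * \prod_i bg i) ^+ N) y.
    rewrite /mpoly_fun rmorphXn /= -/(mpoly_fun _ y) -exprMn; congr (_ ^+ _).
    rewrite Fe // !mpoly_funM.
    have : e y != 0 by [].
    rewrite /e !mulf_eq0 !negb_or => /andP[/andP[_ h1] h2].
    by field; rewrite by2 h1 h2.
  rewrite ec' mulr_sumr; apply: eq_bigr => i _; rewrite mpoly_funM -!mulrA; congr (_ * (_ * _)).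
  by have [_ ->] := hbg i; rewrite // mulrC divfK.
pose J (F : 'rV[K]_(m + 1) -> K) := areg _ z F /\ exists N,
  anear _ z (fun y => (forall i, g i y = 0) -> s y ^+ N * F y = 0).
have Jz F : J F -> F z = 0.
  move=> [rF [N hF]]; apply/eqP; apply: contraT => Fz.
  have [|M] := nullst s rs; last first.
    move=> [c [rc ec]]; case: (@zeros_power G gG _ z gs rgs gsz ginj (rshift m ord0) M).
    exists (fun i => match fintype.split i with inl j => c j | inr _ => fun=> 0 end); split.
      by move=> i; case: (fintype.split i) => j //; exact: ag_cst.
    apply: (around_sub ec) => y; rewrite gsr => ->.
    rewrite big_split_ord /= [X in _ + X]big1 ?addr0; last first.
      by move=> i; rewrite (ord1 i) eqxx.
    apply: eq_big => [i|i _]; first by rewrite eq_lrshift.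
    by rewrite gsl (unsplitK (inl i)).
  apply: (around_sub (ag_aroundI hF (ag_ne0 rF Fz))) => y [h Fy] gy.
  have /eqP := h gy; rewrite mulf_eq0 (negPf Fy) orbF expf_eq0 => /andP[_ /eqP //].
have Jstep F : J F -> exists F1, J F1 /\ exists c : 'I_m -> 'rV[K]_(m + 1) -> K,
    (forall i, areg _ z (c i)) /\ anear _ z (fun y => F y = s y * F1 y + \sum_i c i y * g i y).
  move=> JF; have [rF [N hF]] := JF.
  have [c [rc ec]] := zeros_coord gG rgs gsz ginj rF (Jz _ JF).
  have ec' : anear _ z (fun y => F y = s y * c (rshift m ord0) y + \sum_i c (lshift 1 i) y * g i y).
    apply: (around_sub ec) => y ->; rewrite big_split_ord /= addrC big_ord1 gsr mulrC.
    by congr (_ + _); apply: eq_bigr => i _; rewrite gsl.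
  exists (c (rshift m ord0)); split; last by exists (fun i => c (lshift 1 i)).
  split => //; exists N.+1; apply: (around_sub (ag_aroundI hF ec')) => y [h1 h2] gy.
  have := h1 gy; rewrite h2 [X in _ * (_ + X)]big1 ?addr0; last by move=> i _; rewrite gy mulr0.
  by rewrite mulrA -exprSr.
pose I p := J (mpoly_fun p).
have rsX N : areg _ z (fun y => s y ^+ N) by exact: (reg_exp gG _ tz).
have iI : ideal I.
  split.
  - split; first exact: ag_poly.
    by exists 0%N; apply: (around_sub (aroundT tz)) => y _ _; rewrite mpoly_fun0 mulr0.
  - move=> p q [_ [N hN]] [_ [M hM]]; split; first exact: ag_poly.
    exists (N + M)%N; apply: (around_sub (ag_aroundI hN hM)) => y [h1 h2] gy.
    by rewrite mpoly_funD mulrDr exprD mulrAC h1 // mul0r -mulrA h2 // mulr0 addr0.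
  - move=> a p [_ [N hN]]; split; first exact: ag_poly.
    exists N; apply: (around_sub hN) => y h1 gy.
    by rewrite mpoly_funM mulrCA h1 // mulr0.
have [t tI ht] := @noetherian_mpoly K _ I iI.
have Jpoly F : J F -> exists c : nat -> 'rV[K]_(m + 1) -> K, (forall i, areg _ z (c i)) /\
    anear _ z (fun y => F y = \sum_(i < size t) c i y * mpoly_fun t`_i y).
  move=> [[a [b [bz Fe]]] [N hN]].
  have nb : anear _ z (fun y => mpoly_fun b y != 0) by apply: ag_ne0 => //; exact: ag_poly.
  have Ia : I a.
    split; first exact: ag_poly.
    exists N; apply: (around_sub (ag_aroundI hN nb)) => y [h1 h2] gy.
    have /eqP := h1 gy; rewrite Fe // mulrA mulf_eq0 invr_eq0 (negPf h2) orbF.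
    by move/eqP.
  have [c e] := ispan_sum (ht _ Ia).
  exists (fun i y => (mpoly_fun b y)^-1 * mpoly_fun (c i) y); split.
    by move=> i; apply: ag_mul; [apply: ag_inv => //|]; exact: ag_poly.
  apply: (around_sub nb) => y h; rewrite Fe // mulrC e mpoly_fun_sum mulr_sumr.
  by apply: eq_bigr => i _; rewrite mpoly_funM mulrA.
have /choice[F1 hF1] : forall k : 'I_(size t), exists F1, J F1 /\ exists c : 'I_m -> 'rV[K]_(m + 1) -> K,
    (forall i, areg _ z (c i)) /\ anear _ z (fun y => mpoly_fun t`_k y = s y * F1 y + \sum_i c i y * g i y).
  by move=> k; apply: Jstep; apply: tI; exact: mem_nth.
have /choice[c0 hc0] := fun k => (hF1 k).2.
have /choice[C hC] := fun k => Jpoly _ (hF1 k).1.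
(* Nakayama's matrix 1 - s C: it takes the generators t of J to combinations of the g, and it is the
   identity at z because s z = 0. *)
pose M (y : 'rV[K]_(m + 1)) : 'M[K]_(size t) := \matrix_(k, j) ((k == j)%:R - s y * C k j y).
have rM k j : areg _ z (fun y => M y k j).
  under eq_fun do rewrite mxE.
  apply: (reg_sub gG tz); first exact: ag_cst.
  by apply: ag_mul => //; have [h _] := hC k.
have uM : M z \in unitmx.
  have -> : M z = 1%:M by apply/matrixP => k j; rewrite !mxE sz mul0r subr0.
  exact: unitmx1.
have [rI nI] := reg_invmx gG tz rM uM.
have [|C0 [rC0 eC0]] := Jpoly H.
  by split => //; exists 0%N; apply: (around_sub hH) => y h gy; rewrite h // mulr0.
exists (fun i y => \sum_(k < size t) C0 k y * \sum_j invmx (M y) k j * c0 j i y); split.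
  move=> i; apply: (reg_sum gG tz) => k _; apply: ag_mul => //.
  apply: (reg_sum gG tz) => j _; apply: ag_mul => //.
  by have [h _] := hc0 j.
have near1 : anear _ z (fun y => forall k : 'I_(size t), mpoly_fun t`_k y = s y * F1 k y + \sum_i c0 k i y * g i y).
  by apply: (around_forall tz) => k; have [_ h] := hc0 k.
have near2 : anear _ z (fun y => forall k : 'I_(size t), F1 k y = \sum_(i < size t) C k i y * mpoly_fun t`_i y).
  by apply: (around_forall tz) => k; have [_ h] := hC k.
apply: (around_sub (ag_aroundI eC0 (ag_aroundI nI (ag_aroundI near1 near2)))) => y [-> [uy [h1 h2]]].
pose T : 'cV[K]_(size t) := \col_k mpoly_fun t`_k y.
pose g0 : 'cV[K]_(size t) := \col_k \sum_i c0 k i y * g i y.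
have MT : M y *m T = g0.
  apply/colP => k; rewrite !mxE.
  under eq_bigr => j _ do rewrite !mxE mulrBl.
  rewrite sumrB (bigD1 k) //= eqxx mul1r big1 ?addr0; last first.
    by move=> j jk; rewrite eq_sym (negPf jk) mul0r.
  rewrite {1}h1 h2 mulr_sumr addrAC -[RHS]add0r; congr (_ + _); apply/eqP; rewrite subr_eq0.
  by apply/eqP; apply: eq_bigr => j _; rewrite mulrA.
have {}MT : T = invmx (M y) *m g0 by rewrite -MT mulKmx.
have eT (k : 'I_(size t)) : mpoly_fun t`_k y = \sum_j invmx (M y) k j * \sum_i c0 j i y * g i y.
  have := congr1 (fun A : 'cV[K]_(size t) => A k 0) MT; rewrite !mxE => ->.
  by apply: eq_bigr => j _; rewrite mxE.
under eq_bigr => k _ do rewrite eT.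
transitivity (\sum_(k < size t) \sum_(j < size t) \sum_i C0 k y * (invmx (M y) k j * (c0 j i y * g i y))).
  apply: eq_bigr => k _; rewrite mulr_sumr; apply: eq_bigr => j _.
  by rewrite !mulr_sumr.
under eq_bigr => k _ do rewrite exchange_big.
rewrite exchange_big; apply: eq_bigr => i _; rewrite mulr_suml; apply: eq_bigr => k _.
rewrite -mulrA; rewrite mulr_suml mulr_sumr; apply: eq_bigr => j _; by rewrite !mulrA.
Qed.

End Algebraic.

End AlgebraicGeometry.

(** * The smooth and holomorphic categories *)

From mathcomp Require Import all_classical all_reals all_analysis.
From mathcomp Require Import complex.
From mathcomp Require Import lra.
Import numFieldNormedType.Exports.

(** * Estimates over R and C *)

Section Basic.
Variable F : numFieldType.

Lemma row_norm_lt n (z : 'rV[F]_n) (e : F) : 0 < e ->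
  `|z| < e <-> forall l, `|z 0 l| < e.
Proof.
move=> e0; have := @mx_norm_ball F 1 n; rewrite funeq3E => /(_ 0 e (- z)).
rewrite /ball_ /= sub0r opprK => <-; split.
  by move=> [_ h] l; have := h 0 l; rewrite !mxE -ball_normE /ball_ /= sub0r opprK.
move=> h; split => // i j; rewrite (ord1 i).
by rewrite !mxE -ball_normE /ball_ /= sub0r opprK.
Qed.

Lemma row_norm_le n (z : 'rV[F]_n) l : `|z 0 l| <= `|z|.
Proof.
have [z0|z0] := eqVneq z 0; first by rewrite z0 mxE !normr0.
have zp : 0 < `|z| by rewrite normr_gt0.
rewrite real_leNgt ?normr_real //; apply/negP => h.
have h2 := @row_norm_lt n z `|z 0 l| (lt_trans zp h).
have /h2 : `|z| < `|z 0 l| by [].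
by move=> /(_ l); rewrite ltxx.
Qed.

(** F may be R[i], whose order is partial; positive elements are real and therefore comparable. *)
Lemma pos_min (a b : F) : 0 < a -> 0 < b -> exists c, [/\ 0 < c, c <= a & c <= b].
Proof.
move=> a0 b0; have /orP[ab|ba] : (a <= b) || (b <= a).
- by apply: real_comparable; exact: gtr0_real.
- by exists a; split.
- by exists b; split.
Qed.

Lemma openB (V : normedModType F) (U : set V) : open U <->
  forall x, U x -> exists2 e : F, 0 < e & forall y, `|y - x| < e -> U y.
Proof.
rewrite openE; split=> [oU x /oU /nbhs_normP[e /= e0 h]|h x /h[e e0 he]].
  by exists e => // y yx; apply: h; rewrite /= distrC.
by apply/nbhs_normP; exists e => // y /=; rewrite distrC; exact: he.
Qed.

Lemma cont_at (V : normedModType F) (f : V -> F) x : {for x, continuous f} <->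
  forall e : F, 0 < e -> exists2 d : F, 0 < d & forall y, `|y - x| < d -> `|f y - f x| < e.
Proof.
split=> [/cvgrPdist_lt h e /h /nbhs_normP[d /= d0 hd]|h].
  by exists d => // y yx; rewrite distrC; apply: hd; rewrite /= distrC.
apply/cvgrPdist_lt => e /h[d d0 hd]; apply/nbhs_normP; exists d => // y /= yx.
by rewrite distrC; apply: hd; rewrite distrC.
Qed.

(** Directional derivative as an error estimate cleared of the division by h, which includes h = 0;
    [ddP] links it with [derivable]. *)
Definition dd (V : normedModType F) (f : V -> F) (x v : V) (l : F) :=
  forall e : F, 0 < e -> exists2 d : F, 0 < d &
    forall h : F, `|h| < d -> `|f (x + h *: v) - f x - h * l| <= e * `|h|.

Lemma ddP (V : normedModType F) (f : V -> F) (x v : V) l :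
  dd f x v l <-> (derivable f x v /\ 'D_v f x = l).
Proof.
have key : dd f x v l <->
    (fun h : F => h^-1 *: (f (h *: v + x) - f x)) @ 0^' --> l.
  split=> [h|/cvgrPdist_le h e e0].
    apply/cvgrPdist_le => e /h[d d0 hd].
    apply/nbhs_normP; exists d => // k /=; rewrite sub0r normrN => kd k0.
    have := hd k kd; rewrite [x + _]addrC => hk.
    have -> : l - k^-1 *: (f (k *: v + x) - f x) = - (k^-1 * (f (k *: v + x) - f x - k * l)).
      rewrite mulrBr mulKf // /GRing.scale /=; ring.
    rewrite normrN normrM normfV -ler_pdivlMl ?invr_gt0 ?normr_gt0 //.
    by rewrite invrK [_ * e]mulrC.
  have /nbhs_normP[d /= d0 hd] := h e e0; exists d => // k kd.
  have [->|k0] := eqVneq k 0; first by rewrite scale0r addr0 subrr mul0r subrr normr0 mulr0.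
  have := hd k; rewrite /= sub0r normrN => /(_ kd k0).
  have -> : l - k^-1 *: (f (k *: v + x) - f x) = - (k^-1 * (f (k *: v + x) - f x - k * l)).
    rewrite mulrBr mulKf // /GRing.scale /=; ring.
  rewrite normrN normrM normfV -ler_pdivlMl ?invr_gt0 ?normr_gt0 // invrK [_ * e]mulrC.
  by rewrite [x + _]addrC.
rewrite key; split=> [h|[d <-]]; last exact: d.
split; first by apply/cvg_ex; exists l; exact: h.
exact: cvg_lim h.
Qed.

Lemma dd_derive (V : normedModType F) (f : V -> F) (x v : V) :
  derivable f x v -> dd f x v ('D_v f x).
Proof. by move=> h; apply/ddP. Qed.

Lemma dd_scale (V : normedModType F) (f : V -> F) (x v : V) l s :
  dd f x v l -> dd f x (s *: v) (s * l).
Proof.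
have [->|s0] := eqVneq s 0.
  move=> _ e e0; exists 1 => // h _.
  rewrite scale0r scaler0 addr0 mul0r mulr0 !subrr normr0.
  by apply: mulr_ge0; [exact: ltW|].
move=> h e e0; have s1 : 0 < `|s| by rewrite normr_gt0.
have [d d0 hd] := h (e / `|s|) (divr_gt0 e0 s1).
exists (d / `|s|); first exact: divr_gt0.
move=> k kd; have := hd (k * s); rewrite normrM -ltr_pdivlMr // => /(_ kd).
by rewrite scalerA -[k * s * l]mulrA mulrACA [_^-1 * _]mulVf ?gt_eqF // mulr1.
Qed.

End Basic.

Local Notation ei i := (delta_mx 0 i).

(** * Functions of class C^r *)

Section ClassC.
Variable F : numFieldType.

Section N.
Variable n : nat.
Implicit Types (U V : set 'rV[F]_n) (f g : 'rV[F]_n -> F).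

Lemma class_C_sub r U V f : U `<=` V -> class_C r V f -> class_C r U f.
Proof.
elim: r f => [|r ih] f UV /= [h1 h2]; split => //; first by move=> x /UV /h1.
  by move=> x /UV /h1.
move=> i; have [h3 h4] := h2 i; split; first by move=> x /UV /h3.
exact: ih.
Qed.

Lemma class_C_cont r U f : class_C r U f -> forall x, U x -> {for x, continuous f}.
Proof. by case: r => [|r] /= []. Qed.

Lemma class_C_S r U f : class_C r.+1 U f -> class_C r U f.
Proof.
elim: r f => [|r ih] f [h1 h2]; split => // i; have [h3 h4] := h2 i; split => //.
exact: ih.
Qed.

Lemma open_near U f g x : open U -> U x -> (forall y, U y -> f y = g y) ->
  \forall y \near x, f y = g y.
Proof.
move=> /openB oU /oU[e e0 h] fg; apply/nbhs_normP; exists e => // y /= yx.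
by apply: fg; apply: h; rewrite distrC.
Qed.

Lemma open_dd U f g x v l : open U -> U x -> (forall y, U y -> f y = g y) ->
  dd f x v l -> dd g x v l.
Proof.
move=> oU Ux fg /ddP[d e]; have h := open_near oU Ux fg; apply/ddP; split.
  by apply: near_eq_derivable d.
by rewrite -(near_eq_derive _ h).
Qed.

Lemma class_C_ext r U f g : open U -> (forall y, U y -> f y = g y) ->
  class_C r U f -> class_C r U g.
Proof.
move=> oU; elim: r f g => [|r ih] f g fg /= [h1 h2]; (split; first
  by move=> x Ux; have hn := open_near oU Ux fg; rewrite /prop_for /continuous_at
    -(fg x Ux); apply: cvg_trans (h1 x Ux); exact: near_eq_cvg hn) => //.
move=> i; have [h3 h4] := h2 i; split.
  by move=> x Ux; have /ddP[] := open_dd oU Ux fg (dd_derive (h3 x Ux)).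
apply: ih h4 => x Ux.
by have /ddP[_ ->] := open_dd oU Ux fg (dd_derive (h3 x Ux)).
Qed.

Lemma class_C_cst r U c : class_C r U (fun=> c : F).
Proof.
elim: r c => [|r ih] c /=; (split; first by move=> x _; exact: (@cst_continuous _ _ c x)) => //.
move=> i; split=> [x _|]; first exact: derivable_cst.
have -> : (fun x : 'rV[F]_n => 'D_(ei i) (fun=> c) x) = (fun=> 0).
  by apply/funext => x; exact: derive_cst.
exact: ih.
Qed.

Lemma class_C_add r U f g : open U -> class_C r U f -> class_C r U g ->
  class_C r U (fun y => f y + g y).
Proof.
move=> oU; elim: r f g => [|r ih] f g /= [f1 f2] [g1 g2]; (split; first
  by move=> x Ux; exact: (continuousD (f1 x Ux) (g1 x Ux))) => //.
move=> i; have [f3 f4] := f2 i; have [g3 g4] := g2 i; split.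
  by move=> x Ux; apply: derivableD; [exact: f3|exact: g3].
apply: (@class_C_ext _ _ _ _ oU) (ih _ _ f4 g4) => y Uy.
by rewrite -(deriveD (f3 y Uy) (g3 y Uy)).
Qed.

Lemma class_C_mul r U f g : open U -> class_C r U f -> class_C r U g ->
  class_C r U (fun y => f y * g y).
Proof.
move=> oU; elim: r f g => [|r ih] f g cf cg; have [f1 f2] := cf; have [g1 g2] := cg; (split; first
  by move=> x Ux; exact: (continuousM (f1 x Ux) (g1 x Ux))) => //.
move=> i; have [f3 f4] := f2 i; have [g3 g4] := g2 i; split.
  by move=> x Ux; apply: derivableM; [exact: f3|exact: g3].
have := class_C_add oU (ih _ _ (class_C_S cf) g4) (ih _ _ (class_C_S cg) f4).
apply: (@class_C_ext _ _ _ _ oU) => y Uy.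
by rewrite (deriveM (f3 y Uy) (g3 y Uy)).
Qed.

Lemma class_C_sum r U m (f : 'I_m -> 'rV[F]_n -> F) : open U ->
  (forall j, class_C r U (f j)) -> class_C r U (fun y => \sum_j f j y).
Proof.
move=> oU h; suff : forall s : seq 'I_m, class_C r U (fun y => \sum_(j <- s) f j y).
  by move=> /(_ (index_enum _)).
elim=> [|j s ih].
  by apply: class_C_ext oU _ (class_C_cst r U 0) => y _; rewrite big_nil.
by apply: class_C_ext oU _ (class_C_add oU (h j) ih) => y _; rewrite big_cons.
Qed.

Lemma class_C_coord r U l : open U -> class_C r U (fun y => y 0 l).
Proof.
move=> oU; have dl (i : 'I_n) (x : 'rV[F]_n) : dd (fun y : 'rV[F]_n => y 0 l) x (ei i) (l == i)%:R.
  move=> e e0; exists 1 => // h _; rewrite !mxE eqxx /= [_ + h * _]addrC addrK subrr normr0.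
  by apply: mulr_ge0 => //; exact: ltW.
case: r => [|r]; (split; first by move=> x _; exact: coord_continuous) => // i; split.
  by move=> x _; have /ddP[] := dl i x.
apply: class_C_ext oU _ (class_C_cst r U (l == i)%:R) => y _.
by have /ddP[] := dl i y.
Qed.

Lemma class_C_inv r U f : open U -> (forall x, U x -> f x != 0) -> class_C r U f ->
  class_C r U (fun y => (f y)^-1).
Proof.
move=> oU f0; elim: r => [|r ih] cf; have [f1 f2] := cf; (split; first
  by move=> x Ux; exact: (continuousV (f0 x Ux) (f1 x Ux))) => //.
move=> i; have [f3 f4] := f2 i; split.
  by move=> x Ux; apply: derivableV; [exact: f0|exact: f3].
have ci := ih (class_C_S cf).
have := class_C_mul oU (class_C_mul oU ci ci) (class_C_mul oU (class_C_cst r U (-1)) f4).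
apply: (@class_C_ext _ _ _ _ oU) => y Uy.
rewrite (deriveV (f0 y Uy) (f3 y Uy)) /GRing.scale /= expr2 invfM; ring.
Qed.

End N.

(** A common radius for finitely many estimates, in place of a minimum; each property is asked of
    all smaller radii so that it survives shrinking. *)
Lemma fin_pos (I : finType) (P : I -> F -> Prop) :
  (forall i, exists2 d : F, 0 < d & forall c, 0 < c -> c <= d -> P i c) ->
  exists2 d : F, 0 < d & forall i, P i d.
Proof.
move=> h; suff : forall s : seq I, exists2 d : F, 0 < d &
    forall c, 0 < c -> c <= d -> forall i, i \in s -> P i c.
  move=> /(_ (enum I)) [d d0 hd]; exists d => // i; apply: hd => //.
  by rewrite mem_enum.
elim=> [|i s [d d0 hd]]; first by exists 1.
have [d' d'0 hd'] := h i; have [c [c0 c1 c2]] := pos_min d0 d'0.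
exists c => // b b0 bc j; rewrite inE => /orP[/eqP ->|js].
  by apply: hd' => //; exact: le_trans bc c2.
by apply: hd => //; exact: le_trans bc c1.
Qed.

Definition fre n (f : 'rV[F]_n -> F) (x : 'rV[F]_n) (L : 'I_n -> F) :=
  forall e : F, 0 < e -> exists2 d : F, 0 < d &
    forall h : 'rV[F]_n, `|h| < d -> `|f (x + h) - f x - \sum_l h 0 l * L l| <= e * `|h|.

(** A mean value inequality up to a factor k serves R and C alike: k = 1 over R, and k = 2 over C,
    where real and imaginary part are treated separately. In both cases 0 <= t forces t to be
    real. *)
Variables (k : F) (k0 : 0 < k).
Hypothesis kP : forall n (f : 'rV[F]_n -> F) (x v : 'rV[F]_n) (M : F),
  (forall t, 0 <= t <= 1 -> derivable f (x + t *: v) v /\ `|'D_v f (x + t *: v)| <= M) ->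
  `|f (x + v) - f x| <= k * M.

Lemma segment_bound n (f : 'rV[F]_n -> F) (x : 'rV[F]_n) i (s M : F) :
  (forall t, 0 <= t <= 1 -> exists2 l, dd f (x + (t * s) *: ei i) (ei i) l & `|l| <= M) ->
  `|f (x + s *: ei i) - f x| <= k * (M * `|s|).
Proof.
move=> h; apply: kP => t t01; have [l dl lM] := h t t01.
have := dd_scale s dl; rewrite -scalerA => /ddP[d ->]; split => //.
by rewrite normrM mulrC; apply: ler_pM.
Qed.

Lemma row_sub_lt n (h g : 'rV[F]_n) (d : F) : `|h| < d -> (forall l, `|g 0 l| <= `|h 0 l|) ->
  `|g| < d.
Proof.
move=> hd le; have d0 : 0 < d := le_lt_trans (normr_ge0 _) hd.
by apply/(row_norm_lt _ d0) => l; apply: le_lt_trans (le l) _; apply: le_lt_trans (row_norm_le _ _) hd.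
Qed.

Lemma convex_lt (a b t d : F) : 0 <= t <= 1 -> a < d -> b < d -> (1 - t) * a + t * b < d.
Proof.
move=> /andP[t0 t1] ad bd; rewrite -subr_gt0.
have -> : d - ((1 - t) * a + t * b) = (1 - t) * (d - a) + t * (d - b) by ring.
have [->|tn] := eqVneq t 0; first by rewrite subr0 mul1r mul0r addr0 subr_gt0.
apply: ltr_wpDl; first by rewrite mulr_ge0 ?subr_ge0 // ltW.
by rewrite mulr_gt0 ?subr_gt0 // lt_neqAle eq_sym tn.
Qed.

(** Walk from b to a along the axes: on each segment f minus its linear part has small derivative by
    continuity, so [segment_bound] controls the increment. In the maximum norm the path stays inside
    the ball. *)
Lemma strict_C1 n (f : 'rV[F]_n -> F) U x : open U -> U x ->
  (forall l y, U y -> derivable f y (ei l)) ->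
  (forall l, {for x, continuous (fun y => 'D_(ei l) f y)}) ->
  forall e : F, 0 < e -> exists2 d : F, 0 < d &
    forall a b : 'rV[F]_n, `|a - x| < d -> `|b - x| < d ->
    `|f a - f b - \sum_l (a - b) 0 l * 'D_(ei l) f x| <= e * `|a - b|.
Proof.
move=> /openB oU Ux df cf e e0; have [d1 d10 hU] := oU x Ux.
(* Each of the n segments contributes at most k e' |a - b|; n + 1 keeps the denominator nonzero when
   n = 0. *)
pose e' := e / (k * n.+1%:R).
have kn : 0 < k * n.+1%:R by rewrite mulr_gt0 // ltr0n.
have e'0 : 0 < e' by rewrite divr_gt0.
have [d d0 hd] : exists2 d : F, 0 < d & forall y, `|y - x| < d ->
    U y /\ forall l, `|'D_(ei l) f y - 'D_(ei l) f x| < e'.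
  have [d2 d20 h2] := @fin_pos 'I_n
    (fun l d => forall y, `|y - x| < d -> `|'D_(ei l) f y - 'D_(ei l) f x| < e')
    (fun l => let: ex_intro2 d d0 h := iffLR (cont_at _ _) (cf l) e' e'0 in
      ex_intro2 _ _ d d0 (fun c c0 cd y yc => h y (lt_le_trans yc cd))).
  have [c [c0 c1 c2]] := pos_min d10 d20; exists c => // y yc; split.
    by apply: hU; exact: lt_le_trans yc c1.
  by move=> l; apply: h2; exact: lt_le_trans yc c2.
exists d => // a b ax bx; pose h : 'rV[F]_n := a - b.
pose w j : 'rV[F]_n := b + \row_l (if (l < j)%N then h 0 l else 0).
have wS (j : 'I_n) : w j.+1 = w j + h 0 j *: ei j.
  apply/rowP => l; rewrite !mxE eqxx /= ltnS leq_eqVlt.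
  have [->|ne] := eqVneq l j; first by rewrite eqxx ltnn mulr1 addr0.
  by rewrite -val_eqE /= in ne; rewrite (negPf ne) mulr0 addr0.
have step (j : 'I_n) : `|f (w j.+1) - f (w j) - h 0 j * 'D_(ei j) f x| <= k * (e' * `|h|).
  pose g y := f y - y 0 j * 'D_(ei j) f x.
  have -> : f (w j.+1) - f (w j) - h 0 j * 'D_(ei j) f x = g (w j + h 0 j *: ei j) - g (w j).
    rewrite /g -wS [w j.+1 0 j]mxE [w j 0 j]mxE ![(\row_l _) 0 j]mxE ltnn ltnSn addr0; ring.
  apply: (@le_trans _ _ (k * (e' * `|h 0 j|))); last first.
    by rewrite ler_pM2l // ler_pM2l // row_norm_le.
  apply: segment_bound => t /andP[t0 t1].
  have wU : `|w j + (t * h 0 j) *: ei j - x| < d.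
    apply/row_norm_lt => // l.
    have al : `|a 0 l - x 0 l| < d.
      by apply: le_lt_trans ax; have := row_norm_le (a - x) l; rewrite !mxE.
    have bl : `|b 0 l - x 0 l| < d.
      by apply: le_lt_trans bx; have := row_norm_le (b - x) l; rewrite !mxE.
    rewrite !mxE eqxx /=; have [e1|ne] := eqVneq l j.
      subst l; rewrite ltnn addr0 mulr1.
      apply: (le_lt_trans _ (@convex_lt _ _ t _ _ bl al)); last by apply/andP; split.
      rewrite -[X in X * `|b 0 j - _|]ger0_norm ?subr_ge0 // -[X in X * `|a 0 j - _|]ger0_norm //.
      rewrite -!normrM; apply: (le_trans _ (ler_normD _ _)).
      by rewrite le_eqVlt; apply/orP; left; apply/eqP; congr `|_|; ring.
    rewrite mulr0 addr0; case: ifP => _; last by rewrite addr0.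
    by rewrite [b 0 l + _]addrC subrK.
  have [Uy hy] := hd _ wU.
  exists ('D_(ei j) f (w j + (t * h 0 j) *: ei j) - 'D_(ei j) f x); last exact/ltW/hy.
  apply/ddP; have d1' := df j _ Uy.
  have lin y : dd (fun y : 'rV[F]_n => y 0 j * 'D_(ei j) f x) y (ei j) ('D_(ei j) f x).
    move=> c c0; exists 1 => // c' _; rewrite !mxE !eqxx /=.
    rewrite (_ : _ - _ = 0); first by rewrite normr0 mulr_ge0 // ltW.
    ring.
  have /ddP[d2 e2] := lin (w j + (t * h 0 j) *: ei j).
  split; first exact: derivableB.
  by rewrite -[in RHS]e2; exact: deriveB.
have -> : f a - f b - \sum_l (a - b) 0 l * 'D_(ei l) f x =
    \sum_(j < n) (f (w j.+1) - f (w j) - h 0 j * 'D_(ei j) f x).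
  rewrite sumrB; congr (_ - _).
  rewrite -(big_mkord xpredT (fun j => f (w j.+1) - f (w j))) telescope_sumr //; congr (f _ - f _).
    by apply/rowP => l; rewrite !mxE ltn_ord addrC subrK.
  by apply/rowP => l; rewrite !mxE addr0.
apply: le_trans (ler_norm_sum _ _ _) _.
apply: (@le_trans _ _ (\sum_(j < n) k * (e' * `|h|))); first by apply: ler_sum.
rewrite sumr_const card_ord -mulr_natr.
rewrite (_ : k * _ * _ = e * `|h| * (n%:R / n.+1%:R)); last first.
  have n1 : (n.+1%:R : F) != 0 by rewrite pnatr_eq0.
  rewrite /e'; set N : F := n.+1%:R in n1 *.
  by clearbody N; field; rewrite n1 gt_eqF.
rewrite -[leRHS]mulr1; apply: ler_wpM2l; first by apply: mulr_ge0 => //; exact: ltW.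
by rewrite ler_pdivrMr ?ltr0n // mul1r ler_nat.
Qed.

Lemma fre_C1 n (f : 'rV[F]_n -> F) U x : open U -> U x ->
  (forall l y, U y -> derivable f y (ei l)) ->
  (forall l, {for x, continuous (fun y => 'D_(ei l) f y)}) ->
  fre f x (fun l => 'D_(ei l) f x).
Proof.
move=> oU Ux df cf e e0; have [d d0 hd] := strict_C1 oU Ux df cf e0.
exists d => // h hh; have := hd (x + h) x; rewrite [x + h]addrC addrK subrr normr0.
exact.
Qed.

Lemma dd_comp (V : normedModType F) m (u : 'I_m -> V -> F) (x v : V) (l : 'I_m -> F)
    (H : 'rV[F]_m -> F) (L : 'I_m -> F) :
  (forall j, dd (u j) x v (l j)) -> fre H (\row_j u j x) L ->
  dd (fun y => H (\row_j u j y)) x v (\sum_j l j * L j).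
Proof.
move=> du fH e e0.
(* A |h| bounds the increment of the u_j, and B bounds the sum of the |L_j|; the error e |h| is
   shared equally between the expansion of H and those of the u_j. *)
pose A := 2 + \sum_j `|l j|; pose B := 1 + \sum_j `|L j|.
have A0 : 0 < A by apply: ltr_pwDl => //; apply: sumr_ge0.
have B0 : 0 < B by apply: ltr_pwDl => //; apply: sumr_ge0.
have e1 : 0 < e / (2 * A) by rewrite divr_gt0 // mulr_gt0.
have e2 : 0 < e / (2 * B) by rewrite divr_gt0 // mulr_gt0.
have [d1 d10 h1] := fH _ e1.
have [e3 [e30 e31 e32]] := pos_min e2 (@ltr01 F).
have [d2 d20 h2] := @fin_pos 'I_m
    (fun j d => forall h : F, `|h| < d -> `|u j (x + h *: v) - u j x - h * l j| <= e3 * `|h|)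
    (fun j => let: ex_intro2 d d0 hd := du j _ e30 in
      ex_intro2 _ _ d d0 (fun c c0 cd h hc => hd h (lt_le_trans hc cd))).
have [d [d0 dd1 dd2]] := pos_min (divr_gt0 d10 A0) d20.
exists d => // h hd; have [->|hn0] := eqVneq h 0.
  by rewrite scale0r addr0 subrr mul0r subrr normr0 mulr0.
have h0 : 0 < `|h| by rewrite normr_gt0.
pose q : 'rV[F]_m := \row_j (u j (x + h *: v) - u j x).
have h2' j := h2 j h (lt_le_trans hd dd2).
have qA : `|q| < A * `|h|.
  apply/row_norm_lt; first exact: mulr_gt0.
  move=> j; rewrite mxE.
  apply: (@le_lt_trans _ _ (e3 * `|h| + `|h| * `|l j|)).
    rewrite -(normrM h) -[X in `|X| <= _](subrK (h * l j)).
    by apply: le_trans (ler_normD _ _) _; rewrite lerD2r.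
  rewrite mulrC -mulrDr mulrC ltr_pM2r // /A.
  apply: (@lt_le_trans _ _ (2 + `|l j|)).
    by rewrite ltrD2r; apply: le_lt_trans e32 _; rewrite ltr1n.
  by rewrite lerD2l (bigD1 j) //= lerDl sumr_ge0.
have q1 : `|q| < d1.
  apply: lt_trans qA _; rewrite mulrC -ltr_pdivlMr //.
  exact: lt_le_trans hd dd1.
have := h1 q q1.
have -> : \row_j u j x + q = \row_j u j (x + h *: v).
  by apply/rowP => j; rewrite !mxE addrC subrK.
move=> h3; set a := H _ - H _ in h3 *.
have -> : a - h * (\sum_j l j * L j) =
    (a - \sum_j q 0 j * L j) + \sum_j (q 0 j - h * l j) * L j.
  rewrite [X in _ = _ + X](_ : _ = \sum_j q 0 j * L j - h * \sum_j l j * L j); first by ring.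
  by rewrite mulr_sumr -sumrB; apply: eq_bigr => j _; rewrite mulrBl mulrA.
apply: le_trans (ler_normD _ _) _.
have -> : e * `|h| = e / (2 * A) * (A * `|h|) + e / (2 * B) * `|h| * B.
  by field; rewrite !gt_eqF.
apply: lerD.
  by apply: le_trans h3 _; apply: ler_wpM2l; [exact: ltW|exact: ltW].
apply: le_trans (ler_norm_sum _ _ _) _.
apply: (@le_trans _ _ (\sum_j e / (2 * B) * `|h| * `|L j|)).
  apply: ler_sum => j _; rewrite normrM mxE; apply: ler_wpM2r => //.
  apply: le_trans (h2' j) _; apply: ler_wpM2r => //.
by rewrite -mulr_sumr; apply: ler_wpM2l; [rewrite mulr_ge0 // ltW|rewrite lerDr].
Qed.

Lemma cont_row (V : normedModType F) m (u : 'I_m -> V -> F) (x : V) (P : 'rV[F]_m -> Prop) (d : F) :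
  (forall j, {for x, continuous (u j)}) -> 0 < d ->
  (forall w, `|w - \row_j u j x| < d -> P w) ->
  exists2 c : F, 0 < c & forall y, `|y - x| < c -> P (\row_j u j y).
Proof.
move=> cu d0 hP.
have [c c0 hc] := @fin_pos 'I_m (fun j c => forall y, `|y - x| < c -> `|u j y - u j x| < d)
    (fun l => let: ex_intro2 d d0 h := iffLR (cont_at _ _) (cu l) d d0 in
      ex_intro2 _ _ d d0 (fun c c0 cd y yc => h y (lt_le_trans yc cd))).
exists c => // y yc; apply: hP; apply/(row_norm_lt _ d0) => j; rewrite !mxE; exact: hc.
Qed.

Lemma cont_comp (V : normedModType F) m (u : 'I_m -> V -> F) (x : V) (H : 'rV[F]_m -> F) :
  (forall j, {for x, continuous (u j)}) -> {for \row_j u j x, continuous H} ->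
  {for x, continuous (fun y => H (\row_j u j y))}.
Proof.
move=> cu /cont_at cH; apply/cont_at => e /cH[d d0 hd].
exact: (cont_row cu d0 hd).
Qed.

(** The derivative of the composite is a sum of products of derivatives of the u_j with composites
    of derivatives of H, all of one class lower; so the induction keeps u and H general. *)
Lemma class_C_comp r m n (U : set 'rV[F]_n) (V : set 'rV[F]_m) u H :
  open U -> open V -> (forall x, U x -> V (\row_j u j x)) ->
  (forall j, class_C r U (u j)) -> class_C r V H ->
  class_C r U (fun y => H (\row_j u j y)).
Proof.
move=> oU oV UV; elim: r u H UV => [|r ih] u H UV cu cH.
  split => // x Ux; apply: cont_comp; first by move=> j; have [h _] := cu j; exact: h.
  by have [h _] := cH; apply: h; exact: UV.
have dH x : U x -> forall i : 'I_n, dd (fun y => H (\row_j u j y)) x (ei i)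
    (\sum_j 'D_(ei i) (u j) x * 'D_(ei j) H (\row_j u j x)).
  move=> Ux i; have [_ hH] := cH; apply: dd_comp.
    by move=> j; have [_ h] := cu j; apply: dd_derive; have [h' _] := h i; apply: h'.
  apply: (fre_C1 oV (UV _ Ux)) => l; first by move=> y Vy; have [h _] := hH l; apply: h.
  have [_ h] := hH l; apply: (class_C_cont h); exact: UV.
split.
  move=> x Ux; apply: cont_comp; first by move=> j; have [h _] := cu j; exact: h.
  by have [h _] := cH; apply: h; exact: UV.
move=> i; split; first by move=> x Ux; have /ddP[] := dH x Ux i.
apply: (@class_C_ext _ _ _ (fun x => \sum_j 'D_(ei i) (u j) x * 'D_(ei j) H (\row_j u j x)) _ oU).
  by move=> y Uy; have /ddP[_ ->] := dH y Uy i.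
apply: class_C_sum => // j; apply: class_C_mul => //.
  by have [_ h] := cu j; have [_ h'] := h i.
apply: (ih u (fun w => 'D_(ei j) H w)) => //; first by move=> l; apply: class_C_S.
by have [_ h] := cH; have [_ h'] := h j.
Qed.

End ClassC.

(** * Germs of differentiable functions *)

Section DiffGeo.
Variables (F : numFieldType) (k : F) (k0 : 0 < k).
Hypothesis kP : forall n (f : 'rV[F]_n -> F) (x v : 'rV[F]_n) (M : F),
  (forall t, 0 <= t <= 1 -> derivable f (x + t *: v) v /\ `|'D_v f (x + t *: v)| <= M) ->
  `|f (x + v) - f x| <= k * M.

Local Notation G := (differential_geometry F).

Lemma dg_aroundP n (z : 'rV[F]_n) P : @around _ (affine G n) z P <->
  exists2 e : F, 0 < e & forall y, `|y - z| < e -> P y.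
Proof.
split=> [[U [/openB oU Uz UP]]|[e e0 h]].
  by have [e e0 h] := oU z Uz; exists e => // y /h /UP.
exists [set y | `|y - z| < e]; split => //; last by rewrite /= subrr normr0.
apply/openB => x /= xz; exists (e - `|x - z|); first by rewrite subr_gt0.
move=> y yx; rewrite -[y](subrK x) -addrA; apply: le_lt_trans (ler_normD _ _) _.
by rewrite -ltrBrDr.
Qed.

Lemma open_fin n m (U : 'I_m -> set 'rV[F]_n) : (forall i, open (U i)) ->
  open [set y | forall i, U i y].
Proof.
move=> oU; apply/openB => x Ux.
have [d d0 hd] := @fin_pos F 'I_m (fun i d => forall y, `|y - x| < d -> U i y)
  (fun i => let: ex_intro2 d d0 h := iffLR (openB _) (oU i) x (Ux i) in
      ex_intro2 _ _ d d0 (fun c c0 cd y yc => h y (lt_le_trans yc cd))).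
by exists d => // y yx i; exact: hd.
Qed.

Lemma open_preim n m (U : set 'rV[F]_n) (u : 'I_m -> 'rV[F]_n -> F) (V : set 'rV[F]_m) :
  open U -> open V -> (forall j x, U x -> {for x, continuous (u j)}) ->
  open [set y | U y /\ V (\row_j u j y)].
Proof.
move=> /openB oU /openB oV cu; apply/openB => x [Ux Vx].
have [e e0 he] := oV _ Vx; have [d d0 hd] := oU _ Ux.
have [c c0 hc] := cont_row (fun j => cu j x Ux) e0 he.
have [b [b0 b1 b2]] := pos_min d0 c0; exists b => // y yb; split.
  by apply: hd; exact: lt_le_trans yb b1.
by apply: hc; exact: lt_le_trans yb b2.
Qed.

Local Notation areg n z f := (@regular_at F (affine G n) z f).

Lemma dg_reg_cont n (z : 'rV[F]_n) f : areg n z f -> {for z, continuous f}.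
Proof. by move=> [U [oU Uz hU]]; have [h _] := hU 0%N; exact: h. Qed.

Lemma dg_comp n m (z : 'rV[F]_n) (u : 'I_m -> 'rV[F]_n -> F) (H : 'rV[F]_m -> F) :
  (forall j, areg n z (u j)) -> areg m (\row_j u j z) H ->
  areg n z (fun y => H (\row_j u j y)).
Proof.
move=> /choice[W hW] [V [oV Vz hV]].
pose W' := [set y | forall j, W j y].
have oW : open W' by apply: open_fin => j; have [] := hW j.
have cu j x : W' x -> {for x, continuous (u j)}.
  by move=> Wx; have [_ _ /(_ 0%N) [h _]] := hW j; apply: h; exact: Wx.
exists [set y | W' y /\ V (\row_j u j y)]; split.
- exact: open_preim.
- by split => // j; have [] := hW j.
move=> r; apply: (class_C_comp k0 kP (open_preim oW oV cu) oV) => //.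
  by move=> x [].
move=> j; apply: (@class_C_sub _ _ _ _ (W j)); first by move=> y [h _]; exact: h.
by have [_ _] := hW j; apply.
Qed.

Lemma dg_tame n (z : affine G n) : @tame G (affine G n) z.
Proof.
split.
- by exists setT; split => //; exact: openT.
- move=> P Q [U [oU Uz UP]] [V [oV Vz VQ]]; exists (U `&` V); split => //.
    exact: (openI (A := U) (B := V)).
  by move=> y [/UP ? /VQ ?].
- by move=> f [U [oU Uz hU]]; exists U; split => // y Uy; exists U; split.
- move=> f g [U [oU Uz UP]] [V [oV Vz hV]]; exists (U `&` V); split => //.
    exact: (openI (A := U) (B := V)).
  move=> r; apply: (@class_C_ext _ _ _ _ f); first exact: (openI (A := U) (B := V)).
    by move=> y [/UP].
  by apply: class_C_sub (hV r) => y [].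
- by move=> m f H; exact: dg_comp.
- move=> m f V rf oV Vz; apply/dg_aroundP.
  have [e e0 he] := iffLR (openB (V := 'rV[F]_m) V) oV _ Vz.
  exact: (cont_row (fun j => dg_reg_cont (rf j)) e0 he).
Qed.

Lemma dg_openL n (W : set (affine G n)) : (forall x, W x -> around x W) -> opn (affine G n) W.
Proof. by move=> h; apply/openB => x /h /dg_aroundP. Qed.

Lemma dg_of_class n (z : 'rV[F]_n) f : (forall r, class_C r setT f) -> areg n z f.
Proof. by move=> h; exists setT; split => //; exact: openT. Qed.

Lemma dg_add (z : affine G 2) : regular_at z (fun y : 'rV[F]_2 => y 0 0 + y 0 1).
Proof.
by apply: dg_of_class => r; apply: class_C_add; try exact: openT; apply: class_C_coord; exact: openT.
Qed.

Lemma dg_mul (z : affine G 2) : regular_at z (fun y : 'rV[F]_2 => y 0 0 * y 0 1).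
Proof.
by apply: dg_of_class => r; apply: class_C_mul; try exact: openT; apply: class_C_coord; exact: openT.
Qed.

Lemma dg_ne0 : open [set y : 'rV[F]_1 | y 0 0 != 0].
Proof.
apply/openB => x /= x0; exists `|x 0 0|; first by rewrite normr_gt0.
move=> y yx; apply/eqP => y0; have := le_lt_trans (row_norm_le (y - x) 0) yx.
by rewrite !mxE y0 sub0r normrN ltxx.
Qed.

Lemma dg_inv (z : 'rV[F]_1) : z 0 0 != 0 -> areg 1 z (fun y : 'rV[F]_1 => (y 0 0)^-1).
Proof.
move=> z0; exists [set y | y 0 0 != 0]; split => // [|r]; first exact: dg_ne0.
by apply: class_C_inv => //; [exact: dg_ne0|apply: class_C_coord; exact: dg_ne0].
Qed.

Lemma dg_dens (H : 'rV[F]_1 -> F) : areg 1 0 H ->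
  @around _ (affine G 1) 0 (fun y => y 0 0 * H y = 0) -> H 0 = 0.
Proof.
move=> rH /dg_aroundP[e e0 he]; apply/eqP; apply: contraT => H0.
have := dg_reg_cont rH => /cont_at /(_ `|H 0|); rewrite normr_gt0 => /(_ H0)[d d0 hd].
have [c [c0 c1 c2]] := pos_min e0 d0.
pose y : 'rV[F]_1 := \row_j (c / 2).
have c2' : c / 2 < c by rewrite ltr_pdivrMr // ltr_pMr // ltr1n.
have cp : 0 < c / 2 by rewrite divr_gt0.
have yc : `|y - 0| < c.
  by rewrite subr0; apply/row_norm_lt => // l; rewrite mxE gtr0_norm.
have := he y (lt_le_trans yc c1); rewrite mxE => /eqP; rewrite mulf_eq0 (gt_eqF cp) /= => /eqP Hy.
by have := hd y (lt_le_trans yc c2); rewrite Hy sub0r normrN ltxx.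
Qed.

Lemma two_thirds : 3^-1 + 3^-1 < 1 :> F.
Proof.
have -> : 3^-1 + 3^-1 = 2 / 3 :> F by rewrite -mulr2n -[LHS]mulr_natl.
by rewrite ltr_pdivrMr ?ltr0n // mul1r ltr_nat.
Qed.

(** Schwarz's theorem: the second difference of f over a parallelogram with sides s e_a and s e_b is
    symmetric in a and b, and [segment_bound] used twice compares it with s^2 times either mixed
    derivative. *)
Lemma mixed_partials n (f : 'rV[F]_n -> F) U i j x : open U -> U x -> class_C 2 U f ->
  'D_(ei i) (fun y => 'D_(ei j) f y) x = 'D_(ei j) (fun y => 'D_(ei i) f y) x.
Proof.
move=> /openB oU Ux [cf hf].
have main e : 0 < e -> exists2 d : F, 0 < d & forall a b (s : F), 0 < s -> s < d ->
   `|f (x + s *: ei a + s *: ei b) - f (x + s *: ei a) - f (x + s *: ei b) + f x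
     - s * s * 'D_(ei b) (fun y => 'D_(ei a) f y) x| <= e * (s * s).
  move=> e0; have e'0 : 0 < e / (k * k) by rewrite divr_gt0 // mulr_gt0.
  have [r r0 hr] := oU x Ux.
  have [d1 d10 hd1] : exists2 d : F, 0 < d & forall ab : 'I_n * 'I_n, forall y, `|y - x| < d ->
     `|'D_(ei ab.2) (fun y => 'D_(ei ab.1) f y) y - 'D_(ei ab.2) (fun y => 'D_(ei ab.1) f y) x| < e / (k * k).
    apply: (@fin_pos F ('I_n * 'I_n)%type (fun ab d => forall y, `|y - x| < d ->
     `|'D_(ei ab.2) (fun y => 'D_(ei ab.1) f y) y - 'D_(ei ab.2) (fun y => 'D_(ei ab.1) f y) x| < e / (k * k))).
    move=> [a b] /=; have [_ [_ h]] := hf a; have [_ h2] := h b.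
    have [h3 _] := h2; have /cont_at/(_ _ e'0)[d d0 hd] := h3 x Ux.
    by exists d => // c c0 cd y yc; apply: hd; exact: lt_le_trans yc cd.
  have [d [d0 dr dd1]] := pos_min r0 d10.
  (* Two sides of length s < d / 3 do not leave the ball of radius d. *)
  exists (d / 3); first by rewrite divr_gt0.
  move=> a b s s0 sd.
  have inB t u : 0 <= t <= 1 -> 0 <= u <= 1 ->
      `|x + (t * s) *: ei a + (u * s) *: ei b - x| < d.
    move=> /andP[t0 t1] /andP[u0 u1]; rewrite addrAC [x + _]addrC addrK.
    apply/row_norm_lt => // l; rewrite !mxE eqxx /=.
    apply: le_lt_trans (ler_normD _ _) _.
    have bd (c : bool) (w : F) : 0 <= w -> w <= 1 -> `|w * s * c%:R| <= s.
      move=> w0 w1; rewrite !normrM normr_nat (ger0_norm w0) (gtr0_norm s0).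
      rewrite -[leRHS]mulr1; apply: ler_pM => //; [by rewrite mulr_ge0 // ltW|by rewrite -[leRHS]mul1r ler_pM2r|by case: c].
    apply: (@le_lt_trans _ _ (s + s)); first by apply: lerD; exact: bd.
    apply: (@lt_trans _ _ (d / 3 + d / 3)); first exact: ltrD.
    by rewrite -mulrDr -[ltRHS]mulr1 ltr_pM2l // two_thirds.
  have inU t u (ht : 0 <= t <= 1) (hu : 0 <= u <= 1) : U (x + (t * s) *: ei a + (u * s) *: ei b).
    by apply: hr; apply: lt_le_trans (inB t u ht hu) dr.
  pose D2 : F := 'D_(ei b) (fun y => 'D_(ei a) f y) x.
  pose g (y : 'rV[F]_n) : F := f (y + s *: ei b) - f y - y 0 a * (s * D2).
  have gE y c : g (y + c *: ei a) = f (y + c *: ei a + s *: ei b) - f (y + c *: ei a) - (y 0 a + c) * (s * D2).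
    by rewrite /g !mxE !eqxx mulr1.
  have -> : f (x + s *: ei a + s *: ei b) - f (x + s *: ei a) - f (x + s *: ei b) + f x - s * s * D2 =
      g (x + s *: ei a) - g x.
    rewrite gE /g; ring.
  have -> : e * (s * s) = k * (k * (e / (k * k) * `|s|) * `|s|).
    by rewrite (gtr0_norm s0); field; rewrite gt_eqF.
  apply: (segment_bound kP) => t t01.
  have dS c y : U y -> dd f y (ei c) ('D_(ei c) f y).
    by move=> Uy; apply: dd_derive; have [h _] := hf c; apply: h.
  have t00 : 0 <= (0 : F) <= 1 by rewrite lexx ler01.
  have t11 : 0 <= (1 : F) <= 1 by rewrite lexx ler01.
  have U1 := inU t 0 t01 t00; rewrite mul0r scale0r addr0 in U1.
  have U2 := inU t 1 t01 t11; rewrite mul1r in U2.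
  exists ('D_(ei a) f (x + (t * s) *: ei a + s *: ei b) - 'D_(ei a) f (x + (t * s) *: ei a) - s * D2).
    move=> c c0; have [da da0 ha] := dS a _ U1 (c / 2) (divr_gt0 c0 (ltr0Sn _ _)).
    have [db db0 hb] := dS a _ U2 (c / 2) (divr_gt0 c0 (ltr0Sn _ _)).
    have [dc [dc0 dca dcb]] := pos_min da0 db0; exists dc => // h hh.
    have -> : g (x + (t * s) *: ei a + h *: ei a) - g (x + (t * s) *: ei a) -
      h * ('D_(ei a) f (x + (t * s) *: ei a + s *: ei b) - 'D_(ei a) f (x + (t * s) *: ei a) - s * D2) =
      (f (x + (t * s) *: ei a + s *: ei b + h *: ei a) - f (x + (t * s) *: ei a + s *: ei b)
        - h * 'D_(ei a) f (x + (t * s) *: ei a + s *: ei b)) -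
      (f (x + (t * s) *: ei a + h *: ei a) - f (x + (t * s) *: ei a) - h * 'D_(ei a) f (x + (t * s) *: ei a)).
      rewrite gE /g (addrAC (x + (t * s) *: ei a) (h *: ei a)); ring.
    apply: le_trans (ler_normB _ _) _.
    rewrite [c]splitr mulrDl; apply: lerD; [apply: hb|apply: ha]; exact: lt_le_trans hh _.
  pose g2 (y : 'rV[F]_n) : F := 'D_(ei a) f y - y 0 b * D2.
  have g2E y c : g2 (y + c *: ei b) = 'D_(ei a) f (y + c *: ei b) - (y 0 b + c) * D2.
    by rewrite /g2 !mxE !eqxx mulr1.
  have -> : 'D_(ei a) f (x + (t * s) *: ei a + s *: ei b) - 'D_(ei a) f (x + (t * s) *: ei a) - s * D2 =
     g2 (x + (t * s) *: ei a + s *: ei b) - g2 (x + (t * s) *: ei a).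
    rewrite g2E /g2; ring.
  apply: (@segment_bound _ _ kP n g2 (x + (t * s) *: ei a) b s) => u u01.
  have U3 := inU t u t01 u01.
  exists ('D_(ei b) (fun y => 'D_(ei a) f y) (x + (t * s) *: ei a + (u * s) *: ei b) - D2).
    have [_ [_ h]] := hf a; have [h3 _] := h b.
    move=> c c0; have [da da0 ha] := dd_derive (h3 _ U3) c0; exists da => // h' hh.
    have := ha h' hh; congr (`|_| <= _); rewrite g2E /g2; ring.
  by apply/ltW; apply: (hd1 (a, b)); exact: lt_le_trans (inB t u t01 u01) dd1.
apply/eqP; rewrite -subr_eq0; apply: contraT; rewrite -normr_gt0 => ne.
set D1 := 'D_(ei i) _ x in ne *; set D2 := 'D_(ei j) _ x in ne *.
(* A third of the distance for each order of differentiation: the two errors add up to less than the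
   distance. *)
have [d d0 hd] := main (`|D1 - D2| / 3) (divr_gt0 ne (ltr0Sn _ _)).
have s0 : 0 < d / 2 by rewrite divr_gt0.
have sd : d / 2 < d by rewrite ltr_pdivrMr // ltr_pMr // ltr1n.
have := hd j i _ s0 sd; have := hd i j _ s0 sd; rewrite -/D1 -/D2.
set s := d / 2 in s0 *.
rewrite (addrAC x (s *: ei j)).
set A := f (x + _ + _); set B := f (x + s *: ei i); set C := f (x + s *: ei j) => h1 h2.
have := lerD h1 h2; rewrite -mulrDl => h3.
have h4 : `|D1 - D2| * (s * s) <= (`|D1 - D2| / 3 + `|D1 - D2| / 3) * (s * s).
  apply: le_trans h3; rewrite -[X in _ * X](@gtr0_norm _ (s * s)); last exact: mulr_gt0.
  rewrite -normrM; apply: le_trans _ (ler_normB _ _).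
  by rewrite le_eqVlt; apply/orP; left; apply/eqP; congr `|_|; ring.
move: h4; rewrite ler_pM2r; last exact: mulr_gt0.
rewrite -mulrDr -[leLHS]mulr1 ler_pM2l // => h.
by have := le_lt_trans h two_thirds; rewrite ltxx.
Qed.

End DiffGeo.

(** * Division by a coordinate *)

Section Division.
Variables (F : numFieldType) (k : F) (k0 : 0 < k).
Hypothesis kP : forall n (f : 'rV[F]_n -> F) (x v : 'rV[F]_n) (M : F),
  (forall t, 0 <= t <= 1 -> derivable f (x + t *: v) v /\ `|'D_v f (x + t *: v)| <= M) ->
  `|f (x + v) - f x| <= k * M.
Variables (n : nat) (z : 'rV[F]_n) (i : 'I_n) (e : F).
Hypothesis zi : z 0 i = 0.
Local Notation G := (differential_geometry F).
Local Notation setz := (@setc (differential_geometry F) n).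

Implicit Types (y u : 'rV[F]_n) (f g : 'rV[F]_n -> F).

Let B : set 'rV[F]_n := [set y | `|y - z| < e].
Let p (y : 'rV[F]_n) : 'rV[F]_n := setz y i 0.
Let Dp j (f : 'rV[F]_n -> F) : 'rV[F]_n -> F := fun y => 'D_(ei j) f y.
Let sm f := forall r, class_C r B f.

Let oB : open B.
Proof.
apply/openB => x /= xz; exists (e - `|x - z|); first by rewrite subr_gt0.
move=> y yx; rewrite /B /= -[y](subrK x) -addrA; apply: le_lt_trans (ler_normD _ _) _.
by rewrite -ltrBrDr.
Qed.

Let setB y t : B y -> 0 <= t <= 1 -> B (setz y i (t * y 0 i)).
Proof.
move=> By /andP[t0 t1]; apply: row_sub_lt By _ => l; rewrite !mxE.
case: eqP => [->|//]; rewrite zi !subr0 normrM ger0_norm // -[leRHS]mul1r.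
exact: ler_wpM2r.
Qed.

Let pB y : B y -> B (p y).
Proof. by move=> By; rewrite /p -(mul0r (y 0 i)); apply: setB; rewrite // lexx ler01. Qed.

Let p_id y : y 0 i = 0 -> p y = y.
Proof. by move=> y0; apply/rowP => l; rewrite !mxE; case: eqP => [->|]. Qed.

Let p_i y : p y 0 i = 0. Proof. by rewrite !mxE eqxx. Qed.

Let p_lin y h : p (y + h *: ei i) = p y.
Proof. by apply/rowP => l; rewrite !mxE eqxx /=; case: eqP => // _; rewrite mulr0 addr0. Qed.

Let p_lin' y h j : j != i -> p (y + h *: ei j) = p y + h *: ei j.
Proof.
move=> ji; apply/rowP => l; rewrite !mxE eqxx /=; case: eqP => // ->.
by rewrite eq_sym (negPf ji) mulr0 addr0.
Qed.

Let set_lin y a : setz y i a = p y + a *: ei i.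
Proof.
apply/rowP => l; rewrite !mxE eqxx /=; case: eqP => _; first by rewrite mulr1 add0r.
by rewrite mulr0 addr0.
Qed.

Let smD j f : sm f -> sm (Dp j f).
Proof. by move=> h r; have [_ h2] := h r.+1; have [_ h3] := h2 j. Qed.

Let smDn l f : sm f -> sm (iter l (Dp i) f).
Proof. by elim: l => //= l ih h; apply: smD; exact: ih. Qed.

Let sm_dd j f y : sm f -> B y -> dd f y (ei j) (Dp j f y).
Proof. by move=> h By; have [_ h2] := h 1%N; have [h3 _] := h2 j; apply: dd_derive; exact: h3. Qed.

Let sm_cont f y : sm f -> B y -> {for y, continuous f}.
Proof. by move=> h By; exact: (class_C_cont (h 0%N)). Qed.

Let derive_congr j f g y : B y -> (forall u, B u -> f u = g u) -> Dp j f y = Dp j g y.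
Proof. by move=> By fg; apply: near_eq_derive; exact: (open_near oB By fg). Qed.

Let swapD l j f y : sm f -> B y -> Dp j (iter l (Dp i) f) y = iter l (Dp i) (Dp j f) y.
Proof.
elim: l y => // l ih y sf By; rewrite iterS.
rewrite [LHS](mixed_partials k0 kP j i oB By (smDn l sf 2%N)).
by apply: (@derive_congr i _ _ y By) => u Bu; apply: ih.
Qed.

Let dd_eqv f g (y v : 'rV[F]_n) l : (forall h : F, f (y + h *: v) = g (y + h *: v)) ->
  dd g y v l -> dd f y v l.
Proof.
move=> fg h a /h[d d0 hd]; exists d => // c hc.
by have := fg 0; rewrite scale0r addr0 => ->; rewrite fg; exact: hd.
Qed.

Let dd_lin f g (y v : 'rV[F]_n) l m c : dd f y v l -> dd g y v m ->
  dd (fun u => c * f u + g u) y v (c * l + m).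
Proof.
move=> /ddP[df <-] /ddP[dg <-]; apply/ddP.
have dcf : derivable (c \*: f) y v by exact: derivableZ.
split; first exact: (derivableD dcf dg).
by have := deriveD dcf dg; rewrite (deriveZ c df) => <-.
Qed.

Let dd_cst c (y v : 'rV[F]_n) : dd (fun=> c) y v 0.
Proof.
move=> a a0; exists 1 => // h _; rewrite subrr mulr0 subrr normr0.
by apply: mulr_ge0 => //; exact: ltW.
Qed.

Let dd_mul f g (y v : 'rV[F]_n) l m : dd f y v l -> dd g y v m ->
  dd (fun u => f u * g u) y v (f y * m + g y * l).
Proof.
move=> /ddP[df <-] /ddP[dg <-]; apply/ddP; split; first exact: derivableM.
exact: (deriveM df dg).
Qed.

Let dd_inv f (y v : 'rV[F]_n) l : f y != 0 -> dd f y v l ->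
  dd (fun u => (f u)^-1) y v (- (f y ^+ 2)^-1 * l).
Proof.
move=> fy /ddP[df <-]; apply/ddP; split; first exact: derivableV.
exact: (deriveV fy df).
Qed.

Let dd_pow m y : dd (fun u : 'rV[F]_n => u 0 i ^+ m.+1) y (ei i) (m.+1%:R * y 0 i ^+ m).
Proof.
have d1 : dd (fun u : 'rV[F]_n => u 0 i) y (ei i) 1.
  move=> a a0; exists 1 => // h _; rewrite !mxE !eqxx /= mulr1 [y 0 i + h]addrC addrK subrr normr0.
  by apply: mulr_ge0 => //; exact: ltW.
elim: m => [|m ih].
  by rewrite expr0 mulr1; apply: dd_eqv d1 => h; rewrite expr1.
have := dd_mul d1 ih.
rewrite (_ : _ + _ = m.+2%:R * y 0 i ^+ m.+1); last by rewrite !exprS -[m.+2%:R]natr1; ring.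
by apply: dd_eqv => h; rewrite exprS.
Qed.

(** Taylor polynomial of degree below m in the variable u_i, expanded at the projection p u onto u_i
    = 0. *)
Definition tay m f (u : 'rV[F]_n) : F :=
  \sum_(l < m) iter l (Dp i) f (p u) / l`!%:R * u 0 i ^+ l.

Let tayS m f u : tay m.+1 f u = tay m f u + iter m (Dp i) f (p u) / m`!%:R * u 0 i ^+ m.
Proof. by rewrite /tay big_ord_recr. Qed.

Let tay0 f u : tay 0 f u = 0. Proof. by rewrite /tay big_ord0. Qed.

Let iterD l f : iter l (Dp i) (Dp i f) = iter l.+1 (Dp i) f.
Proof. by rewrite iterSr. Qed.

Let dd_tay m f y : dd (tay m.+1 f) y (ei i) (tay m (Dp i f) y).
Proof.
elim: m => [|m ih].
  rewrite tay0; apply: dd_eqv (dd_cst (f (p y)) y _) => h.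
  by rewrite tayS tay0 add0r p_lin fact0 divr1 expr0 mulr1.
rewrite tayS iterD.
have := dd_lin (iter m.+1 (Dp i) f (p y) / m.+1`!%:R) (dd_pow m y) ih.
rewrite addrC [_ * (_ * _)]mulrA factS natrM invfM -[_ * m.+1%:R]mulrA.
rewrite [m.+1%:R^-1 / _ * _]mulrAC mulVf ?mul1r ?pnatr_eq0 //.
apply: dd_eqv => h; rewrite tayS p_lin addrC factS natrM invfM //.
Qed.

Let tay_p m f y : tay m.+1 f (p y) = f (p y).
Proof.
elim: m => [|m ih]; first by rewrite tayS tay0 add0r p_id // fact0 divr1 expr0 mulr1.
by rewrite tayS ih p_i expr0n /= mulr0 addr0.
Qed.

(** The remainder vanishes on u_i = 0 and its derivative is the remainder of the derivative, so
    induction with [segment_bound] gains a factor k |y_i| at each step. *)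
Let taylor m f y (M : F) : sm f -> B y ->
  (forall t, 0 <= t <= 1 ->
    `|iter m (Dp i) f (setz y i (t * y 0 i)) - iter m (Dp i) f (p y)| <= M) ->
  `|f y - tay m.+1 f y| <= (k * `|y 0 i|) ^+ m * M.
Proof.
have setid u : setz u i (1 * u 0 i) = u.
  by apply/rowP => l; rewrite !mxE mul1r; case: eqP => [->|].
elim: m f y => [|m ih] f y sf By h.
  rewrite expr0 mul1r tayS tay0 add0r fact0 divr1 expr0 mulr1 /=.
  by have := h 1; rewrite lexx ler01 setid; apply.
have -> : f y - tay m.+2 f y = (f y - tay m.+2 f y) - (f (p y) - tay m.+2 f (p y)).
  by rewrite tay_p subrr subr0.
have yE : y = p y + y 0 i *: ei i by rewrite -set_lin -[y 0 i]mul1r setid.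
pose g u := f u - tay m.+2 f u.
rewrite -/(g y) -/(g (p y)) {1}yE exprS -!mulrA.
rewrite [`|y 0 i| * _]mulrC.
apply: (@segment_bound _ _ kP n g (p y) i (y 0 i)) => t t01.
have Bt := setB By t01.
rewrite -set_lin.
set u := setz y i (t * y 0 i) in Bt *.
have pu : p u = p y by apply/rowP => l; rewrite !mxE; case: eqP.
have ui : u 0 i = t * y 0 i by rewrite mxE eqxx.
exists (Dp i f u - tay m.+1 (Dp i f) u).
  have := dd_lin (-1) (dd_tay m.+1 f u) (sm_dd i sf Bt).
  by rewrite mulN1r addrC; apply: dd_eqv => h'; rewrite /g mulN1r addrC.
have /andP[t0 t1] := t01.
have M0 : 0 <= M by apply: le_trans (h 0 _); rewrite // lexx ler01.
apply: (@le_trans _ _ ((k * `|u 0 i|) ^+ m * M)).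
  apply: ih; [exact: smD|exact: Bt|] => s s01.
  rewrite pu iterD ui mulrA.
  have -> : setz u i (s * t * y 0 i) = setz y i (s * t * y 0 i).
    by apply/rowP => l; rewrite !mxE; case: eqP.
  apply: h; move: s01 => /andP[s0 s1]; apply/andP; split; first exact: mulr_ge0.
  by rewrite -[leRHS]mulr1; apply: ler_pM.
apply: ler_wpM2r => //; apply: lerXn2r; rewrite ?nnegrE ?mulr_ge0 ?(ltW k0) //.
rewrite ler_pM2l // ui normrM (ger0_norm t0) -[leRHS]mul1r.
exact: ler_wpM2r.
Qed.

(** The Taylor remainder divided by u_i^m, completed by its limit on u_i = 0. All m are taken at
    once because this family is closed under differentiation: d_j quo m f = quo m (d_j f) for j <>
    i, and d_i quo m f = quo m (d_i f) - m quo (m+1) f. Smoothness follows by induction on r,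
    without integrals and hence also over C. *)
Definition quo m f (u : 'rV[F]_n) : F :=
  if u 0 i == 0 then iter m (Dp i) f u / m`!%:R else (f u - tay m f u) / u 0 i ^+ m.

Let quo_p m f u (M : F) : sm f -> B u ->
  (forall t, 0 <= t <= 1 ->
    `|iter m (Dp i) f (setz u i (t * u 0 i)) - iter m (Dp i) f (p u)| <= M) ->
  `|quo m f u - iter m (Dp i) f (p u) / m`!%:R| <= k ^+ m * M.
Proof.
move=> sf Bu h.
have M0 : 0 <= M by apply: le_trans (h 0 _); rewrite // lexx ler01.
rewrite /quo; case: eqP => [u0|/eqP u0].
  by rewrite p_id // subrr normr0 mulr_ge0 // exprn_ge0 // ltW.
have := taylor sf Bu h; rewrite tayS.
have -> : (k * `|u 0 i|) ^+ m * M = k ^+ m * M * `|u 0 i| ^+ m by rewrite exprMn mulrAC.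
have um : 0 < `|u 0 i| ^+ m by rewrite exprn_gt0 // normr_gt0.
rewrite -ler_pdivrMr // -normrX -normfV -normrM.
congr (`|_| <= _); rewrite mulrBl mulrDl mulfK ?expf_neq0 // mulrBl; ring.
Qed.

Let B' : set 'rV[F]_n := [set u | B u /\ u 0 i != 0].

Let oB' : open B'.
Proof.
have h := @open_preim F n 1 B (fun _ u => u 0 i) [set w : 'rV[F]_1 | w 0 0 != 0] oB (@dg_ne0 F).
have -> : B' = [set y | B y /\ (\row_j y 0 i : 'rV[F]_1) 0 0 != 0].
  by apply/predeqP => u; rewrite /B' /= mxE.
by apply: h => j x _; exact: coord_continuous.
Qed.

Let smp f r : sm f -> class_C r B (fun u => f (p u)).
Proof.
move=> sf.
have h := @class_C_comp F k k0 kP r n n B B (fun l u => if l == i then 0 else u 0 l) f oB oB.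
have : class_C r B (fun u => f (\row_l (if l == i then 0 else u 0 l))).
  apply: h => //.
  by move=> j; case: (j == i); [exact: class_C_cst|exact: class_C_coord].
by [].
Qed.

Let quo_B' m f r : sm f -> class_C r B' (quo m f).
Proof.
move=> sf; have BB' : B' `<=` B by move=> u [].
apply: (@class_C_ext _ _ _ _ (fun u => (f u + (-1) * tay m f u) * (u 0 i ^+ m)^-1) _ oB').
  by move=> u [Bu u0]; rewrite /quo (negPf u0) mulN1r.
have cpow l : class_C r B' (fun u : 'rV[F]_n => u 0 i ^+ l).
  elim: l => [|l ih]; first exact: class_C_cst.
  have := class_C_mul oB' (class_C_coord r i oB') ih.
  by apply: class_C_ext oB' _ => u _; rewrite exprS.
apply: class_C_mul => //; last first.
  by apply: class_C_inv => // u [_ u0]; rewrite expf_neq0.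
apply: class_C_add => //; first exact: class_C_sub (sf r).
apply: class_C_mul => //; first exact: class_C_cst.
apply: class_C_sum => // l; apply: class_C_mul => //; apply: class_C_mul => //; last exact: class_C_cst.
by apply: class_C_sub BB' _; apply: smp; exact: smDn.
Qed.

Let near_p f y a : sm f -> B y -> y 0 i = 0 -> 0 < a -> exists2 d : F, 0 < d &
  forall u, `|u - y| < d -> B u /\ (forall t, 0 <= t <= 1 -> `|f (setz u i (t * u 0 i)) - f y| < a).
Proof.
move=> sf By y0 a0; have [d1 d10 h1] := iffLR (cont_at _ _) (sm_cont sf By) a a0.
have [d2 d20 h2] := iffLR (openB _) oB y By.
have [d [d0 dd1 dd2]] := pos_min d10 d20; exists d => // u uy; split.
  by apply: h2; exact: lt_le_trans uy dd2.
move=> t /andP[t0 t1]; apply: h1; apply: lt_le_trans _ dd1.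
apply: row_sub_lt uy _ => l; rewrite !mxE; case: eqP => [->|//].
by rewrite y0 !subr0 normrM ger0_norm // -[leRHS]mul1r ler_wpM2r.
Qed.

Let quo_cont m f y : sm f -> B y -> {for y, continuous (quo m f)}.
Proof.
move=> sf By; have [y0|y0] := eqVneq (y 0 i) 0; last first.
  by apply: (class_C_cont (quo_B' m 0%N sf)); split.
apply/cont_at => a a0; pose K := k ^+ m * 2 + `|m`!%:R^-1 : F|.
have K0 : 0 < K.
  by rewrite ltr_wpDr // mulr_gt0 // exprn_gt0.
have [d d0 hd] := near_p (smDn m sf) By y0 (divr_gt0 a0 K0).
exists d => // u /hd[Bu hu].
have h0 : `|iter m (Dp i) f (p u) - iter m (Dp i) f y| < a / K.
  by have := hu 0; rewrite mul0r lexx ler01; apply.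
have /(quo_p sf Bu) h1 : forall t, 0 <= t <= 1 ->
    `|iter m (Dp i) f (setz u i (t * u 0 i)) - iter m (Dp i) f (p u)| <= 2 * (a / K).
  move=> t t01; rewrite -[X in `|X|](subrKA (iter m (Dp i) f y)) mulr_natl mulr2n.
  apply: le_trans (ler_normD _ _) _; apply: lerD; first exact/ltW/hu.
  by rewrite distrC ltW.
have -> : quo m f u - quo m f y = (quo m f u - iter m (Dp i) f (p u) / m`!%:R) +
    (iter m (Dp i) f (p u) - iter m (Dp i) f y) / m`!%:R.
  rewrite /quo y0 eqxx; ring.
apply: le_lt_trans (ler_normD _ _) _; rewrite normrM.
apply: (@lt_le_trans _ _ (k ^+ m * (2 * (a / K)) + a / K * `|m`!%:R^-1|)).
  by apply: ler_ltD => //; rewrite ltr_pM2r // normr_gt0 invr_neq0 // pnatr_eq0 -lt0n fact_gt0.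
by rewrite mulrA [_ * `|_|]mulrC -mulrDl -/K mulrC divfK ?gt_eqF.
Qed.

Let quo_ddj m f y j : sm f -> B y -> j != i -> dd (quo m f) y (ei j) (quo m (Dp j f) y).
Proof.
move=> sf By ji.
have co h : (y + h *: ei j) 0 i = y 0 i.
  by rewrite !mxE eqxx /= eq_sym (negPf ji) mulr0 addr0.
have ddp l : dd (fun u => iter l (Dp i) f (p u)) y (ei j) (iter l (Dp i) (Dp j f) (p y)).
  have := sm_dd j (smDn l sf) (pB By); rewrite (swapD l j sf (pB By)) => h a /h[d d0 hd].
  by exists d => // c hc; rewrite p_lin' //; exact: hd.
have ddt : forall l, dd (fun u => tay l f u) y (ei j) (tay l (Dp j f) y).
  elim=> [|l ih].
    by rewrite tay0; apply: dd_eqv (dd_cst 0 y (ei j)) => h; rewrite tay0.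
  rewrite tayS addrC mulrAC -mulrA mulrC.
  have := dd_lin (y 0 i ^+ l / l`!%:R) (ddp l) ih.
  by apply: dd_eqv => h; rewrite tayS co addrC; congr (_ + _); ring.
rewrite /quo; case: eqP => y0.
  have := dd_lin (m`!%:R^-1) (ddp m) (dd_cst 0 y (ei j)).
  rewrite p_id // addr0 mulrC; apply: dd_eqv => h.
  by rewrite co y0 eqxx p_id ?co // addr0 mulrC.
have := dd_lin ((y 0 i ^+ m)^-1) (dd_lin (-1) (ddt m) (sm_dd j sf By)) (dd_cst 0 y (ei j)).
rewrite addr0 mulN1r [- _ + _]addrC mulrC; apply: dd_eqv => h.
by rewrite co; move/eqP/negPf: y0 => ->; rewrite addr0 mulN1r [- _ + _]addrC mulrC.
Qed.

Let quo_ddi m f y : sm f -> B y ->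
  dd (quo m f) y (ei i) (quo m (Dp i f) y - m%:R * quo m.+1 f y).
Proof.
move=> sf By; have fn l : (l`!%:R : F) != 0 by rewrite pnatr_eq0 -lt0n fact_gt0.
have [y0|y0] := eqVneq (y 0 i) 0.
  have -> : quo m (Dp i f) y - m%:R * quo m.+1 f y = iter m.+1 (Dp i) f y / m.+1`!%:R.
    rewrite /quo y0 eqxx iterD factS natrM; have := fn m.
    have m1 : (m.+1%:R : F) != 0 by rewrite pnatr_eq0.
    move=> f1; rewrite -natr1 in m1 *; by field; rewrite f1 m1.
  move=> a a0.
  have K0 : 0 < k ^+ m.+1 * 2 by rewrite mulr_gt0 // exprn_gt0.
  have [d d0 hd] := near_p (smDn m.+1 sf) By y0 (divr_gt0 a0 K0).
  exists d => // h hh.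
  have [->|h0] := eqVneq h 0.
    by rewrite scale0r addr0 subrr mul0r subrr normr0 mulr0.
  have ui : (y + h *: ei i) 0 i = h by rewrite !mxE !eqxx /= y0 mulr1 add0r.
  have hy : `|y + h *: ei i - y| < d.
    rewrite addrC addKr; apply/row_norm_lt => // l; rewrite !mxE eqxx /=.
    by case: eqP; rewrite ?mulr1 ?mulr0 ?normr0.
  have [Bu hu] := hd _ hy; set u := y + h *: ei i in ui Bu hu *.
  have pu : p u = y by rewrite p_lin p_id.
  have hM : forall t, 0 <= t <= 1 ->
    `|iter m.+1 (Dp i) f (setz u i (t * u 0 i)) - iter m.+1 (Dp i) f (p u)| <= a / (k ^+ m.+1 * 2).
    by move=> t t01; rewrite pu; apply/ltW/hu.
  have := taylor sf Bu hM; rewrite ui exprMn => h1.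
  (* As u projects to y, the increment of [quo] minus its linear part is the next Taylor remainder
     divided by h^m. *)
  have -> : quo m f u - quo m f y - h * (iter m.+1 (Dp i) f y / m.+1`!%:R) =
    (f u - tay m.+2 f u) / h ^+ m.
    rewrite /quo ui (negPf h0) y0 eqxx !tayS pu ui exprS; field.
    by rewrite expf_neq0 // !fn.
  have hm : 0 < `|h| ^+ m by rewrite exprn_gt0 // normr_gt0.
  rewrite normrM normfV normrX ler_pdivrMr //; apply: le_trans h1 _.
  have -> : k ^+ m.+1 * `|h| ^+ m.+1 * (a / (k ^+ m.+1 * 2)) = a * `|h| * `|h| ^+ m / 2.
    by rewrite [`|h| ^+ m.+1]exprS; field; rewrite expf_neq0 // gt_eqF.
  rewrite ler_pdivrMr //; rewrite -[leLHS]mulr1; apply: ler_wpM2l; last by rewrite ler1n.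
  by rewrite !mulr_ge0 // ltW.
have ddf : dd (fun u => f u - tay m f u) y (ei i) (Dp i f y - tay m.-1 (Dp i f) y).
  have ht : dd (tay m f) y (ei i) (tay m.-1 (Dp i f) y).
    case: m => [|m]; last exact: dd_tay.
    by rewrite tay0; apply: dd_eqv (dd_cst 0 y (ei i)) => h; rewrite tay0.
  have := dd_lin (-1) ht (sm_dd i sf By).
  by rewrite mulN1r addrC; apply: dd_eqv => h; rewrite mulN1r addrC.
have B'y : B' y by split.
have ddm : dd (fun u : 'rV[F]_n => u 0 i ^+ m) y (ei i) (m%:R * y 0 i ^+ m.-1).
  case: (m) => [|m']; last exact: dd_pow.
  by rewrite mul0r; apply: dd_eqv (dd_cst 1 y (ei i)) => h; rewrite expr0.
have ym : y 0 i ^+ m != 0 by rewrite expf_neq0.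
have d3 := dd_mul ddf (dd_inv ym ddm).
apply: (@open_dd _ _ _ (fun u => (f u - tay m f u) * (u 0 i ^+ m)^-1) _ _ _ _ oB' B'y).
  by move=> u [_ u0]; rewrite /quo (negPf u0).
move: d3; congr (dd _ _ _ _); rewrite /quo (negPf y0) tayS /=.
case: m {ddf ddm} ym => [|m] ym.
  by rewrite !tay0 /= !mul0r !expr0; field.
rewrite [tay m.+1 (Dp i f) y]tayS iterD /= !exprS factS natrM.
have m1 : (m.+1%:R : F) != 0 by rewrite pnatr_eq0.
have ym' : y 0 i ^+ m != 0 by rewrite expf_neq0.
have f1 := fn m.
set a := f y; set b := tay m.+1 f y; set c := Dp i f y; set d := tay m (Dp i f) y.
set g := Dp i _ _; set Y := y 0 i in y0 ym' *; set Z := Y ^+ m in ym' *.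
set N : F := m.+1%:R in m1 *; set P : F := m`!%:R in f1 *.
clearbody a b c d g Y Z N P.
rewrite /GRing.scale /=; field.
by rewrite m1 f1 y0 ym'.
Qed.

Let quo_class r m f : sm f -> class_C r B (quo m f).
Proof.
elim: r m f => [|r ih] m f sf; (split; first by move=> y By; exact: quo_cont) => // j.
have [->|ji] := eqVneq j i.
  split; first by move=> y By; have /ddP[] := quo_ddi m sf By.
  have := class_C_add oB (ih m _ (smD i sf))
    (class_C_mul oB (class_C_cst r B (- m%:R)) (ih m.+1 _ sf)).
  apply: class_C_ext oB _ => y By; have /ddP[_ ->] := quo_ddi m sf By.
  by rewrite mulNr.
split; first by move=> y By; have /ddP[] := quo_ddj m sf By ji.
apply: class_C_ext oB _ (ih m _ (smD j sf)) => y By.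
by have /ddP[_ ->] := quo_ddj m sf By ji.
Qed.

Lemma division f : (forall r, class_C r B f) -> exists Q, (forall r, class_C r B Q) /\
  forall y, f y - f (setz y i 0) = y 0 i * Q y.
Proof.
move=> sf; exists (quo 1 f); split; first by move=> r; exact: quo_class.
move=> y; rewrite /quo; case: eqP => [y0|/eqP y0].
  by rewrite y0 mul0r -/(p y) p_id // subrr.
by rewrite tayS tay0 add0r fact0 divr1 expr0 mulr1 expr1 mulrC divfK.
Qed.

End Division.

Section DG.
Variables (F : numFieldType) (k : F) (k0 : 0 < k).
Hypothesis kP : forall n (f : 'rV[F]_n -> F) (x v : 'rV[F]_n) (M : F),
  (forall t, 0 <= t <= 1 -> derivable f (x + t *: v) v /\ `|'D_v f (x + t *: v)| <= M) ->
  `|f (x + v) - f x| <= k * M.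

Lemma dg_good : good (differential_geometry F).
Proof.
split.
- by move=> n; rewrite pnatr_eq0.
- by move=> n z; exact: (dg_tame k0 kP).
- exact: dg_openL.
- by move=> n z c; apply: dg_of_class => r; exact: class_C_cst.
- by move=> n z i; apply: dg_of_class => r; apply: class_C_coord; exact: openT.
- exact: dg_add.
- exact: dg_mul.
- by move=> z z0; exact: dg_inv.
- exact: dg_ne0.
- move=> n z i f zi [U [oU Uz hU]].
  have [e e0 he] := iffLR (openB (V := 'rV[F]_n) U) oU z Uz.
  have [|Q [hQ eQ]] := division k0 kP zi (e := e) (f := f); first by move=> r; apply: class_C_sub (hU r).
  exists Q; split; last by exists setT; split => //; exact: openT.
  have [V [oV Vz VB]] := iffRL (dg_aroundP z (fun y => `|y - z| < e))
    (ex_intro2 _ _ e e0 (fun y h => h)).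
  by exists V; split => // r; apply: class_C_sub (hQ r).
- exact: dg_dens.
Qed.

End DG.

(* Completeness and the archimedean property, in the form needed for Newton's
   iteration and valid over both R and R[i]. *)
Definition geometric_limits (F : numFieldType) :=
  (forall (u : nat -> F) (C : F), (forall m, `|u m.+1 - u m| <= C / 2 ^+ m) ->
    exists l, forall m, `|u m - l| <= 4 * C / 2 ^+ m) /\
  (forall x C : F, 0 <= x -> (forall m, x <= C / 2 ^+ m) -> x = 0).

(** * The inverse function theorem *)

Section IFT.
Variables (F : numFieldType) (k : F) (k0 : 0 < k).
Hypothesis kP : forall n (f : 'rV[F]_n -> F) (x v : 'rV[F]_n) (M : F),
  (forall t, 0 <= t <= 1 -> derivable f (x + t *: v) v /\ `|'D_v f (x + t *: v)| <= M) ->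
  `|f (x + v) - f x| <= k * M.
Hypothesis geo : geometric_limits F.
Local Notation G := (differential_geometry F).
Local Notation areg n z f := (@regular_at F (affine G n) z f).
Let gG : good G := dg_good k0 kP.

Lemma row_le n (z : 'rV[F]_n) (e : F) : 0 <= e -> (forall l, `|z 0 l| <= e) -> `|z| <= e.
Proof.
move=> e0 h; have [->|z0] := eqVneq z 0; first by rewrite normr0.
have [|[i j] /= hj] := @mx_norm_neq0 F 1 n z; first by rewrite -[mx_norm z]/(`|z|) normr_eq0.
by rewrite -[`|z|]/(mx_norm z) hj (ord1 i).
Qed.

Lemma mul_mx_le n m (A : 'M[F]_(n, m)) : exists2 c : F, 0 < c & forall v : 'rV[F]_n, `|v *m A| <= c * `|v|.
Proof.
exists (1 + \sum_i \sum_j `|A i j|).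
  by apply: ltr_pwDl => //; apply: sumr_ge0 => i _; apply: sumr_ge0.
move=> v; have s0 : 0 <= \sum_i \sum_j `|A i j|.
  by apply: sumr_ge0 => i _; apply: sumr_ge0.
apply: row_le => [|l]; first by rewrite mulr_ge0 // addr_ge0.
rewrite mxE; apply: le_trans (ler_norm_sum _ _ _) _.
apply: (@le_trans _ _ (\sum_i (\sum_j `|A i j|) * `|v|)).
  apply: ler_sum => i _; rewrite normrM mulrC; apply: ler_pM => //; last exact: row_norm_le.
  by rewrite (bigD1 l) //= lerDl sumr_ge0.
by rewrite -mulr_suml mulrDl lerDr mul1r.
Qed.

Lemma small_zero (x C : F) : 0 <= x -> (forall m, x <= C / 2 ^+ m) -> x = 0.
Proof. by have [_ h] := geo; exact: h. Qed.

Lemma contraction_fixpoint n (z : 'rV[F]_n) (r : F) (T : 'rV[F]_n -> 'rV[F]_n) : 0 < r ->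
  (forall a b, `|a - z| <= r -> `|b - z| <= r -> `|T a - T b| <= `|a - b| / 2) ->
  `|T z - z| <= r / 2 -> exists2 a, `|a - z| <= r & T a = a.
Proof.
move=> r0 hT hz; pose u m := iter m T z.
have p2 m : 0 < 2 ^+ m :> F by rewrite exprn_gt0.
(* The bound r (1 - 2^-m) is the sum of the steps r / 2^(j+1) with j < m, so the iterates never
   leave the ball of radius r. *)
have hu m : `|u m - z| <= r * (1 - (2 ^+ m)^-1) /\ `|u m.+1 - u m| <= r / 2 / 2 ^+ m.
  elim: m => [|m [h1 h2]].
    by rewrite /u /= subrr normr0 expr0 invr1 subrr mulr0 mulr1.
  have inr : forall j, `|u j - z| <= r * (1 - (2 ^+ j)^-1) -> `|u j - z| <= r.
    move=> j h; apply: le_trans h _; rewrite ler_piMr ?(ltW r0) // gerBl ?invr_ge0 ?ltW //.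
  have h3 : `|u m.+1 - z| <= r * (1 - (2 ^+ m.+1)^-1).
    rewrite -[u m.+1 - z](subrKA (u m)); apply: le_trans (ler_normD _ _) _.
    apply: le_trans (lerD h2 h1) _; rewrite le_eqVlt; apply/orP; left; apply/eqP.
    rewrite exprS; field; by rewrite expf_neq0 // pnatr_eq0.
  split => //; apply: le_trans (hT _ _ (inr _ h3) (inr _ h1)) _.
  by rewrite exprS invfM [_ * (2^-1 / _)]mulrCA mulrC ler_pM2l ?invr_gt0.
have [l hl] : exists l : 'rV[F]_n, forall m, `|u m - l| <= 2 * r / 2 ^+ m.
  have /choice[l hl] : forall i, exists l : F, forall m, `|u m 0 i - l| <= 2 * r / 2 ^+ m.
    move=> i; have [h _] := geo; have [|l hl] := h (fun m => u m 0 i) (r / 2).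
      by move=> m; have [_] := hu m; apply: le_trans; have := row_norm_le (u m.+1 - u m) i; rewrite !mxE.
    exists l => m; apply: le_trans (hl m) _; rewrite le_eqVlt; apply/orP; left; apply/eqP.
    by field; rewrite expf_neq0 // pnatr_eq0.
  exists (\row_i l i) => m; apply: row_le => [|i]; first by rewrite !mulr_ge0 // ?invr_ge0 ltW.
  by rewrite !mxE.
have lz : `|l - z| <= r.
  rewrite real_leNgt ?normr_real ?gtr0_real //; apply/negP => h.
  have h0 : `|l - z| - r = 0.
    apply: (@small_zero _ (2 * r)); first by rewrite subr_ge0 ltW.
    move=> m; rewrite lerBlDr -[l - z](subrKA (u m)).
    apply: le_trans (ler_normD _ _) _; apply: lerD; first by rewrite distrC.
    have [h1 _] := hu m; apply: le_trans h1 _; rewrite ler_piMr ?(ltW r0) // gerBl ?invr_ge0 ?ltW //.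
  by move: h; rewrite -subr_gt0 h0 ltxx.
exists l => //; apply/eqP; rewrite -subr_eq0 -normr_eq0; apply/eqP.
apply: (@small_zero _ (2 * r)) => // m.
rewrite -[T l - l](subrKA (u m.+1)); apply: le_trans (ler_normD _ _) _.
have um : `|u m - z| <= r.
  have [h1 _] := hu m; apply: le_trans h1 _; rewrite ler_piMr ?(ltW r0) // gerBl ?invr_ge0 ?ltW //.
apply: le_trans (lerD (hT _ _ lz um) (hl m.+1)) _.
rewrite distrC exprS; apply: (@le_trans _ _ (2 * r / 2 ^+ m / 2 + 2 * r / (2 * 2 ^+ m))).
  by rewrite lerD2r ler_pM2r ?invr_gt0.
rewrite le_eqVlt; apply/orP; left; apply/eqP; field; by rewrite expf_neq0 // pnatr_eq0.
Qed.

Lemma dg_pdv n (l : 'I_n) (f : 'rV[F]_n -> F) z : areg n z f -> 'D_(ei l) f z = @pdv G n l f z.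
Proof.
move=> rf; have [Q [rQ eQ]] := pdv_ex gG l rf; rewrite (pdvE gG rQ eQ).
suff /ddP[] : dd f z (ei l) (Q 0) by [].
move=> e e0; have [d1 d10 h1] := iffLR (dg_aroundP _ _) eQ.
have [d2 d20 h2] := iffLR (cont_at _ _) (dg_reg_cont rQ) e e0.
have [d [d0 dd1 dd2]] := pos_min d10 d20; exists d => // h hd.
have hn : `|(\row_j h : 'rV[F]_1) - 0| < d.
  by rewrite subr0; apply/row_norm_lt => // j; rewrite mxE.
have := h1 _ (lt_le_trans hn dd1); rewrite mxE.
have -> : lin z l h = z + h *: ei l.
  by apply/rowP => j; rewrite !mxE eqxx /= mulrC.
move=> ->; rewrite -mulrBr normrM mulrC; apply: ler_wpM2r => //.
by apply/ltW/h2; exact: lt_le_trans hn dd2.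
Qed.

Variables (n : nat) (z : 'rV[F]_n) (Phi : 'I_n -> 'rV[F]_n -> F).
Hypotheses (rPhi : forall i, areg n z (Phi i)) (Phi0 : forall i, Phi i z = 0).
Let Jac (y : 'rV[F]_n) : 'M[F]_n := \matrix_(l, i) 'D_(ei l) (Phi i) y.
Hypothesis uJ : Jac z \in unitmx.
Let vPhi (y : 'rV[F]_n) : 'rV[F]_n := \row_i Phi i y.

(** Newton's iteration with the derivative frozen at z. The inverse P is Lipschitz, hence
    differentiable with the inverse Jacobian at P w as derivative; as this is a smooth function of P
    w, the class of P rises by one at each turn. *)
Lemma inverse_function : exists Psi : 'I_n -> 'rV[F]_n -> F,
  [/\ forall l, areg n 0 (Psi l), \row_l Psi l 0 = z,
    @around _ (affine G n) 0 (fun w => vPhi (\row_l Psi l w) = w) &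
    @around _ (affine G n) z (fun y => \row_l Psi l (vPhi y) = y)].
Proof.
have tz := dg_tame k0 kP (z : affine G n).
have /choice[W hW] := rPhi.
have oW i : open (W i) by have [] := hW i.
have Wz i : W i z by have [] := hW i.
have cW i r : class_C r (W i) (Phi i) by have [_ _] := hW i; apply.
have rJ l i : areg n z (fun y => Jac y l i).
  exists (W i); split => // r; have [_ h] := cW i r.+1; have [_ h2] := h l.
  by apply: class_C_ext (oW i) _ h2 => y _; rewrite mxE.
have [rN uN] := reg_invmx gG tz rJ uJ.
pose N y := invmx (Jac y).
have /choice[Vp hVp] : forall li : 'I_n * 'I_n, exists V : set 'rV[F]_n,
   [/\ open V, V z & forall r, class_C r V (fun y => N y li.1 li.2)].
  by move=> [l i]; exact: rN.
have [dW dW0 hdW] := @fin_pos F 'I_n (fun i d => forall y, `|y - z| < d -> W i y)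
  (fun i => let: ex_intro2 d d0 h := iffLR (openB _) (oW i) z (Wz i) in
      ex_intro2 _ _ d d0 (fun c c0 cd y yc => h y (lt_le_trans yc cd))).
have [dV dV0 hdV] : exists2 d : F, 0 < d & forall li : 'I_n * 'I_n, forall y, `|y - z| < d -> Vp li y.
  apply: (@fin_pos F ('I_n * 'I_n)%type (fun li d => forall y, `|y - z| < d -> Vp li y)) => li.
  have [oV Vz _] := hVp li; have [d d0 h] := iffLR (openB _) oV z Vz.
  by exists d => // c c0 cd y yc; apply: h; exact: lt_le_trans yc cd.
have [dU dU0 hdU] := iffLR (dg_aroundP _ _) uN.
have [cA cA0 hA] := mul_mx_le (invmx (Jac z)).
(* With this constant in the strict differentiability of Phi, the operator T below contracts by
   1/2. *)
have e10 : 0 < (2 * cA)^-1 by rewrite invr_gt0 mulr_gt0.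
have [dS dS0 hdS] : exists2 d : F, 0 < d & forall (i : 'I_n) (a b : 'rV[F]_n), `|a - z| < d -> `|b - z| < d ->
    `|Phi i a - Phi i b - \sum_l (a - b) 0 l * 'D_(ei l) (Phi i) z| <= (2 * cA)^-1 * `|a - b|.
  apply: (@fin_pos F 'I_n (fun i d => forall a b : 'rV[F]_n, `|a - z| < d -> `|b - z| < d ->
    `|Phi i a - Phi i b - \sum_l (a - b) 0 l * 'D_(ei l) (Phi i) z| <= (2 * cA)^-1 * `|a - b|)) => i.
  have [d d0 h] : exists2 d : F, 0 < d & forall a b : 'rV[F]_n, `|a - z| < d -> `|b - z| < d ->
    `|Phi i a - Phi i b - \sum_l (a - b) 0 l * 'D_(ei l) (Phi i) z| <= (2 * cA)^-1 * `|a - b|.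
    have [_ h1] := cW i 1%N.
    apply: (strict_C1 k0 kP (oW i) (Wz i)) => // l; first by move=> y Wy; have [h2 _] := h1 l; exact: h2.
    have [_ [h2 _]] := h1 l; exact: h2.
  by exists d => // c c0 cd a b ac bc; apply: h; [exact: lt_le_trans ac cd|exact: lt_le_trans bc cd].
have [d1 [d10 d1W d1V]] := pos_min dW0 dV0.
have [d2 [d20 d2U d2S]] := pos_min dU0 dS0.
have [d [d0 dd1 dd2]] := pos_min d10 d20.
pose r := d / 2.
have r0 : 0 < r by rewrite divr_gt0.
have rd : r < d by rewrite ltr_pdivrMr // ltr_pMr // ltr1n.
pose T w y := y - (vPhi y - w) *m invmx (Jac z).
have key w a b : `|a - z| < d -> `|b - z| < d -> `|T w a - T w b| <= `|a - b| / 2.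
  move=> az bz.
  have -> : T w a - T w b = - ((vPhi a - vPhi b - (a - b) *m Jac z) *m invmx (Jac z)).
    rewrite mulmxBl mulmxK // /T !mulmxBl opprB; move: (_ *m _) (_ *m _) (_ *m _) => p q s.
    by apply/rowP => j; rewrite !mxE; ring.
  rewrite normrN; apply: le_trans (hA _) _.
  rewrite mulrC -ler_pdivlMr // -mulrA -invfM mulrC.
  apply: row_le => [|i]; first by rewrite mulr_ge0 // ltW.
  have := hdS i a b (lt_le_trans az (le_trans dd2 d2S)) (lt_le_trans bz (le_trans dd2 d2S)).
  congr (`|_| <= _); rewrite !mxE; congr (_ - _).
  by apply: eq_bigr => l _; rewrite !mxE.
(* Makes the first step |T w z - z| at most cA rho = r / 2. *)
pose rho := r / (2 * cA).
have rho0 : 0 < rho by rewrite divr_gt0 // mulr_gt0.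
have TvP w y : (T w y = y) <-> vPhi y = w.
  split=> [|<-]; last by rewrite /T subrr mul0mx subr0.
  move=> /eqP; rewrite /T subr_eq -subr_eq0 opprD addNKr oppr_eq0 => /eqP h.
  have : (vPhi y - w) *m invmx (Jac z) *m Jac z = 0 by rewrite h mul0mx.
  by rewrite mulmxKV // => /eqP; rewrite subr_eq0 => /eqP.
have exP w : `|w| < rho -> exists2 a, `|a - z| <= r & vPhi a = w.
  move=> wr; have [||a az Ta] := @contraction_fixpoint n z r (T w) r0.
  - by move=> a b az bz; apply: key; [exact: le_lt_trans az rd|exact: le_lt_trans bz rd].
  - have -> : T w z - z = w *m invmx (Jac z).
      have v0 : vPhi z = 0 by apply/rowP => i; rewrite !mxE.
      by rewrite /T v0 sub0r mulNmx opprK addrC addKr.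
    apply: le_trans (hA _) _; apply: (@le_trans _ _ (cA * rho)); first by rewrite ler_pM2l // ltW.
    by rewrite le_eqVlt; apply/orP; left; apply/eqP; rewrite /rho; field; rewrite gt_eqF.
  by exists a => //; apply/TvP.
have lip a b : `|a - z| < d -> `|b - z| < d -> `|a - b| <= 2 * cA * `|vPhi a - vPhi b|.
  move=> az bz; have := key 0 a b az bz => h.
  have e1 : a - b = (T 0 a - T 0 b) + (vPhi a - vPhi b) *m invmx (Jac z).
    rewrite /T !subr0 mulmxBl; move: (_ *m _) (_ *m _) => q s.
    by apply/rowP => j; rewrite !mxE; ring.
  have h2 : `|a - b| <= `|a - b| / 2 + cA * `|vPhi a - vPhi b|.
    by rewrite {1}e1; apply: le_trans (ler_normD _ _) _; apply: lerD.
  have : `|a - b| / 2 <= cA * `|vPhi a - vPhi b|.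
    by rewrite {1}[`|a - b|]splitr -lerBlDl addrK in h2.
  by rewrite ler_pdivrMr // mulrC mulrA.
have inj a b : `|a - z| < d -> `|b - z| < d -> vPhi a = vPhi b -> a = b.
  move=> az bz e; have := lip a b az bz; rewrite e subrr normr0 mulr0 normr_le0 subr_eq0.
  by move/eqP.
have /choice[P hP] : forall w, exists a, `|w| < rho -> `|a - z| <= r /\ vPhi a = w.
  move=> w; have [wr|nw] := pselect (`|w| < rho); last by exists z => /nw.
  by have [a az va] := exP w wr; exists a.
have Pd w : `|w| < rho -> `|P w - z| < d by move=> /hP[h _]; exact: le_lt_trans h rd.
have vP w : `|w| < rho -> vPhi (P w) = w by move=> /hP[].
have rowP' w : \row_l P w 0 l = P w by apply/rowP => l; rewrite mxE.
pose B : set 'rV[F]_n := [set w | `|w| < rho].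
have oB : open B.
  apply/openB => x /= xz; exists (rho - `|x|); first by rewrite subr_gt0.
  move=> y yx; rewrite /B /= -[y](subrK x); apply: le_lt_trans (ler_normD _ _) _.
  by rewrite -ltrBrDr.
have P0 : P 0 = z.
  apply: inj; rewrite ?subrr ?normr0 //; first by apply: Pd; rewrite normr0.
  by rewrite vP ?normr0 //; apply/rowP => i; rewrite !mxE.
(* Phi (P w) = w turns the expansion of Phi at b = P w into one of P at w; the Lipschitz bound [lip]
   replaces |a - b| by a multiple of |h| in the error. *)
have dP w j l : B w -> dd (fun w => P w 0 l) w (ei j) (N (P w) j l).
  move=> Bw; set b := P w.
  have bd : `|b - z| < d := Pd w Bw.
  have ub : Jac b \in unitmx by apply: hdU; apply: lt_le_trans bd (le_trans dd2 d2U).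
  have [cN cN0 hN] := mul_mx_le (N b).
  move=> e e0; have e20 : 0 < e / (2 * cA * cN) by rewrite divr_gt0 // !mulr_gt0.
  have [df df0 hdf] : exists2 d : F, 0 < d & forall (i : 'I_n) (h : 'rV[F]_n), `|h| < d ->
     `|Phi i (b + h) - Phi i b - \sum_l h 0 l * 'D_(ei l) (Phi i) b| <= e / (2 * cA * cN) * `|h|.
    apply: (@fin_pos F 'I_n (fun i d => forall h : 'rV[F]_n, `|h| < d ->
     `|Phi i (b + h) - Phi i b - \sum_l h 0 l * 'D_(ei l) (Phi i) b| <= e / (2 * cA * cN) * `|h|)) => i.
    have Wb : W i b by apply: hdW; exact: lt_le_trans bd (le_trans dd1 d1W).
    have [_ h1] := cW i 1%N.
    have fr : fre (Phi i) b (fun l => 'D_(ei l) (Phi i) b).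
      apply: (fre_C1 k0 kP (oW i) Wb) => l'; first by move=> y Wy; have [h2 _] := h1 l'; exact: h2.
      have [_ [h2 _]] := h1 l'; exact: h2.
    have [d' d'0 h] := fr _ e20.
    by exists d' => // c c0 cd h' hc; apply: h; exact: lt_le_trans hc cd.
  have [d3 d30 h3] := iffLR (openB _) oB w Bw.
  have d40 : 0 < df / (2 * cA) by rewrite divr_gt0 // mulr_gt0.
  have [d5 [d50 d53 d54]] := pos_min d30 d40.
  exists d5 => // h hd5.
  have hn : `|h *: ei j : 'rV[F]_n| <= `|h|.
    apply: row_le => // l'; rewrite !mxE eqxx /=; case: eqP => _; first by rewrite mulr1.
    by rewrite mulr0 normr0.
  have Bh : B (w + h *: ei j).
    by apply: h3; rewrite addrC addKr; apply: le_lt_trans hn (lt_le_trans hd5 d53).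
  set a := P (w + h *: ei j).
  have vab : vPhi a - vPhi b = h *: ei j by rewrite !vP // addrC addKr.
  have ab : `|a - b| <= 2 * cA * `|h|.
    apply: le_trans (lip a b (Pd _ Bh) bd) _; rewrite vab ler_pM2l //; exact: mulr_gt0.
  have abf : `|a - b| < df.
    apply: le_lt_trans ab _; rewrite mulrC -ltr_pdivlMr; last exact: mulr_gt0.
    exact: lt_le_trans hd5 d54.
  have est : `|(vPhi a - vPhi b - (a - b) *m Jac b) *m N b| <= e * `|h|.
    apply: le_trans (hN _) _.
    apply: (@le_trans _ _ (cN * (e / (2 * cA * cN) * (2 * cA * `|h|)))); last first.
      rewrite le_eqVlt; apply/orP; left; apply/eqP; field; by rewrite !gt_eqF.
    rewrite ler_pM2l //; apply: (@le_trans _ _ (e / (2 * cA * cN) * `|a - b|)); last by rewrite ler_pM2l.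
    apply: row_le => [|i]; first by rewrite mulr_ge0 // ltW.
    have := hdf i (a - b) abf; rewrite [b + _]addrC subrK; congr (`|_| <= _).
    rewrite !mxE; congr (_ - _); by apply: eq_bigr => l' _; rewrite !mxE.
  apply: le_trans est; apply: le_trans (row_norm_le _ l).
  rewrite vab mulmxBl /N mulmxK // -normrN le_eqVlt; apply/orP; left; apply/eqP; congr `|_|.
  rewrite -scalemxAl -rowE !mxE; ring.
(* The derivative of P is a smooth function of P, hence of class r' as soon as P is. *)
have cP r' : forall l, class_C r' B (fun w => P w 0 l).
  elim: r' => [|r' ih] l; have c0 : forall x, B x -> {for x, continuous (fun w => P w 0 l)}.
  - move=> w Bw; apply/cont_at => e e0.
    have [d3 d30 h3] := iffLR (openB _) oB w Bw.
    have d40 : 0 < e / (2 * cA) by rewrite divr_gt0 // mulr_gt0.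
    have [d5 [d50 d53 d54]] := pos_min d30 d40.
    exists d5 => // y yw; have By := h3 y (lt_le_trans yw d53).
    have := row_norm_le (P y - P w) l; rewrite !mxE => h; apply: le_lt_trans h _.
    apply: le_lt_trans (lip _ _ (Pd _ By) (Pd _ Bw)) _; rewrite !vP //.
    rewrite mulrC -ltr_pdivlMr; last exact: mulr_gt0.
    exact: lt_le_trans yw d54.
  - by split.
  - by move=> w Bw; exact: (class_C_cont (ih l)).
  - split => // j; split; first by move=> w Bw; have /ddP[] := dP w j l Bw.
    have [oV _ cV] := hVp (j, l).
    have := class_C_comp k0 kP oB oV _ ih (cV r'); rewrite /=.
    have BV x : B x -> Vp (j, l) (\row_l0 P x 0 l0).
      move=> Bx; rewrite rowP'; apply: hdV; exact: lt_le_trans (Pd x Bx) (le_trans dd1 d1V).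
    move=> /(_ BV); apply: class_C_ext oB _ => w Bw.
    by have /ddP[_ ->] := dP w j l Bw; rewrite rowP'.
exists (fun l w => P w 0 l); split.
- by move=> l; exists B; split => //; rewrite /B /= normr0.
- by rewrite rowP'.
- apply/dg_aroundP; exists rho => // w; rewrite subr0 => wr; by rewrite rowP' vP.
have nr : @around _ (affine G n) z (fun y => `|y - z| < d /\ `|vPhi y| < rho).
  apply: (aroundI tz); first by apply/dg_aroundP; exists d.
  have := @reg_cont G (affine G n) z tz n Phi B rPhi oB.
  apply; rewrite /B /= (_ : \row_j Phi j z = 0) ?normr0 //.
  by apply/rowP => j; rewrite !mxE.
apply: (around_sub nr) => y [yd yr]; rewrite rowP'.
by apply: inj => //; [exact: Pd|rewrite vP].
Qed.

End IFT.

Section Zeros.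
Variables (F : numFieldType) (k : F) (k0 : 0 < k).
Hypothesis kP : forall n (f : 'rV[F]_n -> F) (x v : 'rV[F]_n) (M : F),
  (forall t, 0 <= t <= 1 -> derivable f (x + t *: v) v /\ `|'D_v f (x + t *: v)| <= M) ->
  `|f (x + v) - f x| <= k * M.
Hypothesis geo : geometric_limits F.
Local Notation G := (differential_geometry F).
Local Notation areg n z f := (@regular_at F (affine G n) z f).
Let gG : good G := dg_good k0 kP.

(** By the inverse function theorem the g and s become coordinates, where [coord_ideal] applies; its
    coefficients are carried back along Phi. *)
Lemma dg_regular_zeros : regular_zeros (differential_geometry F).
Proof.
move=> m z g s H rg rs g0 s0 inj rH zH.
pose Phi (i : 'I_(m + 1)) : 'rV[F]_(m + 1) -> F :=
  match fintype.split i with inl j => g j | inr _ => s end.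
have rPhi i : areg (m + 1) z (Phi i) by rewrite /Phi; case: (fintype.split i).
have Phi0 i : Phi i z = 0 by rewrite /Phi; case: (fintype.split i).
have PhiL i : Phi (lshift 1 i) = g i.
  by rewrite /Phi; have := @unsplitK m 1 (inl i); rewrite /= => ->.
have PhiR i : Phi (rshift m i) = s.
  by rewrite /Phi; have := @unsplitK m 1 (inr i); rewrite /= => ->.
have uJ : \matrix_(l, i) 'D_(ei l) (Phi i) z \in unitmx.
  apply: inj_unit => u uJ.
  have dv i : @dvec G (m + 1) u z (Phi i) = 0.
    rewrite dvecE //; move/rowP: uJ => /(_ i); rewrite !mxE => e; rewrite -[RHS]e.
    by apply: eq_bigr => l _; rewrite mxE (dg_pdv k0 kP).
  apply: inj; first by move=> i; rewrite -PhiL.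
  by rewrite -(PhiR 0).
have [Psi [rPsi Psi0 PhiPsi PsiPhi]] := inverse_function k0 kP geo rPhi Phi0 uJ.
have t0 := aff_tame gG (0 : 'rV[F]_(m + 1)).
have tz := aff_tame gG z.
have rR : areg (m + 1) 0 (fun w => H (\row_l Psi l w)).
  by apply: (aff_comp gG (f := Psi) (w := z) (F := H)).
have zR : @around _ (affine G (m + 1)) 0 (fun w => (forall i : 'I_(m + 1), (i < m)%N -> w 0 i = 0) ->
    H (\row_l Psi l w) = 0).
  have := aff_near gG (f := Psi) (z := 0) (w := z) (esym Psi0) rPsi zH (fun y h => h).
  move=> /(aroundI t0 PhiPsi) /around_sub; apply => w [e h] hw; apply: h => i.
  by move/rowP: e => /(_ (lshift 1 i)); rewrite mxE PhiL => ->; apply: hw; rewrite /= ltn_ord.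
have [h [rh eh]] := coord_ideal gG (leq_addr 1 m) rR zR.
have Pz : 0 = \row_j Phi j z by apply/rowP => j; rewrite !mxE.
exists (fun i y => h (lshift 1 i) (\row_j Phi j y)); split.
  by move=> i; apply: (aff_comp gG (f := Phi) (F := h (lshift 1 i)) Pz).
have := aff_near gG (f := Phi) Pz rPhi eh (fun y h => h).
move=> /(aroundI tz PsiPhi) /around_sub; apply => y [e1]; rewrite e1 => ->.
rewrite big_mkcond big_split_ord /= [X in _ + X]big1 ?addr0.
  by apply: eq_bigr => i _; rewrite ltn_ord mxE PhiL.
by move=> i _; rewrite ltnNge leq_addr.
Qed.

End Zeros.

(** The countable base consists of the traces on T of balls with centre in the dense set D^n and
    radius 2^-m, numbered through [pickle]. *)
Lemma dg_small (F : numFieldType) (D : nat -> F) : geometric_limits F ->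
  (forall (x e : F), 0 < e -> exists m, `|D m - x| < e) ->
  small_subspaces (differential_geometry F).
Proof.
move=> geo hD n T f.
have two m : 0 < (2 ^+ m)^-1 :> F by rewrite invr_gt0 exprn_gt0.
have hr (e : F) : 0 < e -> exists m, (2 ^+ m)^-1 < e.
  move=> e0; apply/not_existsP => h; move: (e0).
  rewrite (_ : e = 0) ?ltxx //; have [_ h2] := geo; apply: (h2 _ 1); first exact: ltW.
  move=> m; rewrite mul1r real_leNgt ?gtr0_real //; apply/negP; exact: h.
pose ctr (s : seq nat) : 'rV[F]_n := \row_i D (nth 0%N s i).
pose B (j : nat) : set T := let sm : seq nat * nat := odflt ([::], 0%N) (unpickle j) in
  [set t | `|f t - ctr sm.1| < (2 ^+ sm.2)^-1].
exists B; split.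
  move=> j; rewrite /B; set sm := odflt _ _.
  exists [set y | `|y - ctr sm.1| < (2 ^+ sm.2)^-1] => //.
  apply/(openB (V := 'rV[F]_n)) => x /= xz; exists ((2 ^+ sm.2)^-1 - `|x - ctr sm.1|); first by rewrite subr_gt0.
  move=> y yx; rewrite -[y](subrK x) -addrA; apply: le_lt_trans (ler_normD _ _) _.
  by rewrite -ltrBrDr.
move=> U x [V /(openB (V := 'rV[F]_n)) oV ->] Vx.
have [e e0 he] := oV _ Vx.
have [m hm] := hr (e / 2) (divr_gt0 e0 (ltr0Sn _ _)).
have [g hg] : exists g : nat -> nat, forall i : 'I_n, `|D (g i) - f x 0 i| < (2 ^+ m)^-1.
  have /choice[g hg] : forall i : 'I_n, exists j, `|D j - f x 0 i| < (2 ^+ m)^-1 by move=> i; exact: hD.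
  exists (fun i => if insub i is Some j then g j else 0%N) => i.
  by rewrite valK.
exists (pickle (mkseq g n, m)); rewrite /B pickleK /=.
have hc : `|f x - ctr (mkseq g n)| < (2 ^+ m)^-1.
  apply/row_norm_lt => // i; rewrite !mxE nth_mkseq // distrC; exact: hg.
split => // t ht; apply: he; rewrite -[f t - _](subrKA (ctr (mkseq g n))).
apply: le_lt_trans (ler_normD _ _) _; rewrite [X in _ + X]distrC [e]splitr.
by apply: ltrD; [exact: lt_trans ht hm|exact: lt_trans hc hm].
Qed.

(** * The field of real numbers *)

Section Real.
Variable R : realType.

Lemma real_mean_value (g l : R -> R) (M : R) :
  (forall t, 0 <= t <= 1 -> dd (g : R -> R) t (1 : R) (l t) /\ `|l t| <= M) -> `|g 1 - g 0| <= M.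
Proof.
move=> h; have [||c c01 e] := @MVT R g l 0 1 ltr01.
- move=> t; rewrite in_itv /= => /andP[t0 t1].
  have [|/ddP[d e] _] := h t; first by rewrite !ltW.
  by rewrite -e; exact: derivableP.
- apply: derivable_within_continuous => t; rewrite in_itv /= => t01.
  by have [/ddP[]] := h t t01.
rewrite e subr0 mulr1; have [|_ //] := h c.
by move: c01; rewrite in_itv /= => /andP[c0 c1]; rewrite !ltW.
Qed.

Lemma real_mv n (f : 'rV[R]_n -> R) (x v : 'rV[R]_n) (M : R) :
  (forall t, 0 <= t <= 1 -> derivable f (x + t *: v) v /\ `|'D_v f (x + t *: v)| <= M) ->
  `|f (x + v) - f x| <= 1 * M.
Proof.
move=> h; rewrite mul1r.
have := @real_mean_value (fun t => f (x + t *: v)) (fun t => 'D_v f (x + t *: v)) M.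
rewrite scale1r scale0r addr0; apply => t t01; have [d b] := h t t01; split => //.
move=> e /(dd_derive d)[a a0 ha]; exists a => // y ya.
have := ha y ya; rewrite (_ : y *: (1 : R) = y) ?scalerDl ?addrA //; exact: mulr1.
Qed.

Let p2 m : 0 < 2 ^+ m :> R. Proof. by rewrite exprn_gt0. Qed.

(** The intervals with centre u m and radius 2 C / 2^m are nested, and the supremum of their left
    ends lies in all of them. *)
Lemma real_geometric_limit (u : nat -> R) (C : R) : (forall m, `|u m.+1 - u m| <= C / 2 ^+ m) ->
  exists l, forall m, `|u m - l| <= 2 * C / 2 ^+ m.
Proof.
move=> h.
  have C0 : 0 <= C by have := h 0%N; rewrite expr0 divr1; apply: le_trans.
  have half m : 2 * C / 2 ^+ m.+1 = C / 2 ^+ m :> R.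
    by rewrite exprS; field; rewrite expf_neq0 // pnatr_eq0.
  have dbl m : 2 * C / 2 ^+ m = C / 2 ^+ m + C / 2 ^+ m by ring.
  have c1 m : 0 <= 2 * C / 2 ^+ m by apply: divr_ge0; [exact: mulr_ge0|exact/ltW].
  pose v m := u m - 2 * C / 2 ^+ m; pose w m := u m + 2 * C / 2 ^+ m.
  have vi m : v m <= v m.+1.
    have := h m; rewrite ler_norml => /andP[h1 _]; rewrite /v half dbl; lra.
  have wd m : w m.+1 <= w m.
    have := h m; rewrite ler_norml => /andP[_ h1]; rewrite /w half dbl; lra.
  have vm m n : (m <= n)%N -> v m <= v n.
    by move=> /subnK <-; elim: (n - m)%N => // j ih; apply: le_trans ih _; rewrite addSn.
  have wm m n : (m <= n)%N -> w n <= w m.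
    by move=> /subnK <-; elim: (n - m)%N => // j ih; apply: le_trans ih; rewrite addSn.
  have vw m : v m <= w m.
    by have := c1 m; rewrite /v /w; lra.
  have vwn m n : v m <= w n.
    by apply: (le_trans (vm m (maxn m n) (leq_maxl _ _))); apply: le_trans (vw _) (wm _ _ (leq_maxr _ _)).
  have hs : has_sup (range v).
    by split; [exists (v 0%N); exists 0%N|exists (w 0%N) => _ [m _ <-]].
  exists (sup (range v)) => m.
  have l1 : v m <= sup (range v) by apply: ub_le_sup; [case: hs|exists m].
  have l2 : sup (range v) <= w m by apply: ge_sup; [case: hs|move=> _ [j _ <-]].
  have := c1 m.
  rewrite ler_norml; move: l1 l2; rewrite /v /w => l1 l2 c2; apply/andP; split; lra.
Qed.

Lemma real_geo : geometric_limits R.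
Proof.
split=> [u C h|x C x0 h].
  have C0 : 0 <= C by have := h 0%N; rewrite expr0 divr1; apply: le_trans.
  have [l hl] := real_geometric_limit h; exists l => m; apply: le_trans (hl m) _.
  by rewrite ler_pM2r ?invr_gt0 // ler_wpM2r // ler_nat.
apply/eqP; rewrite eq_le x0 andbT real_leNgt ?num_real //; apply/negP => xp.
have C0 : 0 <= C by have := h 0%N; rewrite expr0 divr1; apply: le_trans.
have hb := archi_boundP (divr_ge0 C0 x0).
have := h (Num.bound (C / x)); rewrite ler_pdivlMr // mulrC -ler_pdivlMr // => h1.
have : (Num.bound (C / x))%:R <= 2 ^+ Num.bound (C / x) :> R.
  by rewrite -natrX ler_nat ltnW // ltn_expl.
by move=> /le_trans /(_ h1) /le_lt_trans /(_ hb); rewrite ltxx.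
Qed.

Lemma real_dense : exists D : nat -> R, forall (x e : R), 0 < e -> exists m, `|D m - x| < e.
Proof.
exists (fun m => ratr (odflt 0 (unpickle m : option rat))) => x e e0.
have [|q] := @rat_in_itvoo R (x - e) (x + e); first by lra.
rewrite in_itv /= => /andP[h1 h2]; exists (pickle q); rewrite pickleK /=.
rewrite ltr_norml; apply/andP; split; lra.
Qed.

End Real.

(** * The field of complex numbers *)

Section Complex.
Variable R : realType.
Local Notation C := (complex R : numFieldType).
Local Notation Re := (@complex.Re R).
Local Notation Im := (@complex.Im R).
Local Notation "x %:C" := (real_complex R x) : ring_scope.

Lemma normc_le (z : C) : `|z| <= (`|Re z| + `|Im z|)%:C.
Proof.
have h0 : 0 <= `|Re z| + `|Im z| by exact: addr_ge0.
rewrite normc_def lecR -[X in _ <= X](ger0_norm h0) -sqrtr_sqr ler_sqrt ?sqr_ge0 //.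
rewrite sqrrD !real_normK ?num_real //.
have := mulr_ge0 (normr_ge0 (Re z)) (normr_ge0 (Im z)); lra.
Qed.

Lemma Re_le (z : C) : `|Re z|%:C <= `|z|. Proof. exact: normc_ge_Re. Qed.

Lemma Im_le (z : C) : `|Im z|%:C <= `|z|.
Proof.
rewrite normc_def lecR -sqrtr_sqr ler_sqrt ?sqr_ge0 //; last by rewrite addr_ge0 ?sqr_ge0.
by rewrite lerDr sqr_ge0.
Qed.

Lemma ge0_real (z : C) : 0 <= z -> z = (Re z)%:C.
Proof. by case: z => a b; rewrite lecE /= => /andP[/eqP -> _]. Qed.

Lemma norm_real (x : R) : `|x%:C| = `|x|%:C.
Proof. by rewrite normc_def /= expr0n /= addr0 sqrtr_sqr. Qed.

Lemma Re_sub (z w : C) : Re (z - w) = Re z - Re w. Proof. by case: z; case: w. Qed.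
Lemma Im_sub (z w : C) : Im (z - w) = Im z - Im w. Proof. by case: z; case: w. Qed.
Lemma Re_realM (x : R) (w : C) : Re (x%:C * w) = x * Re w.
Proof. by case: w => a b /=; rewrite mul0r subr0. Qed.
Lemma Im_realM (x : R) (w : C) : Im (x%:C * w) = x * Im w.
Proof. by case: w => a b /=; rewrite mul0r addr0. Qed.

(** The real mean value theorem applies to Re f and Im f along the real parameter of the segment;
    each increment is bounded by M, and |z| <= |Re z| + |Im z| gives the factor 2. *)
Lemma complex_mv n (f : 'rV[C]_n -> C) (x v : 'rV[C]_n) (M : C) :
  (forall t, 0 <= t <= 1 -> derivable f (x + t *: v) v /\ `|'D_v f (x + t *: v)| <= M) ->
  `|f (x + v) - f x| <= 2 * M.
Proof.
move=> h.
have M0 : 0 <= M by have [|_] := h 0; [rewrite lexx ler01|apply: le_trans].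
have MR := ge0_real M0.
have key (P : C -> R) : (forall z w, P (z - w) = P z - P w) ->
    (forall (a : R) w, P (a%:C * w) = a * P w) -> (forall z, `|P z|%:C <= `|z|) ->
    `|P (f (x + v) - f x)| <= Re M.
  move=> PB PZ PN.
  have := @real_mean_value R (fun t => P (f (x + t%:C *: v))) (fun t => P ('D_v f (x + t%:C *: v))) (Re M).
  rewrite scale1r scale0r addr0 PB; apply => t t01.
  have [|d b] := h t%:C; first by rewrite -[0 : C]/(0%:C) -[1 : C]/(1%:C) !lecR.
  split; last by rewrite -lecR -MR; apply: le_trans (PN _) b.
  move=> e e0; have [|a a0 ha] := dd_derive d (e := e%:C); first by rewrite -[0 : C]/(0%:C) ltcR.
  have aR := ge0_real (ltW a0).
  exists (Re a); first by rewrite -ltcR -aR.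
  move=> y ya; have := ha y%:C; rewrite norm_real {1}aR ltcR => /(_ ya).
  rewrite -rmorphM /= => hy; rewrite -lecR; apply: le_trans hy.
  apply: le_trans (PN _); rewrite le_eqVlt; apply/orP; left; apply/eqP; congr (`|_|%:C).
  rewrite !PB PZ (_ : y *: (1 : R) = y); last exact: mulr1.
  by rewrite [(t + y)%:C]rmorphD scalerDl addrA.
apply: le_trans (normc_le _) _; rewrite [in leRHS]MR -[2 : C]/(2%:R) mulr_natl -rmorphMn lecR mulr2n.
by apply: lerD; apply: key; [exact: Re_sub|exact: Re_realM|exact: Re_le|exact: Im_sub|exact: Im_realM|exact: Im_le].
Qed.

Lemma complex_geo : geometric_limits C.
Proof.
have p2 m : (2 ^+ m : C) = (2 ^+ m)%:C by rewrite rmorphXn rmorphMn.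
have [_ g2] := real_geo R; have g1 := @real_geometric_limit R.
split=> [u c h|x c x0 h].
  have c0 : 0 <= c by have := h 0%N; rewrite expr0 divr1; apply: le_trans.
  have cR := ge0_real c0.
  have E m : c / 2 ^+ m = (Re c / 2 ^+ m)%:C by rewrite {1}cR p2 rmorphM fmorphV.
  have [|a ha] := g1 (fun m => Re (u m)) (Re c).
    by move=> m; rewrite -Re_sub -lecR -E; apply: le_trans (Re_le _) (h m).
  have [|b hb] := g1 (fun m => Im (u m)) (Re c).
    by move=> m; rewrite -Im_sub -lecR -E; apply: le_trans (Im_le _) (h m).
  (* The limits of real and imaginary part contribute 2 c each: the origin of the constant 4 in
     [geometric_limits]. *)
  have E4 m : 4 * c / 2 ^+ m = (2 * Re c / 2 ^+ m + 2 * Re c / 2 ^+ m)%:C.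
    rewrite -mulrA E -[4]/(4%:R) -(rmorph_nat (real_complex R) 4) -rmorphM /=; congr (_%:C); ring.
  exists (Complex a b) => m; apply: le_trans (normc_le _) _.
  by rewrite E4 lecR Re_sub Im_sub; apply: lerD.
have xR := ge0_real x0.
have c0 : 0 <= c by have := h 0%N; rewrite expr0 divr1; apply: le_trans.
have cR := ge0_real c0.
have E m : c / 2 ^+ m = (Re c / 2 ^+ m)%:C by rewrite {1}cR p2 rmorphM fmorphV.
rewrite xR (g2 (Re x) (Re c)) //; first by rewrite -lecR -xR.
by move=> m; rewrite -lecR -xR -E.
Qed.

Lemma complex_dense : exists D : nat -> C, forall (x e : C), 0 < e -> exists m, `|D m - x| < e.
Proof.
have [D hD] := real_dense R.
exists (fun m => let ab := odflt (0%N, 0%N) (unpickle m) in Complex (D ab.1) (D ab.2)) => x e e0.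
have eR := ge0_real (ltW e0).
have e2 : 0 < Re e / 2 by rewrite divr_gt0 // -ltcR -eR.
have [a ha] := hD (Re x) _ e2; have [b hb] := hD (Im x) _ e2.
exists (pickle (a, b)); rewrite pickleK /=.
apply: le_lt_trans (normc_le _) _; rewrite [ltRHS]eR ltcR Re_sub Im_sub /= [ltRHS]splitr.
exact: ltrD.
Qed.

End Complex.

Theorem corollary24 (C : category) (S : fspace (scalars (geometry_of C)))
    (hS : manifold (G := geometry_of C) 2 S) (k : nat) (hk : (3 <= k)%N) (p : monster (G := geometry_of C) S k) :
  (forall h : nat, (2 <= h)%N ->
     SG p h = (2 + count (fun i => e_num p h i == 0%R)
                     (index_iota 2 (minn h k.+1).+1))%N) /\
  (forall i : nat, (2 <= i <= k.+1)%N -> beta p i.+1 = b_num p i).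
Proof.
have k0 : (0 < k)%N by exact: leq_trans hk.
case: C S hS p => [R|R|K hK] S hS p; apply: small_growth => //.
- exact: (dg_good ltr01 (@real_mv R)).
- exact: (dg_regular_zeros ltr01 (@real_mv R) (real_geo R)).
- by have [D hD] := real_dense R; exact: (dg_small (real_geo R) hD).
- exact: (dg_good (ltr0n _ 2) (@complex_mv R)).
- exact: (dg_regular_zeros _ (@complex_mv R) (complex_geo R)).
- by have [D hD] := complex_dense R; exact: (dg_small (complex_geo R) hD).
- exact: (ag_good hK).
- exact: (ag_regular_zeros hK).
- exact: ag_small.
Qed.
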